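(* Let $\alpha>0$ and let $n\ge 2$ be an integer. Set $\alpha_n=n\,\omega_{n-1}^{1/(n-1)}$ and $$\mathsf{MT}_n^1(\alpha)=\sup_{u\in W^{1,n}_{0,\mathrm{rad}}(B):\ \int_B|\nabla u|^n\,dx\le 1}\ \int_B \exp\big((\alpha_n+|x|^\alpha)\,|u|^{\frac{n}{n-1}}\big)\,dx,$$ $$\mathsf{MT}_n^2(\alpha)=\sup_{u\in W^{1,n}_{0,\mathrm{rad}}(B):\ \int_B|\nabla u|^n\,dx\le 1}\ \int_B \exp\big(\alpha_n\,|u|^{\frac{n}{n-1}+|x|^\alpha}\big)\,dx.$$ Then both constants are attained in $W^{1,n}_{0,\mathrm{rad}}(B)$; that is, for each $i\in\{1,2\}$ there exists $u\in W^{1,n}_{0,\mathrm{rad}}(B)$ with $\int_B|\nabla u|^n\,dx\le 1$ at which the corresponding integral equals $\mathsf{MT}_n^i(\alpha)$.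
   Context: $B$ is the unit ball of $\mathbb R^n$ centered at the origin. $\omega_{n-1}$ is the surface measure of the unit sphere $\mathbb S^{n-1}\subset\mathbb R^n$. $W^{1,n}_{0,\mathrm{rad}}(B)$ is the subspace of $W^{1,n}_0(B)$ consisting of functions radially symmetric about the origin. Both suprema are known to be finite. *)

(* Defs.v *)
From HB Require Import structures.
From mathcomp Require Import all_boot all_order all_algebra.
From mathcomp Require Import all_classical all_reals all_analysis.

Set Implicit Arguments.
Unset Strict Implicit.
Unset Printing Implicit Defensive.

Import Order.TTheory GRing.Theory Num.Theory.
Import numFieldNormedType.Exports.

Local Open Scope classical_set_scope.
Local Open Scope ring_scope.

(* R^n is 'rV[R]_n, with the sigma-algebra generated by the coordinates, that
   is, the Borel sigma-algebra. *)
Section measurable_rV.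
Context {R : realType}.
Variable n : nat.

Definition rV_coord (i : 'I_n) (x : 'rV[R]_n) : R := x ord0 i.

Let rV_set0 : g_sigma_preimage rV_coord set0.
Proof. exact: sigma_algebra0. Qed.

Let rV_setC A : g_sigma_preimage rV_coord A -> g_sigma_preimage rV_coord (~` A).
Proof. exact: sigma_algebraC. Qed.

Let rV_bigcup (F : (set 'rV[R]_n)^nat) :
  (forall i, g_sigma_preimage rV_coord (F i)) ->
  g_sigma_preimage rV_coord (\bigcup_i (F i)).
Proof. exact: sigma_algebra_bigcup. Qed.

HB.instance Definition _ := @isMeasurable.Build default_measure_display
  'rV[R]_n (g_sigma_preimage rV_coord) rV_set0 rV_setC rV_bigcup.

End measurable_rV.

Lemma measurable_rV_coord (R : realType) n (i : 'I_n) :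
  measurable_fun [set: 'rV[R]_n] (@rV_coord R n i).
Proof.
move=> _ Y mY; rewrite setTI; apply: sub_sigma_algebra => /=.
rewrite -bigcup_seq/=; exists i => /=; first by rewrite mem_index_enum.
by exists Y => //; rewrite setTI.
Qed.

Lemma measurable_fun_rVP d (T : measurableType d) (R : realType) n
    (f : T -> 'rV[R]_n) :
  measurable_fun [set: T] f <->
  forall i, measurable_fun [set: T] (fun x => f x ord0 i).
Proof.
split=> [mf i|mf]; first exact: (measurableT_comp (measurable_rV_coord i) mf).
have : g_sigma_preimage (fun i => @rV_coord R n i \o f) `<=` measurable.
  apply: smallest_sub; first exact: sigma_algebra_measurable.
  rewrite -bigcup_seq; apply: bigcup_sub => i _ _ [B mB <-].
  exact: mf.
by rewrite g_sigma_preimage_comp => H _ A mA; apply: H; exists A.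
Qed.

Definition rV_cons (R : realType) n (p : R * 'rV[R]_n) : 'rV[R]_n.+1 :=
  row_mx p.1%:M p.2.

(* n-dimensional Lebesgue measure, as an iterated product. *)
Fixpoint lebesgue_rV (R : realType) (n : nat) : set 'rV[R]_n -> \bar R :=
  match n with
  | 0 => \d_(0 : 'rV[R]_0)
  | m.+1 => fun A =>
      (@lebesgue_measure R \x @lebesgue_rV R m)%E (@rV_cons R m @^-1` A)
  end.

Lemma measurable_rV_cons (R : realType) n :
  measurable_fun [set: R * 'rV[R]_n] (@rV_cons R n).
Proof.
apply/measurable_fun_rVP => i; rewrite /rV_cons.
case: (split_ordP (i : 'I_(1 + n))) => j ->.
  rewrite (_ : (fun _ => _) = fst); first exact: measurable_fst.
  apply/funext => p; apply: (etrans (row_mxEl _ p.2 _ j)).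
  by rewrite !mxE (ord1 j) eqxx mulr1n.
rewrite (_ : (fun _ => _) = rV_coord j \o snd).
  exact: (measurableT_comp (measurable_rV_coord j) measurable_snd).
by apply/funext => p; exact: (row_mxEr p.1%:M).
Qed.

Lemma lebesgue_rV_measure (R : realType) n :
  exists m : {sigma_finite_measure set 'rV[R]_n -> \bar R},
    m = @lebesgue_rV R n :> (set 'rV[R]_n -> \bar R).
Proof.
elim: n => [|n [m mE]]; first by exists (\d_(0 : 'rV[R]_0)).
pose mu A := (@lebesgue_measure R \x m)%E (@rV_cons R n @^-1` A).
have mc := @measurable_rV_cons R n.
have mu0 : mu set0 = 0%E by rewrite /mu preimage_set0 measure0.
have mu_ge0 A : (0 <= mu A)%E by exact: measure_ge0.
have mu_sa : semi_sigma_additive mu.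
  move=> F mF tF mUF; rewrite /mu preimage_bigcup.
  apply: measure_semi_sigma_additive.
  - by move=> k; rewrite -[X in measurable X]setTI; exact: mc.
  - apply/trivIsetP => /= i j _ _ ij; rewrite -preimage_setI.
    by move/trivIsetP : tF => /(_ _ _ _ _ ij) ->//; rewrite preimage_set0.
  - by rewrite -preimage_bigcup -[X in measurable X]setTI; exact: mc.
pose M := isMeasure.Build _ _ _ mu mu0 mu_ge0 mu_sa.
pose mu' : {measure set 'rV[R]_n.+1 -> \bar R} := HB.pack mu M.
have sf : sigma_finite setT mu'.
  have /sigma_finiteP[F [FT ndF Foo]] := sigma_finiteT (@lebesgue_measure R).
  have /sigma_finiteP[G [GT ndG Goo]] := sigma_finiteT m.
  pose u (x : 'rV[R]_n.+1) : R * 'rV[R]_n := 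
    (x ord0 ord0, @rsubmx _ 1 1 n x).
  have mu_ : measurable_fun setT u.
    apply/measurable_fun_pairP; split; first exact: measurable_rV_coord.
    apply/measurable_fun_rVP => i.
    under eq_fun do rewrite mxE.
    exact: measurable_rV_coord.
  have consK p : u (rV_cons p) = p.
    case: p => a b; rewrite /u /rV_cons /=; congr pair; last exact: row_mxKr.
    rewrite (_ : (ord0 : 'I_n.+1) = lshift n (ord0 : 'I_1)); last exact: val_inj.
    by apply: (etrans (row_mxEl _ b _ ord0)); rewrite !mxE eqxx mulr1n.
  exists (fun k => u @^-1` (F k `*` G k)).
    rewrite -preimage_bigcup -(@preimage_setT _ _ u); congr (_ @^-1` _).
    apply/seteqP; split=> // -[x y] _.
    have [i _ Fix] : (\bigcup_i F i) x by rewrite -FT.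
    have [j _ Gjy] : (\bigcup_i G i) y by rewrite -GT.
    exists (maxn i j) => //; split=> /=.
    - by move: x Fix; exact/subsetPset/ndF/leq_maxl.
    - by move: y Gjy; exact/subsetPset/ndG/leq_maxr.
  move=> k; have [mFk Fkoo] := Foo k; have [mGk Gkoo] := Goo k; split.
    by rewrite -[X in measurable X]setTI; apply: mu_ => //; exact: measurableX.
  rewrite /mu' /= /mu (_ : _ @^-1` _ = F k `*` G k).
    by rewrite product_measure1E// lte_mul_pinfty// ge0_fin_numE.
  by apply/funext => p; exact: (congr1 (F k `*` G k) (consK p)).
pose S := Measure_isSigmaFinite.Build _ _ _ mu' sf.
pose mu'' : {sigma_finite_measure set 'rV[R]_n.+1 -> \bar R} := HB.pack mu M S.
by exists mu''; apply/funext => A /=; rewrite /mu mE.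
Qed.

Section lebesgue_rV_instance.
Context {R : realType} {n : nat}.
Local Notation mu := (@lebesgue_rV R n).

Let mu0 : mu set0 = 0%E.
Proof. by have [m <-] := lebesgue_rV_measure R n. Qed.

Let mu_ge0 A : (0 <= mu A)%E.
Proof. by have [m <-] := lebesgue_rV_measure R n. Qed.

Let mu_sigma_additive : semi_sigma_additive mu.
Proof.
have [m <-] := lebesgue_rV_measure R n.
exact: measure_semi_sigma_additive.
Qed.

HB.instance Definition _ :=
  isMeasure.Build _ _ _ mu mu0 mu_ge0 mu_sigma_additive.

Let mu_sigma_finite : sigma_finite setT mu.
Proof. have [m <-] := lebesgue_rV_measure R n; exact: sigma_finiteT. Qed.

HB.instance Definition _ := Measure_isSigmaFinite.Build _ _ _ mu mu_sigma_finite.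

End lebesgue_rV_instance.

Section euclidean.
Context {R : realType} {n : nat}.
Implicit Types x : 'rV[R]_n.

(* The norm `|x| of the library is the sup norm. *)
Definition enorm x : R := Num.sqrt (\sum_i x ord0 i ^+ 2).

Definition unit_ball : set 'rV[R]_n := [set x | enorm x < 1].

Definition unit_sphere : set 'rV[R]_n := [set x | enorm x = 1].

(* Surface measure of a subset of the unit sphere: n times the volume of the
   cone over it, so that dx = r^(n-1) dr dsigma in polar coordinates. *)
Definition sphere_measure (A : set 'rV[R]_n) : \bar R :=
  (n%:R%:E * lebesgue_rV [set r *: y | r in `]0%R, 1%R]%classic & y in A])%E.

End euclidean.
Arguments unit_ball : clear implicits.
Arguments unit_sphere : clear implicits.

(* omega_(n-1); note the shift: n is the dimension of the ambient space. *)
Definition sphere_area (R : realType) (n : nat) : R :=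
  fine (sphere_measure (unit_sphere R n)).

Section sobolev.
Context {R : realType} {n : nat}.
Local Notation mu := (@lebesgue_rV R n).
Implicit Types (Omega : set 'rV[R]_n) (u phi f : 'rV[R]_n -> R).
Implicit Types (g : 'rV[R]_n -> 'rV[R]_n) (p : R).

Definition partial (i : 'I_n) f : 'rV[R]_n -> R :=
  fun x => 'D_(delta_mx ord0 i) (f : 'rV[R]_n -> R^o) x.

Definition smooth f := forall (s : seq 'I_n),
  continuous (foldr partial f s : 'rV[R]_n -> R^o) /\
  forall i x, derivable (foldr partial f s : 'rV[R]_n -> R^o) x (delta_mx ord0 i).

(* C_c^oo(Omega), each function being extended by 0 to the whole space. *)
Definition test_function Omega : set ('rV[R]_n -> R) :=
  [set phi | [/\ smooth phi, compact (closure [set x | phi x != 0]) &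
                 closure [set x | phi x != 0] `<=` Omega]].

Definition loc_integrable Omega u := measurable_fun Omega u /\
  forall K, K `<=` Omega -> compact K -> (\int[mu]_(x in K) `|u x|%:E < +oo)%E.

Definition weak_gradient Omega u g := loc_integrable Omega u /\
  forall i, loc_integrable Omega (fun x => g x ord0 i) /\
    forall phi, test_function Omega phi ->
      (\int[mu]_(x in Omega) (u x * partial i phi x)%:E =
       - \int[mu]_(x in Omega) (g x ord0 i * phi x)%:E)%E.

(* The weak gradient is unique up to a.e. equality on Omega; [grad Omega u] is
   a representative of it, and is only meaningful when it exists. *)
Definition grad Omega u : 'rV[R]_n -> 'rV[R]_n :=
  xget (fun=> 0) [set g | weak_gradient Omega u g].

Definition sobolev_norm p Omega u : \bar R :=
  ((\int[mu]_(x in Omega) (`|u x| `^ p)%:E +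
    \int[mu]_(x in Omega) (enorm (grad Omega u x) `^ p)%:E) `^ p^-1)%E.

(* W^{1,p}(Omega); elements are functions (rather than classes modulo a.e.
   equality) whose values outside Omega are irrelevant. *)
Definition sobolev p Omega : set ('rV[R]_n -> R) :=
  [set u | [/\ measurable_fun Omega u, exists g, weak_gradient Omega u g &
               (sobolev_norm p Omega u < +oo)%E]].

(* W^{1,p}_0(Omega), the closure of C_c^oo(Omega) in W^{1,p}(Omega). *)
Definition sobolev0 p Omega : set ('rV[R]_n -> R) :=
  [set u | sobolev p Omega u /\ forall e : R, 0 < e ->
     exists2 phi, test_function Omega phi &
       (sobolev_norm p Omega (u \- phi)%R < e%:E)%E].

Definition radial Omega u := exists f : R -> R,
  {ae mu, forall x, Omega x -> u x = f (enorm x)}.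

End sobolev.

Section moser_trudinger.
Variables (R : realType) (n : nat).
Local Notation mu := (@lebesgue_rV R n).
Local Notation B := (unit_ball R n).
Implicit Types (u : 'rV[R]_n -> R) (alpha : R).

Definition sobolev0_rad : set ('rV[R]_n -> R) :=
  [set u | sobolev0 n%:R B u /\ radial B u].

Definition dirichlet u : \bar R :=
  \int[mu]_(x in B) (enorm (grad B u x) ^+ n)%:E.

Definition mt_const : R := n%:R * sphere_area R n `^ (n.-1%:R)^-1.

Definition MT1_integral alpha u : \bar R :=
  \int[mu]_(x in B)
    (expR ((mt_const + enorm x `^ alpha) * `|u x| `^ (n%:R / n.-1%:R)))%:E.

Definition MT2_integral alpha u : \bar R :=
  \int[mu]_(x in B)
    (expR (mt_const * `|u x| `^ (n%:R / n.-1%:R + enorm x `^ alpha)))%:E.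

Definition MT1 alpha : \bar R :=
  ereal_sup [set MT1_integral alpha u | u in
    [set u | sobolev0_rad u /\ (dirichlet u <= 1)%E]].

Definition MT2 alpha : \bar R :=
  ereal_sup [set MT2_integral alpha u | u in
    [set u | sobolev0_rad u /\ (dirichlet u <= 1)%E]].

End moser_trudinger.

(* Main.v *)
(* In the variable t = - n ln |x|, a radial function u becomes a function w of
   t >= 0, and after scaling both functionals become the integral of
   exp (G (t, w t) - t) under the constraint int w' ^ n <= 1, where G (t, y)
   differs from y ^ (n/(n-1)) by a term that vanishes as t tends to infinity.
   Only nondecreasing w matter, and the constraint is recorded by an energy pair
   (w, Phi), a bound on the increments of w that is closed under pointwise
   limits.
   If w tends to 0 locally uniformly, the functional is at most
   1 + exp (1 + 1/2 + ... + 1/(n-1)) in the limit (the Carleson-Chang level):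
   past the first time at which w ^ (n/(n-1)) almost reaches t, convexity
   reduces the integral to int exp (psi - nu s) ds, which has a sharp bound in
   terms of the energy of psi. The Carleson-Chang functions, with a parameter a,
   lose only O(exp (- a)) with respect to this level, whereas exp G >= 1 + G on
   1 <= t <= 2 gains a negative power of a; so the supremum is above the level.
   Hence a maximizing sequence spends some energy at bounded t, which makes the
   rest subcritical, and dominated convergence applies to a subsequence. *)
Require Import Defs.
From HB Require Import structures.
From mathcomp Require Import all_boot all_order all_algebra.
From mathcomp Require Import all_classical all_reals all_analysis.
From mathcomp Require Import measurable_realfun ring lra.

Set Implicit Arguments.
Unset Strict Implicit.
Unset Printing Implicit Defensive.

Import Order.TTheory GRing.Theory Num.Theory.
Import numFieldNormedType.Exports.
Import HBNNSimple.

Local Open Scope classical_set_scope.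
Local Open Scope ring_scope.

(** * The dual inequality *)

(** The level has to be an upper bound with its exact constant, so no step after concentration may
    lose a factor. The constant comes from dynamic programming. For psi of given slope, the integral
    of exp (psi - nu s) from s on, normalised at s, solves a linear equation backwards in s; in
    terms of p = 1 / (nu J), the function [Gam n p] grows no faster than energy is spent. [Gam] is -
    ln p without the first n - 1 terms of its series in 1 - p, and these terms add up to the
    harmonic sum at p = 0. Equality along the flow is a logistic curve, whence the Carleson-Chang
    functions. The convexity step leaves a term p ^ (n/(n-1)), absorbed in the rate nu = 1 - k,
    where k ^ (n-1) is the energy left. Near the critical line that energy is O(ln a / a), which
    makes the change of rate harmless. Between the ball and the half line, traces on spheres are
    avoided. One direction uses density of smooth functions in L^n. The other tests u against
    divergences of explicit radial fields: averages of u are thereby bounded by the variation of u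
    along rays, which is monotone and has no more energy than u. *)

Lemma is_derive_ndecr (R : realType) (f df : R -> R) (a b : R) : a <= b ->
  (forall x, a <= x <= b -> is_derive x 1 f (df x)) ->
  (forall x, a <= x <= b -> 0 <= df x) -> f a <= f b.
Proof.
move=> ab fE df0.
have [||c] := @MVT_segment R f df a b ab.
- move=> x; rewrite in_itv/= => /andP[ax xb]; apply: fE.
  by rewrite !ltW.
- apply: derivable_within_continuous => x; rewrite in_itv/= => /fE.
  by case.
- rewrite in_itv/= => /df0 c0 E.
  by rewrite -subr_ge0 E mulr_ge0// subr_ge0.
Qed.

(** The tangent at [y] to the convex function x^(m+1). It serves as Young's inequality, optimised by
    rescaling [y], so that Hoelder-type bounds need integer powers only. The induction multiplies
    the previous case by [x] and adds a multiple of (x - y)^2. *)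
Lemma tangent_pow (R : realType) (m : nat) (x y : R) : 0 <= x -> 0 <= y ->
  m.+1%:R * y ^+ m * x <= x ^+ m.+1 + m%:R * y ^+ m.+1.
Proof.
move=> x0 y0; elim: m => [|m IH]; first by rewrite !expr1 expr0 mul0r addr0; lra.
have := ler_wpM2r x0 IH.
have h : 0 <= m.+1%:R * y ^+ m * (x - y) ^+ 2.
  by rewrite mulr_ge0 ?sqr_ge0// mulr_ge0// exprn_ge0.
rewrite !exprS -!natr1 in h *.
move: h; set u := y ^+ m; set v := x ^+ m => h IH'.
nra.
Qed.

Section expint.
Variable R : realType.
Implicit Types y t : R.

Lemma is_derive_expRM y t :
  is_derive t 1 (fun t => expR (y * t)) (y * expR (y * t)).
Proof. by apply: is_derive_eq; rewrite /GRing.scale/= mulr1 mulrC. Qed.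

(** The primitive of exp (y t) that vanishes at 0. The case y = 0 has to be kept: it occurs when the
    slope of psi equals the decay rate. *)
Definition expint y t := if y == 0 then t else (expR (y * t) - 1) / y.

Lemma expint0 y : expint y 0 = 0.
Proof. by rewrite /expint; case: ifP => //; rewrite mulr0 expR0 subrr mul0r. Qed.

Lemma is_derive_expint y t : is_derive t 1 (expint y) (expR (y * t)).
Proof.
rewrite /expint; have [->|y0] := eqVneq y 0.
  by rewrite mul0r expR0; exact: is_derive_id.
have d1 := is_derive_expRM y t.
rewrite (_ : (fun t => _) = (fun t => y^-1 * (expR (y * t) - 1))); last first.
  by apply/funext => s; rewrite mulrC.
apply: is_derive_eq; rewrite subr0 -[_ *: _]/(_ * _) mulrA mulVf ?mul1r//.
Qed.

Lemma expint_eq y t : y * expint y t + 1 = expR (y * t).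
Proof.
rewrite /expint; have [->|y0] := eqVneq y 0; first by rewrite !mul0r expR0 add0r.
by rewrite mulrC mulfVK// subrK.
Qed.

End expint.

Section moser_constants.
Variables (R : realType) (n : nat).

Definition mexp : R := n%:R / n.-1%:R.
Definition harm : R := \sum_(k < n.-1) k.+1%:R^-1.
Definition lcst : R := (n.-1%:R * mexp ^+ n)^-1.
(** The remainder after n - 1 terms of the series - ln p = sum (1 - p)^k / k, that is, the integral
    of (1 - x)^(n-1) / x from p to 1. At p = 1 / (nu J) it bounds from below, up to [lcst] and a
    power of nu, the energy needed to reach the value J. *)
Definition Gam (p : R) : R :=
  - ln p - \sum_(k < n.-1) (1 - p) ^+ k.+1 / k.+1%:R.

Lemma Gam1 : Gam 1 = 0.
Proof.
rewrite /Gam ln1 oppr0 sub0r big1 ?oppr0// => i _.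
by rewrite subrr expr0n/= mul0r.
Qed.

(** The terms (1 - p)^k / k subtracted in [Gam] are at most 1 / k, their value at p = 0. This is
    where the harmonic sum of the concentration level comes from. *)
Lemma Gam_ge (p : R) : 0 < p <= 1 -> - ln p <= Gam p + harm.
Proof.
move=> /andP[p0 p1]; rewrite /Gam -addrA lerDl addrC subr_ge0.
apply: ler_sum => i _; rewrite ler_pdivrMr// mulVf//.
by rewrite exprn_ile1//; lra.
Qed.

Lemma is_derive_Gam (p : R) : 0 < p -> is_derive p 1 Gam (- (1 - p) ^+ n.-1 / p).
Proof.
move=> p0; rewrite /Gam.
have d1 (k : nat) : is_derive p 1 (fun p => (1 - p) ^+ k.+1 / k.+1%:R)
    (- (1 - p) ^+ k).
  rewrite (_ : (fun _ => _) = k.+1%:R^-1 \*: (fun p => 1 - p) ^+ k.+1).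
    apply: is_derive_eq.
    by rewrite /GRing.scale/= add0r mul1r mulrN1 mulrN mulrA mulVf ?mul1r.
  by apply/funext => x; rewrite /= exprfctE mulrC.
have d2 : is_derive p 1 (fun p => \sum_(k < n.-1) (1 - p) ^+ k.+1 / k.+1%:R)
    (\sum_(k < n.-1) (- (1 - p) ^+ k)).
  rewrite (_ : (fun _ => _) = \sum_(k < n.-1) (fun p => (1 - p) ^+ k.+1 / k.+1%:R)).
    exact: is_derive_sum.
  by apply/funext => x; rewrite fct_sumE.
have d3 := is_derive1_ln p0.
apply: is_derive_eq.
rewrite sumrN opprK.
have := subrX1 (1 - p) n.-1.
rewrite (_ : 1 - p - 1 = - p); last by ring.
move=> h; have {}h : 1 - (1 - p) ^+ n.-1 = p * \sum_(i < n.-1) (1 - p) ^+ i.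
  by rewrite -opprB h mulNr opprK.
apply: (@mulfI _ p); first by rewrite gt_eqF.
rewrite mulrDr -h mulrN divff ?gt_eqF//.
by rewrite mulrCA divff ?gt_eqF//; ring.
Qed.

End moser_constants.

Arguments mexp : clear implicits.
Arguments harm : clear implicits.
Arguments lcst : clear implicits.

Section step.
Variables (R : realType) (n : nat).
Hypothesis hn : (2 <= n)%N.

Let n1 : n.-1%:R != 0 :> R.
Proof. by rewrite pnatr_eq0; case: n hn => [|[]]. Qed.

Lemma mexp_gt0 : 0 < mexp R n.
Proof. by case: n hn => [|[]]// m _; rewrite divr_gt0//. Qed.

Lemma lcst_gt0 : 0 < lcst R n.
Proof. by rewrite invr_gt0 mulr_gt0 ?exprn_gt0 ?mexp_gt0//; case: n hn => [|[]]. Qed.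

(* [lcst] is chosen so that the tangent to [x |-> x ^+ n] at [mexp * v] has
   slope [v ^+ n.-1] after scaling by [lcst]. *)
Lemma lcst_tangent (x v : R) : 0 <= x -> 0 <= v ->
  v ^+ n.-1 * (x - v) <= lcst R n * x ^+ n.
Proof.
move=> x0 v0; have q0 := mexp_gt0; have k0 := lcst_gt0.
have := @tangent_pow R n.-1 x (mexp R n * v) x0 (mulr_ge0 (ltW q0) v0).
rewrite prednK; last by case: n hn.
move=> /(ler_wpM2l (ltW k0)); rewrite mulrDr -lerBlDr.
apply: le_trans; rewrite le_eqVlt; apply/orP; left; apply/eqP.
rewrite /lcst !(exprMn _ (mexp R n) v).
have -> : n%:R = n.-1%:R * mexp R n by rewrite /mexp mulrCA divff// mulr1.
have e : mexp R n ^+ n = mexp R n * mexp R n ^+ n.-1.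
  by rewrite -exprS prednK//; case: n hn.
have e' : v ^+ n = v * v ^+ n.-1.
  by rewrite -exprS prednK//; case: n hn.
rewrite e e'; field.
by rewrite n1 expf_neq0 gt_eqF.
Qed.

(* [J] solves [J' = 1 + (x - mu) J]; it is the integral, normalised at the left
   end, of [expR (psi s - mu s)] for [psi] of slope [x] on a piece of length
   [l] followed by a piece of integral [J1]. *)
Lemma backward_step (mu x l J1 : R) : 0 < mu -> 0 <= x -> 0 <= l ->
  1 <= mu * J1 ->
  let J0 := expR ((x - mu) * l) * J1 + expint (x - mu) l in
  1 <= mu * J0 /\
  Gam n (mu * J0)^-1 <= Gam n (mu * J1)^-1 + lcst R n * x ^+ n * l / mu ^+ n.-1.
Proof.
move=> mu0 x0 l0 J1ge /=.
pose J (t : R) := expR ((x - mu) * t) * J1 + expint (x - mu) t.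
have JE (t : R) : is_derive t 1 J (1 + (x - mu) * J t).
  have d1 := is_derive_expRM (x - mu) t.
  have d2 := is_derive_expint (x - mu) t.
  apply: is_derive_eq.
  rewrite scaler0 add0r -[_ *: _]/(_ * _) /J mulrDr addrCA [1 + _]addrC expint_eq.
  by ring.
have J00 : J 0 = J1 by rewrite /J mulr0 expR0 mul1r expint0 addr0.
have Jge t : 0 <= t -> 1 <= mu * J t.
  move=> t0.
  have h : 1 <= expR ((x - mu) * t) + mu * expint (x - mu) t.
    have := @is_derive_ndecr R
      (fun t => expR ((x - mu) * t) + mu * expint (x - mu) t)
      (fun t => x * expR ((x - mu) * t)) 0 t t0.
    rewrite mulr0 expR0 expint0 mulr0 addr0; apply.
      move=> s _.
      have d1 := is_derive_expRM (x - mu) s.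
      have d2 := is_derive_expint (x - mu) s.
      by apply: is_derive_eq; rewrite -[_ *: _]/(_ * _); ring.
    by move=> s _; rewrite mulr_ge0// expR_ge0.
  apply: (le_trans h); rewrite /J mulrDr lerD2r mulrCA ler_peMr// expR_ge0//.
split; first exact: Jge.
(* With v = 1 - 1 / (mu J), the derivative of Gam (1 / (mu J)) in t is v^(n-1) (x - mu v). By
   [lcst_tangent] at x / mu it is at most the constant c, so c t - Gam is nondecreasing. *)
pose c := lcst R n * x ^+ n / mu ^+ n.-1.
have := @is_derive_ndecr R (fun t => c * t - Gam n (mu * J t)^-1)
  (fun t => c - (1 - (mu * J t)^-1) ^+ n.-1 * (x - mu * (1 - (mu * J t)^-1)))
  0 l l0.
rewrite mulr0 sub0r J00 => H.
have -> : lcst R n * x ^+ n * l / mu ^+ n.-1 = c * l by rewrite /c; ring.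
suff : - Gam n (mu * J1)^-1 <= c * l - Gam n (mu * J l)^-1 by rewrite /J; lra.
apply: H => t /andP[t0 _]; have Jt := Jge _ t0.
  have Jt0 : 0 < J t by rewrite -(pmulr_rgt0 _ mu0) (lt_le_trans ltr01).
  have muJ0 : 0 < mu * J t by rewrite mulr_gt0.
  have d1 := JE t.
  have d2 : is_derive t 1 (fun t => (mu * J t)^-1)
     (- (mu * J t) ^- 2 * (mu * (1 + (x - mu) * J t))).
    have d3 : is_derive t 1 (fun t => mu * J t) (mu * (1 + (x - mu) * J t)).
      exact: is_deriveZ.
    have := @is_deriveV R (fun t => mu * J t) t _ 1 _ d3.
    by apply; rewrite gt_eqF.
  have d3 : is_derive t 1 (fun t => Gam n (mu * J t)^-1)
      ((1 - (mu * J t)^-1) ^+ n.-1 * (x - mu * (1 - (mu * J t)^-1))).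
    have iv0 : 0 < (mu * J t)^-1 by rewrite invr_gt0.
    have d4 := is_derive_Gam n iv0.
    have d5 := @is_derive1_comp R (Gam n) (fun t => (mu * J t)^-1) t _ _ d4 d2.
    apply: (is_derive_eq d5).
    rewrite invrK; set A := (1 - _) ^+ _.
    field; by rewrite !gt_eqF.
  have d6 : is_derive t 1 (fun t => c * t) c.
    by rewrite -[X in is_derive _ _ _ X]mulr1; exact: is_deriveZ.
  exact: is_deriveB.
have muJ0 : 0 < mu * J t by rewrite (lt_le_trans ltr01).
set v := 1 - _.
have v0 : 0 <= v by rewrite subr_ge0 invf_le1.
have := @lcst_tangent (x / mu) v (divr_ge0 x0 (ltW mu0)) v0.
rewrite subr_ge0 /c exprMn exprVn => /(ler_wpM2l (ltW mu0)).
rewrite -(@prednK n) ?[mu ^+ _.+1]exprS /=; last by case: n hn.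
set B := mu ^+ _; have B0 : B != 0 by rewrite expf_neq0// gt_eqF.
have mu1 : mu != 0 by rewrite gt_eqF.
move=> h; have <- : mu * (lcst R n.-1.+1 * (x ^+ n.-1.+1 / (mu * B))) =
  lcst R n.-1.+1 * x ^+ n.-1.+1 / B by field; rewrite B0 mu1.
apply: le_trans h; rewrite le_eqVlt; apply/orP; left; apply/eqP.
by field.
Qed.

End step.

Section one_dim_integrals.
Variable R : realType.
Notation mu := (@lebesgue_measure R).
Local Open Scope ereal_scope.

Lemma ge0_integral_itv_split (a x y : itv_bound R) (f : R -> \bar R) :
  measurable_fun [set: R] f -> (forall t, 0 <= f t) -> (a <= x)%O -> (x <= y)%O ->
  \int[mu]_(t in [set` Interval a y]) f t =
  \int[mu]_(t in [set` Interval a x]) f t + \int[mu]_(t in [set` Interval x y]) f t.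
Proof.
move=> mf f0 ax xy; rewrite (itv_bndbnd_setU ax xy) ge0_integral_setU//=.
  exact: measurable_funTS.
apply/disj_setPS => t [/= tx ty].
have : t \in Interval a x by [].
have : t \in Interval x y by [].
rewrite !itv_boundlr => /andP[xt _] /andP[_ tx'].
have := le_trans xt (le_refl (BLeft t)).
have := le_trans tx' xt.
by rewrite bnd_simp ltxx.
Qed.

Lemma integral_is_derive (f F : R -> R) (a b : R) : (a <= b)%R ->
  (forall x : R, is_derive x 1%R F (f x)) -> continuous f ->
  \int[mu]_(x in `[a, b]) (f x)%:E = (F b - F a)%:E.
Proof.
move=> ab dF cf; have [<-|/eqP anb] := eqVneq a b.
  by rewrite set_itv1 integral_set1 subrr.
have {}ab : (a < b)%R by rewrite lt_neqAle ab andbT; apply/eqP.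
have cF : continuous F.
  move=> x; apply/differentiable_continuous/derivable1_diffP.
  by have [] := dF x.
rewrite (@continuous_FTC2 _ f F a b ab) ?EFinB//.
- exact: continuous_subspaceT.
- split.
  + by move=> x _; have [] := dF x.
  + exact/cvg_at_right_filter/cF.
  + exact/cvg_at_left_filter/cF.
- by move=> x _; rewrite derive1E; have [] := dF x.
Qed.

Lemma ge0_integral_halfline_le (f : R -> \bar R) (a : R) (M : \bar R) :
  measurable_fun [set: R] f -> (forall t, 0 <= f t) ->
  (forall T, (a <= T)%R -> \int[mu]_(t in `[a, T[) f t <= M) ->
  \int[mu]_(t in `[a, +oo[) f t <= M.
Proof.
move=> mf f0 fM.
have -> : (`[a, +oo[ = \bigcup_k `[a, (a + k%:R)%R[)%classic.
  apply/seteqP; split=> [x|x [k _]]/=; rewrite !in_itv/= ?andbT; last by case/andP.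
  move=> ax; exists (Num.truncn (x - a)).+1 => //=; rewrite in_itv/= ax/=.
  by rewrite -ltrBlDl truncnS_gt.
have nd : nondecreasing_seq (fun k : nat => `[a, (a + k%:R)%R[%classic).
  move=> k l kl; rewrite subsetEset; apply: subset_itvl.
  by rewrite bnd_simp lerD2l ler_nat.
have mF k : measurable (`[a, (a + k%:R)%R[%classic : set R) by [].
have h : \int[mu]_(x in `[a, (a + k%:R)%R[) f x @[k --> \oo] -->
    \int[mu]_(x in \bigcup_k `[a, (a + k%:R)%R[%classic) f x.
  apply: ge0_nondecreasing_set_cvg_integral => //.
  by move=> k; exact: measurable_funTS.
rewrite -(cvg_lim _ h)//; apply: lime_le; first by apply/cvg_ex; eexists; exact: h.
by apply: nearW => k; apply: fM; rewrite lerDl.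
Qed.

End one_dim_integrals.

Section energy.
Variables (R : realType) (n : nat).
Implicit Types psi Phi : R -> R.

(* For absolutely continuous nondecreasing [psi], [Phi t] may be taken to be
   the integral of [psi' ^+ n] over [0, t]; the third clause is then Hoelder's
   inequality. The clauses are preserved by pointwise limits. *)
Definition energy_pair (E : R) psi Phi :=
  [/\ psi 0 = 0, {homo psi : s t / s <= t},
      (forall s t, 0 <= s -> s <= t ->
        (psi t - psi s) ^+ n <= (Phi t - Phi s) * (t - s) ^+ n.-1) &
      (forall t, 0 <= t -> 0 <= Phi t <= E)].

End energy.

Section dual_inequality.
Variables (R : realType) (n : nat).
Hypothesis hn : (2 <= n)%N.
Notation mu := (@lebesgue_measure R).
Variables (E : R) (psi Phi : R -> R).
Hypothesis psiE : energy_pair n E psi Phi.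

Let n1_gt0 : (0 < n.-1)%N. Proof. by case: n hn => [|[]]. Qed.
Let nE : n.-1.+1 = n. Proof. by case: n hn. Qed.

Lemma energy_pair_mono s t : 0 <= s -> s <= t -> Phi s <= Phi t.
Proof.
move=> s0 st; have [_ nd h _] := psiE.
have [->//|nst] := eqVneq s t.
have {}nst : 0 < t - s by rewrite subr_gt0 lt_neqAle nst.
have {}h := h _ _ s0 st.
rewrite -subr_ge0 -(@pmulr_lge0 _ ((t - s) ^+ n.-1)) ?exprn_gt0//.
by apply: le_trans h; rewrite exprn_ge0// subr_ge0 nd.
Qed.

Lemma energy_pair_E_ge0 : 0 <= E.
Proof. by have [_ _ _ /(_ 0 (lexx _))/andP[]] := psiE; exact: le_trans. Qed.

Section fixed_rate.
Variable nu : R.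
Hypothesis nu0 : 0 < nu.

Let kernel (a s : R) := expR (psi s - psi a - nu * (s - a)).

Let mkernel a : measurable_fun [set: R] (EFin \o kernel a).
Proof.
apply/measurable_EFinP; apply: measurableT_comp => //.
apply: measurable_funB; last first.
  by apply: measurable_funM => //; exact: measurable_funB.
apply: measurable_funB => //.
by apply: nondecreasing_measurable => //; have [] := psiE.
Qed.

(** Backward induction over a grid of step [l]. On each cell psi is compared with its chord, for
    which [backward_step] is exact. The oscillation of psi on a cell costs a factor exp w, which
    does not accumulate: the chords agree with psi at the grid points, so the factors multiplying J
    chain exactly from cell to cell. *)
Let discrete_bound (T w l : R) (m : nat) : 0 < l -> T = l * m%:R ->
  (forall s, 0 <= s -> psi (s + l) - psi s <= w) ->
  forall k, (k <= m)%N -> exists J, [/\ 1 <= nu * J,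
   (\int[mu]_(s in `[(l * (m - k)%:R)%R, T[) (kernel (l * (m - k)%:R) s)%:E
     <= (expR w * J)%:E)%E &
   Gam n (nu * J)^-1 <= lcst R n * (Phi T - Phi (l * (m - k)%:R)) / nu ^+ n.-1].
Proof.
move=> l0 TE hw; have [_ nd hPhi _] := psiE.
have w0 : 0 <= w.
  apply: le_trans (hw 0 (lexx _)); rewrite add0r subr_ge0 nd// ltW//.
elim=> [_|k IH km].
  (* The value of J for a psi that is constant after T. It makes nu J = 1, where [Gam] vanishes. *)
  exists nu^-1; rewrite divff ?gt_eqF//; split => //.
    by rewrite subn0 -TE set_itv_ge ?bnd_simp ?ltxx// integral_set0 lee_fin mulr_ge0 ?expR_ge0// invr_ge0 ltW.
  by rewrite subn0 -TE subrr mulr0 mul0r invr1 Gam1.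
have [J1 [J1ge J1i J1G]] := IH (ltnW km).
set a := l * (m - k.+1)%:R; set b := l * (m - k)%:R in J1i J1G.
have bE : b = a + l.
  by rewrite /a /b -(subnSK km) -natr1 mulrDr mulr1.
have a0 : 0 <= a by rewrite mulr_ge0// ltW.
have ab : a <= b by rewrite bE lerDl ltW.
have b0 : 0 <= b := le_trans a0 ab.
have bT : b <= T by rewrite TE ler_pM2l// ler_nat leq_subr.
pose x := (psi b - psi a) / l.
have x0 : 0 <= x by rewrite divr_ge0 ?(ltW l0)// subr_ge0 nd.
have [J0ge J0G] := backward_step hn nu0 x0 (ltW l0) J1ge.
exists (expR ((x - nu) * l) * J1 + expint (x - nu) l); split => //.
- rewrite (ge0_integral_itv_split (x := BLeft b))//= ?bnd_simp//;
    [|exact: mkernel|by move=> s; rewrite lee_fin expR_ge0].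
  rewrite mulrDr EFinD addeC; apply: leeD; last first.
    have kE s : kernel a s = expR ((x - nu) * l) * kernel b s.
      rewrite /kernel -expRD; congr expR.
      by rewrite mulrBl /x divfK ?gt_eqF// bE; ring.
    under eq_integral do rewrite kE EFinM.
    rewrite ge0_integralZl//=.
    + rewrite mulrCA EFinM lee_pmul2l// ?lte_fin ?expR_gt0//.
    + by apply: measurable_funTS; exact: mkernel.
    + by move=> s _; rewrite lee_fin expR_ge0.
  pose F s := expint (x - nu) (s - a).
  apply: (@le_trans _ _ (\int[mu]_(s in `[a, b]) (expR w * expR ((x - nu) * (s - a)))%:E)%E).
    apply: (@le_trans _ _ (\int[mu]_(s in `[a, b[) (expR w * expR ((x - nu) * (s - a)))%:E)%E).
      apply: ge0_le_integral => //=.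
      * by move=> s _; rewrite lee_fin expR_ge0.
      * by apply: measurable_funTS; exact: mkernel.
      * apply/measurable_EFinP; apply: measurable_funM => //.
        apply: measurableT_comp => //; apply: measurable_funM => //.
        exact: measurable_funB.
      * move=> s; rewrite in_itv/= => /andP[as_ sb].
        rewrite lee_fin /kernel -expRD ler_expR mulrBl addrA lerD2r.
        apply: (@le_trans _ _ w).
          apply: le_trans (hw a a0); rewrite -bE lerD2r nd// ltW//.
        by rewrite lerDl mulr_ge0// subr_ge0.
    apply: ge0_subset_integral => //=.
    * apply/measurable_EFinP; apply: measurable_funM => //.
      apply: measurableT_comp => //; apply: measurable_funM => //.
      exact: measurable_funB.
    * exact: subset_itv_co_cc.
  have dF (s : R) : is_derive s 1 (fun s => expR w * F s)
      (expR w * expR ((x - nu) * (s - a))).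
    apply: is_deriveZ; rewrite /F.
    have d1 := is_derive_expint (x - nu) (s - a).
    have d2 : is_derive s 1 (fun s : R => s - a) 1.
      by apply: is_derive_eq; rewrite subr0.
    have := @is_derive1_comp R (expint (x - nu)) (fun s => s - a) s _ _ d1 d2.
    by rewrite mulr1.
  rewrite (integral_is_derive ab dF).
    by rewrite /F subrr expint0 mulr0 subr0 bE addrAC subrr add0r.
  move=> s; apply: cvgM; first exact: cvg_cst.
  apply: continuous_comp; last exact: continuous_expR.
  apply: cvgM; first exact: cvg_cst.
  by apply: cvgB; [exact: cvg_id|exact: cvg_cst].
- apply: (le_trans J0G); apply: (le_trans (lerD J1G (lexx _))).
  rewrite -mulrDl ler_pM2r ?invr_gt0 ?exprn_gt0// -mulrA -mulrDr.
  rewrite ler_pM2l ?lcst_gt0//.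
  have -> : Phi T - Phi a = Phi T - Phi b + (Phi b - Phi a) by ring.
  rewrite lerD2l.
  have := hPhi a b a0 ab; rewrite bE addrAC subrr add0r -bE => h.
  have -> : x ^+ n * l = (psi b - psi a) ^+ n / l ^+ n.-1.
    have l1 : l != 0 by rewrite gt_eqF.
    rewrite /x expr_div_n -[in l ^+ n]nE [l ^+ _.+1]exprS.
    by field; rewrite expf_neq0.
  by rewrite ler_pdivrMr// exprn_gt0.
Qed.

Lemma energy_pair_incr (w l s : R) : 0 <= w -> 0 <= l -> 0 <= s ->
  E * l ^+ n.-1 <= w ^+ n -> psi (s + l) - psi s <= w.
Proof.
move=> w0 l0 s0 h; have [_ nd hPhi hE] := psiE.
have psi0 : 0 <= psi (s + l) - psi s by rewrite subr_ge0 nd// lerDl.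
rewrite -(@ler_pXn2r _ n) ?nnegrE//; last by case: n hn.
have sl : s <= s + l by rewrite lerDl.
apply: le_trans h; apply: (le_trans (hPhi s (s + l) s0 sl)).
rewrite addrAC subrr add0r ler_wpM2r ?exprn_ge0//.
have /andP[_ ?] := hE _ (le_trans s0 sl); have /andP[? _] := hE _ s0; lra.
Qed.

(** Letting the mesh of [discrete_bound] tend to 0. The value J reached at 0 satisfies Gam (1 / (nu
    J)) <= lcst E / nu^(n-1), and [Gam_ge] converts this into a bound on ln (nu J). *)
Lemma dual_inequality :
  (\int[mu]_(s in `[0%R, +oo[) (expR (psi s - nu * s))%:E <=
   (nu^-1 * expR (harm R n + lcst R n * E / nu ^+ n.-1))%:E)%E.
Proof.
have [psi00 nd hPhi hE] := psiE.
have kE s : expR (psi s - nu * s) = kernel 0 s.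
  by rewrite /kernel psi00 !subr0.
under eq_integral do rewrite kE.
apply: ge0_integral_halfline_le; first exact: mkernel.
  by move=> t; rewrite lee_fin expR_ge0.
move=> T; rewrite le_eqVlt => /predU1P[<-|T0].
  rewrite set_itv_ge ?bnd_simp ?ltxx// integral_set0 lee_fin mulr_ge0 ?expR_ge0//.
  by rewrite invr_ge0 ltW.
set M := nu^-1 * _; have M0 : 0 < M by rewrite mulr_gt0 ?invr_gt0 ?expR_gt0.
apply/lee_addgt0Pr => e e0.
(* The oscillation allowed per cell: exp w times M is M + e. The mesh l <= [eta] is at most 1, so E
   l^(n-1) <= E l <= w^n, as [energy_pair_incr] requires. *)
pose w := ln (1 + e / M).
have eM : 0 < e / M by rewrite divr_gt0.
have w0 : 0 < w by rewrite ln_gt0// ltrDl.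
have E0 := energy_pair_E_ge0.
pose eta := Num.min 1 (w ^+ n / (E + 1)).
have E1 : 0 < E + 1 by rewrite ltr_wpDl.
have eta0 : 0 < eta by rewrite lt_min ltr01 divr_gt0// exprn_gt0.
pose m := (Num.truncn (T / eta)).+1; pose l := T / m%:R.
have m0 : 0 < m%:R :> R by rewrite ltr0n.
have l0 : 0 < l by rewrite divr_gt0.
have leta : l <= eta.
  by rewrite /l ler_pdivrMr// mulrC -ler_pdivrMr// ltW// truncnS_gt.
have hw s : 0 <= s -> psi (s + l) - psi s <= w.
  move=> s0; apply: (energy_pair_incr (ltW w0) (ltW l0) s0).
  have l1 : l <= 1 by rewrite (le_trans leta)// ge_min lexx.
  have : l ^+ n.-1 <= l by rewrite -{2}(expr1 l) ler_wiXn2l// ltW.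
  move=> /(ler_wpM2l E0)/le_trans; apply.
  have : l <= w ^+ n / (E + 1) by rewrite (le_trans leta)// ge_min lexx orbT.
  rewrite ler_pdivlMr// mulrC; apply: le_trans.
  by rewrite ler_wpM2r ?(ltW l0)// lerDl.
have TE : T = l * m%:R by rewrite /l divfK// gt_eqF.
have [J [Jge Ji JG]] := discrete_bound l0 TE hw (leqnn m).
rewrite subnn mulr0 in Ji JG.
apply: (le_trans Ji).
rewrite -EFinD lee_fin lnK ?posrE; last by rewrite addr_gt0.
have -> : M + e = (1 + e / M) * M by field; rewrite gt_eqF.
rewrite ler_pM2l ?addr_gt0//.
have nJ0 : 0 < nu * J by rewrite (lt_le_trans ltr01).
rewrite /M mulrC ler_pdivlMr// mulrC.
rewrite -(@lnK _ (nu * J)) ?posrE// ler_expR.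
have pJ : 0 < (nu * J)^-1 <= 1 by rewrite invr_gt0 nJ0 invf_le1.
have := Gam_ge n pJ; rewrite lnV ?posrE// opprK => /le_trans; apply.
rewrite addrC lerD2l (le_trans JG)// ler_pM2r ?invr_gt0 ?exprn_gt0//.
rewrite ler_pM2l ?lcst_gt0//.
have /andP[_ ?] := hE _ (ltW T0); have /andP[? _] := hE _ (lexx 0); lra.
Qed.

End fixed_rate.
End dual_inequality.

(** * Lebesgue measure in the radial variable *)

(** Existential form: the measure is known through its values only, which is what the uniqueness and
    density lemmas consume. *)
Lemma pushforward_measureP d1 d2 (T1 : measurableType d1) (T2 : measurableType d2)
    (R : realType) (m : {measure set T1 -> \bar R}) (f : T1 -> T2) :
  measurable_fun [set: T1] f ->
  exists nu : {measure set T2 -> \bar R}, forall A, nu A = m (f @^-1` A).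
Proof.
move=> mf; unshelve eexists; first by unshelve refine (pushforward m f : {measure set T2 -> \bar R}).
by [].
Qed.

Lemma scaled_measureP d (T : measurableType d) (R : realType)
    (m : {measure set T -> \bar R}) (r : R) : 0 <= r ->
  exists nu : {measure set T -> \bar R}, forall A, nu A = (r%:E * m A)%E.
Proof. by move=> r0; exists (mscale (NngNum r0) m). Qed.

Section density.
Local Open Scope ereal_scope.
Context d (T : measurableType d) (R : realType).
Variables (mu nu : {measure set T -> \bar R}) (g : T -> R).
Hypothesis mg : measurable_fun [set: T] g.
Hypothesis g0 : forall x, (0 <= g x)%R.
Hypothesis nuE : forall A, measurable A -> nu A = \int[mu]_(x in A) (g x)%:E.

Import HBNNSimple.

(** For simple functions this is the hypothesis on the values of nu; both sides then pass to the
    limit by monotone convergence along the same approximating sequence. *)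
Lemma ge0_integral_density (f : T -> \bar R) : (forall x, 0 <= f x) ->
  measurable_fun [set: T] f ->
  \int[nu]_x f x = \int[mu]_x (f x * (g x)%:E).
Proof.
move=> f0 mf; set E := [set: T].
have mE : measurable E by exact: measurableT.
have mgE : measurable_fun E (fun x => (g x)%:E) by exact/measurable_EFinP.
pose h := nnsfun_approx mE mf.
have -> : \int[nu]_(x in E) f x =
    lim (\int[nu]_(x in E) (EFin \o h n) x @[n --> \oo]).
  have fE x : E x -> f x = lim ((EFin \o h n) x @[n --> \oo]).
    by move=> Ex; apply/esym/cvg_lim => //; exact: cvg_nnsfun_approx.
  under eq_integral => x /[!inE] /fE -> //.
  apply: monotone_convergence => //.
  - move=> n; apply/measurable_EFinP.
    by apply: (measurable_funS measurableT) => //; exact/measurable_funP.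
  - by move=> n x Ex //=; rewrite lee_fin.
  - by move=> x Ex a b ab; rewrite lee_fin; exact/lefP/nd_nnsfun_approx.
have -> : \int[mu]_(x in E) (f x * (g x)%:E) =
    lim (\int[mu]_(x in E) ((EFin \o h n) x * (g x)%:E) @[n --> \oo]).
  have fg x : E x -> f x * (g x)%:E = lim (((EFin \o h n) x * (g x)%:E) @[n --> \oo]).
    by move=> Ex; apply/esym/cvg_lim => //; apply: cvgeZr => //;
      exact: cvg_nnsfun_approx.
  under eq_integral => x /[!inE] /fg -> //.
  apply: monotone_convergence => //.
  - move=> n; apply/emeasurable_funM => //; apply/measurable_EFinP.
    by apply: (measurable_funS measurableT) => //; exact/measurable_funP.
  - by move=> n x Ex /=; rewrite mule_ge0 ?lee_fin ?g0.
  - by move=> x Ex a b ab/=; rewrite lee_wpmul2r ?lee_fin ?g0//; exact/lefP/nd_nnsfun_approx.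
suff suf n : \int[mu]_(x in E) ((EFin \o h n) x * (g x)%:E) =
    \int[nu]_(x in E) (EFin \o h n) x by under eq_fun do rewrite -suf.
transitivity (\int[nu]_(x in E)
   (\sum_(y \in range (h n)) (y * \1_(h n @^-1` [set y]) x)%:E)); last first.
  by apply: eq_integral => t tE; rewrite /= fimfunE -fsumEFin.
have indich m r : measurable_fun E (fun x => (r * \1_(h m @^-1` [set r]) x)%:E).
  by apply: (measurable_comp measurableT) => //; exact: measurable_funM.
rewrite ge0_integral_fsum//; last by move=> m y Ey; exact: nnfun_muleindic_ge0.
transitivity (\int[mu]_(x in E) (\sum_(y \in range (h n))
    (y * \1_(h n @^-1` [set y]) x)%:E * (g x)%:E)).
  under [RHS]eq_integral => x xE.
    rewrite -ge0_mule_fsuml => [|y]; last exact: nnfun_muleindic_ge0.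
    rewrite fsumEFin // -(fimfunE _ x); over.
  by [].
rewrite ge0_integral_fsum//; last 2 first.
  - by move=> y; apply: emeasurable_funM.
  - by move=> m y Ey; apply: mule_ge0; [exact: nnfun_muleindic_ge0|rewrite lee_fin].
apply: eq_fsbigr => r rhn.
under [RHS]eq_integral do rewrite EFinM.
rewrite integralZl_indic_nnsfun => //.
under eq_integral do rewrite EFinM -muleA.
rewrite ge0_integralZl//.
- under eq_integral do rewrite muleC.
  rewrite (eq_integral ((fun x => (g x)%:E) \_ (h n @^-1` [set r]))); last first.
    by move=> x xE; rewrite epatch_indic.
  by rewrite -integral_mkcondr -nuE// integral_indic// setIC.
- by apply: emeasurable_funM => //; exact/measurable_EFinP.
- by move=> t Et; rewrite mule_ge0 ?lee_fin ?g0.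
- by move: rhn; rewrite inE => -[t _ <-]; rewrite lee_fin.
Qed.

End density.

Section scaling.
Variable R : realType.

Lemma lebesgue_measure_scale (r : R) (A : set R) : 0 < r -> measurable A ->
  lebesgue_measure ( *%R r @^-1` A) = (r^-1%:E * lebesgue_measure A)%E.
Proof.
move=> r0 mA.
pose f : measurableTypeR R -> measurableTypeR R := *%R r.
have mr : measurable_fun [set: measurableTypeR R] f by exact: measurable_funM.
have [nu nuE] := pushforward_measureP (@lebesgue_measure R) mr.
have [nu' nu'E] := scaled_measureP nu (ltW r0).
have h : lebesgue_measure A = nu' A.
  apply: lebesgue_measure_unique => // X [[a b] _ <-] /=.
  rewrite nu'E nuE lebesgue_measure_itv/= /f.
  have -> : *%R r @^-1` `]a, b] = `]a / r, b / r]%classic.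
    apply/seteqP; split => x /=; rewrite !in_itv/= ler_pdivlMr// ltr_pdivrMr//.
      by rewrite mulrC.
    by rewrite mulrC.
  rewrite lebesgue_measure_itv/= !lte_fin ltr_pM2r ?invr_gt0//.
  case: ifP => _; last by rewrite mule0.
  by rewrite -!EFinB -EFinM -mulrBl mulrCA divff ?gt_eqF// mulr1.
by rewrite h nu'E nuE muleA -EFinM mulVf ?gt_eqF// mul1e.
Qed.

Lemma ge0_integral_scale (r : R) (f : R -> \bar R) : 0 < r ->
  measurable_fun [set: R] f -> (forall x, 0 <= f x)%E ->
  (\int[lebesgue_measure]_x f (r * x)%R = r^-1%:E * \int[lebesgue_measure]_x f x)%E.
Proof.
move=> r0 mf f0.
pose h : measurableTypeR R -> measurableTypeR R := *%R r.
have mh : measurable_fun [set: measurableTypeR R] h by exact: measurable_funM.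
have ri0 : 0 <= r^-1 by rewrite invr_ge0 ltW.
transitivity (\int[pushforward lebesgue_measure h]_y f y)%E.
  by rewrite ge0_integral_pushforward.
transitivity (\int[mscale (NngNum ri0) lebesgue_measure]_y f y)%E.
  apply: eq_measure_integral => A mA _.
  exact: lebesgue_measure_scale.
by rewrite ge0_integral_mscale.
Qed.

(** Induction along the iterated product: the sections scale by r^(-n) in the remaining coordinates,
    and the first coordinate contributes one more factor 1 / r. *)
Lemma lebesgue_rV_scale n (r : R) (A : set 'rV[R]_n) : 0 < r -> measurable A ->
  lebesgue_rV ( *:%R r @^-1` A) = ((r ^- n)%:E * lebesgue_rV A)%E.
Proof.
move=> r0; elim: n A => [|n IH] A mA.
  rewrite expr0 invr1 mul1e /= !diracE.
  congr (_%:E); congr (nat_of_bool _)%:R; apply/idP/idP; rewrite !inE/=.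
    by rewrite scaler0.
  by rewrite scaler0.
rewrite /= /product_measure1 /=.
set B := @rV_cons R n @^-1` A.
have mB : measurable B.
  by rewrite -[B]setTI; exact: measurable_rV_cons.
pose g x := lebesgue_rV (xsection B x).
have mg : measurable_fun [set: R] g by exact: (measurable_fun_xsection (lebesgue_rV (n:=n)) mB).
transitivity (\int[lebesgue_measure]_x ((r ^- n)%:E * g (r * x)%R))%E.
  apply: eq_integral => x _ /=; rewrite /g -IH; last exact: measurable_xsection.
  have e y : r *: rV_cons (x, y) = rV_cons (r * x, r *: y).
    by rewrite /rV_cons; etransitivity; [exact: (scale_row_mx r x%:M y)|rewrite scale_scalar_mx].
  congr (lebesgue_rV _); apply/funext => y.
  by apply/propext; rewrite /xsection/= !inE /= /B /= -e.
rewrite ge0_integralZl//.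
- rewrite ge0_integral_scale//.
  by rewrite muleA -EFinM -invfM exprSr.
- by apply: measurableT_comp => //; exact: measurable_funM.
- by rewrite lee_fin invr_ge0 exprn_ge0// ltW.
Qed.

End scaling.

Section enorm_theory.
Variables (R : realType) (n : nat).
Implicit Types x : 'rV[R]_n.

Lemma enorm_ge0 x : 0 <= enorm x. Proof. exact: sqrtr_ge0. Qed.

Lemma enorm_sqr x : enorm x ^+ 2 = \sum_i x ord0 i ^+ 2.
Proof. by rewrite sqr_sqrtr// sumr_ge0// => i _; rewrite sqr_ge0. Qed.

Lemma enormZ (r : R) x : enorm (r *: x) = `|r| * enorm x.
Proof.
rewrite /enorm -sqrtr_sqr -sqrtrM ?sqr_ge0//; congr Num.sqrt.
by rewrite mulr_sumr; apply: eq_bigr => i _; rewrite mxE exprMn.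
Qed.

Lemma coord_le_enorm x i : `|x ord0 i| <= enorm x.
Proof.
rewrite -ler_sqr ?nnegrE ?enorm_ge0// enorm_sqr real_normK ?num_real//.
by rewrite (bigD1 i)//= lerDl sumr_ge0// => j _; rewrite sqr_ge0.
Qed.

Lemma enorm_eq0 x : (enorm x == 0) = (x == 0).
Proof.
apply/idP/idP => [/eqP x0|/eqP ->]; last first.
  by rewrite -(scale0r (0 : 'rV[R]_n)) enormZ normr0 mul0r.
apply/eqP/rowP => i; rewrite mxE; apply/eqP; rewrite -normr_le0 -x0.
exact: coord_le_enorm.
Qed.

Lemma enorm_gt0 x : (0 < enorm x) = (x != 0).
Proof. by rewrite lt_def enorm_ge0 andbT enorm_eq0. Qed.

Lemma enorm_le_coord x (d : R) : (forall i, `|x ord0 i| <= d) ->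
  enorm x ^+ 2 <= n%:R * d ^+ 2.
Proof.
move=> h; rewrite enorm_sqr.
apply: (@le_trans _ _ (\sum_(i < n) d ^+ 2)).
  apply: ler_sum => i _; rewrite -[leLHS]real_normK ?num_real//.
  by rewrite lerXn2r ?nnegrE// (le_trans (normr_ge0 _) (h i)).
by rewrite sumr_const card_ord mulr_natl.
Qed.

Lemma measurable_enorm : measurable_fun [set: 'rV[R]_n] enorm.
Proof.
have ms := continuous_measurable_fun (@sqrt_continuous R).
apply: (measurableT_comp ms).
apply: measurable_sum => i; apply: measurable_funX.
exact: measurable_rV_coord.
Qed.

Lemma measurable_ball_rV (r : R) : measurable [set x : 'rV[R]_n | enorm x < r].
Proof.
have := measurable_enorm measurableT (measurable_itv `]-oo, r[).
by rewrite setTI; congr measurable; apply/seteqP; split=> x /=; rewrite in_itv.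
Qed.

Lemma measurable_unit_ball : measurable (unit_ball R n).
Proof. exact: measurable_ball_rV. Qed.

End enorm_theory.

Section rV_cons_theory.
Variables (R : realType) (n : nat).
Implicit Types p : R * 'rV[R]_n.

Lemma rV_cons0 p : rV_cons p ord0 ord0 = p.1.
Proof.
rewrite (_ : (ord0 : 'I_n.+1) = lshift n (ord0 : 'I_1)); last exact: val_inj.
by apply: (etrans (row_mxEl _ p.2 _ ord0)); rewrite !mxE eqxx mulr1n.
Qed.

Lemma rV_consS p i : rV_cons p ord0 (lift ord0 i) = p.2 ord0 i.
Proof.
rewrite (_ : lift ord0 i = rshift 1 i :> 'I_n.+1); last exact: val_inj.
exact: (row_mxEr p.1%:M).
Qed.

End rV_cons_theory.

Section ball_volume.
Variable R : realType.

Lemma measurable_cube n (s : set R) : measurable s ->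
  measurable [set x : 'rV[R]_n | forall i, s (x ord0 i)].
Proof.
move=> ms; have -> : [set x : 'rV[R]_n | forall i, s (x ord0 i)] =
    \bigcap_(i in [set: 'I_n]) (@rV_coord R n i @^-1` s).
  by apply/seteqP; split => x /= h i; [move=> _; exact: h|exact: h].
apply: fin_bigcap_measurable; first exact: finite_finset.
by move=> i _; rewrite -[X in measurable X]setTI; exact: measurable_rV_coord.
Qed.

Lemma lebesgue_rV_cube n (s : set R) (c : R) : measurable s ->
  lebesgue_measure s = c%:E ->
  lebesgue_rV [set x : 'rV[R]_n | forall i, s (x ord0 i)] = (c ^+ n)%:E.
Proof.
move=> ms sc; elim: n => [|n IH].
  by rewrite /= diracE mem_set ?expr0//= => -[].
rewrite /= (_ : _ @^-1` _ = s `*` [set x : 'rV[R]_n | forall i, s (x ord0 i)]).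
  transitivity (lebesgue_measure s *
      lebesgue_rV [set x : 'rV[R]_n | forall i, s (x ord0 i)])%E.
    by apply: product_measure1E => //; exact: measurable_cube.
  by rewrite sc IH -EFinM exprS.
apply/seteqP; split => p /=.
  move=> h; split; first by have := h ord0; rewrite rV_cons0.
  by move=> i; have := h (lift ord0 i); rewrite rV_consS.
move=> [h0 h1] i; case: (unliftP ord0 i) => [j ->|->].
  by rewrite rV_consS.
by rewrite rV_cons0.
Qed.

Section dim.
Variable n : nat.
Hypothesis n0 : (0 < n)%N.
Notation mu := (@lebesgue_rV R n).
Notation B := (unit_ball R n).

Definition ball_vol : R := fine (mu B).

Lemma lebesgue_rV_set0 : mu [set 0] = 0%E.
Proof.
rewrite (_ : [set 0] = [set x : 'rV[R]_n | forall i, [set 0] (x ord0 i)]).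
  by rewrite (lebesgue_rV_cube n (c := 0)) ?expr0n ?gtn_eqF// lebesgue_measure_set1.
apply/seteqP; split => x /= h; first by move=> i; rewrite h mxE.
by apply/rowP => i; rewrite h mxE.
Qed.

Lemma unit_ball_volE : mu B = ball_vol%:E.
Proof.
rewrite /ball_vol fineK// ge0_fin_numE//.
apply: (@le_lt_trans _ _ (mu [set x | forall i, `[-1, 1]%classic (x ord0 i)])).
  apply: le_measure; rewrite ?inE; [exact: measurable_unit_ball|exact: measurable_cube|].
  move=> x /= x1 i; rewrite in_itv/= -ler_norml.
  exact: le_trans (coord_le_enorm x i) (ltW x1).
rewrite (lebesgue_rV_cube n (c := 2)) ?ltry//.
by rewrite lebesgue_measure_itv/= lte_fin gtrN// -EFinB opprK.
Qed.

Lemma ball_vol_gt0 : 0 < ball_vol.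
Proof.
rewrite -lte_fin -unit_ball_volE.
pose d : R := n.+1%:R^-1.
have d0 : 0 < d by rewrite invr_gt0.
apply: (@lt_le_trans _ _ (mu [set x | forall i, `[0, d]%classic (x ord0 i)])).
  rewrite (lebesgue_rV_cube n (c := d)) ?lte_fin ?exprn_gt0//.
  by rewrite lebesgue_measure_itv/= lte_fin d0 sube0.
apply: le_measure; rewrite ?inE; [exact: measurable_cube|exact: measurable_unit_ball|].
move=> x /= h; rewrite /unit_ball/= -(@ltr_pXn2r _ 2) ?nnegrE ?enorm_ge0//.
rewrite expr1n; apply: (@le_lt_trans _ _ (n%:R * d ^+ 2)).
  apply: enorm_le_coord => i; have := h i; rewrite in_itv/= => /andP[? ?].
  by rewrite ger0_norm.
rewrite /d exprVn -lter_pdivlMr ?invr_gt0 ?exprn_gt0// invrK mul1r -natrX ltr_nat.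
by rewrite expnS expn1 (leq_trans (ltnSn n))// leq_pmulr.
Qed.

Lemma lebesgue_rV_ball (r : R) : 0 < r ->
  mu [set x | enorm x < r] = (r ^+ n * ball_vol)%:E.
Proof.
move=> r0; rewrite (_ : [set x | _] = *:%R r^-1 @^-1` B).
  rewrite lebesgue_rV_scale ?invr_gt0//; last exact: measurable_unit_ball.
  by rewrite unit_ball_volE exprVn invrK EFinM.
apply/seteqP; split => x; rewrite /= /unit_ball/= enormZ ger0_norm ?invr_ge0 ?(ltW r0)//.
  by rewrite mulrC ltr_pdivrMr// mul1r.
by rewrite mulrC ltr_pdivrMr// mul1r.
Qed.

(** The level sets of [tvar] above t >= 0 are punctured balls: the convention ln 0 = 0 sends the
    origin to t = 0 instead of infinity. *)
Lemma lebesgue_rV_ball_punctured (r : R) : 0 < r ->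
  mu [set x | 0 < enorm x < r] = (r ^+ n * ball_vol)%:E.
Proof.
move=> r0; rewrite -lebesgue_rV_ball//.
have -> : [set x : 'rV[R]_n | 0 < enorm x < r] = [set x | enorm x < r] `\` [set 0].
  apply/seteqP; split => x /=; rewrite enorm_gt0.
    by move=> /andP[/eqP].
  by move=> [-> /eqP ->].
rewrite measureD//=.
- rewrite (_ : _ `&` _ = [set 0]); first by rewrite lebesgue_rV_set0 sube0.
  apply/seteqP; split => x /=; first by case.
  move=> ->; split => //.
  by rewrite -(scale0r (0 : 'rV[R]_n)) enormZ normr0 mul0r.
- exact: measurable_ball_rV.
- rewrite (_ : [set 0] = [set x : 'rV[R]_n | forall i, [set 0] (x ord0 i)]).
    exact: measurable_cube.
  apply/seteqP; split => x /= h; first by move=> i; rewrite h mxE.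
  by apply/rowP => i; rewrite h mxE.
- by rewrite lebesgue_rV_ball// ltry.
Qed.

(** The cone over the sphere is the punctured closed ball. Squeezing it between punctured open balls
    of radius 1 and r > 1 gives its volume without a separate proof that the sphere is null. *)
Lemma sphere_areaE : sphere_area R n = n%:R * ball_vol.
Proof.
rewrite /sphere_area /sphere_measure.
suff -> : mu [set r *: y | r in `]0, 1]%classic & y in unit_sphere R n] = ball_vol%:E.
  by [].
have -> : [set r *: y | r in `]0, 1]%classic & y in unit_sphere R n] =
    [set x | 0 < enorm x <= 1].
  apply/seteqP; split => x /=.
    move=> [r]; rewrite in_itv/= => /andP[r0 r1] [y]; rewrite /unit_sphere/= => y1 <-.
    by rewrite enormZ y1 mulr1 gtr0_norm// r0 r1.
  move=> /andP[x0 x1]; exists (enorm x); first by rewrite /= in_itv/= x0 x1.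
  exists ((enorm x)^-1 *: x); last by rewrite scalerA divff ?gt_eqF// scale1r.
  by rewrite /unit_sphere/= enormZ ger0_norm ?invr_ge0 ?enorm_ge0// mulVf// gt_eqF.
have mS : measurable [set x : 'rV[R]_n | 0 < enorm x <= 1].
  have := @measurable_enorm R n measurableT _ (measurable_itv `]0, 1]).
  by rewrite setTI; congr measurable; apply/seteqP; split=> x /=; rewrite in_itv.
have mP r : measurable [set x : 'rV[R]_n | 0 < enorm x < r].
  have := @measurable_enorm R n measurableT _ (measurable_itv `]0, r[).
  by rewrite setTI; congr measurable; apply/seteqP; split=> x /=; rewrite in_itv.
apply/eqP; rewrite eq_le; apply/andP; split.
  apply/lee_addgt0Pr => e e0.
  have V0 := ball_vol_gt0.
  have [r r1 re] : exists2 r, 1 < r & r ^+ n * ball_vol <= ball_vol + e.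
    have c : (fun r : R => r ^+ n * ball_vol) r @[r --> 1^'+] --> 1 ^+ n * ball_vol.
      apply: cvg_at_right_filter; apply: cvgM; last exact: cvg_cst.
      exact: exprn_continuous.
    rewrite expr1n mul1r in c.
    have {}c : \forall r \near (1:R)^'+, r ^+ n * ball_vol < ball_vol + e.
      by apply: (cvgr_lt _ c); rewrite ltrDl.
    by near (1:R)^'+ => r; exists r => //; apply: ltW; near: r.
  apply: (@le_trans _ _ (mu [set x | 0 < enorm x < r])).
    apply: le_measure; [by rewrite inE|by rewrite inE; exact: mP|].
    by move=> x /= /andP[-> /=]/le_lt_trans; apply.
  by rewrite lebesgue_rV_ball_punctured ?(lt_trans ltr01)// -EFinD lee_fin.
have := @lebesgue_rV_ball_punctured 1 ltr01; rewrite expr1n mul1r => <-.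
apply: le_measure; [by rewrite inE; exact: mP|by rewrite inE|].
by move=> x /= /andP[-> /ltW].
Unshelve. all: by end_near. Qed.

End dim.
End ball_volume.

Section radial_integration.
Variable R : realType.

Lemma cvg_expRN : expR (- t) @[t --> +oo%R] --> (0 : R).
Proof. exact: cvgr_expR. Qed.

Lemma continuous_expRN : continuous (fun t : R => expR (- t)).
Proof.
move=> t; apply: continuous_comp; last exact: continuous_expR.
exact: opp_continuous.
Qed.

Lemma measurable_expRN : measurable_fun [set: R] (fun t => (expR (- t))%:E).
Proof.
apply/measurable_EFinP; apply: continuous_measurable_fun.
exact: continuous_expRN.
Qed.

Lemma integral_expRN (x : R) :
  (\int[lebesgue_measure]_(t in `[x, +oo[) (expR (- t))%:E = (expR (- x))%:E)%E.
Proof.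
have cN := continuous_expRN.
rewrite (@ge0_continuous_FTC2y R _ (fun t => - expR (- t)) _ 0).
- by rewrite EFinN oppeK add0e.
- by move=> t _; exact: expR_ge0.
- exact: continuous_subspaceT.
- by rewrite -oppr0; apply: cvgN; exact: cvg_expRN.
- by move=> t _; exact: ex_derive.
- by apply: cvg_at_right_filter; apply: cvgN; exact: cN.
- by move=> t _; rewrite derive1E derive_val /GRing.scale/= mulrN1 opprK.
Qed.

Variable n : nat.
Hypothesis n0 : (0 < n)%N.
Notation mu := (@lebesgue_rV R n).
Notation B := (unit_ball R n).

Definition tvar (x : 'rV[R]_n) : R := - n%:R * ln (enorm x).

Lemma measurable_tvar : measurable_fun [set: 'rV[R]_n] tvar.
Proof.
apply: measurable_funM => //; apply: measurableT_comp; first exact: measurable_ln.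
exact: measurable_enorm.
Qed.

Lemma tvar_ge0 x : B x -> 0 <= tvar x.
Proof.
move=> x1; rewrite /tvar mulNr oppr_ge0 mulr_ge0_le0// ln_le0//.
exact: ltW.
Qed.

Lemma tvar_gtE (x : 'rV[R]_n) (t : R) : x != 0 ->
  (t < tvar x) = (enorm x < expR (- t / n%:R)).
Proof.
rewrite -enorm_gt0 => x0.
have nR : 0 < n%:R :> R by rewrite ltr0n.
rewrite -[enorm x in RHS]lnK ?posrE// ltr_expR ltr_pdivlMr// /tvar.
by rewrite mulNr ltrNr mulrC.
Qed.

(** The factor n in [tvar] is chosen so that, for t >= 0, the set tvar > t is the punctured ball of
    radius exp (- t / n), whose volume is exp (- t) times that of B. Thus [tvar] carries dx on B to
    a multiple of the exponential law of rate 1: the two measures agree on the rays ]x, +oo[, a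
    generating pi-system. *)
Let emeas (A : set R) : measurable A ->
  (mu (B `&` tvar @^-1` A) = (ball_vol R n)%:E * exponential_prob 1 A)%E.
Proof.
have mB : measurable B by exact: measurable_unit_ball.
have V0 := ltW (ball_vol_gt0 R n).
pose f : 'rV[R]_n -> measurableTypeR R := tvar.
have mf : measurable_fun [set: 'rV[R]_n] f by exact: measurable_tvar.
have [nu nuE] := pushforward_measureP (mrestr mu mB) mf.
have [ex exE] : exists ex : {measure set (measurableTypeR R) -> \bar R},
    forall A, ex A = exponential_prob 1 A.
  unshelve eexists; first by unshelve refine (exponential_prob 1 : {measure set _ -> \bar R}).
  by [].
have exI (x : R) : 0 <= x -> exponential_prob 1 `]x, +oo[ = (expR (- x))%:E.
  move=> x0; rewrite /exponential_prob.
  rewrite -integral_expRN -integral_itv_obnd_cbnd//; last first.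
    by apply: measurable_funTS; exact: measurable_expRN.
  apply: eq_integral => t; rewrite inE/= in_itv/= andbT => xt.
  by rewrite exponential_pdfE ?mul1r ?mulN1r// (le_trans x0 (ltW xt)).
have exT : exponential_prob 1 [set: R] = 1%E.
  by rewrite /exponential_prob integral_exponential_pdf.
have [m mE] := scaled_measureP ex V0.
move=> mA; rewrite -exE -mE.
have -> : mu (B `&` tvar @^-1` A) = nu A by rewrite nuE /mrestr setIC.
have goo : forall k : nat, nu `](- k%:R), +oo[%classic = m `](- k%:R), +oo[%classic /\
    nu `](- k%:R), +oo[%classic = (ball_vol R n)%:E.
  move=> k; have -> : nu `](- k%:R), +oo[%classic = (ball_vol R n)%:E.
    rewrite nuE /mrestr /f; apply/eqP; rewrite eq_le; apply/andP; split.
      rewrite -unit_ball_volE; apply: le_measure; rewrite ?inE//.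
      apply: measurableI => //; rewrite -[X in measurable X]setTI.
      by apply: measurable_tvar.
    have := @lebesgue_rV_ball_punctured R n n0 1 ltr01; rewrite expr1n mul1r => <-.
    apply: le_measure; rewrite ?inE//.
    - have := @measurable_enorm R n measurableT _ (measurable_itv `]0, 1[).
      by rewrite setTI; congr measurable; apply/seteqP; split=> x /=; rewrite in_itv.
    - apply: measurableI => //; rewrite -[X in measurable X]setTI.
      by apply: measurable_tvar.
    - move=> x /= /andP[x0 x1]; split => //; rewrite in_itv/= andbT.
      rewrite tvar_gtE -?enorm_gt0// opprK (lt_le_trans x1)//.
      by rewrite -expR0 ler_expR divr_ge0.
  split => //; rewrite mE exE.
  have -> : exponential_prob 1 `](- k%:R), +oo[ = 1%E :> \bar R.
    apply/eqP; rewrite eq_le; apply/andP; split.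
      by rewrite -exT -!exE; apply: le_measure; rewrite ?inE.
    have := exI 0 (lexx _); rewrite oppr0 expR0 => <-.
    rewrite -!exE; apply: le_measure; rewrite ?inE//.
    by apply: subset_itvr; rewrite bnd_simp oppr_le0.
  by rewrite mule1.
refine (@measure_unique _ R (measurableTypeR R) (@RGenOInfty.G R) (fun k : nat => `](- k%:R), +oo[%classic) _ _ _ _ nu m _ _ A mA).
- exact: RGenOInfty.measurableE.
- move=> _ _ [x ->] [y ->]; exists (Num.max x y).
  by apply/seteqP; split => z /=; rewrite !in_itv/= !andbT gt_max;
    [move=> [-> ->]|move/andP].
- by move=> k; exists (- k%:R).
- rewrite -subTset => x _; exists (Num.truncn `|x|).+1 => //=.
  rewrite in_itv/= andbT ltrNl (le_lt_trans _ (truncnS_gt _))//.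
  by rewrite -normrN ler_norm.
- move=> _ [x ->]; have [x0|x0] := leP 0 x; last first.
    have k0 : 0 < - x by rewrite oppr_gt0.
    have nuB k : nu `](- k%:R), +oo[%classic = (ball_vol R n)%:E by have [] := goo k.
    have mB' k : m `](- k%:R), +oo[%classic = (ball_vol R n)%:E by have [<-] := goo k.
    pose k := (Num.truncn (- x)).+1.
    have kx : - k%:R < x by rewrite ltrNl truncnS_gt.
    transitivity ((ball_vol R n)%:E : \bar R).
      apply/eqP; rewrite eq_le; apply/andP; split.
        rewrite -(nuB k); apply: le_measure; rewrite ?inE//.
        by apply: subset_itvr; rewrite bnd_simp ltW.
      rewrite -(nuB 0%N) oppr0; apply: le_measure; rewrite ?inE//.
      by apply: subset_itvr; rewrite bnd_simp ltW.
    apply/eqP; rewrite eq_le; apply/andP; split.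
      rewrite -(mB' 0%N) oppr0; apply: le_measure; rewrite ?inE//.
      by apply: subset_itvr; rewrite bnd_simp ltW.
    rewrite -(mB' k); apply: le_measure; rewrite ?inE//.
    by apply: subset_itvr; rewrite bnd_simp ltW.
  rewrite mE exE exI// nuE /mrestr /f.
  rewrite -EFinM mulrC.
  have -> : expR (- x) = expR (- x / n%:R) ^+ n.
    by rewrite -expRM_natl mulrC divfK// pnatr_eq0 -lt0n.
  rewrite -lebesgue_rV_ball_punctured ?expR_gt0//.
  congr (mu _); apply/seteqP; split => y /=; rewrite in_itv/= andbT.
    move=> [yx y1].
    have [y0|y0] := eqVneq y 0.
      move: yx; rewrite y0 /tvar -(scale0r (0 : 'rV[R]_n)) enormZ normr0 mul0r ln0//.
      by rewrite mulr0 ltNge x0.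
    by rewrite enorm_gt0 y0 -tvar_gtE.
  move=> /andP[]; rewrite enorm_gt0 => y0 yx; rewrite tvar_gtE//; split => //.
  rewrite /unit_ball/= (lt_le_trans yx)// -expR0 ler_expR.
  by rewrite mulNr oppr_le0 divr_ge0.
- by move=> k; have [_ ->] := goo k; rewrite ltry.
Qed.

Lemma ge0_integral_tvar (g : R -> \bar R) : measurable_fun [set: R] g ->
  (forall t, 0 <= g t)%E ->
  (\int[mu]_(x in B) g (tvar x) = (ball_vol R n)%:E *
   \int[lebesgue_measure]_(t in `[0%R, +oo[) (g t * (expR (- t))%:E))%E.
Proof.
move=> mg g0.
have mB : measurable B by exact: measurable_unit_ball.
have V0 := ltW (ball_vol_gt0 R n).
pose f : 'rV[R]_n -> measurableTypeR R := tvar.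
have mf : measurable_fun [set: 'rV[R]_n] f by exact: measurable_tvar.
have [nuB nuBE] : exists nu : {measure set 'rV[R]_n -> \bar R},
    forall A, nu A = mu (A `&` B) by exists (mrestr mu mB).
pose d (t : R) := ball_vol R n * exponential_pdf 1 t.
have md : measurable_fun [set: R] d.
  by apply: measurable_funM => //; exact: measurable_exponential_pdf.
have d0 t : 0 <= d t by rewrite mulr_ge0// exponential_pdf_ge0.
have [nu nuE] := pushforward_measureP nuB mf.
transitivity (\int[nu]_t g t)%E.
  transitivity (\int[nuB]_x g (tvar x))%E.
    rewrite (@ge0_integral_density _ _ _ mu nuB (fun x => \1_B x))//.
    - rewrite [LHS]integral_mkcond; apply: eq_integral => x _.
      by rewrite patchE indicE; case: (x \in B); rewrite /= ?mule1// mule0.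
    - exact: measurable_indic.
    - move=> A mA; rewrite nuBE integral_indic//.
      by rewrite setIC.
    - exact: measurableT_comp mg measurable_tvar.
  transitivity (\int[pushforward nuB f]_t g t)%E.
    by rewrite [RHS]ge0_integral_pushforward.
  by apply: eq_measure_integral => A mA _; rewrite nuE.
rewrite (@ge0_integral_density _ _ _ lebesgue_measure nu d)//; last first.
  move=> A mA; rewrite nuE nuBE setIC emeas// /exponential_prob.
  rewrite -ge0_integralZl//=.
  - by apply: measurable_funTS; apply/measurable_EFinP; exact: measurable_exponential_pdf.
  - by move=> t _; rewrite lee_fin exponential_pdf_ge0.
rewrite -ge0_integralZl//=; last 2 first.
- apply: measurable_funTS; apply: emeasurable_funM => //.
  exact: measurable_expRN.
- by move=> t _; rewrite mule_ge0// lee_fin expR_ge0.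
rewrite [RHS]integral_mkcond; apply: eq_integral => t _; rewrite patchE.
rewrite /d; case: ifPn => [|]; rewrite ?inE ?notin_setE /= in_itv/= andbT => t0.
  by rewrite exponential_pdfE// mul1r mulN1r EFinM muleCA.
by rewrite lt0_exponential_pdf ?mulr0 ?mule0// ltNge; apply/negP.
Qed.

End radial_integration.

(** * Smooth functions and weak gradients *)

Section smooth1.
Variable R : realType.
Implicit Types (D E : set R) (f g : R -> R).

(** C^k on D, by recursion on the derivative. The set D is a parameter because radial profiles are
    glued from two charts, one around the origin and one where ln is smooth, by means of
    [smooth1_setU]. *)
Fixpoint smooth1 D (k : nat) f : Prop :=
  match k with
  | 0 => forall x, D x -> {for x, continuous f}
  | k'.+1 => (forall x : R, D x -> derivable f x 1) /\ smooth1 D k' (derive1 f)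
  end.

Lemma derivable1_continuous f (x : R) : derivable f x 1 -> {for x, continuous f}.
Proof. by move=> d; apply/differentiable_continuous/derivable1_diffP. Qed.

Lemma smooth1_prev D k f : smooth1 D k.+1 f -> smooth1 D k f.
Proof.
elim: k f => [|k IH] f [df sf]; first by move=> x /df; exact: derivable1_continuous.
by split => //; exact: IH.
Qed.

Lemma smooth1_continuous D k f x : smooth1 D k f -> D x -> {for x, continuous f}.
Proof.
case: k => [|k]; first exact.
by move=> [df _] /df; exact: derivable1_continuous.
Qed.

Lemma smooth1_is_derive D k f (x : R) : smooth1 D k.+1 f -> D x ->
  is_derive x 1 f (derive1 f x).
Proof. by move=> [df _] /df h; rewrite derive1E; exact: derivableP. Qed.

Lemma smooth1_setU D E k f : smooth1 D k f -> smooth1 E k f ->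
  smooth1 (D `|` E) k f.
Proof.
elim: k f => [|k IH] f; first by move=> hD hE x [/hD|/hE].
by move=> [hD hD'] [hE hE']; split; [move=> x [/hD|/hE]|exact: IH].
Qed.

Lemma eq_smooth1 D k f g : open D -> (forall x, D x -> f x = g x) ->
  smooth1 D k f -> smooth1 D k g.
Proof.
move=> oD; elim: k f g => [|k IH] f g fg.
  move=> cf x Dx; have fgx : \forall y \near x, f y = g y.
    by near=> y; apply: fg; near: y; exact: open_nbhs_nbhs.
  rewrite /prop_for/continuous_at -(fg x Dx).
  exact: cvg_trans (near_eq_cvg fgx) (cf x Dx).
have nfg (x : R) : D x -> \forall y \near x, f y = g y.
  by move=> Dx; near=> y; apply: fg; near: y; exact: open_nbhs_nbhs.
move=> [df sf]; split.
  by move=> x Dx; apply: (@near_eq_derivable _ _ _ f) => //; [exact: nfg|exact: df].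
apply: IH sf => x Dx; rewrite !derive1E.
by apply: near_eq_derive => //; exact: nfg.
Unshelve. all: by end_near. Qed.

Lemma smooth1_is_deriveP D k f df : open D ->
  (forall x : R, D x -> is_derive x 1 f (df x)) -> smooth1 D k df ->
  smooth1 D k.+1 f.
Proof.
move=> oD fE sdf; split; first by move=> x /fE [].
by apply: eq_smooth1 sdf => // x /fE h; rewrite derive1E; case: h.
Qed.

Lemma smooth1_cst D k (c : R) : open D -> smooth1 D k (fun=> c).
Proof.
move=> oD; elim: k c => [|k IH] c; first by move=> x _; exact: cvg_cst.
by apply: (smooth1_is_deriveP oD) (IH 0) => x _; exact: is_derive_cst.
Qed.

Lemma smooth1_id D k : open D -> smooth1 D k id.
Proof.
move=> oD; case: k => [|k]; first by move=> x _; exact: cvg_id.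
by apply: (smooth1_is_deriveP oD) (smooth1_cst k 1 oD) => x _; exact: is_derive_id.
Qed.

Lemma smooth1D D k f g : open D -> smooth1 D k f -> smooth1 D k g ->
  smooth1 D k (fun x => f x + g x).
Proof.
move=> oD; elim: k f g => [|k IH] f g sf sg.
  by move=> x Dx; apply: cvgD; [exact: sf|exact: sg].
apply: (smooth1_is_deriveP oD) (IH _ _ sf.2 sg.2) => x Dx.
exact: is_deriveD (smooth1_is_derive sf Dx) (smooth1_is_derive sg Dx).
Qed.

Lemma smooth1M D k f g : open D -> smooth1 D k f -> smooth1 D k g ->
  smooth1 D k (fun x => f x * g x).
Proof.
move=> oD; elim: k f g => [|k IH] f g sf sg.
  by move=> x Dx; apply: cvgM; [exact: sf|exact: sg].
have s1 := IH _ _ (smooth1_prev sf) sg.2.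
have s2 := IH _ _ sf.2 (smooth1_prev sg).
apply: (smooth1_is_deriveP oD) (smooth1D oD s1 s2) => x Dx.
have d1 := smooth1_is_derive sf Dx; have d2 := smooth1_is_derive sg Dx.
have d3 := is_deriveM d1 d2.
apply: (is_derive_eq d3).
by rewrite /GRing.scale/= [g x * _]mulrC.
Qed.

Lemma smooth1_comp D E k f g : open D -> open E -> (forall x, D x -> E (f x)) ->
  smooth1 D k f -> smooth1 E k g -> smooth1 D k (fun x => g (f x)).
Proof.
move=> oD oE DE; elim: k f g DE => [|k IH] f g DE sf sg.
  by move=> x Dx; apply: continuous_comp; [exact: sf|apply: sg; exact: DE].
have s1 := smooth1M oD (IH _ _ DE (smooth1_prev sf) sg.2) sf.2.
apply: (smooth1_is_deriveP oD) s1 => x Dx.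
have d1 := smooth1_is_derive sf Dx; have d2 := smooth1_is_derive sg (DE _ Dx).
exact: is_derive1_comp d2 d1.
Qed.

Lemma smooth1_expR D k : open D -> smooth1 D k expR.
Proof.
move=> oD; elim: k => [|k IH]; first by move=> x _; exact: continuous_expR.
by apply: (smooth1_is_deriveP oD) IH => x _; exact: is_derive_expR.
Qed.

Lemma smooth1_inv k : smooth1 `]0, +oo[ k (fun x => x^-1).
Proof.
have oD : open (`]0, +oo[%classic : set R) by exact: interval_open.
elim: k => [|k IH].
  move=> x /=; rewrite in_itv/= andbT => x0; apply: cvgV; [|exact: cvg_id].
  by rewrite gt_eqF.
have s1 := smooth1M oD IH IH.
apply: (smooth1_is_deriveP oD (df := fun x => -1 * (x^-1 * x^-1))); last first.
  exact: smooth1M oD (smooth1_cst k (-1) oD) s1.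
move=> x /=; rewrite in_itv/= andbT => x0.
have x1 : x != 0 by rewrite gt_eqF.
have := @is_deriveV R id x 1 1 x1 (is_derive_id _ _).
move=> h; apply: (is_derive_eq h).
by rewrite /GRing.scale/= mulr1 mulN1r -invfM.
Qed.

Lemma smooth1_ln k : smooth1 `]0, +oo[ k (@ln R).
Proof.
have oD : open (`]0, +oo[%classic : set R) by exact: interval_open.
case: k => [|k].
  by move=> x /=; rewrite in_itv/= andbT => x0; exact: continuous_ln.
apply: (smooth1_is_deriveP oD) (smooth1_inv k) => x /=.
by rewrite in_itv/= andbT => x0; exact: is_derive1_ln.
Qed.

Section flat.

(* [flat p] is the function [p (1/x) * exp (- 1/x)], extended by 0 to the
   negative half line; these functions are stable under derivation. *)
Definition flat (p : {poly R}) (x : R) : R :=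
  if 0 < x then p.[x^-1] * expR (- x^-1) else 0.

(** The exponential beats every power. In the induction the polynomial p X + c hands its factor y
    over to the power [m], so [m] has to vary. *)
Lemma flat_bound (p : {poly R}) (m : nat) :
  exists C, 0 <= C /\ forall y, 0 < y -> `|p.[y]| * y ^+ m * expR (- y) <= C / y.
Proof.
elim/poly_ind: p m => [|p c IH] m.
  by exists 0; split => // y _; rewrite horner0 normr0 !mul0r.
have [C [C0 hC]] := IH m.+1.
exists (C + `|c| * (m.+1)`!%:R); split; first by rewrite addr_ge0// mulr_ge0.
move=> y y0; rewrite hornerMXaddC.
apply: (@le_trans _ _ ((`|p.[y]| * y + `|c|) * y ^+ m * expR (- y))).
  rewrite -!mulrA ler_wpM2r ?mulr_ge0 ?exprn_ge0 ?expR_ge0 ?(ltW y0)//.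
  by rewrite (le_trans (ler_normD _ _))// normrM (gtr0_norm y0).
rewrite !mulrDl lerD//.
  by have := hC y y0; rewrite exprS !mulrA.
rewrite -mulrA -mulrA ler_wpM2l// ler_pdivlMr// mulrAC -exprSr expRN.
rewrite ler_pdivrMr ?expR_gt0//.
have := @expR_ge1Dxn R y m (ltW y0).
have f0 : 0 < (m.+1)`!%:R :> R by rewrite ltr0n fact_gt0.
move=> h; rewrite mulrC -ler_pdivrMr//; apply: le_trans h.
by rewrite lerDr.
Qed.

Lemma is_derive_flat (p : {poly R}) (x : R) :
  is_derive x 1 (flat p) (flat ('X^2 * (p - p^`())) x).
Proof.
have [x0|x0|->] := ltgtP x 0.
- rewrite {2}/flat ltNge (ltW x0)/=.
  apply: (@near_eq_is_derive _ _ _ (fun=> 0)) => //.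
  near=> y; rewrite /flat ifF//; apply/negbTE; rewrite -leNgt.
  by apply: ltW; near: y; exact: lt_nbhsl.
- rewrite {2}/flat x0.
  apply: (@near_eq_is_derive R R R (fun x : R => p.[x^-1] * expR (- x^-1))).
    near=> y; rewrite /flat ifT//; near: y; exact: lt_nbhsr.
  have x1 : x != 0 by rewrite gt_eqF.
  have d1 := @is_deriveV R id x 1 1 x1 (is_derive_id _ _).
  have d2 := @is_derive1_comp R (horner p) (fun x => x^-1) x _ _ (is_derive_poly p x^-1) d1.
  have d3 := @is_derive1_comp R expR (fun x => - x^-1) x _ _ (is_derive_expR _) (is_deriveN d1).
  have d4 := is_deriveM d2 d3.
  apply: (is_derive_eq d4).
  by rewrite /GRing.scale/= !hornerE /=; field.
- rewrite {2}/flat ltxx.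
  (* The power m = 1 pays for the factor 1 / h of the difference quotient at 0 and leaves a bound C
     h. *)
  have [C [C0 hC]] := flat_bound p 1.
  suff h : h^-1 *: ((flat p \o shift 0) (h *: 1) - flat p 0) @[h --> 0^'] --> (0 : R).
    apply: DeriveDef; first by apply/cvg_ex; exists 0.
    exact: cvg_lim h.
  apply/cvgrPdist_le => e e0.
  have Ce : 0 < e / (C + 1) by rewrite divr_gt0// ltr_wpDl.
  near=> h.
  rewrite sub0r normrN /= addr0 /GRing.scale/= mulr1 {2}/flat ltxx subr0.
  rewrite /flat; case: ifPn => [h0|_]; last by rewrite mulr0 normr0 ltW.
  have hi0 : 0 < h^-1 by rewrite invr_gt0.
  have := hC _ hi0; rewrite expr1 invrK => hh.
  rewrite !normrM (gtr0_norm hi0) (gtr0_norm (expR_gt0 _)) mulrCA mulrA.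
  apply: (le_trans hh).
  have he : h <= e / (C + 1).
    by rewrite -(gtr0_norm h0); near: h; exact: dnbhs0_le.
  apply: (le_trans (ler_wpM2l C0 he)).
  rewrite mulrA ler_pdivrMr ?ltr_wpDl// mulrC ler_pM2l//; lra.
Unshelve. all: by end_near. Qed.

Lemma smooth1_flat D k p : open D -> smooth1 D k (flat p).
Proof.
move=> oD; elim: k p => [|k IH] p.
  by move=> x _; apply: derivable1_continuous; case: (is_derive_flat p x).
by apply: (smooth1_is_deriveP oD) (IH _) => x _; exact: is_derive_flat.
Qed.

End flat.

End smooth1.

Section smooth_rV.
Variables (R : realType) (n : nat).
Implicit Types (f g : 'rV[R]_n -> R) (x : 'rV[R]_n).

Definition evec (i : 'I_n) : 'rV[R]_n := delta_mx ord0 i.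

(** A finite-order version of [smooth], recursive in the first derivative so that the product and
    chain rules go by induction. Continuity is demanded at every order, since the existence of
    partial derivatives does not imply it. *)
Fixpoint smoothk (k : nat) f : Prop :=
  continuous (f : 'rV[R]_n -> R^o) /\
  match k with
  | 0 => True
  | k'.+1 => forall i, (forall x, derivable (f : 'rV[R]_n -> R^o) x (evec i)) /\
                       smoothk k' (partial i f)
  end.

Lemma smoothk_continuous k f : smoothk k f -> continuous (f : 'rV[R]_n -> R^o).
Proof. by case: k => [|k] []. Qed.

Lemma smoothk_prev k f : smoothk k.+1 f -> smoothk k f.
Proof.
elim: k f => [|k IH] f [cf sf]; first by split.
by split => // i; have [df s] := sf i; split => //; exact: IH.
Qed.

Lemma smoothk_smooth f : (forall k, smoothk k f) -> smooth f.
Proof.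
move=> sf s; elim/last_ind: s f sf => [|s i IH] f sf.
  split; first exact: smoothk_continuous (sf 0%N).
  by move=> i x; have [_ /(_ i)[]] := sf 1%N.
rewrite foldr_rcons; apply: IH => k.
by have [_ /(_ i)[]] := sf k.+1.
Qed.

Lemma smoothk_is_derive k f i x : smoothk k.+1 f ->
  is_derive x (evec i) (f : 'rV[R]_n -> R^o) (partial i f x).
Proof. by move=> [_ /(_ i)[+ _]] => /(_ x) h; exact: derivableP. Qed.

Lemma smoothk_is_deriveP k f df : continuous (f : 'rV[R]_n -> R^o) ->
  (forall i x, is_derive x (evec i) (f : 'rV[R]_n -> R^o) (df i x)) ->
  (forall i, smoothk k (df i)) -> smoothk k.+1 f.
Proof.
move=> cf fE sdf; split => // i; split; first by move=> x; have [] := fE i x.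
suff -> : partial i f = df i by [].
by apply/funext => x; rewrite /partial; have [_ <-] := fE i x.
Qed.

Lemma smoothk_cst k (c : R) : smoothk k (fun=> c).
Proof.
elim: k c => [|k IH] c; first by split => //; exact: cst_continuous.
apply: (@smoothk_is_deriveP _ _ (fun _ _ => 0)) => //.
exact: cst_continuous.
Qed.

Lemma is_derive_coord i j x :
  is_derive x (evec i) (fun x : 'rV[R]_n => x ord0 j : R^o) ((i == j)%:R : R).
Proof.
suff h : h^-1 *: (((fun x : 'rV[R]_n => x ord0 j : R^o) \o shift x) (h *: evec i) - x ord0 j)
    @[h --> 0^'] --> ((i == j)%:R : R^o).
  apply: DeriveDef; first by apply/cvg_ex; eexists; exact: h.
  exact: cvg_lim h.
apply: cvg_near_cst; near=> h.
rewrite /= !mxE eqxx /= addrK [j == i]eq_sym /GRing.scale /= mulrA mulVf ?mul1r//.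
by near: h; exact: nbhs_dnbhs_neq.
Unshelve. all: by end_near. Qed.

Lemma smoothk_coord k j : smoothk k (fun x => x ord0 j).
Proof.
have c : continuous (fun x : 'rV[R]_n => x ord0 j : R^o) by exact: coord_continuous.
case: k => [|k]; first by split.
apply: (smoothk_is_deriveP c (df := fun i _ => (i == j)%:R)).
  by move=> i x; exact: is_derive_coord.
by move=> i; exact: smoothk_cst.
Qed.

Lemma smoothkD k f g : smoothk k f -> smoothk k g ->
  smoothk k (fun x => f x + g x).
Proof.
elim: k f g => [|k IH] f g sf sg.
  have c : continuous ((fun x => f x + g x) : 'rV[R]_n -> R^o).
    move=> x; exact: (continuousD (@smoothk_continuous 0 f sf x) (@smoothk_continuous 0 g sg x)).
  by split.
apply: (@smoothk_is_deriveP _ _ (fun i x => partial i f x + partial i g x)).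
- move=> x; exact: (continuousD (@smoothk_continuous _ f sf x) (@smoothk_continuous _ g sg x)).
- move=> i x.
  exact: is_deriveD (smoothk_is_derive i x sf) (smoothk_is_derive i x sg).
- by move=> i; apply: IH; [exact: (sf.2 i).2|exact: (sg.2 i).2].
Qed.

Lemma smoothkM k f g : smoothk k f -> smoothk k g ->
  smoothk k (fun x => f x * g x).
Proof.
elim: k f g => [|k IH] f g sf sg.
  have c : continuous ((fun x => f x * g x) : 'rV[R]_n -> R^o).
    move=> x; exact: (continuousM (@smoothk_continuous 0 f sf x) (@smoothk_continuous 0 g sg x)).
  by split.
apply: (@smoothk_is_deriveP _ _ (fun i x => f x * partial i g x + g x * partial i f x)).
- move=> x; exact: (continuousM (@smoothk_continuous _ f sf x) (@smoothk_continuous _ g sg x)).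
- move=> i x.
  exact: is_deriveM (smoothk_is_derive i x sf) (smoothk_is_derive i x sg).
- move=> i; apply: smoothkD; apply: IH.
  + exact: smoothk_prev sf.
  + exact: (sg.2 i).2.
  + exact: smoothk_prev sg.
  + exact: (sf.2 i).2.
Qed.

Lemma smoothk_sum (I : Type) (s : seq I) k (F : I -> 'rV[R]_n -> R) :
  (forall i, smoothk k (F i)) -> smoothk k (fun x => \sum_(i <- s) F i x).
Proof.
move=> sF; elim: s => [|i s IH].
  by under eq_fun do rewrite big_nil; exact: smoothk_cst.
by under eq_fun do rewrite big_cons; exact: smoothkD.
Qed.

Lemma smoothk_prod (I : Type) (s : seq I) k (F : I -> 'rV[R]_n -> R) :
  (forall i, smoothk k (F i)) -> smoothk k (fun x => \prod_(i <- s) F i x).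
Proof.
move=> sF; elim: s => [|i s IH].
  by under eq_fun do rewrite big_nil; exact: smoothk_cst.
by under eq_fun do rewrite big_cons; exact: smoothkM.
Qed.

Lemma is_derive_line f x (v : 'rV[R]_n) (d : R) :
  is_derive x v (f : 'rV[R]_n -> R^o) d <->
  is_derive (0 : R) 1 (fun h : R => f (h *: v + x)) d.
Proof.
have e : (fun h : R => h^-1 *: (((f : 'rV[R]_n -> R^o) \o shift x) (h *: v) - f x)) =
    (fun h : R => h^-1 *: (((fun h : R => f (h *: v + x)) \o shift 0) (h *: 1) - f (0 *: v + x))).
  by apply/funext => h; rewrite /= addr0 scale0r add0r [h *: 1]mulr1.
by split => -[h1 h2]; split; move: h1 h2; rewrite /derivable /derive e.
Qed.

Lemma is_derive_comp_rV f (H : R -> R) x (v : 'rV[R]_n) (df dH : R) :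
  is_derive x v (f : 'rV[R]_n -> R^o) df -> is_derive (f x) 1 H dH ->
  is_derive x v ((fun x => H (f x)) : 'rV[R]_n -> R^o) (dH * df).
Proof.
move=> /is_derive_line d1 d2; apply/is_derive_line.
have d2' : is_derive (f (0 *: v + x)) 1 H dH by rewrite scale0r add0r.
exact: is_derive1_comp d2' d1.
Qed.

Lemma smoothk_comp k f (H : R -> R) : smooth1 setT k H -> smoothk k f ->
  smoothk k (fun x => H (f x)).
Proof.
elim: k f H => [|k IH] f H sH sf.
  split => // x; apply: continuous_comp; first exact: sf.1.
  exact: sH.
apply: (@smoothk_is_deriveP _ _ (fun i x => derive1 H (f x) * partial i f x)).
- move=> x; apply: continuous_comp; first exact: (smoothk_continuous sf).
  exact: (smooth1_continuous sH).
- move=> i x; apply: is_derive_comp_rV; first exact: smoothk_is_derive sf.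
  exact: smooth1_is_derive sH _.
- move=> i; apply: smoothkM; last exact: (sf.2 i).2.
  by apply: IH; [exact: sH.2|exact: smoothk_prev sf].
Qed.

Lemma partial_compE f (H : R -> R) i x k : smooth1 setT 1 H -> smoothk k.+1 f ->
  partial i (fun x => H (f x)) x = derive1 H (f x) * partial i f x.
Proof.
move=> sH sf; rewrite /partial.
have d := is_derive_comp_rV (smoothk_is_derive i x sf)
   (smooth1_is_derive sH (I : [set: R] (f x))).
by have [_ ->] := d.
Qed.

Lemma partialM k f g i x : smoothk k.+1 f -> smoothk k.+1 g ->
  partial i (fun x => f x * g x) x = f x * partial i g x + g x * partial i f x.
Proof.
move=> sf sg; rewrite /partial.
by have [_ ->] := is_deriveM (smoothk_is_derive i x sf) (smoothk_is_derive i x sg).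
Qed.

End smooth_rV.

(** * Measurability of continuous functions, and integration by parts in several variables *)

Section continuous_measurable.
Variables (R : realType) (n : nat).

Definition roundx (k : nat) (t : R) : R := (Num.floor (k.+1%:R * t))%:~R / k.+1%:R.

Lemma roundx_le k t : `|t - roundx k t| <= k.+1%:R^-1.
Proof.
have k0 : 0 < k.+1%:R :> R by [].
have /andP[h1 h2] := floor_itv (k.+1%:R * t).
have -> : t - roundx k t = (k.+1%:R * t - (Num.floor (k.+1%:R * t))%:~R) / k.+1%:R.
  by rewrite /roundx mulrBl mulrAC divff ?mul1r.
rewrite ger0_norm; last by rewrite divr_ge0// subr_ge0.
rewrite ler_pdivrMr// mulVf//.
by move: h2; rewrite intrD mulr1z; lra.
Qed.

Definition roundv k (x : 'rV[R]_n) : 'rV[R]_n := \row_i roundx k (x ord0 i).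

Lemma roundv_cvg x : roundv k x @[k --> \oo] --> x.
Proof.
apply/cvg_ballP => e e0; near=> k; split => // i j.
rewrite (ord1 i) mxE /ball/= (le_lt_trans (roundx_le _ _))//.
by near: k; exact: near_infty_natSinv_lt (PosNum e0).
Unshelve. all: by end_near. Qed.

(** The sigma-algebra is generated by the coordinates, not by the open sets, so continuity does not
    give measurability at once. Here f is the pointwise limit of its compositions with rounding to
    the grid of mesh 1 / (k + 1), which are constant on countably many measurable cells. *)
Lemma continuous_measurable_rV (f : 'rV[R]_n -> R) :
  continuous (f : 'rV[R]_n -> R^o) -> measurable_fun [set: 'rV[R]_n] f.
Proof.
move=> cf; apply: (@measurable_fun_cvg _ _ _ _ (fun k x => f (roundv k x))).
  move=> k _ A mA; rewrite setTI.
  pose v (z : 'rV[int]_n) : 'rV[R]_n := \row_i ((z ord0 i)%:~R / k.+1%:R).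
  have -> : (fun x => f (roundv k x)) @^-1` A = \bigcup_(z in [set z | A (f (v z))])
      \bigcap_(i in [set: 'I_n]) (@rV_coord R n i @^-1` (fun t => Num.floor (k.+1%:R * t) = z ord0 i)).
    apply/seteqP; split => x /=.
      move=> Ax; exists (\row_i Num.floor (k.+1%:R * x ord0 i)).
        rewrite /= (_ : v _ = roundv k x)//.
        by apply/rowP => i; rewrite !mxE.
      by move=> i _ /=; rewrite mxE.
    move=> [z Az xz]; rewrite (_ : roundv k x = v z)//.
    apply/rowP => i; rewrite !mxE /roundx.
    by have := xz i Logic.I; rewrite /= /rV_coord => ->.
  rewrite bigcup_mkcond; apply: countable_bigcupT_measurable => // z.
  case: ifP => // _.
  apply: fin_bigcap_measurable; first exact: finite_finset.
  move=> i _; rewrite -[X in measurable X]setTI.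
  apply: measurable_rV_coord => //.
  have -> : (fun t => Num.floor (k.+1%:R * t) = z ord0 i) =
     ( *%R k.+1%:R) @^-1` `[(z ord0 i)%:~R, (z ord0 i + 1)%:~R[ :> set R.
    apply/funext => t; apply/propext => /=; rewrite in_itv/=; split.
      by move=> <-; exact: floor_itv.
    by move=> h; exact: floor_def.
  rewrite -[X in measurable X]setTI.
  have mk : measurable_fun [set: R] ( *%R k.+1%:R : R -> R) by exact: measurable_funM.
  exact: mk.
move=> x _; apply: continuous_cvg; first exact: cf.
exact: roundv_cvg.
Qed.

End continuous_measurable.

Section bounded_support.
Variables (R : realType) (n : nat).
Notation mu := (@lebesgue_rV R n).
Implicit Types (f : 'rV[R]_n -> R) (M : R).

Definition bsupp M f := forall x : 'rV[R]_n, (exists j, M < `|x ord0 j|) -> f x = 0.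

Lemma continuous_bsupp_bounded M f : continuous (f : 'rV[R]_n -> R^o) ->
  bsupp M f -> exists C, forall x, `|f x| <= C.
Proof.
move=> cf sf; pose K : set 'rV[R]_n := [set v | forall i, `[- M, M]%classic (v ord0 i)].
have cK : compact K by apply: (@rV_compact R n (fun=> `[- M, M]%classic)) => i; exact: segment_compact.
have cfK : compact ((f : 'rV[R]_n -> R^o) @` K).
  by apply: continuous_compact => //; exact: continuous_subspaceT.
have [C [_ hC]] := compact_bounded cfK.
exists (Num.max 0 (C + 1)) => x.
have [Kx|Kx] := pselect (K x).
  by rewrite le_max (hC (C + 1)) ?orbT ?ltrDl//; exists x.
rewrite sf ?normr0 ?le_max ?lexx//.
apply: contra_notP Kx => /forallNP h i.
by rewrite /= in_itv/= -ler_norml leNgt; apply/negP/h.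
Qed.

Lemma integrable_bsupp M f C : 0 < M -> measurable_fun [set: 'rV[R]_n] f ->
  (forall x, `|f x| <= C) -> bsupp M f -> mu.-integrable setT (EFin \o f).
Proof.
move=> M0 mf fC sf; pose K : set 'rV[R]_n := [set v | forall i, `[- M, M]%classic (v ord0 i)].
have mK : measurable K by exact: measurable_cube.
have muK : mu K = ((2 * M) ^+ n)%:E.
  apply: lebesgue_rV_cube => //.
  by rewrite lebesgue_measure_itv/= lte_fin gtrN// -EFinB opprK mulr_natl mulr2n.
apply/integrableP; split; first exact/measurable_EFinP.
have C0 : 0 <= C by apply: le_trans (fC 0).
apply: (@le_lt_trans _ _ (\int[mu]_x (C%:E * (\1_K x)%:E))%E).
  apply: ge0_le_integral => //.
  - by apply: measurableT_comp => //; exact/measurable_EFinP.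
  - by apply: measurable_funeM; exact/measurable_EFinP/measurable_indic.
  - move=> x _ /=; rewrite indicE -EFinM lee_fin; have [Kx|Kx] := boolP (x \in K).
      by rewrite mulr1.
    rewrite mulr0 sf ?normr0//; move: Kx; rewrite notin_setE => Kx.
    apply: contra_notP Kx => /forallNP h i.
    by rewrite /= in_itv/= -ler_norml leNgt; apply/negP/h.
rewrite ge0_integralZl//; last exact/measurable_EFinP/measurable_indic.
rewrite integral_indic// setIT.
by apply: (@le_lt_trans _ _ (C * (2 * M) ^+ n)%:E); [rewrite EFinM -muK|rewrite ltry].
Qed.

Lemma partial_bsupp i M f : bsupp M f -> bsupp M (partial i f).
Proof.
move=> sf x [j xj]; rewrite /partial.
rewrite (@near_eq_derive _ _ _ _ (fun=> 0 : R^o)); first exact: derive_cst.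
have c := @coord_continuous R 1 n ord0 j x.
have : \forall y \near x, M < `|(y : 'rV[R]_n) ord0 j|.
  have c' : {for x, continuous (fun y : 'rV[R]_n => `|y ord0 j|)}.
    by apply: continuous_comp; [exact: c|exact: norm_continuous].
  exact: (cvgr_gt _ c' _ xj).
by apply: filterS => y My; apply: sf; exists j.
Qed.

End bounded_support.

Section rV_cons_calculus.
Variables (R : realType) (n : nat).

Lemma rV_addE m (a b : 'rV[R]_m) i : (a + b) ord0 i = a ord0 i + b ord0 i.
Proof. by rewrite mxE. Qed.

Lemma rV_scaleE m (c : R) (a : 'rV[R]_m) i : (c *: a) ord0 i = c * a ord0 i.
Proof. by rewrite mxE. Qed.

Lemma evecE m (i j : 'I_m) : evec R i ord0 j = (j == i)%:R.
Proof. by rewrite mxE eqxx. Qed.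

Lemma rV_cons_line (x : R) (y : 'rV[R]_n) :
  rV_cons (x, y) = x *: evec R ord0 + rV_cons (0, y).
Proof.
apply/rowP => i; rewrite rV_addE rV_scaleE evecE.
case: (unliftP ord0 i) => [j ->|->].
  by rewrite !rV_consS /= mulr0 add0r.
by rewrite !rV_cons0/= addr0 mulr1.
Qed.

Lemma rV_consD (x : R) (y : 'rV[R]_n) (h : R) j :
  rV_cons (x, h *: evec R j + y) = h *: evec R (lift ord0 j) + rV_cons (x, y).
Proof.
apply/rowP => i; rewrite rV_addE rV_scaleE evecE.
case: (unliftP ord0 i) => [k ->|->].
  by rewrite !rV_consS /= rV_addE rV_scaleE evecE (inj_eq lift_inj).
by rewrite !rV_cons0/= mulr0 add0r.
Qed.

Lemma continuous_rV_consl (y : 'rV[R]_n) :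
  continuous (fun x : R => rV_cons (x, y) : 'rV[R]_n.+1).
Proof.
under eq_fun do rewrite rV_cons_line.
move=> x; apply: cvgD; last exact: cvg_cst.
by apply: cvgZr_tmp; exact: cvg_id.
Qed.

Lemma continuous_rV_consr (x : R) :
  continuous (fun y : 'rV[R]_n => rV_cons (x, y) : 'rV[R]_n.+1).
Proof.
move=> y A /nbhs_ballP[e e0 eA]; apply/nbhs_ballP; exists e => // z yz.
apply: eA; have [_ hyz] := yz; split => // i j; rewrite (ord1 i).
case: (unliftP ord0 j) => [k ->|->].
  by rewrite !rV_consS/=; exact: hyz.
by rewrite !rV_cons0/=; exact: ballxx.
Qed.

Lemma integral_rV_cons (f : 'rV[R]_n.+1 -> R) :
  (@lebesgue_rV R n.+1).-integrable setT (EFin \o f) ->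
  ((@lebesgue_measure R \x @lebesgue_rV R n)%E).-integrable setT
     (EFin \o (fun p => f (rV_cons p))) /\
  (\int[@lebesgue_rV R n.+1]_x (f x)%:E =
   \int[(@lebesgue_measure R \x @lebesgue_rV R n)%E]_p (f (rV_cons p))%:E)%E.
Proof.
move=> intf.
have mc := @measurable_rV_cons R n.
have mf : measurable_fun setT (EFin \o f) by exact: measurable_int intf.
have intp : ((@lebesgue_measure R \x @lebesgue_rV R n)%E).-integrable setT
     (EFin \o (fun p => f (rV_cons p))).
  apply/integrableP; split; first exact: (measurableT_comp mf).
  have /integrableP[_] := intf; apply: le_lt_trans.
  rewrite le_eqVlt; apply/orP; left; apply/eqP.
  transitivity (\int[pushforward (@lebesgue_measure R \x @lebesgue_rV R n)%E (@rV_cons R n)]_x `|(f x)%:E|)%E.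
    rewrite ge0_integral_pushforward ?preimage_setT//.
    exact: measurableT_comp.
  by apply: eq_measure_integral.
split => //.
transitivity (\int[pushforward (@lebesgue_measure R \x @lebesgue_rV R n)%E (@rV_cons R n)]_x (f x)%:E)%E.
  by apply: eq_measure_integral.
by rewrite integral_pushforward// preimage_setT.
Qed.

End rV_cons_calculus.

Section integral_partial.
Variable R : realType.

Lemma is_derive_shift (g : R -> R) (x d : R) :
  is_derive (0 : R) 1 (fun h => g (h + x)) d -> is_derive x 1 g d.
Proof.
move=> dg.
have ds : is_derive x 1 (fun y : R => y - x) 1 by apply: is_derive_eq; rewrite subr0.
have dg' : is_derive (x - x) 1 (fun h => g (h + x)) d by rewrite subrr.
have := @is_derive1_comp R (fun h => g (h + x)) (fun y => y - x) x _ _ dg' ds.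
rewrite mulr1; congr (is_derive _ _ _ _).
by apply/funext => y /=; rewrite subrK.
Qed.

(** Fubini on the first coordinate. If [i] is that coordinate, the inner integral vanishes by the
    fundamental theorem of calculus on an interval that goes beyond the support; otherwise the inner
    integral is the same statement on a slice, in one dimension less. *)
Lemma integral_partial0 n (i : 'I_n) (f : 'rV[R]_n -> R) (M : R) : 0 < M ->
  continuous (f : 'rV[R]_n -> R^o) ->
  (forall x, derivable (f : 'rV[R]_n -> R^o) x (evec R i)) ->
  continuous (partial i f : 'rV[R]_n -> R^o) -> bsupp M f ->
  (\int[@lebesgue_rV R n]_x (partial i f x)%:E = 0)%E.
Proof.
move=> M0; elim: n i f => [|n IH] i f cf df cdf sf; first by case: i {df cdf}.
have spf := partial_bsupp i sf.
have [C hC] := continuous_bsupp_bounded cdf spf.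
have int := integrable_bsupp M0 (continuous_measurable_rV cdf) hC spf.
have [intp ->] := integral_rV_cons int.
case: (unliftP ord0 i) => [j ij|i0].
  rewrite -integral12_prod_meas1//.
  apply: integral0_eq => x _ /=.
  pose fx y := f (rV_cons (x, y)).
  have dfx y : is_derive y (evec R j) (fx : 'rV[R]_n -> R^o) (partial i f (rV_cons (x, y))).
    apply/is_derive_line; rewrite /fx.
    under eq_fun do rewrite rV_consD -ij.
    by apply/is_derive_line; exact: derivableP.
  have pE : partial j fx = fun y => partial i f (rV_cons (x, y)).
    by apply/funext => y; rewrite /partial; have [_ ->] := dfx y.
  transitivity (\int[@lebesgue_rV R n]_y (partial j fx y)%:E)%E; first by rewrite pE.
  apply: IH.
  - by move=> y; apply: continuous_comp; [exact: continuous_rV_consr|exact: cf].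
  - by move=> y; have [] := dfx y.
  - rewrite pE => y.
    by apply: continuous_comp; [exact: continuous_rV_consr|exact: cdf].
  - by move=> y [k yk]; apply: sf; exists (lift ord0 k); rewrite rV_consS.
rewrite -integral21_prod_meas1//.
apply: integral0_eq => y _ /=.
pose g x := f (rV_cons (x, y)).
have dg (x : R) : is_derive x 1 g (partial i f (rV_cons (x, y))).
  apply: is_derive_shift; rewrite /g.
  have -> : (fun h : R => f (rV_cons (h + x, y))) =
      (fun h : R => f (h *: evec R i + rV_cons (x, y))).
    apply/funext => h; rewrite rV_cons_line [in RHS]rV_cons_line i0.
    by rewrite scalerDl addrA.
  by apply/is_derive_line; exact: derivableP.
have cg : continuous (fun x : R => partial i f (rV_cons (x, y))).
  by move=> x; apply: continuous_comp; [exact: continuous_rV_consl|exact: cdf].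
(* M + 1 instead of M: [bsupp] makes f vanish only where a coordinate strictly exceeds M. *)
have MM : - (M + 1) <= M + 1 by lra.
transitivity (\int[lebesgue_measure]_(x in `[(- (M + 1))%R, (M + 1)%R])
    (partial i f (rV_cons (x, y)))%:E)%E; last first.
  rewrite (integral_is_derive MM dg cg) /g !sf ?subrr//.
    by exists ord0; rewrite rV_cons0/= normrN gtr0_norm; lra.
  by exists ord0; rewrite rV_cons0/= gtr0_norm; lra.
rewrite [RHS]integral_mkcond; apply: eq_integral => x _; rewrite patchE.
case: ifPn => //; rewrite notin_setE /= in_itv/= -ler_norml => /negP.
rewrite -ltNge => xM; rewrite spf//; exists ord0; rewrite rV_cons0/=.
by rewrite (lt_trans _ xM)// ltrDl.
Qed.

End integral_partial.

Section borel_rV.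
Variables (R : realType) (n : nat).

Lemma measurable_roundv k (P : set 'rV[R]_n) : measurable (@roundv R n k @^-1` P).
Proof.
pose v (z : 'rV[int]_n) : 'rV[R]_n := \row_i ((z ord0 i)%:~R / k.+1%:R).
have -> : roundv k @^-1` P = \bigcup_(z in [set z | P (v z)])
    \bigcap_(i in [set: 'I_n]) (@rV_coord R n i @^-1` (fun t => Num.floor (k.+1%:R * t) = z ord0 i)).
  apply/seteqP; split => x /=.
    move=> Ax; exists (\row_i Num.floor (k.+1%:R * x ord0 i)).
      rewrite /= (_ : v _ = roundv k x)//.
      by apply/rowP => i; rewrite !mxE.
    by move=> i _ /=; rewrite mxE.
  move=> [z Az xz]; rewrite (_ : roundv k x = v z)//.
  apply/rowP => i; rewrite !mxE /roundx.
  by have := xz i Logic.I; rewrite /= /rV_coord => ->.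
rewrite bigcup_mkcond; apply: countable_bigcupT_measurable => // z.
case: ifP => // _.
apply: fin_bigcap_measurable; first exact: finite_finset.
move=> i _; rewrite -[X in measurable X]setTI.
apply: measurable_rV_coord => //.
have -> : (fun t => Num.floor (k.+1%:R * t) = z ord0 i) =
   ( *%R k.+1%:R) @^-1` `[(z ord0 i)%:~R, (z ord0 i + 1)%:~R[ :> set R.
  apply/funext => t; apply/propext => /=; rewrite in_itv/=; split.
    by move=> <-; exact: floor_itv.
  by move=> h; exact: floor_def.
rewrite -[X in measurable X]setTI.
have mk : measurable_fun [set: R] ( *%R k.+1%:R : R -> R) by exact: measurable_funM.
exact: mk.
Qed.

Lemma open_measurable_rV (O : set 'rV[R]_n) : open O -> measurable O.
Proof.
move=> oO.
(* The points y such that the whole cube of half-side 1 / (k + 1) around y lies in O. A point of O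
   is caught by rounding it on a grid so fine that this cube, all within twice the mesh of the
   point, stays in O. *)
pose P k : set 'rV[R]_n := [set y | forall x : 'rV[R]_n,
  (forall i, `|x ord0 i - (y : 'rV[R]_n) ord0 i| <= k.+1%:R^-1) -> O x].
have -> : O = \bigcup_k (roundv k @^-1` P k).
  apply/seteqP; split => x /=; last first.
    by move=> [k _]; apply => i; rewrite mxE; exact: roundx_le.
  move=> Ox; have := open_nbhs_nbhs (conj oO Ox) => /nbhs_ballP[e /= e0 xe].
  have e2 : 0 < e / 2 by rewrite divr_gt0.
  near \oo => k; exists k => // y hy; apply: xe; split => // i j; rewrite (ord1 i).
  rewrite /ball/=.
  have -> : x ord0 j - y ord0 j = (x ord0 j - roundx k (x ord0 j)) - (y ord0 j - roundx k (x ord0 j)) by ring.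
  apply: le_lt_trans (ler_normB _ _) _.
  have h1 := roundx_le k (x ord0 j).
  have := hy j; rewrite mxE => h2.
  have : k.+1%:R^-1 < e / 2 by near: k; exact: near_infty_natSinv_lt (PosNum e2).
  by move=> h3; rewrite (le_lt_trans (lerD h1 h2))// [ltRHS]splitr ltrD.
apply: bigcupT_measurable => k; exact: measurable_roundv.
Unshelve. all: by end_near. Qed.

Lemma compact_measurable_rV (K : set 'rV[R]_n) : compact K -> measurable K.
Proof.
move=> cK; rewrite -[K]setCK; apply: measurableC; apply: open_measurable_rV.
by apply: closed_openC; apply: compact_closed.
Qed.

End borel_rV.

(** * Weak gradients on the ball and their uniqueness *)

Section integral_pi_lambda.
Context d (T : measurableType d) (R : realType) (mu : {measure set T -> \bar R}).

Lemma cvg_integral_ndseq (F : (set T)^nat) (f : T -> R) :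
  (forall k, measurable (F k)) -> nondecreasing_seq F ->
  mu.-integrable setT (EFin \o f) ->
  (\int[mu]_(x in F k) (f x)%:E)%E @[k --> \oo] -->
  (\int[mu]_(x in \bigcup_k F k) (f x)%:E)%E.
Proof.
move=> mF ndF intf.
have mf : measurable_fun setT (EFin \o f) := measurable_int _ intf.
have mU : measurable (\bigcup_k F k) by exact: bigcupT_measurable.
under eq_cvg do rewrite integral_mkcond.
have -> : (\int[mu]_(x in \bigcup_k F k) (f x)%:E =
    \int[mu]_x ((EFin \o f) \_ (\bigcup_k F k)) x)%E by rewrite integral_mkcond.
have [|||||//] := @dominated_convergence _ _ _ mu setT measurableT
    (fun k => (EFin \o f) \_ (F k)) ((EFin \o f) \_ (\bigcup_k F k)) (fun x => `|(f x)%:E|%E).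
- by move=> k; apply/(measurable_restrictT _ (mF k)); exact: measurable_funTS.
- by apply/(measurable_restrictT _ mU); exact: measurable_funTS.
- apply: aeW => x _; apply: cvg_near_cst.
  have [[k _ Fkx]|nFx] := pselect ((\bigcup_k F k) x).
    near=> l; rewrite !patchE.
    have -> : x \in F l.
      rewrite inE; have := ndF k l; rewrite subsetEset; apply => //.
      by near: l; exact: nbhs_infty_ge.
    have -> // : x \in \bigcup_k F k.
    by rewrite inE; exists k.
  apply: nearW => l; rewrite !patchE !memNset// => Fl; apply: nFx; by exists l.
- exact: integrable_abse intf.
- apply: aeW => x k _; rewrite patchE; case: ifP => // _.
  by rewrite abse0.
Unshelve. all: by end_near. Qed.

(** The sets of zero integral form a lambda-system containing the pi-system [G]. As f has no sign,
    closure under increasing unions rests on dominated convergence, hence on integrability over the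
    whole space. *)
Lemma integral_pi_lambda_eq0 (G : set (set T)) (g : (set T)^nat) (f : T -> R) :
  measurable `<=` <<s G >> -> G `<=` measurable -> setI_closed G ->
  (forall k, G (g k)) -> nondecreasing_seq g -> \bigcup_k g k = setT ->
  mu.-integrable setT (EFin \o f) ->
  (forall A, G A -> \int[mu]_(x in A) (f x)%:E = 0)%E ->
  forall A, measurable A -> (\int[mu]_(x in A) (f x)%:E = 0)%E.
Proof.
move=> mG Gm GI Gg ndg gT intf fG.
pose H : set (set T) := [set A | measurable A /\ (\int[mu]_(x in A) (f x)%:E = 0)%E].
have int A : measurable A -> mu.-integrable A (EFin \o f).
  by move=> mA; apply: integrableS intf.
have Hnd : ndseq_closed H.
  move=> F ndF HF; have mF k : measurable (F k) by have [] := HF k.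
  split; first exact: bigcupT_measurable.
  have := cvg_integral_ndseq mF ndF intf.
  under eq_cvg do rewrite (HF _).2.
  by move=> /cvg_lim <-//; rewrite lim_cst.
have HT : H setT by rewrite -gT; apply: Hnd => // k; split; [exact/Gm/Gg|exact: fG].
have HD : setSD_closed H.
  move=> A B BA [mA A0] [mB B0]; split; first exact: measurableD.
  have := A0; rewrite -[in X in X -> _](setDUK BA) integral_setU//=.
  - by rewrite B0 add0e.
  - exact: measurableD.
  - by rewrite setDUK//; exact: measurable_int (int _ mA).
  - by apply/disj_setPS => x [Bx [_ /(_ Bx)]].
have lH : lambda_system setT H by split.
have sub : <<s G >> `<=` H.
  by apply: (lambda_system_subset GI lH) => // A GA; split; [exact: Gm|exact: fG].
by move=> A /mG/sub[].
Qed.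

End integral_pi_lambda.

Section orthants.
Variables (R : realType) (n : nat).

(** These sets form a pi-system generating the sigma-algebra, and their indicators are limits of
    products of smooth functions of one coordinate. *)
Definition orthant (a : 'rV[R]_n) : set 'rV[R]_n := [set x | forall i, a ord0 i < x ord0 i].

Definition orthants : set (set 'rV[R]_n) := range orthant.

Lemma measurable_orthant a : measurable (orthant a).
Proof.
have -> : orthant a = \bigcap_(i in [set: 'I_n]) (@rV_coord R n i @^-1` `]a ord0 i, +oo[).
  apply/seteqP; split => x /= h i; first by move=> _; rewrite /= in_itv/= andbT; exact: h.
  by have := h i Logic.I; rewrite /= in_itv/= andbT.
apply: fin_bigcap_measurable; first exact: finite_finset.
by move=> i _; rewrite -[X in measurable X]setTI; exact: measurable_rV_coord.
Qed.

Lemma orthantsI : setI_closed orthants.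
Proof.
move=> _ _ [a _ <-] [b _ <-]; exists (\row_i Num.max (a ord0 i) (b ord0 i)) => //.
apply/seteqP; split => x /=.
  by move=> h; split => i; have := h i; rewrite mxE gt_max => /andP[].
by move=> [h1 h2] i; rewrite mxE gt_max h1 h2.
Qed.

Definition big_orthant (k : nat) := orthant (const_mx (- k%:R)).

Lemma big_orthant_cover : \bigcup_k big_orthant k = setT.
Proof.
rewrite -subTset => x _; pose k := (Num.truncn (enorm x)).+1.
exists k => //= i; rewrite mxE ltrNl.
rewrite (le_lt_trans _ (truncnS_gt (enorm x)))// (le_trans _ (coord_le_enorm x i))//.
by rewrite -normrN ler_norm.
Qed.

Lemma big_orthant_nd : nondecreasing_seq big_orthant.
Proof.
move=> k l kl; rewrite subsetEset => x h i; apply: le_lt_trans (h i).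
by rewrite !mxE lerN2 ler_nat.
Qed.

Lemma measurable_sub_orthants : (measurable : set (set 'rV[R]_n)) `<=` <<s orthants >>.
Proof.
pose T := g_sigma_algebraType orthants.
have mid : measurable_fun [set: T] (id : T -> 'rV[R]_n).
  apply/measurable_fun_rVP => i.
  apply: (@measurability _ _ T R setT _ (@RGenOInfty.G R)).
    exact: RGenOInfty.measurableE.
  move=> _ [_ [x ->] <-]; rewrite setTI.
  have -> : (fun y : T => (y : 'rV[R]_n) ord0 i) @^-1` `]x, +oo[ =
     \bigcup_k (orthant (\row_j if j == i then x else - k%:R) : set T).
    apply/seteqP; split => y /=; rewrite in_itv/= andbT.
      move=> xy; pose k := (Num.truncn (enorm (y : 'rV[R]_n))).+1.
      exists k => //= j; rewrite mxE; case: eqP => [->//|_]; rewrite ltrNl.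
      rewrite (le_lt_trans _ (truncnS_gt (enorm (y : 'rV[R]_n))))//.
      rewrite (le_trans _ (coord_le_enorm (y : 'rV[R]_n) j))//.
      by rewrite -normrN ler_norm.
    by move=> [k _ /(_ i)]; rewrite mxE eqxx.
  apply: bigcupT_measurable => k; apply: sub_sigma_algebra.
  by eexists; [|reflexivity].
by move=> A mA; have := mid measurableT A mA; rewrite setTI.
Qed.

End orthants.

Section weak_gradient_theory.
Variables (R : realType) (n : nat).
Notation mu := (@lebesgue_rV R n).
Notation B := (unit_ball R n).
Implicit Types (u v f phi : 'rV[R]_n -> R) (x : 'rV[R]_n).

Let mB : measurable B. Proof. exact: measurable_unit_ball. Qed.

Lemma test_smoothk1 (O : set 'rV[R]_n) phi : test_function O phi -> smoothk 1 phi.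
Proof.
move=> [sphi _ _]; have [c0 d0] := sphi [::].
split => // i; split; first by move=> x; exact: d0.
by have [c1 _] := sphi [:: i].
Qed.

Lemma partial_continuous f i : smoothk 1 f -> continuous (partial i f : 'rV[R]_n -> R^o).
Proof. by move=> [_ /(_ i)[_ []]]. Qed.

Definition supp f := closure [set x | f x != 0].

Lemma supp_off f i x : ~ supp f x -> f x = 0 /\ partial i f x = 0.
Proof.
move=> nx.
have nfx : \forall y \near x, f y = 0.
  have oC : open (~` supp f) by apply: closed_openC; exact: closed_closure.
  have := open_nbhs_nbhs (conj oC nx); apply: filterS => y ny.
  by apply/eqP; apply: contra_notT ny => fy; exact: subset_closure.
split; first exact: nbhs_singleton nfx.
rewrite /partial (@near_eq_derive _ _ _ _ (fun=> 0 : R^o))//; exact: derive_cst.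
Qed.

Lemma compact_bounded_on (K : set 'rV[R]_n) f : compact K ->
  continuous (f : 'rV[R]_n -> R^o) -> exists2 C, 0 <= C & forall x, K x -> `|f x| <= C.
Proof.
move=> cK cf.
have cfK : compact ((f : 'rV[R]_n -> R^o) @` K).
  by apply: continuous_compact => //; exact: continuous_subspaceT.
have [C [_ hC]] := compact_bounded cfK.
exists (Num.max 0 (C + 1)); first by rewrite le_max lexx.
by move=> x Kx; rewrite le_max (hC (C + 1)) ?orbT ?ltrDl//; exists x.
Qed.

Lemma loc_integrable_continuous f : continuous (f : 'rV[R]_n -> R^o) ->
  loc_integrable B f.
Proof.
move=> cf; have mf := continuous_measurable_rV cf.
split; first exact: measurable_funTS.
move=> K KB cK; have mK := compact_measurable_rV cK.
have [C C0 hC] := compact_bounded_on cK cf.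
apply: (@le_lt_trans _ _ (\int[mu]_(x in K) (cst C%:E x))%E).
  apply: ge0_le_integral => //.
  by apply/measurable_EFinP; apply: measurable_funTS; exact: measurableT_comp.
rewrite integral_cst// ltey_eq.
apply/orP; left; rewrite fin_numM// ge0_fin_numE//.
apply: (@le_lt_trans _ _ (mu B)); last by rewrite unit_ball_volE ltry.
by apply: le_measure; rewrite ?inE.
Qed.

Lemma loc_integrable_mul u f (K : set 'rV[R]_n) : loc_integrable B u ->
  continuous (f : 'rV[R]_n -> R^o) -> compact K -> K `<=` B ->
  (forall x, ~ K x -> f x = 0) ->
  mu.-integrable B (EFin \o (fun x => u x * f x)).
Proof.
move=> [mu_ iu] cf cK KB f0; have mK := compact_measurable_rV cK.
have [C C0 hC] := compact_bounded_on cK cf.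
have mf : measurable_fun B f by apply: measurable_funTS; exact: continuous_measurable_rV.
apply/integrableP; split.
  by apply/measurable_EFinP; exact: measurable_funM.
have mnu : measurable_fun B (fun x => `|u x|%:E).
  by apply/measurable_EFinP; exact: measurableT_comp.
apply: (@le_lt_trans _ _ (\int[mu]_(x in B) (C%:E * ((fun x => `|u x|%:E) \_ K) x))%E).
  apply: ge0_le_integral => //.
  - apply: measurableT_comp => //; apply/measurable_EFinP; exact: measurable_funM.
  - apply: measurable_funeM; apply/measurable_restrict => //.
    by apply: measurable_funS mnu => // x [].
  - move=> x Bx /=; rewrite patchE; case: ifPn => [|]; rewrite ?inE ?notin_setE => Kx.
      by rewrite -EFinM lee_fin normrM mulrC ler_wpM2r// hC.
    by rewrite f0// mulr0 normr0 mule0.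
rewrite ge0_integralZl//.
- rewrite -integral_mkcondr setIidr// lte_mul_pinfty//.
  exact: iu.
- apply/measurable_restrict => //.
  by apply: measurable_funS mnu => // x [].
- by move=> x _; rewrite patchE; case: ifP => // _; rewrite lee_fin.
Qed.

Lemma test_loc_integrable_mul u phi i : loc_integrable B u -> test_function B phi ->
  mu.-integrable B (EFin \o (fun x => u x * phi x)) /\
  mu.-integrable B (EFin \o (fun x => u x * partial i phi x)).
Proof.
move=> lu tphi; have s1 := test_smoothk1 tphi; have [_ cK KB] := tphi.
split; apply: (loc_integrable_mul lu _ cK KB).
- exact: (smoothk_continuous s1).
- by move=> x /(supp_off i)[].
- exact: partial_continuous.
- by move=> x /(supp_off i)[].
Qed.

(** Integration by parts: the product of f with a test function is C^1 with compact support, so the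
    integrals of its partial derivatives vanish by [integral_partial0]. *)
Lemma smoothk1_weak_gradient f : smoothk 1 f ->
  weak_gradient B f (fun x => \row_i partial i f x).
Proof.
move=> sf; have cf : continuous (f : 'rV[R]_n -> R^o) := @smoothk_continuous _ _ _ f sf.
have lf := loc_integrable_continuous cf.
split => // i.
have -> : (fun x => (\row_i partial i f x) ord0 i) = partial i f.
  by apply/funext => x; rewrite mxE.
have lp := loc_integrable_continuous (partial_continuous (i := i) sf).
split => // phi tphi.
have -> : (\int[mu]_(x in B) ((\row_i0 partial i0 f x) ord0 i * phi x)%:E =
    \int[mu]_(x in B) (partial i f x * phi x)%:E)%E.
  by apply: eq_integral => x _; rewrite mxE.
have sphi := test_smoothk1 tphi; have [_ cK KB] := tphi.
pose th x := f x * phi x.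
have sth : smoothk 1 th by exact: smoothkM.
have pth x : partial i th x = f x * partial i phi x + phi x * partial i f x.
  exact: (partialM i x sf sphi).
have th0 : bsupp 1 th.
  move=> x [j xj]; rewrite /th; have [->|phi0] := eqVneq (phi x) 0; first by rewrite mulr0.
  have : B x by apply: KB; exact: subset_closure.
  rewrite /unit_ball /= => Bx; exfalso.
  by have := lt_le_trans xj (coord_le_enorm x j); rewrite ltNge (ltW Bx).
have := @integral_partial0 R n i th 1 ltr01 (smoothk_continuous sth)
  (fun x => (sth.2 i).1 x) (partial_continuous (i := i) sth) th0.
have -> : (\int[mu]_x (partial i th x)%:E = \int[mu]_(x in B) (partial i th x)%:E)%E.
  rewrite [RHS]integral_mkcond; apply: eq_integral => x _; rewrite patchE.
  case: ifPn => //; rewrite notin_setE => nB.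
  have nK : ~ supp phi x by move=> /KB.
  by rewrite pth; have [-> ->] := supp_off i nK; rewrite mulr0 mul0r addr0.
have [_ i1] := test_loc_integrable_mul i lf tphi.
have [i2 _] := test_loc_integrable_mul i lp tphi.
have -> : (\int[mu]_(x in B) (partial i th x)%:E =
   \int[mu]_(x in B) (f x * partial i phi x)%:E +
   \int[mu]_(x in B) (partial i f x * phi x)%:E)%E.
  rewrite -integralD//; apply: eq_integral => x _.
  by rewrite pth EFinD [phi x * _]mulrC.
have f1 := integrable_fin_num mB i1; have f2 := integrable_fin_num mB i2.
move: f1 f2.
rewrite /=; case: (integral _ _ _) => // a; case: (integral _ _ _) => // b _ _.
by rewrite -EFinD => -[] /eqP; rewrite addr_eq0 => /eqP ->; rewrite EFinN.
Qed.

Lemma loc_integrableB u v : loc_integrable B u -> loc_integrable B v ->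
  loc_integrable B (fun x => u x - v x).
Proof.
move=> [mu_ iu] [mv iv]; split; first exact: measurable_funB.
move=> K KB cK; have mK := compact_measurable_rV cK.
have mu' : measurable_fun K (fun x => `|u x|%:E).
  by apply/measurable_EFinP; apply: measurableT_comp => //; exact: measurable_funS mu_.
have mv' : measurable_fun K (fun x => `|v x|%:E).
  by apply/measurable_EFinP; apply: measurableT_comp => //; exact: measurable_funS mv.
apply: (@le_lt_trans _ _ (\int[mu]_(x in K) (`|u x|%:E + `|v x|%:E))%E).
  apply: ge0_le_integral => //.
  - apply/measurable_EFinP; apply: measurableT_comp => //.
    by apply: measurable_funB; [exact: measurable_funS mu_|exact: measurable_funS mv].
  - exact: emeasurable_funD.
  - by move=> x _; rewrite -EFinD lee_fin ler_normB.
by rewrite ge0_integralD// lte_add_pinfty//; [exact: iu|exact: iv].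
Qed.

Lemma weak_gradientB u v g h : weak_gradient B u g -> weak_gradient B v h ->
  weak_gradient B (u \- v) (fun x => g x - h x).
Proof.
move=> [lu wu] [lv wv]; split; first exact: loc_integrableB.
move=> i; have [lg wg] := wu i; have [lh wh] := wv i.
have e : (fun x => (g x - h x) ord0 i) = (fun x => g x ord0 i - h x ord0 i).
  by apply/funext => x; rewrite !mxE.
split; first by rewrite e; exact: loc_integrableB.
move=> phi tphi.
have [_ i1] := test_loc_integrable_mul i lu tphi.
have [_ i2] := test_loc_integrable_mul i lv tphi.
have [i3 _] := test_loc_integrable_mul i lg tphi.
have [i4 _] := test_loc_integrable_mul i lh tphi.
transitivity (\int[mu]_(x in B) (u x * partial i phi x)%:E -
   \int[mu]_(x in B) (v x * partial i phi x)%:E)%E.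
  rewrite -integralB//; apply: eq_integral => x _.
  by rewrite -EFinB mulrBl.
rewrite wg// wh//.
have -> : (\int[mu]_(x in B) ((g x - h x) ord0 i * phi x)%:E =
   \int[mu]_(x in B) (g x ord0 i * phi x)%:E -
   \int[mu]_(x in B) (h x ord0 i * phi x)%:E)%E.
  rewrite -integralB//; apply: eq_integral => x _.
  by rewrite !mxE -EFinB mulrBl.
have f1 := integrable_fin_num mB i3; have f2 := integrable_fin_num mB i4.
by rewrite fin_num_oppeB// ?fin_numN// oppeK.
Qed.

(** The support is controlled by the squared norm, which is smooth at the origin, unlike the norm.
    The margin r < 1 keeps the closure of the support inside B. *)
Lemma test_function_ball phi (r : R) : r < 1 -> (forall k, smoothk k phi) ->
  (forall x, phi x != 0 -> enorm x ^+ 2 <= r) -> test_function B phi.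
Proof.
move=> r1 sphi phir.
have cn : continuous ((fun x => \sum_i x ord0 i ^+ 2) : 'rV[R]_n -> R^o).
  apply: (@smoothk_continuous R n 0); apply: smoothk_sum => i.
  under eq_fun do rewrite expr2.
  by apply: smoothkM; exact: smoothk_coord.
have cl : closed [set x : 'rV[R]_n | \sum_i x ord0 i ^+ 2 <= r].
  have := @closed_le R r => /(closed_comp (f := (fun x : 'rV[R]_n => \sum_i x ord0 i ^+ 2)))/=.
  by apply => x _; exact: cn.
have sub : supp phi `<=` [set x : 'rV[R]_n | \sum_i x ord0 i ^+ 2 <= r].
  rewrite [X in _ `<=` X](closure_id _).1//; apply: closure_subset => x /= /phir.
  by rewrite enorm_sqr.
have KB : supp phi `<=` B.
  move=> x /sub /=; rewrite -enorm_sqr => h; rewrite /unit_ball/=.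
  rewrite -(@ltr_pXn2r _ 2) ?nnegrE ?enorm_ge0// expr1n.
  exact: le_lt_trans h r1.
split => //; first exact: smoothk_smooth.
have cQ : compact [set v : 'rV[R]_n | forall i, `[-1, 1]%classic (v ord0 i)].
  by apply: (@rV_compact R n (fun=> `[-1, 1]%classic)) => i; exact: segment_compact.
apply: (subclosed_compact _ cQ); first exact: closed_closure.
move=> x /KB Bx i; rewrite /= in_itv/= -ler_norml.
exact: le_trans (coord_le_enorm x i) (ltW Bx).
Qed.

End weak_gradient_theory.

Section bumps.
Variable R : realType.

(** Smooth, zero up to [a], and tending to 1 beyond it as j grows: a smooth approximation from below
    of the indicator of ]a, +oo[. *)
Definition sbump (a : R) (j : nat) (x : R) : R := 1 - expR (- (j%:R * flat 1 (x - a))).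

Lemma flat1_ge0 (x : R) : 0 <= flat 1 x.
Proof.
by rewrite /flat; case: ifP => // _; rewrite hornerC mul1r expR_ge0.
Qed.

Lemma flat1_gt0 (x : R) : 0 < x -> 0 < flat 1 x.
Proof. by move=> x0; rewrite /flat x0 hornerC mul1r expR_gt0. Qed.

Lemma flat1_eq0 (x : R) : x <= 0 -> flat 1 x = 0.
Proof. by move=> x0; rewrite /flat ltNge x0. Qed.

Lemma sbump_ge0 a j x : 0 <= sbump a j x.
Proof. by rewrite subr_ge0 -expR0 ler_expR oppr_le0 mulr_ge0// flat1_ge0. Qed.

Lemma sbump_le1 a j x : sbump a j x <= 1.
Proof. by rewrite gerBl expR_ge0. Qed.

Lemma sbump_eq0 a j x : x <= a -> sbump a j x = 0.
Proof.
by move=> xa; rewrite /sbump flat1_eq0 ?subr_le0// mulr0 oppr0 expR0 subrr.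
Qed.

Lemma cvg_expR_natmul (c : R) : 0 < c -> expR (- (j%:R * c)) @[j --> \oo] --> (0 : R).
Proof.
move=> c0.
have -> : (fun j : nat => expR (- (j%:R * c))) = (fun j => expR (- c) ^+ j).
  by apply/funext => j; rewrite -expRM_natl mulrN.
apply: cvg_expr; rewrite ger0_norm ?expR_ge0//.
by rewrite expR_lt1 oppr_lt0.
Qed.

Lemma sbump_cvg a x : a < x -> sbump a j x @[j --> \oo] --> (1 : R).
Proof.
move=> ax; rewrite -[X in _ --> X]subr0; apply: cvgB; first exact: cvg_cst.
by apply: cvg_expR_natmul; apply: flat1_gt0; rewrite subr_gt0.
Qed.

Let oT : open [set: R]. Proof. exact: openT. Qed.

Lemma smooth1_shift k (a : R) : smooth1 setT k (fun x : R => x - a).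
Proof. exact: smooth1D oT (smooth1_id k oT) (smooth1_cst k (- a) oT). Qed.

Lemma smooth1_sbump k a j : smooth1 setT k (sbump a j).
Proof.
have s1 := smooth1_comp oT oT (fun _ _ => Logic.I) (smooth1_shift k a) (smooth1_flat k 1 oT).
have s2 := smooth1M oT (smooth1_cst k (- j%:R) oT) s1.
have s3 := smooth1_comp oT oT (fun _ _ => Logic.I) s2 (smooth1_expR k oT).
have s4 := smooth1D oT (smooth1_cst k 1 oT) (smooth1M oT (smooth1_cst k (-1) oT) s3).
apply: eq_smooth1 s4 => // x _.
by rewrite /sbump mulN1r mulNr.
Qed.

End bumps.

Section uniqueness.
Variables (R : realType) (n : nat).
Notation mu := (@lebesgue_rV R n).
Notation B := (unit_ball R n).

Let mB : measurable B. Proof. exact: measurable_unit_ball. Qed.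

Definition sqnorm (x : 'rV[R]_n) : R := \sum_i x ord0 i ^+ 2.

Lemma smoothk_sqnorm k : smoothk k sqnorm.
Proof.
apply: smoothk_sum => i; under eq_fun do rewrite expr2.
by apply: smoothkM; exact: smoothk_coord.
Qed.

Definition cutoff (r : R) (x : 'rV[R]_n) : R := flat 1 (r - sqnorm x).

Lemma smoothk_cutoff k r : smoothk k (cutoff r).
Proof.
have s : smoothk k (fun x => r + -1 * sqnorm x).
  apply: smoothkD; first exact: smoothk_cst.
  by apply: smoothkM; [exact: smoothk_cst|exact: smoothk_sqnorm].
have := smoothk_comp (smooth1_flat k 1 (@openT R)) s.
by under eq_fun do rewrite mulN1r.
Qed.

Lemma smoothk_box_bump k (r : R) (a : 'rV[R]_n) j :
  smoothk k (fun x => cutoff r x * \prod_i sbump (a ord0 i) j (x ord0 i)).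
Proof.
apply: smoothkM; first exact: smoothk_cutoff.
apply: smoothk_prod => i; apply: smoothk_comp; first exact: smooth1_sbump.
exact: smoothk_coord.
Qed.

Lemma test_box_bump (r : R) (a : 'rV[R]_n) j : r < 1 ->
  test_function B (fun x => cutoff r x * \prod_i sbump (a ord0 i) j (x ord0 i)).
Proof.
move=> r1; apply: (test_function_ball r1) => [k|x]; first exact: smoothk_box_bump.
apply: contraNT; rewrite -ltNge enorm_sqr => xr.
by rewrite /cutoff flat1_eq0 ?mul0r// subr_le0 ltW.
Qed.

Lemma test_cutoff (r : R) : r < 1 -> test_function B (cutoff r).
Proof.
move=> r1; apply: (test_function_ball r1) => [k|x]; first exact: smoothk_cutoff.
apply: contraNT; rewrite -ltNge enorm_sqr => xr.
by rewrite /cutoff flat1_eq0// subr_le0 ltW.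
Qed.

Lemma prod_sbump_itv (a : 'rV[R]_n) j (x : 'rV[R]_n) :
  0 <= \prod_i sbump (a ord0 i) j (x ord0 i) <= 1.
Proof.
apply/andP; split; first by apply: prodr_ge0 => i _; exact: sbump_ge0.
by apply: prodr_ile1 => i _; rewrite sbump_ge0 sbump_le1.
Qed.

Lemma prod_sbump_cvg (a x : 'rV[R]_n) :
  \prod_i sbump (a ord0 i) j (x ord0 i) @[j --> \oo] --> (\1_(orthant a) x : R).
Proof.
rewrite indicE; have [|] := boolP (x \in orthant a); rewrite ?inE ?notin_setE => ax.
  rewrite [X in _ --> X](_ : _ = \prod_(i < n) (1 : R)); last by rewrite big1.
  apply: cvg_big => [|i _]; first exact: mul_continuous.
  apply: sbump_cvg; exact: ax.
apply: cvg_near_cst; apply: nearW => j.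
have [i ai] : exists i, x ord0 i <= a ord0 i.
  apply: contra_notP ax => /forallNP h i; rewrite ltNge; apply/negP; exact: h.
by rewrite (bigD1 i)//= sbump_eq0// mul0r.
Qed.

(** The fundamental lemma of the calculus of variations. Products of bumps converge to indicators of
    orthants; multiplied by [cutoff r], which is positive exactly where the squared norm is below r,
    they are test functions of B. So [d] times the cutoff has integral 0 over every orthant, hence
    over every measurable set. *)
Lemma weak_zero_ae (d : 'rV[R]_n -> R) : loc_integrable B d ->
  (forall phi, test_function B phi -> (\int[mu]_(x in B) (d x * phi x)%:E = 0)%E) ->
  forall r : R, r < 1 -> {ae mu, forall x, sqnorm x < r -> d x = 0}.
Proof.
move=> ld dphi r r1.
pose f := (fun x => d x * cutoff r x) \_ B.
have tc := test_cutoff r1; have [_ cK KB] := tc.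
have intB : mu.-integrable B (EFin \o (fun x => d x * cutoff r x)).
  apply: (loc_integrable_mul ld _ cK KB); first exact: (smoothk_continuous (smoothk_cutoff 0 r)).
  move=> x nx; apply/eqP; apply: contra_notT nx => ?; exact: subset_closure.
have intf : mu.-integrable setT (EFin \o f).
  have := (integrable_mkcond _ mB).1 intB.
  by rewrite restrict_EFin.
have f0 a : (\int[mu]_(x in orthant a) (f x)%:E = 0)%E.
  pose F j x := (fun x => d x * (cutoff r x * \prod_i sbump (a ord0 i) j (x ord0 i)))
     \_ B x.
  have F0 j : (\int[mu]_x (F j x)%:E = 0)%E.
    rewrite -(dphi _ (test_box_bump a j r1)) [RHS]integral_mkcond.
    by apply: eq_integral => x _; rewrite /F !patchE; case: ifP.
  have mF j : measurable_fun [set: 'rV[R]_n] (fun x => (F j x)%:E).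
    apply/measurable_EFinP; apply/(measurable_restrictT _ mB).
    apply: measurable_funM; first exact: ld.1.
    apply: measurable_funTS; apply: continuous_measurable_rV.
    exact: (smoothk_continuous (smoothk_box_bump 0 r a j)).
  rewrite integral_mkcond.
  have [||||_ _] := @dominated_convergence _ _ _ mu setT measurableT
    (fun j x => (F j x)%:E) ((fun x => (f x)%:E) \_ (orthant a)) (fun x => `|(f x)%:E|%E) mF.
  - apply/(measurable_restrictT _ (measurable_orthant a)); apply: measurable_funTS.
    exact: measurable_int intf.
  - apply: aeW => x _; rewrite patchE.
    have -> : (if x \in orthant a then (f x)%:E else 0%E) = (f x * \1_(orthant a) x)%:E.
      by rewrite indicE; case: (x \in orthant a); rewrite ?mulr1 ?mulr0.
    apply: cvg_EFin; first exact: nearW.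
    rewrite /= (_ : _ \o _ = (fun j => f x * \prod_i sbump (a ord0 i) j (x ord0 i))); last first.
      apply/funext => j; rewrite /F /f /= !patchE; case: ifP => _; last by rewrite mul0r.
      by rewrite mulrA.
    by apply: cvgM; [exact: cvg_cst|exact: prod_sbump_cvg].
  - exact: integrable_abse intf.
  - apply: aeW => x j _; rewrite lee_fin /F /f !patchE; case: ifP => // _.
    rewrite mulrA normrM ler_piMr//.
    by have /andP[p0 p1] := prod_sbump_itv a j x; rewrite ger0_norm.
  - move=> hL; rewrite -(cvg_lim _ hL)//.
    rewrite (_ : (fun j => _) = (fun=> 0%E)) ?lim_cst//.
    by apply/funext => j; rewrite /= F0.
have fA A : measurable A -> (\int[mu]_(x in A) (f x)%:E = 0)%E.
  apply: (@integral_pi_lambda_eq0 _ _ _ mu (@orthants R n) (@big_orthant R n) f).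
  - exact: measurable_sub_orthants.
  - by move=> _ [a _ <-]; exact: measurable_orthant.
  - exact: orthantsI.
  - by move=> k; exists (const_mx (- k%:R)).
  - exact: big_orthant_nd.
  - exact: big_orthant_cover.
  - exact: intf.
  - by move=> _ [a _ <-].
have : ae_eq mu setT (EFin \o f) (cst 0%E).
  apply: integral_ae_eq => // E _ mE.
  by rewrite [RHS]integral0; exact: fA.
apply: filterS => x /(_ Logic.I) /= [] fx xr.
move: fx; rewrite /f patchE ifT; last first.
  rewrite inE /unit_ball/= -(@ltr_pXn2r _ 2) ?nnegrE ?enorm_ge0// expr1n enorm_sqr.
  exact: lt_trans xr r1.
move=> /eqP; rewrite mulf_eq0 => /orP[/eqP//|].
by rewrite gt_eqF// flat1_gt0// subr_gt0.
Qed.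

(** [grad] is an arbitrary choice among weak gradients; uniqueness lets its energy be computed from
    any explicit one. [weak_zero_ae] applies where the squared norm is below 1 - 1 / (m + 2), and
    these balls exhaust B. *)
Lemma weak_gradient_unique (u : 'rV[R]_n -> R) (g1 g2 : 'rV[R]_n -> 'rV[R]_n) :
  weak_gradient B u g1 -> weak_gradient B u g2 ->
  {ae mu, forall x, B x -> g1 x = g2 x}.
Proof.
move=> [lu w1] [_ w2].
have h (i : 'I_n) (m : nat) : {ae mu, forall x, sqnorm x < 1 - m.+2%:R^-1 ->
    g1 x ord0 i - g2 x ord0 i = 0}.
  have [l1 e1] := w1 i; have [l2 e2] := w2 i.
  apply: weak_zero_ae.
  - exact: loc_integrableB.
  - move=> phi tphi.
    have [i1 _] := test_loc_integrable_mul i l1 tphi.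
    have [i2 _] := test_loc_integrable_mul i l2 tphi.
    transitivity (\int[mu]_(x in B) (g1 x ord0 i * phi x)%:E -
        \int[mu]_(x in B) (g2 x ord0 i * phi x)%:E)%E.
      by rewrite -integralB//; apply: eq_integral => x _; rewrite -EFinB mulrBl.
    have := e2 _ tphi; rewrite (e1 _ tphi) => /eqP; rewrite eqe_opp => /eqP ->.
    by rewrite subee// integrable_fin_num.
  - by rewrite gtrBl invr_gt0.
have h' (m : nat) : {ae mu, forall x, forall i : 'I_n, sqnorm x < 1 - m.+2%:R^-1 ->
    g1 x ord0 i - g2 x ord0 i = 0}.
  by apply: filter_forall => i; exact: h.
have := ae_foralln h'; apply: filterS => x hx Bx.
apply/rowP => i; apply/eqP; rewrite -subr_eq0; apply/eqP.
have x1 : 0 < 1 - sqnorm x.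
  rewrite subr_gt0 /sqnorm -enorm_sqr -(expr1n _ 2) ltr_pXn2r ?nnegrE ?enorm_ge0//.
near \oo => m.
apply: (hx m i); rewrite ltrBrDl -ltrBrDr.
have : m.+1%:R^-1 < 1 - sqnorm x by near: m; exact: near_infty_natSinv_lt (PosNum x1).
by apply: le_lt_trans; rewrite lef_pV2 ?posrE// ler_nat.
Unshelve. all: by end_near. Qed.

End uniqueness.

(** * From energy pairs to Sobolev functions *)

Section lebesgue_translation.
Variable R : realType.
Local Open Scope ereal_scope.

Lemma lebesgue_measure_itvoc (a b : R) : (a <= b)%R ->
  lebesgue_measure (`]a, b]%classic : set R) = (b - a)%:E.
Proof.
move=> ab; rewrite lebesgue_measure_itv/= lte_fin -EFinB; case: ltP => // ba.
by have -> : b = a; [apply/eqP; rewrite eq_le ba ab|rewrite subrr].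
Qed.

Lemma lebesgue_measure_shift (c : R) (A : set R) : measurable A ->
  lebesgue_measure ((fun x => x + c)%R @^-1` A) = lebesgue_measure A.
Proof.
move=> mA.
pose f : measurableTypeR R -> measurableTypeR R := fun x => (x + c)%R.
have mf : measurable_fun [set: measurableTypeR R] f by exact: measurable_funD.
have [nu nuE] := pushforward_measureP (@lebesgue_measure R) mf.
rewrite -nuE; apply/esym; apply: lebesgue_measure_unique => // X [[a b] _ <-] /=.
rewrite nuE.
have -> : f @^-1` `]a, b] = `](a - c)%R, (b - c)%R]%classic.
  by apply/seteqP; split => x /=; rewrite !in_itv/= /f ltrBlDr lerBrDr.
rewrite lebesgue_measure_itv/= (lebesgue_measure_itv `](a - c)%R, (b - c)%R])/=.
rewrite !lte_fin ltrD2r.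
by case: ifP => // _; rewrite -!EFinB; congr (_%:E); ring.
Qed.

Lemma ge0_integral_shift (c a b : R) (f : R -> \bar R) :
  measurable_fun [set: R] f -> (forall x, 0 <= f x) ->
  \int[lebesgue_measure]_(x in `[a, b[) f (x + c)%R =
  \int[lebesgue_measure]_(x in `[(a + c)%R, (b + c)%R[) f x.
Proof.
move=> mf f0.
pose h : measurableTypeR R -> measurableTypeR R := fun x => (x + c)%R.
have mh : measurable_fun [set: measurableTypeR R] h by exact: measurable_funD.
transitivity (\int[pushforward lebesgue_measure h]_(x in `[(a + c)%R, (b + c)%R[) f x).
  rewrite ge0_integral_pushforward//=; last exact: measurable_funTS.
  congr (integral _ _ _); apply/seteqP; split => x /=; rewrite !in_itv/= /h.
    by rewrite lerD2r ltrD2r.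
  by rewrite lerD2r ltrD2r.
apply: eq_measure_integral => A mA _.
exact: lebesgue_measure_shift.
Qed.

End lebesgue_translation.

Section stieltjes.
Variable R : realType.

(** Uniqueness is part of the statement so that the measure of a sum of monotone functions can be
    identified with the sum of their measures. *)
Lemma stieltjes_measureP (F : R -> R) : {homo F : x y / x <= y} ->
  right_continuous F ->
  exists m : {measure set (measurableTypeR R) -> \bar R},
    (forall a b, a <= b -> m `]a, b]%classic = (F b - F a)%:E) /\
    (forall m' : {measure set (measurableTypeR R) -> \bar R},
       (forall a b, a <= b -> m' `]a, b]%classic = (F b - F a)%:E) ->
       forall A, measurable A -> m A = m' A).
Proof.
move=> nd rc.
pose mix := isCumulative.Build R _ R F nd rc.
pose F' : cumulative R R := HB.pack F mix.
have mE' (G : cumulative R R) a b : a <= b ->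
    lebesgue_stieltjes_measure G `]a, b]%classic = (G b - G a)%:E.
  move=> ab; rewrite /lebesgue_stieltjes_measure /measure_extension/=.
  rewrite measurable_mu_extE/=; last exact: is_ocitv.
  by rewrite wlength_itv_bnd.
have mE a b : a <= b -> lebesgue_stieltjes_measure F' `]a, b]%classic = (F b - F a)%:E.
  exact: mE'.
exists (lebesgue_stieltjes_measure F'); split => // m' hm' A mA.
apply: lebesgue_stieltjes_measure_unique => // X [[a b] _ <-] /=.
have [ab|ba] := leP a b; first by rewrite mE// hm'.
rewrite set_itv_ge ?measure0// bnd_simp -leNgt ltW//.
Qed.

End stieltjes.

Section absolute_continuity.
Variables (R : realType) (n : nat).
Hypothesis hn : (2 <= n)%N.
Notation mu := (@lebesgue_measure R).
Variables (E : R) (w Phi : R -> R).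
Hypothesis wE : energy_pair n E w Phi.

Let n1_gt0 : (0 < n.-1)%N. Proof. by case: n hn => [|[]]. Qed.
Let nE : n.-1.+1 = n. Proof. by case: n hn. Qed.

(** Extensions to the whole line, where Stieltjes measures live: w is frozen at its value at 0,
    whereas [Phi] is extended by 0 and may jump there, staying monotone because it is
    nonnegative. *)
Let Phi0 (t : R) : R := if t < 0 then 0 else Phi t.
Let w0 (t : R) : R := w (Num.max t 0).

Let Phi0_nd : {homo Phi0 : s t / s <= t}.
Proof.
have [_ _ _ hE] := wE.
move=> s t st; rewrite /Phi0; case: ltP => s0.
  case: ltP => // t0; by have /andP[] := hE _ t0.
rewrite ltNge (le_trans s0 st)/=; exact: energy_pair_mono wE _ _ s0 st.
Qed.

Let Phi0_itv t : 0 <= Phi0 t <= E.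
Proof.
have E0 := energy_pair_E_ge0 wE; have [_ _ _ hE] := wE.
by rewrite /Phi0; case: ltP => [_|/hE//]; rewrite lexx.
Qed.

Let w0_nd : {homo w0 : s t / s <= t}.
Proof.
have [_ nd _ _] := wE; move=> s t st; rewrite /w0; apply: nd.
by rewrite ge_max !le_max st lexx orbT.
Qed.

(* Young's inequality for the increments: this is what makes [dw] absolutely
   continuous, the weight of [dPhi] being arbitrarily small *)
Let w0_incr (M : R) s t : 0 < M -> s <= t ->
  w0 t - w0 s <= (Phi0 t - Phi0 s) / M ^+ n.-1 + M * (t - s).
Proof.
move=> M0 st; have [_ nd hPhi _] := wE.
have Mn0 : 0 < M ^+ n.-1 by rewrite exprn_gt0.
have P0 : 0 <= (Phi0 t - Phi0 s) / M ^+ n.-1.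
  by rewrite divr_ge0 ?(ltW Mn0)// subr_ge0 Phi0_nd.
have [t0|t0] := leP t 0.
  have s0 : s <= 0 by rewrite (le_trans st).
  rewrite /w0 (max_idPr t0) (max_idPr s0) subrr addr_ge0// mulr_ge0 ?(ltW M0)// subr_ge0//.
pose s' := Num.max s 0.
have s'0 : 0 <= s' by rewrite le_max lexx orbT.
have s't : s' <= t by rewrite ge_max st (ltW t0).
have ws : w0 s = w s' by [].
have wt : w0 t = w t by rewrite /w0 (max_idPl (ltW t0)).
have Ps : Phi s' - Phi0 s >= 0.
  rewrite subr_ge0; have -> : Phi s' = Phi0 s' by rewrite /Phi0 ltNge s'0.
  by apply: Phi0_nd; rewrite le_max lexx.
have Pt : Phi0 t = Phi t by rewrite /Phi0 ltNge (ltW t0).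
rewrite ws wt; set a := w t - w s'.
have a0 : 0 <= a by rewrite subr_ge0 nd.
have ts' : t - s' <= t - s by rewrite lerD2l lerN2 le_max lexx.
have d0 : 0 <= t - s' by rewrite subr_ge0.
have [aM|Ma] := leP a (M * (t - s')).
  apply: (le_trans aM); rewrite -[leLHS]add0r lerD// ler_wpM2l// ltW//.
have a1 : 0 < a by apply: le_lt_trans Ma; rewrite mulr_ge0// ltW.
have h := hPhi _ _ s'0 s't.
have PP : 0 <= Phi t - Phi s' by rewrite subr_ge0 (energy_pair_mono wE).
have h2 : a ^+ n.-1 * a <= a ^+ n.-1 * ((Phi t - Phi s') / M ^+ n.-1).
  rewrite -exprSr nE (le_trans h)// mulrCA ler_wpM2l//.
  by rewrite ler_pdivlMr// -exprMn mulrC lerXn2r ?nnegrE ?mulr_ge0 ?(ltW M0)// ltW.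
rewrite ler_pM2l ?exprn_gt0// in h2.
apply: (le_trans h2); rewrite -[leLHS]addr0 lerD ?mulr_ge0 ?(ltW M0)// ?subr_ge0//.
rewrite ler_pM2r ?invr_gt0// Pt; lra.
Qed.

Let w0_rc : right_continuous w0.
Proof.
move=> x; apply: cvg_at_right_filter.
apply/cvgrPdist_le => e e0.
have E0 := energy_pair_E_ge0 wE.
(* In [w0_incr] this makes the term in Phi at most e / 2, because M^(n-1) >= M >= 2 E / e; the other
   term is small when t - s is. *)
pose M := Num.max 1 (2 * E / e).
have M1 : 1 <= M by rewrite le_max lexx.
have M0 : 0 < M by apply: lt_le_trans M1.
have Mn : M <= M ^+ n.-1 by rewrite -{1}(expr1 M) ler_weXn2l.
have key s t : s <= t -> M * (t - s) <= e / 2 -> w0 t - w0 s <= e.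
  move=> st Mts; apply: (le_trans (w0_incr M0 st)); rewrite [leRHS]splitr lerD//.
  rewrite ler_pdivrMr ?exprn_gt0//.
  have /andP[P1 P2] := Phi0_itv t; have /andP[P3 P4] := Phi0_itv s.
  apply: (@le_trans _ _ (e / 2 * M)); last by rewrite ler_wpM2l// divr_ge0// ltW.
  have : 2 * E / e <= M by rewrite le_max lexx orbT.
  rewrite ler_pdivrMr// => ?; lra.
have eM : 0 < e / 2 / M by rewrite !divr_gt0.
near=> y.
have xy : `|x - y| <= e / 2 / M by near: y; exact: cvgr_dist_le.
have xy' : M * `|x - y| <= e / 2 by rewrite mulrC -ler_pdivlMr.
have [le|le] := leP x y.
  rewrite distrC ger0_norm ?subr_ge0 ?w0_nd//; apply: key => //.
  by move: xy'; rewrite distrC ger0_norm// subr_ge0.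
have yx := ltW le.
rewrite ger0_norm ?subr_ge0 ?w0_nd//; apply: key => //.
by move: xy'; rewrite ger0_norm// subr_ge0.
Unshelve. all: by end_near. Qed.

(** Right limits of [Phi0]. A pointwise limit of energies need not be right-continuous, whereas a
    Stieltjes measure requires it. *)
Let PhiR (t : R) : R := inf [set Phi0 s | s in `]t, +oo[%classic].

Let PhiR_has_inf t : has_inf [set Phi0 s | s in `]t, +oo[%classic].
Proof.
split; first by exists (Phi0 (t + 1)), (t + 1) => //=; rewrite in_itv/= andbT ltrDl.
by exists 0 => _ [s _ <-]; have /andP[] := Phi0_itv s.
Qed.

Let PhiR_le t s : t < s -> PhiR t <= Phi0 s.
Proof.
move=> ts; apply: ge_inf; first by have [] := PhiR_has_inf t.
by exists s => //=; rewrite in_itv/= andbT.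
Qed.

Let PhiR_lt t e : 0 < e -> exists2 s, t < s & Phi0 s < PhiR t + e.
Proof.
move=> e0; have [_ [s ts <-] h] := inf_adherent e0 (PhiR_has_inf t).
by exists s => //; move: ts; rewrite /= in_itv/= andbT.
Qed.

Let PhiR_nd : {homo PhiR : s t / s <= t}.
Proof.
move=> s t st; apply/ler_addgt0Pr => e e0.
have [r tr h] := PhiR_lt t e0.
by rewrite (le_trans (PhiR_le (le_lt_trans st tr)))// ltW.
Qed.

Let PhiR_itv t : 0 <= PhiR t <= E.
Proof.
apply/andP; split.
  apply: lb_le_inf; first by have [] := PhiR_has_inf t.
  by move=> _ [s _ <-]; have /andP[] := Phi0_itv s.
have /andP[_ h] := Phi0_itv (t + 1).
by apply: le_trans h; apply: PhiR_le; rewrite ltrDl.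
Qed.

Let PhiR_rc : right_continuous PhiR.
Proof.
move=> x; apply/cvgrPdist_le => e e0.
have [s xs hs] := PhiR_lt x e0.
near=> y.
have xy : x < y by near: y; exact: nbhs_right_gt.
have ys : y < s by near: y; exact: nbhs_right_lt.
rewrite distrC ger0_norm ?subr_ge0 ?PhiR_nd ?(ltW xy)//.
by rewrite lerBlDl (le_trans (PhiR_le ys))// ltW.
Unshelve. all: by end_near. Qed.

(** This is [w0_incr] on the interval shifted to the right by a small d: there [Phi0] is at least
    [PhiR s] at the left end and close to [PhiR t] at the right end, while w hardly moves, being
    right-continuous. *)
Let w0_incrR (M : R) s t : 0 < M -> s <= t ->
  w0 t - w0 s <= (PhiR t - PhiR s) / M ^+ n.-1 + M * (t - s).
Proof.
move=> M0; rewrite le_eqVlt => /predU1P[->|st].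
  by rewrite !subrr mulr0 mul0r addr0.
have Mn0 : 0 < M ^+ n.-1 by rewrite exprn_gt0.
apply/ler_addgt0Pr => e e0.
have e2 : 0 < e / 2 * M ^+ n.-1 by rewrite mulr_gt0// divr_gt0.
have [r tr hr] := PhiR_lt t e2.
have [d [d0 dr hd]] : exists d, [/\ 0 < d, t + d <= r & w0 (s + d) <= w0 s + e / 2].
  have c : \forall y \near s^'+, w0 y <= w0 s + e / 2.
    by apply: (cvgr_le _ (w0_rc (x := s))); rewrite ltrDl divr_gt0.
  near s^'+ => y; exists (y - s); split.
  - rewrite subr_gt0; near: y; exact: nbhs_right_gt.
  - suff : y < s + (r - t) by lra.
    by near: y; apply: nbhs_right_lt; rewrite ltrDl subr_gt0.
  - by rewrite addrC subrK; near: y.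
have h := @w0_incr M (s + d) (t + d) M0 _.
have {}h := h (lerD (ltW st) (lexx d)).
have h1 : w0 t <= w0 (t + d) by apply: w0_nd; rewrite lerDl ltW.
have h2 : PhiR s <= Phi0 (s + d) by apply: PhiR_le; rewrite ltrDl.
have h3 : Phi0 (t + d) <= PhiR t + e / 2 * M ^+ n.-1.
  by rewrite (le_trans (Phi0_nd dr))// ltW.
have h4 : (Phi0 (t + d) - Phi0 (s + d)) / M ^+ n.-1 <=
    (PhiR t - PhiR s) / M ^+ n.-1 + e / 2.
  rewrite ler_pdivrMr// mulrDl divfK ?gt_eqF//; lra.
have h5 : M * (t + d - (s + d)) = M * (t - s) by congr (_ * _); ring.
rewrite h5 in h; lra.
Unshelve. all: by end_near. Qed.

(** On a Lebesgue null set A, the bound dw <= M^(-(n-1)) dPhi + M dx leaves dw (A) <= E / M^(n-1),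
    and M is arbitrary. The bound between measures holds because the difference of the two
    distribution functions is nondecreasing, so that the gap is itself a Stieltjes measure. *)
Lemma energy_pair_stieltjes :
  exists m : {measure set (measurableTypeR R) -> \bar R},
    (forall a b, 0 <= a -> a <= b -> m `]a, b]%classic = (w b - w a)%:E) /\
    (forall A, measurable A -> mu A = 0%E -> m A = 0%E).
Proof.
have [mw [mwE _]] := stieltjes_measureP w0_nd w0_rc.
have [mP [mPE _]] := stieltjes_measureP PhiR_nd PhiR_rc.
exists mw; split.
  move=> a b a0 ab; rewrite mwE// /w0 (max_idPl a0) (max_idPl (le_trans a0 ab))//.
move=> A mA A0.
have mPT : (mP setT <= E%:E)%E.
  have -> : [set: measurableTypeR R] = \bigcup_k `](- k%:R), k%:R]%classic.
    apply/esym; rewrite -subTset => x _; exists (Num.truncn `|x|).+1 => //=.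
    have h : `|x| < (Num.truncn `|x|).+1%:R by exact: truncnS_gt.
    by rewrite in_itv/= ltrNl (le_lt_trans _ h) ?(le_trans _ (ltW h)) ?ler_norm// -normrN ler_norm.
  have nd : nondecreasing_seq (fun k : nat => `](- k%:R : R), k%:R]%classic).
    move=> k l kl; rewrite subsetEset; apply: subset_itv; rewrite bnd_simp ?lerN2 ler_nat//.
  have c := @nondecreasing_cvg_mu _ _ _ mP _ (fun k => measurable_itv `](- k%:R : R), k%:R])
    (bigcupT_measurable _ (fun k => measurable_itv `](- k%:R : R), k%:R])) nd.
  rewrite -(cvg_lim _ c)//; apply: lime_le; first by apply/cvg_ex; eexists; exact: c.
  apply: nearW => k /=; rewrite mPE ?lee_fin; last first.
    by rewrite (@le_trans _ _ 0) ?oppr_le0.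
  have /andP[P1 P2] := PhiR_itv k%:R; have /andP[P3 P4] := PhiR_itv (- k%:R); lra.
have key (M : R) : 0 < M -> (mw A <= (M ^- n.-1 * E)%:E)%E.
  move=> M0; have Mn0 : 0 < M ^+ n.-1 by rewrite exprn_gt0.
  pose F t := PhiR t / M ^+ n.-1 + M * t.
  have F_nd : {homo F : s t / s <= t}.
    by move=> s t st; rewrite lerD// ?ler_pM2r ?ler_pM2l ?invr_gt0// PhiR_nd.
  have F_rc : right_continuous F.
    move=> x; apply: cvgD; first by apply: cvgM; [exact: PhiR_rc|exact: cvg_cst].
    by apply: cvgM; [exact: cvg_cst|apply: cvg_at_right_filter; exact: cvg_id].
  pose D t := F t - w0 t.
  have D_nd : {homo D : s t / s <= t}.
    move=> s t st; have := w0_incrR M0 st; rewrite /D /F mulrBr mulrBl; lra.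
  have D_rc : right_continuous D.
    by move=> x; apply: cvgB; [exact: F_rc|exact: w0_rc].
  have [mF [mFE mFu]] := stieltjes_measureP F_nd F_rc.
  have [mD [mDE _]] := stieltjes_measureP D_nd D_rc.
  have Mi0 : 0 <= (M ^+ n.-1)^-1 by rewrite invr_ge0 ltW.
  have [m1 m1E] := scaled_measureP mP Mi0.
  have [m2 m2E] := scaled_measureP (@lebesgue_measure R) (ltW M0).
  have [ma maE] : exists ma : {measure set (measurableTypeR R) -> \bar R},
      forall X, ma X = (mw X + mD X)%E.
    by exists (measure_add mw mD) => X; exact: measure_addE.
  have [mb mbE] : exists mb : {measure set (measurableTypeR R) -> \bar R},
      forall X, mb X = (m1 X + m2 X)%E.
    by exists (measure_add m1 m2) => X; exact: measure_addE.
  have e1 : mF A = ma A.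
    apply: mFu => // a b ab; rewrite maE mwE// mDE// -EFinD /D; congr (_%:E); ring.
  have e2 : mF A = mb A.
    apply: mFu => // a b ab; rewrite mbE m1E mPE//.
    have -> : m2 `]a, b]%classic = (M * (b - a))%:E.
      rewrite m2E EFinM; congr (_ * _)%E.
      exact: lebesgue_measure_itvoc.
    by rewrite -!EFinM -EFinD /F; congr (_%:E); ring.
  apply: (@le_trans _ _ (mF A)); first by rewrite e1 maE leeDl.
  have m20 : m2 A = 0%E.
    by rewrite m2E -(mule0 M%:E); congr (_ * _)%E; exact: A0.
  rewrite e2 mbE m1E m20 adde0 EFinM lee_pmul2l ?lte_fin ?invr_gt0//.
  by apply: le_trans mPT; apply: le_measure; rewrite ?inE.
apply/eqP; rewrite eq_le measure_ge0 andbT; apply/lee_addgt0Pr => e e0.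
have E0 := energy_pair_E_ge0 wE.
pose M := Num.max 1 (E / e).
have M1 : 1 <= M by rewrite le_max lexx.
have M0 : 0 < M by apply: lt_le_trans M1.
apply: (le_trans (key M M0)); rewrite add0e lee_fin mulrC ler_pdivrMr ?exprn_gt0//.
rewrite mulrC -ler_pdivrMr//.
apply: (@le_trans _ _ M); first by rewrite le_max lexx orbT.
by rewrite -{1}(expr1 M) ler_weXn2l.
Qed.

End absolute_continuity.

Lemma lebesgue_measure_itvco (R : realType) (a b : R) : a <= b ->
  lebesgue_measure (`[a, b[%classic : set R) = (b - a)%:E.
Proof.
move=> ab; rewrite lebesgue_measure_itv/= lte_fin -EFinB; case: ltP => // ba.
by have -> : b = a; [apply/eqP; rewrite eq_le ba ab|rewrite subrr].
Qed.

Section energy_density.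
Variables (R : realType) (n : nat).
Hypothesis hn : (2 <= n)%N.
Notation mu := (@lebesgue_measure R).
Variables (E : R) (w Phi : R -> R).
Hypothesis wE : energy_pair n E w Phi.

Let n1_gt0 : (0 < n.-1)%N. Proof. by case: n hn => [|[]]. Qed.
Let nE : n.-1.+1 = n. Proof. by case: n hn. Qed.

Definition dquot (k : nat) (t : R) : R := k.+1%:R * (w (t + k.+1%:R^-1) - w t).

Let w_nd : {homo w : s t / s <= t}. Proof. by have [] := wE. Qed.

Lemma dquot_ge0 k t : 0 <= dquot k t.
Proof. by rewrite mulr_ge0// subr_ge0 w_nd// lerDl. Qed.

Lemma measurable_dquot k : measurable_fun [set: R] (dquot k).
Proof.
apply: measurable_funM => //; apply: measurable_funB; apply: nondecreasing_measurable => //.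
by move=> s t st; apply: w_nd; rewrite lerD2r.
Qed.

Lemma dquot_cvg (t d : R) : is_derive t 1 w d -> dquot k t @[k --> \oo] --> d.
Proof.
move=> [/cvg_ex[l hl] dE].
have {dE} ld : l = d by rewrite -dE; apply/esym; exact: cvg_lim hl.
rewrite ld in hl.
have hk : (k.+1%:R^-1 : R) @[k --> \oo] --> (0 : R)^'.
  move=> A [e /= e0 eA]; suff : \forall k \near \oo, A (k.+1%:R^-1 : R) by [].
  near=> k; apply: eA => /=.
    rewrite sub0r normrN ger0_norm//.
    by near: k; exact: near_infty_natSinv_lt (PosNum e0).
  by have : (k.+1%:R^-1 : R) != 0 by rewrite invr_eq0 pnatr_eq0.
have := @cvg_comp _ _ _ (fun k : nat => k.+1%:R^-1 : R) _ _ _ _ hk hl; apply: cvg_trans; apply: near_eq_cvg; apply: nearW => k.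
by rewrite /dquot /= invrK /GRing.scale/= mulr1 [_^-1 + t]addrC.
Unshelve. all: by end_near. Qed.

(** With d = 1 / (k + 1), the third clause of [energy_pair] gives d dquot^n <= Phi (t + d) - Phi t.
    Over [0, T[ the right-hand side integrates to at most the integral of Phi over [T, T + d[, hence
    to at most E d. The inequality is kept in additive form until the finite integral of Phi can be
    cancelled. *)
Lemma integral_dquot_le k :
  (\int[mu]_(t in `[0%R, +oo[) (dquot k t ^+ n)%:E <= E%:E)%E.
Proof.
have E0 := energy_pair_E_ge0 wE.
have [_ _ hPhi hE] := wE.
pose d : R := k.+1%:R^-1; have d0 : 0 < d by rewrite invr_gt0.
have mq : measurable_fun [set: R] (fun t => (dquot k t ^+ n)%:E).
  by apply/measurable_EFinP; apply: measurable_funX; exact: measurable_dquot.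
apply: ge0_integral_halfline_le => //.
  by move=> t; rewrite lee_fin exprn_ge0// dquot_ge0.
move=> T T0.
pose P t := Phi (Num.max t 0).
have P_nd : {homo P : s t / s <= t}.
  move=> s t st; apply: (energy_pair_mono wE); first by rewrite le_max lexx orbT.
  by rewrite ge_max !le_max st lexx orbT.
have PE t : 0 <= P t <= E by apply: hE; rewrite le_max lexx orbT.
have mP : measurable_fun [set: R] (fun t => (P t)%:E).
  by apply/measurable_EFinP; exact: nondecreasing_measurable.
have mPd : measurable_fun [set: R] (fun t => (P (t + d))%:E).
  apply/measurable_EFinP; apply: nondecreasing_measurable => // s t st.
  by apply: P_nd; rewrite lerD2r.
have Ple (a b : R) : a <= b -> (\int[mu]_(t in `[a, b[) (P t)%:E <= (E * (b - a))%:E)%E.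
  move=> ab; apply: (@le_trans _ _ (\int[mu]_(t in `[a, b[) (cst E%:E t))%E).
    apply: ge0_le_integral => //.
    - by move=> t _; rewrite lee_fin; have /andP[] := PE t.
    - exact: measurable_funTS.
    - by move=> t _; rewrite lee_fin; have /andP[] := PE t.
  rewrite integral_cst// EFinM; apply: lee_wpmul2l; first by rewrite lee_fin.
  by rewrite -(lebesgue_measure_itvco ab).
have key : (d%:E * \int[mu]_(t in `[0%R, T[) (dquot k t ^+ n)%:E +
    \int[mu]_(t in `[0%R, T[) (P t)%:E <= \int[mu]_(t in `[0%R, T[) (P (t + d)%R)%:E)%E.
  rewrite -ge0_integralZl//=; last 3 first.
  - exact: measurable_funTS.
  - by move=> t _; rewrite lee_fin exprn_ge0// dquot_ge0.
  - by rewrite lee_fin ltW.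
  rewrite -ge0_integralD//=; last 4 first.
  - by move=> t _; rewrite -EFinM lee_fin mulr_ge0 ?exprn_ge0 ?dquot_ge0// ltW.
  - by apply: measurable_funeM; exact: measurable_funTS.
  - by move=> t _; rewrite lee_fin; have /andP[] := PE t.
  - exact: measurable_funTS.
  apply: ge0_le_integral => //.
  - move=> t _; rewrite -EFinM -EFinD lee_fin addr_ge0 ?mulr_ge0 ?exprn_ge0 ?dquot_ge0 ?(ltW d0)//.
    by have /andP[] := PE t.
  - apply: emeasurable_funD; last exact: measurable_funTS.
    by apply: measurable_funeM; exact: measurable_funTS.
  - exact: measurable_funTS.
  - move=> t; rewrite /= in_itv/= => /andP[t0 _]; rewrite -EFinM -EFinD lee_fin -lerBrDr.
    have td : t <= t + d by rewrite lerDl ltW.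
    have := hPhi _ _ t0 td; rewrite addrAC subrr add0r => h.
    rewrite /P (max_idPl t0) (max_idPl (le_trans t0 td)).
    rewrite -(@ler_pM2r _ (d ^+ n.-1)) ?exprn_gt0//; apply: le_trans h.
    rewrite /dquot -/d exprMn; set A := (w _ - w _) ^+ n.
    have -> : k.+1%:R = d^-1 :> R by rewrite /d invrK.
    have -> : d^-1 ^+ n = d^-1 * (d ^+ n.-1)^-1 by rewrite -exprVn -exprS nE.
    rewrite le_eqVlt; apply/orP; left; apply/eqP.
    by field; rewrite expf_neq0 gt_eqF.
have shift : (\int[mu]_(t in `[0%R, T[) (P (t + d)%R)%:E <=
    \int[mu]_(t in `[0%R, T[) (P t)%:E + (E * d)%:E)%E.
  have := @ge0_integral_shift R d 0 T (fun t => (P t)%:E) mP _.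
  move=> -> //; last by move=> t; rewrite lee_fin; have /andP[] := PE t.
  apply: (@le_trans _ _ (\int[mu]_(t in `[0%R, (T + d)%R[) (P t)%:E)%E).
    apply: ge0_subset_integral => //.
    - exact: measurable_funTS.
    - by move=> t _; rewrite lee_fin; have /andP[] := PE t.
    - by apply: subset_itvr; rewrite bnd_simp add0r ltW.
  rewrite (ge0_integral_itv_split (x := BLeft T))//=; last 2 first.
  - by move=> t; rewrite lee_fin; have /andP[] := PE t.
  - by rewrite bnd_simp lerDl ltW.
  rewrite leeD2l// (le_trans (Ple _ _ _))// ?lerDl ?(ltW d0)//.
  by rewrite addrAC subrr add0r.
have fin : (\int[mu]_(t in `[0%R, T[) (P t)%:E \is a fin_num)%E.
  rewrite ge0_fin_numE; last by apply: integral_ge0 => t _; rewrite lee_fin; have /andP[] := PE t.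
  by apply: le_lt_trans (Ple _ _ T0) _; rewrite ltry.
have := le_trans key shift; rewrite [leRHS]addeC leeD2rE//.
rewrite mulrC EFinM lee_pmul2l ?lte_fin//.
Qed.

(* [dw] has a density by the Radon-Nikodym theorem; it is recovered almost
   everywhere as the limit of the quotients [dquot], so that Fatou's lemma
   bounds its energy. *)
Lemma energy_pair_density : exists h : R -> R,
  [/\ measurable_fun [set: R] h, forall t, 0 <= h t,
      forall t, 0 <= t -> (\int[mu]_(s in `[0%R, t]) (h s)%:E = (w t)%:E)%E &
      (\int[mu]_(s in `[0%R, +oo[) (h s ^+ n)%:E <= E%:E)%E].
Proof.
have [w00 _ hPhi hE] := wE.
have [m [mE m0]] := energy_pair_stieltjes hn wE.
(* The Radon-Nikodym theorem is applied to dw restricted to ]0, T], which is a finite measure. *)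
have RN (T : R) : 0 <= T -> exists g : R -> R, [/\ (forall t, 0 <= g t),
    mu.-integrable setT (EFin \o g) &
    forall t, 0 <= t <= T -> (\int[mu]_(s in `[0%R, t]) (g s)%:E = (w t)%:E)%E].
  move=> T0.
  have moo : (m `]0%R, T]%classic < +oo)%E by rewrite mE// ltry.
  have mT : measurable (`]0%R, T]%classic : set (measurableTypeR R)) by [].
  have dom : mfrestr mT moo `<< (@lebesgue_measure R).
    move=> N N0 A mA AN; rewrite /mfrestr/= /mrestr.
    apply: m0; first exact: measurableI.
    have muA : mu A = 0%E by exact: N0.
    apply/eqP; rewrite eq_le measure_ge0 andbT -muA le_measure// inE//.
    exact: measurableI.
  have [f [f0 ffin fint fE]] := radon_nikodym_sigma_finite dom.
  exists (fine \o f); split => /=.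
  - by move=> t; rewrite fine_ge0.
  - by rewrite (_ : EFin \o _ = f)//; apply/funext => t; rewrite /= fineK.
  - move=> t /andP[t0 tT].
    rewrite (eq_integral f); last by move=> s _; rewrite fineK.
    rewrite -fE//; transitivity (m `]0%R, t]%classic); last by rewrite mE// w00 subr0.
    rewrite /mfrestr /mrestr /=; congr (m _).
    apply/seteqP; split => s /=; rewrite !in_itv/=.
      by move=> [/andP[_ ->] /andP[->]].
    by move=> /andP[s0 st]; rewrite s0 st (ltW s0) (le_trans st tT).
have RN' (k : nat) : {g : R -> R | [/\ (forall t, 0 <= g t),
    mu.-integrable setT (EFin \o g) &
    forall t, 0 <= t <= k%:R -> (\int[mu]_(s in `[0%R, t]) (g s)%:E = (w t)%:E)%E]}.
  by apply: cid; exact: RN.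
pose g k := sval (RN' k).
have g_ge0 k t : 0 <= g k t by have [h _ _] := svalP (RN' k); exact: h.
have gint k : mu.-integrable setT (EFin \o g k) by have [_ h _] := svalP (RN' k); exact: h.
have gE k t : 0 <= t <= k%:R -> (\int[mu]_(s in `[0%R, t]) (g k s)%:E = (w t)%:E)%E.
  by have [_ _] := svalP (RN' k); apply.
have dg k : {ae mu, forall x : R, 0 < x < k%:R -> is_derive x 1 w (g k x)}.
  have gl : locally_integrable setT (g k).
    by apply: open_integrable_locally; [exact: openT|exact: gint].
  have gi y : mu.-integrable [set` Interval (BLeft (0 : R)) (BRight y)] (EFin \o g k).
    exact: integrableS (gint k).
  have := FTC1 gi gl; apply: filterS; first exact: (ae_filter_ringOfSetsType mu).
  move=> x hx /andP[x0 xk].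
  have [|dF FE] := hx _; first by rewrite lte_fin.
  have dF' : is_derive x 1 (fun x => \int[mu]_(t in [set` Interval (BLeft 0) (BRight x)]) g k t) (g k x).
    by rewrite -FE derive1E; exact: derivableP.
  apply: near_eq_is_derive dF'.
  near=> y.
  rewrite /Rintegral gE//; apply/andP; split; apply: ltW; near: y.
    exact: lt_nbhsr.
  exact: lt_nbhsl.
(* One function for all T: the upper limit of the quotients is measurable, and by Lebesgue
   differentiation it equals each [g k] almost everywhere on ]0, k[. *)
pose h (t : R) := fine (limn_esup (fun k => (dquot k t)%:E)).
have mh : measurable_fun [set: R] h.
  apply: measurableT_comp => //.
  apply: measurable_fun_limn_esup => k.
  by apply/measurable_EFinP; exact: measurable_dquot.
have h0 t : 0 <= h t.
  apply: fine_ge0; apply: le_trans (limn_einf_sup _).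
  rewrite limn_einf_lim; apply: lime_ge; first exact: is_cvg_einfs.
  apply: nearW => k; rewrite /einfs; apply: le_ereal_inf_tmp => _ [l _ <-].
  by rewrite lee_fin dquot_ge0.
have hE' : {ae mu, forall x : R, forall k : nat, 0 < x < k%:R ->
    h x = g k x /\ dquot j x @[j --> \oo] --> h x}.
  apply: ae_foralln => k; have := dg k; apply: filterS; first exact: (ae_filter_ringOfSetsType mu).
  move=> x hx /hx d.
  have c := dquot_cvg d.
  have -> : h x = g k x.
    rewrite /h is_cvg_limn_esupE; last first.
      by apply/cvg_ex; exists (g k x)%:E; apply: cvg_EFin => //; exact: nearW.
    rewrite (_ : limn _ = (g k x)%:E)//; apply/cvg_lim => //.
    by apply: cvg_EFin => //; exact: nearW.
  by split.
exists h; split => //.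
- move=> t t0.
  pose k := (Num.truncn t).+1.
  have tk : t < k%:R by exact: truncnS_gt.
  rewrite -(gE k) ?t0 ?(ltW tk)//.
  have mg : measurable_fun [set: R] (fun s => (g k s)%:E) := measurable_int _ (gint k).
  have mh' : measurable_fun [set: R] (fun s => (h s)%:E) by exact/measurable_EFinP.
  rewrite -[LHS]integral_itv_obnd_cbnd; last exact: measurable_funTS.
  rewrite -[RHS]integral_itv_obnd_cbnd; last exact: measurable_funTS.
  apply: ae_eq_integral => //; [exact: measurable_funTS|exact: measurable_funTS|].
  move: hE'; apply: filterS; first exact: (ae_filter_ringOfSetsType mu).
    move=> x hx; rewrite /= in_itv/= => /andP[x0 xt].
  have [|-> _] := hx k; last by [].
  by rewrite x0 (le_lt_trans xt).
- have mh' : measurable_fun [set: R] (fun s => (h s ^+ n)%:E).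
    by apply/measurable_EFinP; exact: measurable_funX.
  have mq k : measurable_fun [set: R] (fun t => (dquot k t ^+ n)%:E).
    by apply/measurable_EFinP; apply: measurable_funX; exact: measurable_dquot.
  have -> : (\int[mu]_(s in `[0%R, +oo[) (h s ^+ n)%:E =
      \int[mu]_(s in `[0%R, +oo[) limn_einf (fun k => (dquot k s ^+ n)%:E))%E.
    have ml : measurable_fun [set: R] (fun s => limn_einf (fun k => (dquot k s ^+ n)%:E)).
      rewrite /limn_einf; apply: measurableT_comp => //.
      by apply: measurable_fun_limn_esup => k; exact: measurableT_comp.
    rewrite -[LHS]integral_itv_obnd_cbnd; last exact: measurable_funTS.
    rewrite -[RHS]integral_itv_obnd_cbnd; last exact: measurable_funTS.
    apply: ae_eq_integral => //; [exact: measurable_funTS|exact: measurable_funTS|].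
    move: hE'; apply: filterS; first exact: (ae_filter_ringOfSetsType mu).
    move=> x hx; rewrite /= in_itv/= andbT => x0.
    have [|_ c] := hx (Num.truncn x).+1; last first.
      have c' : (dquot j x ^+ n)%:E @[j --> \oo] --> (h x ^+ n)%:E.
        apply: cvg_EFin; first exact: nearW.
        exact: (@cvg_comp _ _ _ (fun j => dquot j x) (fun z : R => z ^+ n) _ _ _ c (@exprn_continuous R n (h x))).
      rewrite is_cvg_limn_einfE; last by apply/cvg_ex; eexists; exact: c'.
      by apply/esym/cvg_lim.
    by rewrite x0 truncnS_gt.
  have mD : measurable (`[0%R, +oo[%classic : set R) by [].
  have mq' k : measurable_fun (`[0%R, +oo[%classic : set R) (fun t => (dquot k t ^+ n)%:E).
    exact: measurable_funTS.
  have q0 k x : (`[0%R, +oo[%classic : set R) x -> (0 <= (dquot k x ^+ n)%:E)%E.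
    by move=> _; rewrite lee_fin exprn_ge0// dquot_ge0.
  apply: (le_trans (fatou mu mD mq' q0)).
  apply: le_trans (limn_einf_sup _) _; rewrite limn_esup_lim; apply: lime_le.
    exact: is_cvg_esups.
  apply: nearW => k; apply: ge_ereal_sup => _ [l _ <-].
  exact: integral_dquot_le.
Unshelve. all: by end_near. Qed.

End energy_density.

Import HBNNSimple.

(** * Density of smooth compactly supported functions in L^n of the half line *)

Section interval_bump.
Variable R : realType.

Definition ibump (a b : R) (j : nat) (x : R) : R := sbump a j x * sbump (- b) j (- x).

Lemma smooth1_ibump k a b j : smooth1 setT k (ibump a b j).
Proof.
have oT : open [set: R] by exact: openT.
apply: (smooth1M oT (smooth1_sbump k a j)).
have sN : smooth1 setT k (fun x : R => - x).
  have := smooth1M oT (smooth1_cst k (-1) oT) (smooth1_id k oT).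
  by apply: eq_smooth1 => // x _; rewrite mulN1r.
exact: (smooth1_comp oT oT (fun _ _ => Logic.I) sN (smooth1_sbump k (- b) j)).
Qed.

Lemma ibump_itv a b j x : 0 <= ibump a b j x <= 1.
Proof.
by rewrite mulr_ge0 ?sbump_ge0//= mulr_ile1 ?sbump_ge0 ?sbump_le1.
Qed.

Lemma ibump_eq0 a b j x : x <= a \/ b <= x -> ibump a b j x = 0.
Proof.
case=> h; rewrite /ibump; first by rewrite sbump_eq0// mul0r.
by rewrite (@sbump_eq0 _ (- b)) ?mulr0// lerN2.
Qed.

Lemma ibump_cvg a b x :
  ibump a b j x @[j --> \oo] --> (\1_(`]a, b[%classic : set R) x : R).
Proof.
rewrite indicE; case: (boolP (x \in _)); last first.
  rewrite notin_setE /= in_itv/= => /negP h; apply: cvg_near_cst; apply: nearW => j.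
  apply: ibump_eq0; move: h; case: (lerP x a) => [xa _|ax /=]; [by left|].
  by rewrite -leNgt; right.
rewrite inE /= in_itv/= => /andP[ax xb]; rewrite -[1%:R](mulr1 1).
by apply: cvgM; apply: sbump_cvg; rewrite ?ltrN2.
Qed.

End interval_bump.

Lemma exprD_le (R : realType) (n : nat) (a b : R) : 0 <= a -> 0 <= b ->
  (a + b) ^+ n <= 2 ^+ n * (a ^+ n + b ^+ n).
Proof.
move=> a0 b0; wlog ab : a b a0 b0 / a <= b.
  move=> h; case: (leP a b) => [/h|/ltW/h]; first exact.
  by rewrite addrC [b ^+ n + _]addrC; apply.
apply: (@le_trans _ _ ((2 * b) ^+ n)).
  rewrite lerXn2r ?nnegrE ?addr_ge0 ?mulr_ge0//.
  by rewrite mulrDl !mul1r lerD2r.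
by rewrite exprMn ler_wpM2l ?exprn_ge0// lerDr exprn_ge0.
Qed.

Section Ln_density.
Variables (R : realType) (n : nat).
Hypothesis n0 : (0 < n)%N.
Notation mu := (@lebesgue_measure R).
Notation D := (`]0%R, +oo[%classic : set R).

(** C_c^oo of the open half line. In the ball, the support stays away both from the boundary, t = 0,
    and from the origin, t = +oo. *)
Definition csmooth (chi : R -> R) := (forall k, smooth1 setT k chi) /\
  exists a b : R, 0 < a /\ forall t, t <= a \/ b <= t -> chi t = 0.

Lemma csmoothD chi1 chi2 : csmooth chi1 -> csmooth chi2 ->
  csmooth (fun t => chi1 t + chi2 t).
Proof.
move=> [s1 [a1 [b1 [a10 h1]]]] [s2 [a2 [b2 [a20 h2]]]]; split.
  by move=> k; apply: smooth1D => //; exact: openT.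
exists (Num.min a1 a2), (Num.max b1 b2); split; first by rewrite lt_min a10.
move=> t; rewrite le_min ge_max => -[/andP[ta1 ta2]|/andP[bt1 bt2]].
  by rewrite h1 ?h2 ?addr0//; left.
by rewrite h1 ?h2 ?addr0//; right.
Qed.

Lemma csmoothZ c chi : csmooth chi -> csmooth (fun t => c * chi t).
Proof.
move=> [s [a [b [a0 h]]]]; split.
  have oT : open [set: R] by exact: openT.
  by move=> k; apply: (smooth1M oT (smooth1_cst k c oT)).
by exists a, b; split => // t /h ->; rewrite mulr0.
Qed.

Lemma csmooth_continuous chi : csmooth chi -> continuous chi.
Proof. by move=> [s _] x; exact: smooth1_continuous (s 0%N) Logic.I. Qed.

Lemma csmooth_measurable chi : csmooth chi -> measurable_fun [set: R] chi.
Proof. by move=> /csmooth_continuous; exact: continuous_measurable_fun. Qed.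

(** The n-th power of the L^n distance. The triangle inequality is lost, but [LdistD], with its
    constant 2^n, is enough for density arguments and keeps all powers integral. *)
Definition Ldist (f g : R -> R) : \bar R := (\int[mu]_(t in D) (`|f t - g t| ^+ n)%:E)%E.

Let mpow (f g : R -> R) : measurable_fun [set: R] f -> measurable_fun [set: R] g ->
  measurable_fun [set: R] (fun t => (`|f t - g t| ^+ n)%:E).
Proof.
move=> mf mg; apply/measurable_EFinP; apply: measurable_funX.
by apply: measurableT_comp => //; exact: measurable_funB.
Qed.

Let pow0 (f g : R -> R) t : (0 <= (`|f t - g t| ^+ n)%:E)%E.
Proof. by rewrite lee_fin exprn_ge0. Qed.

Lemma LdistD (f1 f2 g1 g2 : R -> R) : measurable_fun [set: R] f1 -> measurable_fun [set: R] f2 ->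
  measurable_fun [set: R] g1 -> measurable_fun [set: R] g2 ->
  (Ldist (fun t => (f1 t + f2 t)%R) (fun t => (g1 t + g2 t)%R) <=
    (2 ^+ n)%:E * (Ldist f1 g1 + Ldist f2 g2))%E.
Proof.
move=> mf1 mf2 mg1 mg2; rewrite /Ldist.
have m1 := measurable_funTS (D := D) (mpow mf1 mg1).
have m2 := measurable_funTS (D := D) (mpow mf2 mg2).
rewrite -(ge0_integralD mu _ (fun t _ => pow0 f1 g1 t) m1 (fun t _ => pow0 f2 g2 t) m2)//.
have mS : measurable_fun D (fun t => (`|f1 t - g1 t| ^+ n)%:E + (`|f2 t - g2 t| ^+ n)%:E)%E.
  by apply: emeasurable_funD; apply: measurable_funTS; exact: mpow.
have S0 t : D t -> (0 <= (`|f1 t - g1 t| ^+ n)%:E + (`|f2 t - g2 t| ^+ n)%:E)%E.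
  by move=> _; rewrite adde_ge0.
rewrite -(ge0_integralZl_EFin mu _ S0 mS) ?exprn_ge0//.
apply: ge0_le_integral => //.
- by apply: measurable_funTS; apply: mpow; exact: measurable_funD.
- exact: measurable_funeM.
- move=> t _; rewrite -EFinD -EFinM lee_fin.
  apply: le_trans (exprD_le n _ _); rewrite ?normr_ge0//.
  by rewrite lerXn2r ?nnegrE ?addr_ge0// opprD addrACA ler_normD.
Qed.

Lemma LdistZ (c : R) (f g : R -> R) : measurable_fun [set: R] f -> measurable_fun [set: R] g ->
  (Ldist (fun t => (c * f t)%R) (fun t => (c * g t)%R) = (`|c| ^+ n)%:E * Ldist f g)%E.
Proof.
move=> mf mg; rewrite /Ldist.
have m1 := measurable_funTS (D := D) (mpow mf mg).
rewrite -(ge0_integralZl_EFin mu _ (fun t _ => pow0 f g t) m1)//.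
by apply: eq_integral => t _; rewrite -EFinM -mulrBr normrM exprMn.
Qed.

Definition Lapprox (f : R -> R) := measurable_fun [set: R] f /\
  forall e : R, 0 < e -> exists2 chi, csmooth chi & (Ldist f chi <= e%:E)%E.

Lemma eq_Lapprox f g : f =1 g -> Lapprox f -> Lapprox g.
Proof. by move=> /funext ->. Qed.

Lemma Lapprox_csmooth chi : csmooth chi -> Lapprox chi.
Proof.
move=> s; split=> [|e e0]; first exact: csmooth_measurable.
exists chi => //; rewrite /Ldist integral0_eq ?lee_fin ?ltW// => t _.
by rewrite subrr normr0 expr0n; case: n n0.
Qed.

Lemma LapproxD f g : Lapprox f -> Lapprox g -> Lapprox (fun t => f t + g t).
Proof.
move=> [mf hf] [mg hg]; split=> [|e e0]; first exact: measurable_funD.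
have e1 : 0 < e / 2 / 2 ^+ n by rewrite !divr_gt0// exprn_gt0.
have [c1 s1 d1] := hf _ e1; have [c2 s2 d2] := hg _ e1.
exists (fun t => c1 t + c2 t); first exact: csmoothD.
apply: (le_trans (LdistD _ _ _ _)) => //; try exact: csmooth_measurable.
apply: (@le_trans _ _ ((2 ^+ n)%:E * ((e / 2 / 2 ^+ n)%:E + (e / 2 / 2 ^+ n)%:E))%E).
  by apply: lee_wpmul2l; [rewrite lee_fin exprn_ge0|exact: leeD].
by rewrite -EFinD -EFinM lee_fin -mulrDl -splitr mulrCA divff ?mulr1// expf_neq0.
Qed.

Lemma LapproxZ c f : Lapprox f -> Lapprox (fun t => c * f t).
Proof.
move=> [mf hf]; split=> [|e e0]; first exact: measurable_funM.
have c1 : 0 < `|c| ^+ n + 1 by rewrite ltr_wpDl ?exprn_ge0.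
have [chi s d] := hf (e / (`|c| ^+ n + 1)) (divr_gt0 e0 c1).
exists (fun t => c * chi t); first exact: csmoothZ.
rewrite LdistZ//; last exact: csmooth_measurable.
apply: (@le_trans _ _ ((`|c| ^+ n)%:E * (e / (`|c| ^+ n + 1))%:E)%E).
  by apply: lee_wpmul2l => //; rewrite lee_fin exprn_ge0.
rewrite -EFinM lee_fin mulrCA ler_piMr ?ltW// ltr_pdivrMr// mul1r.
by rewrite ltrDl.
Qed.

Lemma Lapprox_sum (I : Type) (s : seq I) (F : I -> R -> R) :
  (forall i, Lapprox (F i)) -> Lapprox (fun t => \sum_(i <- s) F i t).
Proof.
move=> h; elim: s => [|i s IH].
  apply: (@eq_Lapprox (fun t => 0)); first by move=> t; rewrite big_nil.
  apply: Lapprox_csmooth; split; first by move=> k; apply: smooth1_cst; exact: openT.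
  by exists 1, 1.
apply: (@eq_Lapprox (fun t => F i t + \sum_(j <- s) F j t)).
  by move=> t; rewrite big_cons.
exact: LapproxD.
Qed.

(** Dominated convergence in L^n. Closure under dominated limits carries the approximation from
    bumps to intervals, to Borel sets and finally to limits of simple functions. *)
Lemma Lapprox_lim (F : nat -> R -> R) (f g : R -> R) :
  (forall k, Lapprox (F k)) -> measurable_fun [set: R] f ->
  measurable_fun [set: R] g ->
  (\int[mu]_(t in D) (g t ^+ n)%:E < +oo)%E ->
  (forall k t, D t -> `|F k t| <= g t) ->
  (forall t, D t -> F k t @[k --> \oo] --> f t) -> Lapprox f.
Proof.
move=> hF mf mg gfin Fg Ff; split=> // e e0.
have mF k : measurable_fun [set: R] (F k) by have [] := hF k.
have fg t : D t -> `|f t| <= g t.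
  move=> Dt; have c : `|F k t| @[k --> \oo] --> `|f t| by apply: cvg_norm; exact: Ff.
  rewrite -(cvg_lim _ c)//; apply: limr_le; first by apply/cvg_ex; exists `|f t|.
  by apply: nearW => k; exact: Fg.
have g0 t : D t -> 0 <= g t by move=> /(Fg 0%N); apply: le_trans.
have lim0 : (Ldist f (F k)) @[k --> \oo] --> 0%E.
  have [|||||_ _] := @dominated_convergence _ _ _ mu D (measurable_itv _)
    (fun k t => (`|f t - F k t| ^+ n)%:E) (fun=> 0%E) (fun t => ((2 ^+ n)%:E * (g t ^+ n)%:E)%E).
  - by move=> k; apply: measurable_funTS; exact: mpow.
  - exact: measurable_cst.
  - apply: aeW => t Dt; apply: cvg_EFin; first exact: nearW.
    have -> : 0 = (fun z : R => `|f t - z| ^+ n) (f t).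
      by rewrite subrr normr0 expr0n; case: n n0.
    have cont : {for f t, continuous (fun z : R => `|f t - z| ^+ n)}.
      apply: (@continuous_comp _ _ _ (fun z : R => `|f t - z|) (fun y : R => y ^+ n)).
        apply: (@continuous_comp _ _ _ (fun z : R => f t - z) (fun y : R => `|y|)).
          by apply: cvgB; [exact: cvg_cst|exact: cvg_id].
        exact: norm_continuous.
      exact: exprn_continuous.
    exact: (@cvg_comp _ _ _ (fun k => F k t) _ _ _ _ (Ff t Dt) cont).
  - apply: integrableZl => //; apply/integrableP; split.
      by apply: measurable_funTS; apply/measurable_EFinP; exact: measurable_funX.
    rewrite (_ : integral _ _ _ = \int[mu]_(t in D) (g t ^+ n)%:E)%E//.
    apply: eq_integral => t; rewrite inE => Dt.
    by rewrite gee0_abs// lee_fin exprn_ge0// g0.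
  - apply: aeW => t k Dt; rewrite -EFinM gee0_abs ?lee_fin ?exprn_ge0// -exprMn.
    rewrite lerXn2r ?nnegrE ?mulr_ge0 ?g0//.
    apply: le_trans (ler_normB _ _) _; rewrite mulrDl mul1r.
    by rewrite lerD ?fg ?Fg.
  by rewrite integral0.
have e1 : 0 < e / 2 / 2 ^+ n by rewrite !divr_gt0// exprn_gt0.
have [k hk] : exists k, (Ldist f (F k) < (e / 2 / 2 ^+ n)%:E)%E.
  have : \forall k \near \oo, (Ldist f (F k) < (e / 2 / 2 ^+ n)%:E)%E.
    suff : nbhs 0%E [set x | (x < (e / 2 / 2 ^+ n)%:E)%E] by exact: lim0.
    apply: open_nbhs_nbhs; split; first exact: open_ereal_lt_ereal.
    by rewrite /= lte_fin.
  by case=> k _ h; exists k; apply: h => /=.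
have [_ /(_ _ e1)[chi s d]] := hF k.
exists chi => //.
have := LdistD (mf) (mF k) (mF k) (csmooth_measurable s).
have -> : Ldist (fun t => (f t + F k t)%R) (fun t => (F k t + chi t)%R) = Ldist f chi.
  by apply: eq_integral => t _; rewrite opprD addrA addrK.
move=> /le_trans; apply.
apply: (@le_trans _ _ ((2 ^+ n)%:E * ((e / 2 / 2 ^+ n)%:E + (e / 2 / 2 ^+ n)%:E))%E).
  by apply: lee_wpmul2l; [rewrite lee_fin exprn_ge0|apply: leeD => //; exact: ltW].
by rewrite -EFinD -EFinM lee_fin -mulrDl -splitr mulrCA divff ?mulr1// expf_neq0.
Qed.

Let itv_dom (a N : R) : 0 <= a -> (\int[mu]_(t in D) (\1_(`]a, N[%classic : set R) t ^+ n)%:E < +oo)%E.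
Proof.
move=> a0; rewrite (_ : integral _ _ _ = \int[mu]_(t in D) (\1_(`]a, N[%classic : set R) t)%:E)%E.
  rewrite integral_indic//.
  apply: (@le_lt_trans _ _ (mu (`]a, N[%classic : set R))).
    by apply: le_measure; rewrite ?inE; [exact: measurableI| |exact: subIsetl].
  rewrite lebesgue_measure_itv/=; case: ifP => _; last by rewrite ltry.
  by rewrite -EFinB ltry.
by apply: eq_integral => t _; rewrite indicE; case: (_ \in _); rewrite ?expr1n// expr0n; case: n n0.
Qed.

Lemma Lapprox_itv (a N : R) : 0 <= a -> Lapprox (\1_(`]a, N[%classic : set R)).
Proof.
have pos (b : R) : 0 < b -> Lapprox (\1_(`]b, N[%classic : set R)).
  move=> b0; apply: (@Lapprox_lim (ibump b N) _ (\1_(`]b, N[%classic : set R))) => //.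
  - move=> j; apply: Lapprox_csmooth; split; first by move=> k; exact: smooth1_ibump.
    by exists b, N; split => // t; exact: ibump_eq0.
  - by apply: itv_dom; exact: ltW.
  - move=> k t _; have /andP[i0 i1] := ibump_itv b N k t; rewrite ger0_norm//.
    rewrite indicE; case: (boolP (t \in _)) => //; rewrite notin_setE/= in_itv/= => /negP h.
    rewrite ibump_eq0//; move: h; case: (lerP t b) => [xa _|ax /=]; [by left|].
    by rewrite -leNgt; right.
  - by move=> t _; exact: ibump_cvg.
move=> a0.
apply: (@Lapprox_lim (fun k => \1_(`](a + k.+1%:R^-1), N[%classic : set R)) _
  (\1_(`]a, N[%classic : set R))) => //.
- by move=> k; apply: pos; rewrite ltr_wpDl.
- exact: itv_dom.
- move=> k t _; rewrite !indicE ger0_norm//; case: (boolP (t \in _)) => //.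
  rewrite inE/= in_itv/= => /andP[h1 h2]; rewrite mem_set//= in_itv/= h2 andbT.
  by apply: le_lt_trans h1; rewrite lerDl.
- move=> t _; apply: cvg_near_cst; case: (ltP a t) => at_; last first.
    apply: nearW => k; rewrite !indicE !memNset//= in_itv/= => /andP[h _].
      by move: h; rewrite ltNge at_.
    by move: h; rewrite ltNge (le_trans at_)// lerDl.
  have ta : 0 < t - a by rewrite subr_gt0.
  near=> k; rewrite !indicE; congr (_%:R); congr nat_of_bool.
  apply/idP/idP; rewrite !inE/= !in_itv/= => /andP[h1 ->]; rewrite andbT//.
  rewrite -ltrBrDl.
  near: k; exact: near_infty_natSinv_lt (PosNum ta).
Unshelve. all: by end_near. Qed.

(** Dynkin induction from the rays ]a, +oo[. The intersection with ]0, N[ keeps the indicators in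
    L^n through complements and countable unions. *)
Lemma Lapprox_indic (A : set R) (N : R) : measurable A ->
  Lapprox (\1_(A `&` `]0, N[)).
Proof.
move=> mA; move: A mA N.
suff h (A : set R) : <<s @RGenOInfty.G R >> A -> forall N, Lapprox (\1_(A `&` `]0, N[)).
  by move=> A mA; apply: h; move: mA; rewrite [measurable]RGenOInfty.measurableE.
move=> h; apply: (@dynkin_induction _ R (@RGenOInfty.G R)
  (fun A => forall N, Lapprox (\1_(A `&` `]0, N[)))) h.
- exact: RGenOInfty.measurableE.
- move=> _ _ [a ->] [b ->]; exists (Num.max a b).
  by apply/seteqP; split => x /=; rewrite !in_itv/= !andbT gt_max; [by move=> [-> ->]|by move=> /andP[]].
- by move=> N; rewrite setTI; exact: Lapprox_itv.
- move=> _ [a ->] N.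
  have -> : `]a, +oo[ `&` `]0, N[ = `](Num.max a 0), N[%classic :> set R.
    apply/seteqP; split => x /=; rewrite !in_itv/= !andbT gt_max.
      by move=> [-> /andP[-> ->]].
    by move=> /andP[/andP[-> ->] ->].
  by apply: Lapprox_itv; rewrite le_max lexx orbT.
- move=> S mS hS N.
  apply: (@eq_Lapprox (fun t => \1_(`]0, N[) t + (-1) * \1_(S `&` `]0, N[) t)).
    move=> t; rewrite !indicE !in_setI in_setC.
    by case: (t \in S); case: (t \in _); rewrite /= ?mulr0 ?mulr1 ?addr0 ?subrr.
  by apply: LapproxD; [exact: Lapprox_itv|exact: LapproxZ].
- move=> F mF tF hF N.
  have mU : measurable (\bigcup_k F k) by exact: bigcupT_measurable.
  (* By disjointness, at a point of [F i0] only the term of index [i0] survives, and it is present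
     once k > i0. *)
  have part k t i0 : F i0 t -> \sum_(i <- index_iota 0 k) \1_(F i `&` `]0, N[) t =
      (i0 < k)%N%:R * \1_(`]0, N[) t :> R.
    move=> Ft; transitivity (\sum_(i <- index_iota 0 k) (i == i0)%:R * \1_(`]0, N[) t : R).
      apply: eq_bigr => i _; rewrite !indicE in_setI.
      suff -> : (t \in F i) = (i == i0) by rewrite -natrM mulnb.
      apply/idP/eqP => [|->]; last by rewrite inE.
      by rewrite inE => Fit; apply: tF => //; exists t.
    rewrite -mulr_suml; congr (_ * _); elim: k => [|k IH]; first by rewrite big_geq.
    rewrite big_nat_recr//= IH ltnS [in RHS]leq_eqVlt -natrD; congr (_%:R).
    by case: (ltngtP i0 k).
  apply: (@Lapprox_lim (fun k t => \sum_(i <- index_iota 0 k) \1_(F i `&` `]0, N[) t) _ (\1_(`]0, N[))) => //.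
  - by move=> k; apply: Lapprox_sum.
  - by apply: measurable_indic; exact: measurableI.
  - by apply: itv_dom.
  - move=> k t _; rewrite ger0_norm ?sumr_ge0//.
    case: (pselect ((\bigcup_i F i) t)) => [[i0 _ Fi]|nF].
      rewrite (part k t i0)// ler_piMl//; case: (_ < _)%N => //.
    rewrite big1// => i _; rewrite indicE memNset// => -[Ft _]; apply: nF; by exists i.
  - move=> t _; apply: cvg_near_cst.
    case: (pselect ((\bigcup_i F i) t)) => [[i0 _ Fi]|nF].
      near=> k; rewrite (part k t i0)//.
      have -> : (i0 < k)%N by near: k; exact: nbhs_infty_gt.
      by rewrite mul1r !indicE in_setI; have -> : t \in \bigcup_i F i by rewrite inE; exists i0.
    apply: nearW => k; rewrite big1; last first.
      by move=> i _; rewrite indicE memNset// => -[Ft _]; apply: nF; exists i.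
    by rewrite indicE memNset// => -[].
Unshelve. all: by end_near. Qed.

Lemma Lapprox_pow_integrable (h : R -> R) : measurable_fun [set: R] h ->
  (forall t, 0 <= h t) -> (\int[mu]_(t in D) (h t ^+ n)%:E < +oo)%E -> Lapprox h.
Proof.
move=> mh h0 hfin.
have mh' : measurable_fun [set: R] (EFin \o h) by exact/measurable_EFinP.
pose fs := nnsfun_approx measurableT mh'.
pose f k (t : R) : R := fs k t.
have fc t : f k t @[k --> \oo] --> h t.
  have := @cvg_nnsfun_approx _ _ _ _ measurableT _ mh' (fun t _ => h0 t) t Logic.I.
  by move=> /fine_cvgP[].
have fh k t : f k t <= h t.
  rewrite -(cvg_lim _ (fc t))//; apply: nondecreasing_cvgn_le.
    by move=> i j ij; have /lefP := nd_nnsfun_approx measurableT mh' ij; exact.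
  by apply/cvg_ex; exists (h t).
apply: (@Lapprox_lim (fun k t => f k t * \1_(`]0, k%:R[) t) _ (fun t => h t)) => //.
- move=> k.
  apply: (@eq_Lapprox (fun t => \sum_(y <- finmap.enum_fset (fset_set (range (fs k))))
     y * \1_((fs k @^-1` [set y]) `&` `]0, k%:R[) t)).
    move=> t; rewrite /f fimfunE fsbig_finite//= mulr_suml; apply: eq_bigr => i _.
    by rewrite indicI /= mulrA.
  apply: Lapprox_sum => y; apply: LapproxZ; apply: Lapprox_indic.
  exact: measurable_funPTI.
- move=> k t _; rewrite normrM !ger0_norm//; apply: le_trans (fh k t).
  by rewrite ler_piMr// indicE; case: (_ \in _).
- move=> t; rewrite /= in_itv/= andbT => t0.
  rewrite -[h t]mulr1; apply: cvgM; first exact: fc.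
  apply: cvg_near_cst; near=> k; rewrite indicE mem_set//= in_itv/= t0/=.
  by near: k; exact: nbhs_infty_gtr.
Unshelve. all: by end_near. Qed.

End Ln_density.

Section csmooth_primitives.
Variable R : realType.
Notation mu := (@lebesgue_measure R).

Lemma csmooth_integrable (chi : R -> R) : csmooth chi -> mu.-integrable setT (EFin \o chi).
Proof.
move=> s; have cc := csmooth_continuous s; have [_ [a [b [a0 h]]]] := s.
have -> : EFin \o chi = (EFin \o chi) \_ (`[a, b]%classic : set R).
  apply/funext => t; rewrite patchE; case: ifPn => // /negP nt.
  rewrite /= h//; case: (lerP t a) => [|ta]; [by left|right].
  by rewrite leNgt; apply/negP => tb; apply: nt; rewrite inE/= in_itv/= !ltW.
have mI : measurable (`[a, b]%classic : set (measurableTypeR R)) by exact: measurable_itv.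
have i1 : mu.-integrable (`[a, b]%classic : set R) (EFin \o chi).
  by apply: continuous_compact_integrable; [exact: segment_compact|exact: continuous_subspaceT].
exact: (iffLR (integrable_mkcond _ mI) i1).
Qed.

(** These properties make W (tvar x) a test function of the ball: W vanishes for t near 0, that is,
    near the boundary, and is constant for large t, that is, near the origin. *)
Lemma csmooth_primitive (chi : R -> R) : csmooth chi -> exists W : R -> R,
  [/\ forall k, smooth1 setT k W, forall t : R, is_derive t 1 W (chi t),
      exists2 a : R, 0 < a & forall t, t <= a -> W t = 0 &
      exists b : R, forall t, b <= t -> W t = W b].
Proof.
move=> s; have cc := csmooth_continuous s; have [sm [a [b [a0 h]]]] := s.
have ic := csmooth_integrable s.
pose W (x : R) := \int[mu]_(t in `]-oo, x]) chi t.
have dW (t : R) : is_derive t 1 W (chi t).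
  have ici : mu.-integrable `]-oo, t + 1] (EFin \o chi) by exact: integrableS ic.
  have tt : t < t + 1 by rewrite ltrDl.
  have [dF FE] := continuous_FTC1 (a := -oo%O) tt ici (ltNyr _) (@cc t).
  by rewrite -FE derive1E; exact: derivableP.
exists W; split => //.
- move=> k; apply: smooth1_prev; apply: (smooth1_is_deriveP (@openT R) (fun x _ => dW x)).
  exact: sm.
- exists a => // t ta; rewrite /W /Rintegral integral0_eq// => x.
  by rewrite /= in_itv/= => xt; rewrite h//; left; exact: le_trans ta.
- exists b => t bt.
  have := integral_is_derive bt dW cc.
  rewrite integral0_eq; last by move=> x; rewrite /= in_itv/= => /andP[bx _]; rewrite h//; right.
  by move=> [] /esym/eqP; rewrite subr_eq0 => /eqP.
Qed.

End csmooth_primitives.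

(** * Smooth radial functions on the ball, and limits of weak gradients *)

Section radial_profile.
Variables (R : realType) (n : nat).
Hypothesis n0 : (0 < n)%N.
Notation B := (unit_ball R n).

(* [rho] stands for [enorm x ^+ 2], and [- (n/2) * ln rho] for [tvar x]. *)
Definition profile (f : R -> R) (c rho : R) : R :=
  if 0 < rho then f (- (n%:R / 2) * ln rho) else c.

Lemma is_derive_profile (f : R -> R) (c rho df : R) : 0 < rho ->
  is_derive (- (n%:R / 2) * ln rho) 1 f df ->
  is_derive rho 1 (profile f c) (- (n%:R / 2) / rho * df).
Proof.
move=> r0 hf.
have dl : is_derive rho 1 (fun x => - (n%:R / 2) * ln x) (- (n%:R / 2) / rho).
  have d := is_derive1_ln r0.
  by apply: is_derive_eq; rewrite /GRing.scale/= .
have h := @is_derive1_comp R f (fun x => - (n%:R / 2) * ln x) rho _ _ hf dl.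
have e : \forall x \near rho, (f \o (fun x => - (n%:R / 2) * ln x)) x = profile f c x.
  near=> x; rewrite /profile /=; case: ifPn => // /negP[].
  by near: x; exact: lt_nbhsr.
by apply: (is_derive_eq (near_eq_is_derive e h)); rewrite mulrC.
Unshelve. all: by end_near. Qed.

(** Two overlapping charts cover the line: below r1 = exp (- 2 b / n) the profile is the constant
    [c], since t >= b there, and on ]0, +oo[ it is a composition with ln. *)
Lemma smooth1_profile (f : R -> R) (c b : R) k : (forall k, smooth1 setT k f) ->
  (forall t, b <= t -> f t = c) -> smooth1 setT k (profile f c).
Proof.
move=> sf fb; pose r1 := expR (- (2 * b / n%:R)).
have nR : 0 < n%:R :> R by rewrite ltr0n.
have r0 : 0 < r1 by exact: expR_gt0.
have -> : setT = `]-oo, r1[ `|` `]0, +oo[ :> set R.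
  apply/seteqP; split => // x _ /=; rewrite !in_itv/= andbT.
  by case: (ltP x r1) => h; [left|right; exact: lt_le_trans h].
have oD : open (`]0, +oo[%classic : set R) by exact: rray_open.
have oN : open (`]-oo, r1[%classic : set R) by exact: lray_open.
apply: smooth1_setU.
  apply: eq_smooth1 (smooth1_cst k c oN) => // x /=; rewrite in_itv/= => xr.
  rewrite /profile; case: ifPn => // x0; rewrite fb//.
  rewrite mulNr lerNr.
  have lx : ln x <= - (2 * b / n%:R) by rewrite -[leRHS]expRK ler_ln ?posrE// ltW.
  have -> : - b = n%:R / 2 * - (2 * b / n%:R) by field; rewrite gt_eqF.
  by rewrite ler_pM2l// divr_gt0.
have sl : smooth1 (`]0, +oo[%classic : set R) k (fun x => - (n%:R / 2) * ln x).
  exact: smooth1M oD (smooth1_cst k _ oD) (smooth1_ln R k).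
have := smooth1_comp oD (@openT R) (fun _ _ => Logic.I) sl (sf k).
apply: eq_smooth1 => // x /=; rewrite in_itv/= andbT => x0.
by rewrite /profile x0.
Qed.

Lemma sqnorm_gt0 (x : 'rV[R]_n) : x != 0 -> 0 < sqnorm x.
Proof. by rewrite -enorm_gt0 => x0; rewrite /sqnorm -enorm_sqr exprn_gt0. Qed.

Lemma tvarE (x : 'rV[R]_n) : x != 0 -> - (n%:R / 2) * ln (sqnorm x) = tvar x.
Proof.
rewrite -enorm_gt0 => x0; rewrite /sqnorm -enorm_sqr lnXn// /tvar.
by rewrite -mulr_natl; field.
Qed.

Lemma profile_tvar f c (x : 'rV[R]_n) : x != 0 -> profile f c (sqnorm x) = f (tvar x).
Proof. by move=> x0; rewrite /profile sqnorm_gt0// tvarE. Qed.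

Lemma smoothk_profile (f : R -> R) (c b : R) k : (forall k, smooth1 setT k f) ->
  (forall t, b <= t -> f t = c) -> smoothk k (fun x : 'rV[R]_n => profile f c (sqnorm x)).
Proof.
move=> sf fb; apply: smoothk_comp; first exact: smooth1_profile fb.
exact: smoothk_sqnorm.
Qed.

Lemma partial_sqnorm i (x : 'rV[R]_n) : partial i (@sqnorm R n) x = 2 * x ord0 i.
Proof.
apply: derive_val.
rewrite (_ : @sqnorm R n = (\sum_j (fun x : 'rV[R]_n => x ord0 j ^+ 2 : R^o))); last first.
  by apply/funext => y; rewrite fct_sumE.
have d j : is_derive x (evec R i) (fun x : 'rV[R]_n => x ord0 j ^+ 2 : R^o) ((2 * x ord0 j) * (i == j)%:R).
  have dj := is_derive_coord i j x.
  have d2 : is_derive (x ord0 j) 1 (fun z : R => z ^+ 2) (2 * x ord0 j).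
    by apply: is_derive_eq; rewrite /GRing.scale/= mulr1 mulr_natl.
  exact: is_derive_comp_rV dj d2.
by apply: is_derive_eq; rewrite (bigD1 i)//= eqxx mulr1 big1 ?addr0// => j ji; rewrite eq_sym (negPf ji) mulr0.
Qed.

(* At [x = 0] both sides are 0, division by 0 being 0. *)
Lemma partial_profile (f df : R -> R) (c b : R) i (x : 'rV[R]_n) :
  (forall k, smooth1 setT k f) -> (forall t, b <= t -> f t = c) ->
  (forall t : R, is_derive t 1 f (df t)) ->
  partial i (fun x : 'rV[R]_n => profile f c (sqnorm x)) x =
  - n%:R * df (tvar x) * x ord0 i / sqnorm x.
Proof.
move=> sf fb hd.
rewrite (@partial_compE _ _ (@sqnorm R n) _ i x 0); last 2 first.
- exact: smooth1_profile fb.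
- exact: smoothk_sqnorm.
rewrite partial_sqnorm derive1E.
have [->|x0] := eqVneq x 0; first by rewrite mxE !mulr0 mul0r.
have s0 := sqnorm_gt0 x0.
have d := is_derive_profile c s0 (hd (- (n%:R / 2) * ln (sqnorm x))).
rewrite (@derive_val _ _ _ _ _ _ _ d) tvarE//.
by field; rewrite gt_eqF.
Qed.

Lemma test_profile (f : R -> R) (a b : R) : (forall k, smooth1 setT k f) -> 0 < a ->
  (forall t, t <= a -> f t = 0) -> (forall t, b <= t -> f t = f b) ->
  test_function B (fun x => profile f (f b) (sqnorm x)).
Proof.
move=> sf a0 fa fb.
have nR : 0 < n%:R :> R by rewrite ltr0n.
have r1 : expR (- a / n%:R) ^+ 2 < 1.
  by rewrite expr_lt1 ?expR_ge0// expR_lt1 mulNr oppr_lt0 divr_gt0.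
apply: (test_function_ball r1) => [k|x fx]; first exact: smoothk_profile fb.
rewrite lerXn2r ?nnegrE ?enorm_ge0 ?expR_ge0//.
have [->|x0] := eqVneq x 0; first by rewrite (_ : enorm 0 = 0) ?expR_ge0//; apply/eqP; rewrite enorm_eq0.
apply: ltW; rewrite -tvar_gtE// ltNge; apply: contra fx => ta.
by rewrite profile_tvar// fa.
Qed.

End radial_profile.

Lemma fine_dist_le (R : realDomainType) (x y : \bar R) (c : R) :
  x \is a fin_num -> y \is a fin_num -> (`|x - y| <= c%:E)%E ->
  `|fine x - fine y| <= c.
Proof. by case: x; case: y. Qed.

Section weak_gradient_limits.
Variables (R : realType) (n : nat).
Hypothesis n0 : (0 < n)%N.
Notation mu := (@lebesgue_rV R n).
Notation B := (unit_ball R n).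

Let mB : measurable B. Proof. exact: measurable_unit_ball. Qed.

Definition L1 (f : 'rV[R]_n -> R) : \bar R := (\int[mu]_(x in B) `|f x|%:E)%E.
Definition Lpow (f : 'rV[R]_n -> R) : \bar R := (\int[mu]_(x in B) (`|f x| ^+ n)%:E)%E.

Lemma abse_integral_mul_le (f g : 'rV[R]_n -> R) (C e : R) : 0 <= C ->
  measurable_fun B f -> measurable_fun B g -> (forall x, B x -> `|g x| <= C) ->
  (L1 f <= e%:E)%E -> (`|\int[mu]_(x in B) (f x * g x)%:E| <= (C * e)%:E)%E.
Proof.
move=> C0 mf mg gC fe.
have mf' : measurable_fun B (fun x => `|f x|%:E).
  by apply/measurable_EFinP; exact: measurableT_comp.
have mfg : measurable_fun B (fun x => (f x * g x)%:E).
  by apply/measurable_EFinP; exact: measurable_funM.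
apply: (le_trans (le_abse_integral mu mB mfg)).
apply: (@le_trans _ _ (\int[mu]_(x in B) (C%:E * `|f x|%:E))%E).
  apply: ge0_le_integral => //.
  - exact: measurableT_comp.
  - exact: measurable_funeM.
  - move=> x Bx; rewrite abse_EFin -EFinM lee_fin normrM mulrC ler_wpM2r//.
    exact: gC.
rewrite (ge0_integralZl_EFin mu mB _ mf')//.
by rewrite EFinM; apply: lee_wpmul2l.
Qed.

Lemma L1_loc_integrable (f : 'rV[R]_n -> R) : measurable_fun B f ->
  (L1 f < +oo)%E -> loc_integrable B f.
Proof.
move=> mf ff; split => // K KB cK; apply: le_lt_trans ff.
apply: ge0_subset_integral => //; first exact: compact_measurable_rV.
by apply/measurable_EFinP; exact: measurableT_comp.
Qed.

Lemma test_bounded phi i : test_function B phi -> exists2 C : R, 0 <= C &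
  forall x, `|phi x| <= C /\ `|partial i phi x| <= C.
Proof.
move=> tphi; have s1 := test_smoothk1 tphi; have [_ cK KB] := tphi.
have [C1 C10 h1] := compact_bounded_on cK (@smoothk_continuous _ _ _ phi s1).
have [C2 C20 h2] := compact_bounded_on cK (partial_continuous (i := i) s1).
exists (C1 + C2) => [|x]; first exact: addr_ge0.
have [Kx|/(supp_off i)[-> ->]] := pselect (supp phi x); last by rewrite normr0 addr_ge0.
by split; [rewrite ler_wpDr// h1|rewrite ler_wpDl// h2].
Qed.

(** Both sides of the defining identity are continuous for the L^1 norm, because a test function and
    its derivatives are bounded. Approximation in L^1 is therefore enough, although the energies are
    in L^n. *)
Lemma weak_gradient_lim (u : 'rV[R]_n -> R) (g : 'rV[R]_n -> 'rV[R]_n) :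
  measurable_fun B u -> (L1 u < +oo)%E ->
  (forall i, measurable_fun B (fun x => g x ord0 i)) ->
  (forall i, L1 (fun x => g x ord0 i) < +oo)%E ->
  (forall e : R, 0 < e -> exists v h, [/\ weak_gradient B v h,
    (L1 (fun x => u x - v x)%R <= e%:E)%E &
    forall i, (L1 (fun x => g x ord0 i - h x ord0 i)%R <= e%:E)%E]) ->
  weak_gradient B u g.
Proof.
move=> mu_ fu mg fg lim; have lu := L1_loc_integrable mu_ fu.
split => // i; have lg := L1_loc_integrable (mg i) (fg i).
split => // phi tphi.
have [iu0 iu] := test_loc_integrable_mul i lu tphi.
have [ig _] := test_loc_integrable_mul i lg tphi.
have fiu := integrable_fin_num mB iu; have fig := integrable_fin_num mB ig.
have [C C0 phiC] := test_bounded i tphi.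
have s1 := test_smoothk1 tphi.
have mphi : measurable_fun B phi.
  exact: measurable_funTS (continuous_measurable_rV (@smoothk_continuous _ _ _ phi s1)).
have mdphi : measurable_fun B (partial i phi).
  exact: measurable_funTS (continuous_measurable_rV (partial_continuous (i := i) s1)).
set a := (\int[mu]_(x in B) (u x * partial i phi x)%:E)%E in fiu *.
set b := (\int[mu]_(x in B) (g x ord0 i * phi x)%:E)%E in fig *.
suff : fine a + fine b = 0.
  by move/eqP; rewrite addr_eq0 => /eqP ab; rewrite -(fineK fiu) ab EFinN fineK.
apply/eqP; rewrite -normr_le0; apply/ler_addgt0Pl => e e0; rewrite addr0.
(* Each of the two errors is at most C e / (2 C + 1); the divisor is positive even if C = 0. *)
have C1 : 0 < 2 * C + 1 by rewrite ltr_wpDl// mulr_ge0.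
have [v [h [[lv wv] uv gh]]] := lim _ (divr_gt0 e0 C1).
have [lh wh] := wv i.
have [_ iv] := test_loc_integrable_mul i lv tphi.
have [ih _] := test_loc_integrable_mul i lh tphi.
have mv := lv.1; have mh := lh.1.
set e' := e / (2 * C + 1) in uv gh.
set av := (\int[mu]_(x in B) (v x * partial i phi x)%:E)%E in wh *.
have fav : av \is a fin_num := integrable_fin_num mB iv.
pose bv := (\int[mu]_(x in B) (h x ord0 i * phi x)%:E)%E.
have fbv : bv \is a fin_num := integrable_fin_num mB ih.
have hA : `|fine a - fine av| <= C * e'.
  apply: fine_dist_le => //.
  rewrite /a /av -integralB//.
  have -> : (\int[mu]_(x in B) ((EFin \o (fun x => u x * partial i phi x)%R) x -
      (EFin \o (fun x => v x * partial i phi x)%R) x))%E =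
      (\int[mu]_(x in B) ((u x - v x) * partial i phi x)%:E)%E.
    by apply: eq_integral => x _; rewrite -EFinB mulrBl.
  apply: abse_integral_mul_le => //; first exact: measurable_funB.
  by move=> x _; have [] := phiC x.
have hB : `|fine b - fine bv| <= C * e'.
  apply: fine_dist_le => //.
  rewrite /b /bv -integralB//.
  have -> : (\int[mu]_(x in B) ((EFin \o (fun x => g x ord0 i * phi x)%R) x -
      (EFin \o (fun x => h x ord0 i * phi x)%R) x))%E =
      (\int[mu]_(x in B) ((g x ord0 i - h x ord0 i) * phi x)%:E)%E.
    by apply: eq_integral => x _; rewrite -EFinB mulrBl.
  apply: abse_integral_mul_le => //; first exact: measurable_funB.
  by move=> x _; have [] := phiC x.
have avE : fine av = - fine bv by rewrite -fineN -wh.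
have -> : fine a + fine b = (fine a - fine av) + (fine b - fine bv) by rewrite avE; ring.
apply: le_trans (ler_normD _ _) _; apply: le_trans (lerD hA hB) _.
rewrite -mulrDl -mulr2n -mulr_natl /e' mulrCA ler_piMr ?ltW//.
by rewrite ltr_pdivrMr// mul1r ltrDl.
Qed.

End weak_gradient_limits.

Section power_means.
Context d (T : measurableType d) (R : realType) (mu : {measure set T -> \bar R}).
Variables (D : set T) (m : nat).
Hypothesis mD : measurable D.

Let young (f g : T -> R) (l P L : R) : 0 <= l ->
  measurable_fun D f -> measurable_fun D g ->
  (forall x, D x -> 0 <= f x) -> (forall x, D x -> 0 <= g x) ->
  (\int[mu]_(x in D) (f x ^+ m.+1)%:E <= P%:E)%E ->
  (\int[mu]_(x in D) (g x ^+ m.+1)%:E <= L%:E)%E ->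
  ((m.+1%:R * l ^+ m)%:E * \int[mu]_(x in D) (f x * g x ^+ m)%:E <=
    (P + m%:R * l ^+ m.+1 * L)%:E)%E.
Proof.
move=> l0 mf mg f0 g0 fP gL.
have mfg : measurable_fun D (fun x => (f x * g x ^+ m)%:E).
  by apply/measurable_EFinP; apply: measurable_funM => //; exact: measurable_funX.
have mfm : measurable_fun D (fun x => (f x ^+ m.+1)%:E).
  by apply/measurable_EFinP; exact: measurable_funX.
have mgm : measurable_fun D (fun x => (g x ^+ m.+1)%:E).
  by apply/measurable_EFinP; exact: measurable_funX.
have fg0 x : D x -> (0 <= (f x * g x ^+ m)%:E)%E.
  by move=> Dx; rewrite lee_fin mulr_ge0 ?exprn_ge0 ?f0 ?g0.
have c0 : 0 <= m.+1%:R * l ^+ m by rewrite mulr_ge0// exprn_ge0.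
have c1 : 0 <= m%:R * l ^+ m.+1 by rewrite mulr_ge0// exprn_ge0.
rewrite -(ge0_integralZl_EFin mu mD fg0 mfg c0).
have g1 x : D x -> (0 <= (g x ^+ m.+1)%:E)%E.
  by move=> Dx; rewrite lee_fin exprn_ge0// g0.
have f1 x : D x -> (0 <= (f x ^+ m.+1)%:E)%E.
  by move=> Dx; rewrite lee_fin exprn_ge0// f0.
apply: (@le_trans _ _ (\int[mu]_(x in D) ((f x ^+ m.+1)%:E + (m%:R * l ^+ m.+1)%:E * (g x ^+ m.+1)%:E))%E).
  apply: ge0_le_integral => //.
  - by move=> x Dx; apply: mule_ge0; [rewrite lee_fin|exact: fg0].
  - exact: measurable_funeM.
  - by apply: emeasurable_funD => //; exact: measurable_funeM.
  - move=> x Dx; rewrite -!EFinM -EFinD lee_fin.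
    have := tangent_pow m (f0 x Dx) (mulr_ge0 l0 (g0 x Dx)).
    by rewrite !exprMn !mulrA [_ * f x * _]mulrAC.
rewrite ge0_integralD//; last 2 first.
- by move=> x Dx; rewrite mule_ge0 ?g1.
- exact: measurable_funeM.
rewrite (ge0_integralZl_EFin mu mD g1 mgm c1) EFinD.
by apply: leeD => //; rewrite [leRHS]EFinM; apply: lee_wpmul2l; rewrite ?lee_fin.
Qed.

(** Hoelder's inequality with exponents m + 1 and (m + 1) / m, raised to the power m + 1. It follows
    from Young's inequality for f and l g: the choice l = 1 shows that the integral I is finite, and
    l = I / L is optimal. *)
Lemma power_mean (f g : T -> R) (P L : R) : 0 < L ->
  measurable_fun D f -> measurable_fun D g ->
  (forall x, D x -> 0 <= f x) -> (forall x, D x -> 0 <= g x) ->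
  (\int[mu]_(x in D) (f x ^+ m.+1)%:E <= P%:E)%E ->
  (\int[mu]_(x in D) (g x ^+ m.+1)%:E <= L%:E)%E ->
  exists2 I : R, (\int[mu]_(x in D) (f x * g x ^+ m)%:E = I%:E)%E &
    0 <= I /\ I ^+ m.+1 <= P * L ^+ m.
Proof.
move=> L0 mf mg f0 g0 fP gL.
have I0 : (0 <= \int[mu]_(x in D) (f x * g x ^+ m)%:E)%E.
  by apply: integral_ge0 => x Dx; rewrite lee_fin mulr_ge0 ?exprn_ge0 ?f0 ?g0.
have key l (l0 : 0 <= l) := young l0 mf mg f0 g0 fP gL.
have fin : (\int[mu]_(x in D) (f x * g x ^+ m)%:E)%E \is a fin_num.
  have := key 1 ler01; rewrite !expr1n !mulr1.
  rewrite ge0_fin_numE//; move: I0; set J := integral _ _ _.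
  case: J => [r| |] //= _; first by rewrite ltry.
  by rewrite gt0_muley ?lte_fin.
move: I0 key; rewrite -(fineK fin); set I := fine _ => I0 key.
exists I => //; rewrite lee_fin in I0; split => //.
have := key _ (divr_ge0 I0 (ltW L0)); rewrite -EFinM lee_fin.
have -> : m.+1%:R * (I / L) ^+ m * I = m%:R * (I ^+ m.+1 / L ^+ m) + I ^+ m.+1 / L ^+ m.
  rewrite -natr1 expr_div_n exprSr; field.
  by rewrite expf_neq0// gt_eqF.
have -> : m%:R * (I / L) ^+ m.+1 * L = m%:R * (I ^+ m.+1 / L ^+ m).
  rewrite expr_div_n [L ^+ m.+1]exprSr; field.
  by rewrite expf_neq0 gt_eqF.
by rewrite addrC lerD2r ler_pdivrMr ?exprn_gt0.
Qed.

End power_means.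

Section L1_Ln.
Variables (R : realType) (n : nat).
Hypothesis n0 : (0 < n)%N.
Notation mu := (@lebesgue_rV R n).
Notation B := (unit_ball R n).
Notation V := (ball_vol R n).

Let mB : measurable B. Proof. exact: measurable_unit_ball. Qed.
Let nE : n.-1.+1 = n. Proof. by case: n n0. Qed.

(** Where |f| <= e, the contribution is at most e V; where |f| > e, one has |f| <= |f|^n /
    e^(n-1). *)
Lemma L1_le_Lpow (f : 'rV[R]_n -> R) (e : R) : 0 < e -> measurable_fun B f ->
  (L1 f <= (e * V)%:E + ((e ^+ n.-1)^-1)%:E * Lpow f)%E.
Proof.
move=> e0 mf.
have c0 : 0 <= (e ^+ n.-1)^-1 by rewrite invr_ge0 exprn_ge0// ltW.
have mf1 : measurable_fun B (fun x => `|f x|) by exact: measurableT_comp.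
have mfn : measurable_fun B (fun x => (`|f x| ^+ n)%:E).
  by apply/measurable_EFinP; exact: measurable_funX.
apply: (@le_trans _ _ (\int[mu]_(x in B) (e%:E + ((e ^+ n.-1)^-1)%:E * (`|f x| ^+ n)%:E))%E).
  apply: ge0_le_integral => //.
  - exact/measurable_EFinP.
  - by apply: emeasurable_funD => //; exact: measurable_funeM.
  - move=> x _; rewrite -EFinM -EFinD lee_fin.
    case: (leP `|f x| e) => fe; first by rewrite ler_wpDr// mulr_ge0// exprn_ge0.
    rewrite ler_wpDl ?(ltW e0)// mulrC ler_pdivlMr ?exprn_gt0//.
    have -> : `|f x| ^+ n = `|f x| * `|f x| ^+ n.-1 by rewrite -exprS nE.
    by rewrite ler_wpM2l// lerXn2r ?nnegrE ?(ltW e0) ?(ltW fe).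
rewrite ge0_integralD//; last 3 first.
- by move=> x _; rewrite lee_fin ltW.
- by move=> x _; rewrite mule_ge0// lee_fin exprn_ge0.
- exact: measurable_funeM.
rewrite integral_cst//.
have -> : (e%:E * mu B = (e * V)%:E)%E.
  by rewrite EFinM; congr (_ * _)%E; exact: unit_ball_volE.
by rewrite (ge0_integralZl_EFin mu mB _ mfn).
Qed.

Lemma L1_small (e : R) : 0 < e -> exists2 d : R, 0 < d &
  forall f : 'rV[R]_n -> R, measurable_fun B f -> (Lpow f <= d%:E -> L1 f <= e%:E)%E.
Proof.
move=> e0; have V0 : 0 < V := ball_vol_gt0 R n.
pose e' := e / (2 * V); have e1 : 0 < e' by rewrite divr_gt0// mulr_gt0.
exists (e' ^+ n.-1 * (e / 2)); first by apply: mulr_gt0; [exact: exprn_gt0|exact: divr_gt0].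
move=> f mf fd; apply: le_trans (L1_le_Lpow e1 mf) _.
apply: (@le_trans _ _ ((e' * V)%:E + ((e' ^+ n.-1)^-1)%:E * (e' ^+ n.-1 * (e / 2))%:E)%E).
  by rewrite leeD2l// lee_wpmul2l// lee_fin invr_ge0 exprn_ge0// ltW.
rewrite -EFinM -EFinD lee_fin mulKf ?gt_eqF ?exprn_gt0//.
rewrite le_eqVlt; apply/orP; left; apply/eqP; rewrite /e'; field.
by rewrite gt_eqF.
Qed.

Lemma L1_fin (f : 'rV[R]_n -> R) : measurable_fun B f ->
  (Lpow f < +oo -> L1 f < +oo)%E.
Proof.
move=> mf ff; apply: le_lt_trans (L1_le_Lpow ltr01 mf) _.
by rewrite expr1n invr1 mul1e lte_add_pinfty// ltry.
Qed.

End L1_Ln.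

Section gamma_integral.
Variable R : realType.
Notation mu := (@lebesgue_measure R).

Lemma integral_expR_half_le :
  (\int[mu]_(t in `[0%R, +oo[) (expR (- (t / 2)))%:E <= 2%:E)%E.
Proof.
have dE (t : R) : is_derive t 1 (fun t => - 2 * expR (- (t / 2))) (expR (- (t / 2))).
  by apply: is_derive_eq; rewrite /GRing.scale/=; field.
have cE : continuous (fun t : R => expR (- (t / 2))).
  move=> t; apply: (@continuous_comp _ _ _ (fun t : R => - (t / 2)) expR); last exact: continuous_expR.
  by apply: cvgN; apply: cvgM; [exact: cvg_id|exact: cvg_cst].
apply: ge0_integral_halfline_le => //.
- by apply/measurable_EFinP; exact: continuous_measurable_fun.
- move=> t t0; rewrite integral_itv_bndo_bndc; last first.
    by apply: measurable_funTS; apply/measurable_EFinP; exact: continuous_measurable_fun.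
  rewrite (integral_is_derive t0 dE cE) lee_fin mul0r oppr0 expR0 mulr1 opprK.
  by rewrite gerDr mulNr oppr_le0 mulr_ge0 ?expR_ge0.
Qed.

Lemma integral_powM_expRN_fin (m : nat) : (0 < m)%N ->
  exists2 C : R, 0 <= C & (\int[mu]_(t in `[0%R, +oo[) (t ^+ m * expR (- t))%:E <= C%:E)%E.
Proof.
case: m => // m _; pose C : R := 2 ^+ m.+1 * (m.+1)`!%:R.
have C0 : 0 <= C by rewrite mulr_ge0// exprn_ge0.
have cE : continuous (fun t : R => expR (- (t / 2))).
  move=> t; apply: (@continuous_comp _ _ _ (fun t : R => - (t / 2)) expR); last exact: continuous_expR.
  by apply: cvgN; apply: cvgM; [exact: cvg_id|exact: cvg_cst].
have mE : measurable_fun (`[0, +oo[%classic : set R) (fun t : R => (expR (- (t / 2)))%:E).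
  by apply: measurable_funTS; apply/measurable_EFinP; exact: continuous_measurable_fun.
exists (C * 2); first by rewrite mulr_ge0.
apply: (@le_trans _ _ (\int[mu]_(t in `[0%R, +oo[) (C%:E * (expR (- (t / 2)))%:E))%E).
  apply: ge0_le_integral => //.
  - by move=> t; rewrite /= in_itv/= andbT => t0; rewrite lee_fin mulr_ge0 ?expR_ge0 ?exprn_ge0.
  - apply: measurable_funTS; apply/measurable_EFinP; apply: measurable_funM; first exact: measurable_funX.
    by apply/measurable_EFinP; exact: measurable_expRN.
  - exact: measurable_funeM.
  - move=> t; rewrite /= in_itv/= andbT => t0; rewrite -EFinM lee_fin.
    have t2 : 0 <= t / 2 by rewrite divr_ge0.
    have := @expR_ge1Dxn R (t / 2) m t2.
    have f0 : 0 < (m.+1)`!%:R :> R by rewrite ltr0n fact_gt0.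
    move=> h; have {h} h : (t / 2) ^+ m.+1 <= (m.+1)`!%:R * expR (t / 2).
      by rewrite -ler_pdivrMl// [leLHS]mulrC; apply: le_trans h; rewrite lerDr.
    have -> : expR (- (t / 2)) = expR (t / 2) * expR (- t).
      by rewrite -expRD; congr expR; field.
    rewrite mulrA ler_wpM2r ?expR_ge0// /C -mulrA.
    rewrite -ler_pdivrMl ?exprn_gt0// mulrC -expr_div_n; exact: h.
rewrite ge0_integralZl_EFin//.
by rewrite [leRHS]EFinM; apply: lee_wpmul2l => //; exact: integral_expR_half_le.
Qed.

End gamma_integral.

Section gradient_representatives.
Variables (R : realType) (n : nat).
Hypothesis n0 : (0 < n)%N.
Notation mu := (@lebesgue_rV R n).
Notation B := (unit_ball R n).

Let mB : measurable B. Proof. exact: measurable_unit_ball. Qed.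

Lemma gradP (u : 'rV[R]_n -> R) g : weak_gradient B u g -> weak_gradient B u (grad B u).
Proof. by move=> h; rewrite /grad; apply: xgetPex; exists g. Qed.

Lemma grad_ae (u : 'rV[R]_n -> R) g : weak_gradient B u g ->
  {ae mu, forall x, B x -> grad B u x = g x}.
Proof. by move=> h; have h' := gradP h; exact: weak_gradient_unique h' h. Qed.

Lemma measurable_enorm_field (g : 'rV[R]_n -> 'rV[R]_n) :
  (forall i, measurable_fun B (fun x => g x ord0 i)) ->
  measurable_fun B (fun x => enorm (g x)).
Proof.
move=> mg; rewrite /enorm.
apply: (@measurableT_comp _ _ _ _ _ _ (@Num.sqrt R)).
  by apply: continuous_measurable_fun; exact: sqrt_continuous.
by apply: measurable_sum => i; exact: measurable_funX.
Qed.

Lemma weak_gradient_measurable (u : 'rV[R]_n -> R) g : weak_gradient B u g ->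
  measurable_fun B (fun x => enorm (g x)).
Proof. by move=> [_ h]; apply: measurable_enorm_field => i; have [[]] := h i. Qed.

Lemma integral_grad (u : 'rV[R]_n -> R) g : weak_gradient B u g ->
  (dirichlet u = \int[mu]_(x in B) (enorm (g x) ^+ n)%:E)%E.
Proof.
move=> ug; apply: ge0_ae_eq_integral => //.
- apply/measurable_EFinP; apply: measurable_funX.
  exact: weak_gradient_measurable (gradP ug).
- by apply/measurable_EFinP; apply: measurable_funX; exact: weak_gradient_measurable ug.
- by move=> x _; rewrite lee_fin exprn_ge0// enorm_ge0.
- by move=> x _; rewrite lee_fin exprn_ge0// enorm_ge0.
- by have := grad_ae ug; apply: filterS => x h Bx; rewrite h.
Qed.

Lemma sobolev_normE (u : 'rV[R]_n -> R) :
  sobolev_norm n%:R B u = ((Lpow u + dirichlet u) `^ n%:R^-1)%E.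
Proof.
rewrite /sobolev_norm; congr (_ `^ _)%E; congr (_ + _)%E.
  by apply: eq_integral => x _; rewrite powR_mulrn.
by apply: eq_integral => x _; rewrite powR_mulrn// enorm_ge0.
Qed.

Lemma Lpow_ge0 (u : 'rV[R]_n -> R) : (0 <= Lpow u)%E.
Proof. by apply: integral_ge0 => x _; rewrite lee_fin exprn_ge0. Qed.

Lemma dirichlet_ge0 (u : 'rV[R]_n -> R) : (0 <= dirichlet u)%E.
Proof. by apply: integral_ge0 => x _; rewrite lee_fin exprn_ge0// enorm_ge0. Qed.

Lemma sobolev_norm_lt (u : 'rV[R]_n -> R) (e : R) : 0 < e ->
  (sobolev_norm n%:R B u < e%:E)%E <-> (Lpow u + dirichlet u < (e ^+ n)%:E)%E.
Proof.
move=> e0; rewrite sobolev_normE.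
have : (0 <= Lpow u + dirichlet u)%E by rewrite adde_ge0 ?Lpow_ge0 ?dirichlet_ge0.
have nR : 0 < n%:R :> R by rewrite ltr0n.
case: (Lpow u + dirichlet u)%E => [s| |] //= s0; last first.
  by rewrite gt_eqF// invr_gt0.
rewrite !lte_fin; rewrite lee_fin in s0.
have eE : e = (e ^+ n) `^ n%:R^-1.
  by rewrite -powR_mulrn ?ltW// -powRrM divff ?powRr1 ?gt_eqF ?ltW.
have en0 : 0 <= e ^+ n by rewrite exprn_ge0 ?ltW.
split=> [|h]; last by rewrite eE gt0_ltr_powR ?invr_gt0.
apply: contraTT; rewrite -!leNgt => h.
by rewrite eE ge0_ler_powR ?invr_ge0 ?nnegrE// ltW.
Qed.

End gradient_representatives.

Section radial_fields.
Variables (R : realType) (n : nat).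
Hypothesis hn : (2 <= n)%N.
Notation mu := (@lebesgue_rV R n).
Notation B := (unit_ball R n).
Notation V := (ball_vol R n).

Let n0 : (0 < n)%N. Proof. exact: ltnW. Qed.
Let nR : 0 < n%:R :> R. Proof. by rewrite ltr0n. Qed.
Let mB : measurable B. Proof. exact: measurable_unit_ball. Qed.
Let V0 : 0 < V. Proof. exact: ball_vol_gt0. Qed.
Let n1_gt0 : (0 < n.-1)%N. Proof. by case: n hn => [|[]]. Qed.
Let nE : n.-1.+1 = n. Proof. by case: n hn. Qed.

(* The normalization for which [u = w (tvar x) / mtc] has Dirichlet energy
   [\int w' ^+ n], and [(mtc * |u|) ^ (n/(n-1)) = mt_const * |u| ^ (n/(n-1))]. *)
Definition mtc : R := n%:R * V `^ n%:R^-1.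

Lemma mtc_gt0 : 0 < mtc.
Proof. by rewrite mulr_gt0// powR_gt0. Qed.

Lemma mtc_pow : mtc ^+ n = n%:R ^+ n * V.
Proof.
rewrite exprMn -(@powR_mulrn _ (V `^ _)) ?powR_ge0// -powRrM mulVf ?gt_eqF//.
by rewrite powRr1// ltW.
Qed.

(** The gradient of w (tvar x) / mtc when w' = h. The factor exp (2 t / n) is |x|^(-2) away from the
    origin. *)
Definition Rfield (h : R -> R) (x : 'rV[R]_n) : 'rV[R]_n :=
  (- n%:R / mtc * h (tvar x) * expR (2 / n%:R * tvar x)) *: x.

Lemma tvar_scaled (x : 'rV[R]_n) : x != 0 -> expR (2 / n%:R * tvar x) = (sqnorm x)^-1.
Proof.
rewrite -enorm_gt0 => x0; rewrite /sqnorm -enorm_sqr /tvar.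
have -> : 2 / n%:R * (- n%:R * ln (enorm x)) = - (2 * ln (enorm x)).
  by field; rewrite gt_eqF.
by rewrite expRN expRM_natl lnK.
Qed.

Lemma expR_tvar (x : 'rV[R]_n) : x != 0 -> expR (tvar x) = (enorm x ^+ n)^-1.
Proof.
rewrite -enorm_gt0 => x0; rewrite /tvar mulNr expRN expRM_natl lnK//.
Qed.

Lemma RfieldE h i (x : 'rV[R]_n) :
  Rfield h x ord0 i = - n%:R * (h (tvar x) / mtc) * x ord0 i / sqnorm x.
Proof.
rewrite /Rfield rV_scaleE; have [->|x0] := eqVneq x 0; first by rewrite mxE !mulr0 mul0r.
rewrite tvar_scaled//; field.
by apply/andP; split; rewrite gt_eqF ?mtc_gt0 ?sqnorm_gt0.
Qed.

Lemma RfieldB h k x : Rfield h x - Rfield k x = Rfield (fun t => h t - k t) x.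
Proof. by rewrite /Rfield -scalerBl; congr (_ *: _); ring. Qed.

Lemma measurable_Rfield h i : measurable_fun [set: R] h ->
  measurable_fun [set: 'rV[R]_n] (fun x => Rfield h x ord0 i).
Proof.
move=> mh; rewrite /Rfield; under eq_fun do rewrite rV_scaleE.
have mt := @measurable_tvar R n.
apply: measurable_funM; last exact: measurable_rV_coord.
apply: measurable_funM.
  by apply: measurable_funM => //; exact: measurableT_comp.
by apply: measurableT_comp => //; apply: measurable_funM.
Qed.

Lemma enorm_Rfield_le h x :
  enorm (Rfield h x) ^+ n <= V^-1 * (`|h (tvar x)| ^+ n * expR (tvar x)).
Proof.
rewrite /Rfield enormZ; have [->|x0] := eqVneq x 0.
  rewrite (_ : enorm 0 = 0); last by apply/eqP; rewrite enorm_eq0.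
  by rewrite mulr0 expr0n gtn_eqF//= mulr_ge0 ?invr_ge0 ?(ltW V0)// mulr_ge0 ?expR_ge0 ?exprn_ge0.
have e0 : 0 < enorm x by rewrite enorm_gt0.
rewrite !normrM (ger0_norm (expR_ge0 _)) tvar_scaled// /sqnorm -enorm_sqr.
rewrite normrN !normfV (gtr0_norm nR) (gtr0_norm mtc_gt0) expR_tvar//.
rewrite !exprMn exprVn mtc_pow.
rewrite le_eqVlt; apply/orP; left; apply/eqP.
rewrite exprVn -exprM mulnC exprM; field.
by rewrite !expf_neq0 ?gt_eqF.
Qed.

(** Away from the origin the n-th power of the norm is |h t|^n exp t / V, since mtc^n = n^n V; the
    weight exp (- t) of the change of variable then cancels exp t. *)
Lemma integral_Rfield_le (h : R -> R) : measurable_fun [set: R] h ->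
  (\int[mu]_(x in B) (enorm (Rfield h x) ^+ n)%:E <=
   \int[lebesgue_measure]_(t in `]0%R, +oo[) (`|h t| ^+ n)%:E)%E.
Proof.
move=> mh; pose g (t : R) := (V^-1 * (`|h t| ^+ n * expR t))%:E.
have mhn : measurable_fun [set: R] (fun t => `|h t| ^+ n).
  by apply: measurable_funX; exact: measurableT_comp.
have mg : measurable_fun [set: R] g.
  by apply/measurable_EFinP; apply: measurable_funM => //; exact: measurable_funM.
have g0 t : (0 <= g t)%E.
  by rewrite lee_fin mulr_ge0 ?invr_ge0 ?(ltW V0)// mulr_ge0 ?expR_ge0 ?exprn_ge0.
apply: (@le_trans _ _ (\int[mu]_(x in B) g (tvar x))%E).
  apply: ge0_le_integral => //.
  - by move=> x _; rewrite lee_fin exprn_ge0// enorm_ge0.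
  - apply/measurable_EFinP; apply: measurable_funX; apply: measurable_enorm_field => i.
    by apply: measurable_funTS; exact: measurable_Rfield.
  - by apply: measurable_funTS; apply: measurableT_comp => //; exact: measurable_tvar.
  - by move=> x _; rewrite lee_fin; exact: enorm_Rfield_le.
rewrite ge0_integral_tvar// -ge0_integralZl_EFin ?(ltW V0)//; last 2 first.
- by move=> t _; rewrite mule_ge0// lee_fin expR_ge0.
- apply: emeasurable_funM; first exact: measurable_funTS.
  by apply: measurable_funTS; exact: measurable_expRN.
rewrite -integral_itv_obnd_cbnd; last first.
  apply: measurable_funeM; apply: emeasurable_funM; first exact: measurable_funTS.
  by apply: measurable_funTS; exact: measurable_expRN.
rewrite le_eqVlt; apply/orP; left; apply/eqP; apply: eq_integral => t _.
rewrite /g -!EFinM; congr (_%:E).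
rewrite expRN; field.
by apply/andP; split; rewrite gt_eqF ?expR_gt0.
Qed.

Lemma Lpow_coord_le (g : 'rV[R]_n -> 'rV[R]_n) i :
  (forall i, measurable_fun B (fun x => g x ord0 i)) ->
  (Lpow (fun x => g x ord0 i) <= \int[mu]_(x in B) (enorm (g x) ^+ n)%:E)%E.
Proof.
move=> mg; apply: ge0_le_integral => //.
- by apply/measurable_EFinP; apply: measurable_funX; exact: measurableT_comp.
- by apply/measurable_EFinP; apply: measurable_funX; exact: measurable_enorm_field.
- by move=> x _; rewrite lee_fin lerXn2r ?nnegrE ?enorm_ge0// coord_le_enorm.
Qed.

(** A substitute for Poincare's inequality: a function of t with energy [e] grows at most as
    Hoelder's inequality allows, and t^(n-1) is integrable against exp (- t). *)
Lemma radial_Lpow_le : exists2 K : R, 0 < K &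
  forall (e : R) (f : 'rV[R]_n -> R) (v : R -> R), 0 <= e -> measurable_fun B f ->
  (forall t, 0 <= t -> `|v t| ^+ n <= t ^+ n.-1 * e) ->
  (forall x, x != 0 -> B x -> `|f x| = `|v (tvar x)| / mtc) ->
  (Lpow f <= (K * e)%:E)%E.
Proof.
have [C C0 hC] := integral_powM_expRN_fin R n1_gt0.
exists (V * (C + 1) / mtc ^+ n).
  by rewrite divr_gt0 ?exprn_gt0 ?mtc_gt0// mulr_gt0// ltr_wpDl.
move=> e f v e0 mf hv fv.
pose g (t : R) := ((e / mtc ^+ n) * `|t| ^+ n.-1)%:E.
have c0 : 0 <= e / mtc ^+ n by rewrite divr_ge0// exprn_ge0// ltW// mtc_gt0.
have mg : measurable_fun [set: R] g.
  apply/measurable_EFinP; apply: measurable_funM => //.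
  by apply: measurable_funX; exact: normr_measurable.
have g0 t : (0 <= g t)%E by rewrite lee_fin mulr_ge0 ?exprn_ge0.
apply: (@le_trans _ _ (\int[mu]_(x in B) g (tvar x))%E).
  apply: ae_ge0_le_integral => //.
  - by apply/measurable_EFinP; apply: measurable_funX; exact: measurableT_comp.
  - by apply: measurable_funTS; apply: measurableT_comp => //; exact: measurable_tvar.
  - exists [set 0]; split.
    + exact: compact_measurable_rV (@compact_set1 _ _).
    + exact: lebesgue_rV_set0.
    + move=> x /= h; apply: contrapT => /eqP x0; apply: h => Bx.
      rewrite lee_fin fv// expr_div_n mulrAC ler_pM2r ?invr_gt0 ?exprn_gt0 ?mtc_gt0//.
      by have T0 := tvar_ge0 Bx; rewrite mulrC (ger0_norm T0) hv.
rewrite ge0_integral_tvar//.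
have -> : (\int[lebesgue_measure]_(t in `[0%R, +oo[) (g t * (expR (- t))%:E) =
   (e / mtc ^+ n)%:E * \int[lebesgue_measure]_(t in `[0%R, +oo[) (t ^+ n.-1 * expR (- t))%:E)%E.
  rewrite -ge0_integralZl_EFin//.
  - apply: eq_integral => t; rewrite inE/= in_itv/= andbT => t0.
    by rewrite /g -!EFinM ger0_norm// mulrA.
  - by move=> t; rewrite /= in_itv/= andbT => t0; rewrite lee_fin mulr_ge0 ?expR_ge0 ?exprn_ge0.
  - apply: measurable_funTS; apply/measurable_EFinP; apply: measurable_funM; first exact: measurable_funX.
    by apply/measurable_EFinP; exact: measurable_expRN.
apply: (@le_trans _ _ (V%:E * ((e / mtc ^+ n)%:E * C%:E))%E).
  apply: lee_wpmul2l; first by rewrite lee_fin ltW.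
  by apply: lee_wpmul2l.
rewrite -!EFinM lee_fin.
have -> : V * (C + 1) / mtc ^+ n * e = V * (e / mtc ^+ n * (C + 1)) by ring.
by rewrite ler_pM2l// ler_wpM2l// lerDl.
Qed.

End radial_fields.

Section sobolev_of_energy_pair.
Variables (R : realType) (n : nat).
Hypothesis hn : (2 <= n)%N.
Notation mu := (@lebesgue_measure R).
Notation B := (unit_ball R n).

Let n0 : (0 < n)%N. Proof. exact: ltnW. Qed.
Let mB : measurable B. Proof. exact: measurable_unit_ball. Qed.
Let nE : n.-1.+1 = n. Proof. by case: n hn. Qed.

Lemma primitive_dist (w h chi W : R -> R) (e : R) :
  measurable_fun [set: R] h -> (forall t, 0 <= h t) -> w 0 = 0 ->
  (forall t, 0 <= t -> (\int[mu]_(s in `[0%R, t]) (h s)%:E = (w t)%:E)%E) ->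
  csmooth chi -> (forall t : R, is_derive t 1 W (chi t)) -> W 0 = 0 ->
  (Ldist n h chi <= e%:E)%E ->
  forall t, 0 <= t -> `|w t - W t| ^+ n <= t ^+ n.-1 * e.
Proof.
move=> mh h0 w0 wh schi dW W0 he t; rewrite le_eqVlt => /orP[/eqP <-|t0].
  rewrite w0 W0 subrr normr0 expr0n gtn_eqF//= expr0n gtn_eqF ?mul0r//.
  by case: n hn => [|[]].
have cchi := csmooth_continuous schi.
have mchi := csmooth_measurable schi.
have mT : measurable (`[0, t]%classic : set (measurableTypeR R)) by exact: measurable_itv.
have mh' : measurable_fun [set: R] (EFin \o h) by exact/measurable_EFinP.
have ih : mu.-integrable (`[0, t]%classic : set R) (EFin \o h).
  apply/integrableP; split; first exact: measurable_funTS.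
  rewrite (_ : integral _ _ _ = (w t)%:E) ?ltry// -wh ?(ltW t0)//.
  by apply: eq_integral => s _; rewrite gee0_abs// lee_fin.
have ic : mu.-integrable (`[0, t]%classic : set R) (EFin \o chi).
  exact: integrableS (csmooth_integrable schi).
have mhc : measurable_fun [set: R] (fun s => `|h s - chi s|).
  by apply: measurableT_comp => //; exact: measurable_funB.
have E : (\int[mu]_(s in `[0%R, t]) (h s - chi s)%:E = (w t - W t)%:E)%E.
  have := integralB mT ih ic.
  rewrite (wh _ (ltW t0)) (integral_is_derive (ltW t0) dW cchi) W0 subr0 EFinB => <-.
  by apply: eq_integral => s _; rewrite EFinB.
have [||||||I hI [I0 hIn]] := @power_mean _ (measurableTypeR R) R mu `]0, t] n.-1 (measurable_itv _)
  (fun s => `|h s - chi s|) (fun=> 1) e t t0.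
- exact: measurable_funTS.
- exact: measurable_cst.
- by [].
- by [].
- rewrite nE; apply: le_trans he; apply: ge0_subset_integral => //.
  + by apply/measurable_EFinP; apply: measurable_funX; exact: measurable_funTS.
  + by move=> s /=; rewrite !in_itv/= andbT => /andP[].
- rewrite (_ : integral _ _ _ = \int[mu]_(s in `]0%R, t]) (cst 1%E s))%E; last first.
    by apply: eq_integral => s _; rewrite expr1n.
  rewrite integral_cst// mul1e le_eqVlt; apply/orP; left; apply/eqP.
  by apply: etrans (lebesgue_measure_itvoc (ltW t0)) _; rewrite subr0.
rewrite mulrC; move: hIn; rewrite nE; apply: le_trans.
rewrite lerXn2r ?nnegrE// -lee_fin -abse_EFin -E.
have mhcE : measurable_fun (`[0, t]%classic : set R) (fun s => (h s - chi s)%:E).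
  by apply: measurable_funTS; apply/measurable_EFinP; exact: measurable_funB.
apply: (le_trans (le_abse_integral mu mT mhcE)).
rewrite -hI -integral_itv_obnd_cbnd; last first.
  by apply: measurableT_comp => //; apply: measurable_funTS; apply/measurable_EFinP; exact: measurable_funB.
rewrite le_eqVlt; apply/orP; left; apply/eqP; apply: eq_integral => s _.
by rewrite expr1n mulr1.
Qed.

Variables (w Phi : R -> R).
Hypothesis wE : energy_pair n 1 w Phi.
Let u (x : 'rV[R]_n) : R := w (tvar x) / mtc R n.

(** The density h of w is approximated in L^n by [csmooth] functions chi. The primitive of chi gives
    a test function phi with gradient [Rfield chi]; closeness of chi to h bounds both u - phi and
    the difference of the fields. The same approximation identifies the weak gradient of u and puts
    u in the closure of the test functions. *)
Lemma energy_pair_sobolev : sobolev0_rad u /\ (dirichlet u <= 1)%E.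
Proof.
have [w0 wnd wP PE] := wE.
have [h [mh h0 wh hE]] := energy_pair_density hn wE.
have c0 : 0 < mtc R n := mtc_gt0 R hn.
have mw : measurable_fun [set: R] w by exact: nondecreasing_measurable.
have mu_ : measurable_fun [set: 'rV[R]_n] u.
  apply: measurable_funM => //; apply: measurableT_comp => //; exact: measurable_tvar.
have muB : measurable_fun B u by exact: measurable_funTS.
have hE' : (\int[mu]_(s in `]0%R, +oo[) (`|h s| ^+ n)%:E <= 1)%E.
  apply: le_trans hE; rewrite (_ : integral _ _ _ = \int[mu]_(s in `]0%R, +oo[) (h s ^+ n)%:E)%E; last first.
    by apply: eq_integral => s _; rewrite ger0_norm.
  by rewrite integral_itv_obnd_cbnd//; apply: measurable_funTS; apply/measurable_EFinP; exact: measurable_funX.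
have La : Lapprox n h.
  apply: Lapprox_pow_integrable => //; apply: le_lt_trans (ltry 1).
  move: hE'; rewrite (_ : integral _ _ _ = \int[mu]_(s in `]0%R, +oo[) (h s ^+ n)%:E)%E//.
  by apply: eq_integral => s _; rewrite ger0_norm.
have [K K0 hK] := radial_Lpow_le R hn.
have approx (e : R) : 0 < e -> exists phi (chi : R -> R), [/\ test_function B phi, measurable_fun [set: R] chi,
    weak_gradient B phi (Rfield chi), (Lpow (u \- phi)%R <= (K * e)%:E)%E &
    (\int[@lebesgue_rV R n]_(x in B) (enorm (Rfield h x - Rfield chi x) ^+ n)%:E <= e%:E)%E].
  move=> e0; have [_ /(_ _ e0)[chi schi he]] := La.
  have [W [sW dW [a a0 Wa] [b Wb]]] := csmooth_primitive schi.
  have W0 : W 0 = 0 by apply: Wa; exact: ltW.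
  pose f t := (mtc R n)^-1 * W t.
  have sf k : smooth1 setT k f.
    exact: smooth1M (@openT R) (smooth1_cst k _ (@openT R)) (sW k).
  have df (t : R) : is_derive t 1 f ((mtc R n)^-1 * chi t).
    by have d := dW t; apply: is_derive_eq; rewrite /GRing.scale/=.
  have fa t : t <= a -> f t = 0 by move=> /Wa Wt; rewrite /f Wt mulr0.
  have fb t : b <= t -> f t = f b by move=> /Wb Wt; rewrite /f Wt.
  pose phi (x : 'rV[R]_n) := profile n f (f b) (sqnorm x).
  have sphi k : smoothk k phi by exact: smoothk_profile fb.
  exists phi, chi; split.
  - exact: test_profile sf a0 fa fb.
  - exact: csmooth_measurable.
  - have -> : Rfield chi = (fun x => \row_i partial i phi x).
      apply/funext => x; apply/rowP => i; rewrite mxE RfieldE//.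
      by rewrite (partial_profile n0 i x sf fb df) [_^-1 * chi _]mulrC.
    exact: smoothk1_weak_gradient.
  - have hv := primitive_dist mh h0 w0 wh schi dW W0 he.
    apply: (hK e (u \- phi) (fun t => w t - W t)) => //; first exact: ltW.
      apply: measurable_funB => //; apply: measurable_funTS.
      exact: continuous_measurable_rV (@smoothk_continuous _ _ 0 phi (sphi 0%N)).
    move=> x x0 _; rewrite /= /u /phi profile_tvar// /f.
    by rewrite [_^-1 * W _]mulrC -mulrBl normrM normfV (gtr0_norm c0).
  - rewrite (_ : integral _ _ _ = \int[@lebesgue_rV R n]_(x in B)
        (enorm (Rfield (fun t => h t - chi t)%R x) ^+ n)%:E)%E; last first.
      by apply: eq_integral => x _; rewrite RfieldB.
    apply: le_trans he; apply: integral_Rfield_le => //.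
    by apply: measurable_funB => //; exact: csmooth_measurable.
have LuE : (Lpow u <= (K * 1)%:E)%E.
  apply: (hK 1 u w) => //.
    move=> t t0; have := wP _ _ (lexx 0) t0; rewrite w0 !subr0 => h1.
    have wt0 : 0 <= w t by rewrite -w0 wnd.
    rewrite ger0_norm//; apply: le_trans h1 _; rewrite mulrC ler_wpM2l ?exprn_ge0//.
    have /andP[_ P1] := PE _ t0; have /andP[P0 _] := PE _ (lexx 0).
    by rewrite lerBlDr (le_trans P1)// lerDl.
  by move=> x x0 _; rewrite /u normrM normfV (gtr0_norm c0).
have Lu : (Lpow u < +oo)%E by apply: le_lt_trans LuE _; rewrite ltry.
have mG i : measurable_fun B (fun x => Rfield h x ord0 i).
  by apply: measurable_funTS; exact: measurable_Rfield.
have GE : (\int[@lebesgue_rV R n]_(x in B) (enorm (Rfield h x) ^+ n)%:E <= 1)%E.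
  by apply: le_trans hE'; exact: integral_Rfield_le.
have wg : weak_gradient B u (Rfield h).
  apply: weak_gradient_lim => //.
  - exact: L1_fin.
  - move=> i; apply: L1_fin => //; apply: le_lt_trans (Lpow_coord_le _ _) _ => //.
    by apply: le_lt_trans GE (ltry 1).
  - move=> e e0; have [d d0 hd] := L1_small n0 e0.
    (* The error on the function is K d', the error on the gradient is d'; both have to be at most
       d. *)
    pose d' := Num.min (d / K) d.
    have d'0 : 0 < d' by rewrite lt_min d0 divr_gt0.
    have [phi [chi [tphi mchi wphi Lphi Gphi]]] := approx d' d'0.
    have s1 := test_smoothk1 tphi.
    have mphi := continuous_measurable_rV (@smoothk_continuous _ _ _ phi s1).
    exists phi, (Rfield chi); split => //.
      apply: hd; first by apply: measurable_funB => //; exact: measurable_funTS.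
      apply: le_trans Lphi _; rewrite lee_fin mulrC -ler_pdivlMr//.
      by rewrite ge_min lexx.
    move=> i; apply: hd.
      by apply: measurable_funB => //; apply: measurable_funTS; exact: measurable_Rfield.
    have mD j : measurable_fun B (fun x => (Rfield h x - Rfield chi x) ord0 j).
      have -> : (fun x => (Rfield h x - Rfield chi x) ord0 j) =
          (fun x => Rfield h x ord0 j - Rfield chi x ord0 j).
        by apply/funext => x; rewrite !mxE.
      by apply: measurable_funB => //; apply: measurable_funTS; exact: measurable_Rfield.
    have -> : (fun x => Rfield h x ord0 i - Rfield chi x ord0 i) =
        (fun x => (Rfield h x - Rfield chi x) ord0 i).
      by apply/funext => x; rewrite !mxE.
    apply: le_trans (Lpow_coord_le i mD) _; apply: le_trans Gphi _.
    by rewrite lee_fin ge_min lexx orbT.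
have du : (dirichlet u <= 1)%E by rewrite (integral_grad wg).
split => //; split; last first.
  exists (fun r => w (- n%:R * ln r) / mtc R n).
  by apply: aeW.
split; first split => //.
- by exists (Rfield h).
- rewrite sobolev_normE; apply: poweR_lty; apply: lte_add_pinfty => //.
  by apply: le_lt_trans du (ltry 1).
- move=> e e0.
  have en0 : 0 < e ^+ n by rewrite exprn_gt0.
  pose d := e ^+ n / (K + 2).
  have K2 : 0 < K + 2 by rewrite addr_gt0.
  have d0 : 0 < d by rewrite divr_gt0.
  have [phi [chi [tphi mchi wphi Lphi Gphi]]] := approx d d0.
  exists phi => //; apply/(sobolev_norm_lt n0 _ e0).
  rewrite (integral_grad (weak_gradientB wg wphi)).
  apply: le_lt_trans (leeD Lphi Gphi) _; rewrite -EFinD lte_fin.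
  have -> : K * d + d = (K + 1) * d by ring.
  by rewrite /d mulrCA gtr_pMr// ltr_pdivrMr// mul1r ltrD2l ltr1n.
Qed.

End sobolev_of_energy_pair.

(** * From Sobolev functions to energy pairs *)

Section radial_representative.
Variables (R : realType) (n : nat).
Hypothesis n0 : (0 < n)%N.
Notation mu := (@lebesgue_rV R n).
Notation B := (unit_ball R n).

Let mB : measurable B. Proof. exact: measurable_unit_ball. Qed.
Let nR : 0 < n%:R :> R. Proof. by rewrite ltr0n. Qed.

Let dilate (p : R * 'rV[R]_n) : 'rV[R]_n := expR (- p.1 / n%:R) *: p.2.

Let measurable_dilate : measurable_fun [set: R * 'rV[R]_n] dilate.
Proof.
apply/measurable_fun_rVP => i; rewrite /dilate; under eq_fun do rewrite rV_scaleE.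
apply: measurable_funM.
  apply: measurableT_comp => //; apply: measurable_funM => //.
  exact: measurableT_comp measurable_fst.
exact: (measurableT_comp (measurable_rV_coord i) measurable_snd).
Qed.

(** Fubini for the pairs (t, y) under dilation by exp (- t / n): at fixed t the slice is a dilate of
    N, hence null, so the slice in t is null for almost every y. *)
Lemma null_rays (N : set 'rV[R]_n) : measurable N -> mu N = 0%E ->
  {ae mu, forall y : 'rV[R]_n,
    lebesgue_measure [set t : R | N (expR (- t / n%:R) *: y)] = 0%E}.
Proof.
move=> mN N0.
have mN' : measurable (dilate @^-1` N).
  by rewrite -[X in measurable X]setTI; exact: measurable_dilate.
have := @indic_fubini_tonelli _ _ _ _ R (@lebesgue_measure R) mu _ mN'.
rewrite indic_fubini_tonelli_FE//.
rewrite integral0_eq; last first.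
  move=> t _; rewrite /= (_ : xsection _ _ = *:%R (expR (- t / n%:R)) @^-1` N).
    by rewrite lebesgue_rV_scale ?expR_gt0//; rewrite N0 mule0.
  by apply/seteqP; split => y; rewrite /xsection/= inE.
move=> /esym I0.
have mG := @indic_measurable_fun_fubini_tonelli_G _ _ _ _ R (@lebesgue_measure R) _ mN'.
have G0 := @indic_fubini_tonelli_G_ge0 _ _ _ _ R (@lebesgue_measure R) (dilate @^-1` N).
have : ae_eq mu setT (fubini_G lebesgue_measure (EFin \o \1_(dilate @^-1` N))) (cst 0%E).
  apply/(ae_eq_integral_abs mu measurableT) => //.
  by rewrite -[RHS]I0; apply: eq_integral => y _; rewrite gee0_abs.
apply: filterS => y /(_ Logic.I).
rewrite indic_fubini_tonelli_GE//= => <-; congr (lebesgue_measure _).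
by apply/seteqP; split => t; rewrite /ysection/= inE.
Qed.

Lemma null_tvar (Z : set R) : measurable Z -> lebesgue_measure Z = 0%E ->
  mu (B `&` @tvar R n @^-1` Z) = 0%E.
Proof.
move=> mZ Z0; have mt := @measurable_tvar R n.
have mZ' : measurable (@tvar R n @^-1` Z) by rewrite -[X in measurable X]setTI; exact: mt.
have -> : mu (B `&` @tvar R n @^-1` Z) = (\int[mu]_(x in B) (\1_Z (tvar x))%:E)%E.
  by rewrite setIC -integral_indic.
rewrite (ge0_integral_tvar n0 (g := fun t => (\1_Z t)%:E))//; last first.
  by apply/measurable_EFinP; exact: measurable_indic.
rewrite (_ : integral _ _ _ = 0%E) ?mule0//.
have mE := @measurable_expRN R.
have m1 : measurable_fun [set: R] (fun t : R => (\1_Z t)%:E : \bar R).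
  by apply/measurable_EFinP; exact: measurable_indic.
transitivity (\int[lebesgue_measure]_(t in `[0%R, +oo[) cst 0%E (t : R))%E; last by rewrite integral0.
apply: ge0_ae_eq_integral => //.
- by apply: emeasurable_funM; exact: measurable_funTS.
exists Z; split => // t /= h; apply: contrapT => Zt; apply: h => _.
by rewrite indicE memNset// mul0e.
Qed.

(** [radial] provides a profile without any measurability. A measurable one is read off u itself
    along a single ray, chosen by [null_rays] to meet the exceptional set in a null set of
    parameters. *)
Lemma radial_rep (u : 'rV[R]_n -> R) : measurable_fun B u -> radial B u ->
  exists2 v : R -> R, measurable_fun [set: R] v &
    {ae mu, forall x : 'rV[R]_n, B x -> u x = v (tvar x)}.
Proof.
move=> mu_ [f [N [mN N0 hN]]].
have [M [mM M0 hM]] := null_rays mN N0.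
have [y0 [By0 y00 yM]] : exists y0 : 'rV[R]_n, [/\ B y0, y0 != 0 & ~ M y0].
  apply: contrapT => h.
  have : (mu B <= mu (M `|` [set (0 : 'rV[R]_n)%R]))%E.
    have ms0 : measurable [set 0 : 'rV[R]_n] by exact: compact_measurable_rV (@compact_set1 _ _).
    apply: le_measure; rewrite ?inE//; first exact: measurableU.
    move=> x Bx; apply: contrapT => /not_orP[Mx x0]; apply: h; exists x; split => //.
    exact/eqP.
  apply/negP; rewrite -ltNge.
  have ms0 : measurable [set 0 : 'rV[R]_n] by exact: compact_measurable_rV (@compact_set1 _ _).
  apply: (@le_lt_trans _ _ (mu M + mu [set (0 : 'rV[R]_n)%R])%E); first exact: measureU2.
  by rewrite M0 lebesgue_rV_set0// adde0 unit_ball_volE lte_fin ball_vol_gt0.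
have ray0 : lebesgue_measure [set t : R | N (expR (- t / n%:R) *: y0)] = 0%E.
  by apply: contrapT => h; apply: yM; apply: hM => /=.
have e0 : 0 < enorm y0 by rewrite enorm_gt0.
(* The point at norm exp (- t / n) on the ray through [y0]. *)
pose pt (t : R) : 'rV[R]_n := expR (- (t + n%:R * ln (enorm y0)) / n%:R) *: y0.
have ptE t : enorm (pt t) = expR (- t / n%:R).
  rewrite /pt enormZ (ger0_norm (expR_ge0 _)) -[X in _ * X]lnK// -expRD; congr expR.
  by field; rewrite gt_eqF.
have mpt : measurable_fun [set: R] pt.
  apply/measurable_fun_rVP => i; rewrite /pt; under eq_fun do rewrite rV_scaleE.
  apply: measurable_funM => //; apply: measurableT_comp => //.
  apply: measurable_funM => //; apply: measurableT_comp => //.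
  exact: measurable_funD.
exists (fun t => (u \_ B) (pt t)).
  apply: measurableT_comp => //.
  exact/(measurable_restrictT _ mB).
pose Z : set R := [set t | N (pt t)].
have mZ : measurable Z by rewrite /Z -[X in measurable X]setTI; exact: mpt.
have Z0 : lebesgue_measure Z = 0%E.
  pose Z1 := [set t : R | N (expR (- t / n%:R) *: y0)].
  have -> : Z = (fun t => t + n%:R * ln (enorm y0)) @^-1` Z1 by [].
  rewrite lebesgue_measure_shift//.
  rewrite /Z1 -[X in measurable X]setTI.
  have m1 : measurable_fun [set: R] (fun t : R => expR (- t / n%:R) *: y0).
    exact: (measurableT_comp measurable_dilate (measurable_pair2 y0)).
  exact: m1.
exists (N `|` ((B `&` @tvar R n @^-1` Z) `|` [set 0])); split.
- apply: measurableU => //; apply: measurableU.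
    apply: measurableI => //; rewrite -[X in measurable X]setTI.
    exact: measurable_tvar.
  exact: compact_measurable_rV (@compact_set1 _ _).
- have ms0 : measurable [set 0 : 'rV[R]_n] by exact: compact_measurable_rV (@compact_set1 _ _).
  have mBZ : measurable (B `&` @tvar R n @^-1` Z).
    apply: measurableI => //; rewrite -[X in measurable X]setTI.
    exact: measurable_tvar.
  rewrite measureU0//; first exact: measurableU.
  by rewrite measureU0//; [exact: null_tvar|exact: lebesgue_rV_set0].
- move=> x /= h; apply: contrapT => /not_orP[Nx /not_orP[Zx /eqP x0]]; apply: h => Bx.
  have pE : enorm (pt (tvar x)) = enorm x.
    rewrite ptE /tvar mulNr opprK mulrAC divff ?gt_eqF// mul1r lnK// posrE enorm_gt0//.
  have Bp : B (pt (tvar x)) by rewrite /unit_ball/= pE.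
  have Np : ~ N (pt (tvar x)) by move=> h; apply: Zx; split.
  rewrite patchE mem_set//.
  have good z : ~ N z -> B z -> u z = f (enorm z).
    by move=> Nz Bz; apply: contrapT => h; apply: Nz; apply: hN => /= /(_ Bz).
  by rewrite (good _ Nx Bx) (good _ Np Bp) pE.
Qed.

End radial_representative.

(** * Radial vector fields with prescribed divergence *)

Section radial_flux.
Variables (R : realType) (n : nat).
Hypothesis hn : (2 <= n)%N.
Notation mu := (@lebesgue_rV R n).
Notation B := (unit_ball R n).

Let n0 : (0 < n)%N. Proof. exact: ltnW. Qed.
Let nR : 0 < n%:R :> R. Proof. by rewrite ltr0n. Qed.
Let mB : measurable B. Proof. exact: measurable_unit_ball. Qed.
Let nE : n.-1.+1 = n. Proof. by case: n hn. Qed.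

Definition gradient (phi : 'rV[R]_n -> R) (x : 'rV[R]_n) : 'rV[R]_n := \row_i partial i phi x.

Lemma dot_le_enorm (a b : 'rV[R]_n) :
  `|\sum_i a ord0 i * b ord0 i| <= enorm a * enorm b.
Proof.
have [->|a0] := eqVneq a 0.
  rewrite big1 ?normr0 ?mulr_ge0 ?enorm_ge0// => i _; by rewrite mxE mul0r.
have [->|b0] := eqVneq b 0.
  rewrite big1 ?normr0 ?mulr_ge0 ?enorm_ge0// => i _; by rewrite mxE mulr0.
rewrite -enorm_gt0 in a0; rewrite -enorm_gt0 in b0.
set A := enorm a in a0 *; set C := enorm b in b0 *.
(* Cauchy-Schwarz by weighted means: with the norms as weights, each term a_i b_i is dominated by
   the corresponding term of this sum. *)
have -> : A * C = \sum_i (C / (2 * A) * a ord0 i ^+ 2 + A / (2 * C) * b ord0 i ^+ 2).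
  rewrite big_split/= -!mulr_sumr -!enorm_sqr -/A -/C; field.
  by rewrite !gt_eqF.
apply: le_trans (ler_norm_sum _ _ _) _; apply: ler_sum => i _.
set x := a ord0 i; set y := b ord0 i; rewrite normrM.
rewrite -(real_normK (num_real x)) -(real_normK (num_real y)).
rewrite -subr_ge0; set p := `|x|; set q := `|y|.
have -> : C / (2 * A) * p ^+ 2 + A / (2 * C) * q ^+ 2 - p * q = (C * p - A * q) ^+ 2 / (2 * A * C).
  by field; rewrite !gt_eqF.
by rewrite divr_ge0 ?sqr_ge0 ?mulr_ge0 ?ltW.
Qed.

Lemma test_off phi x : test_function B phi -> ~ B x ->
  phi x = 0 /\ gradient phi x = 0.
Proof.
move=> [_ _ sB] nB; have nx : ~ supp phi x by move=> /sB.
split; first by have [] := supp_off (Ordinal n0) nx.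
by apply/rowP => i; rewrite !mxE; have [] := supp_off i nx.
Qed.

Lemma test_bsupp phi : test_function B phi -> bsupp 1 phi.
Proof.
move=> tphi x [j xj]; suff nB : ~ B x by have [] := test_off tphi nB.
move=> Bx; have := le_lt_trans (coord_le_enorm x j) Bx; by rewrite ltNge (ltW xj).
Qed.

Section flux_identity.
Variables (chi W : R -> R) (a b : R).
Hypothesis sW : forall k, smooth1 setT k W.
Hypothesis dW : forall t : R, is_derive t 1 W (chi t).
Hypothesis a0 : 0 < a.
Hypothesis chia : forall t, t <= a -> chi t = 0.
Hypothesis Wb : forall t, b <= t -> W t = W b.

(** The radial field x f (tvar x) has divergence n (f - f') = n exp t chi t, because x . grad (f
    (tvar x)) = - n f'. Testing u against a bump in t thus amounts to testing its gradient against
    this field, which vanishes near the origin since f is 0 for t >= b. *)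
Let f (t : R) := expR t * (W b - W t).

Let sf k : smooth1 setT k f.
Proof.
have oT := @openT R.
have s1 : smooth1 setT k (fun t => W b + (-1) * W t).
  by apply: (smooth1D oT (smooth1_cst k _ oT)); exact: smooth1M oT (smooth1_cst k _ oT) (sW k).
apply: eq_smooth1 (smooth1M oT (smooth1_expR k oT) s1) => // t _.
by rewrite mulN1r.
Qed.

Let df (t : R) : is_derive t 1 f (f t - expR t * chi t).
Proof.
have d := dW t; apply: is_derive_eq; rewrite /GRing.scale/= /f; ring.
Qed.

Let fb t : b <= t -> f t = 0. Proof. by move=> /Wb Wt; rewrite /f Wt subrr mulr0. Qed.

Let Q (x : 'rV[R]_n) := profile n f 0 (sqnorm x).

Lemma smoothk_flux_profile k :
  smoothk k (fun x : 'rV[R]_n => profile n (fun t => expR t * (W b - W t)) 0 (sqnorm x)).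
Proof. exact: smoothk_profile sf fb. Qed.

Let sQ k : smoothk k Q := smoothk_flux_profile k.

Let flux_pointwise phi x : test_function B phi ->
  \sum_i partial i (fun y : 'rV[R]_n => phi y * (y ord0 i * Q y)) x =
  (\sum_i gradient phi x ord0 i * x ord0 i) * Q x +
  phi x * (n%:R * expR (tvar x) * chi (tvar x)).
Proof.
move=> tphi; have s1 := test_smoothk1 tphi.
have pE i : partial i (fun y : 'rV[R]_n => phi y * (y ord0 i * Q y)) x =
    gradient phi x ord0 i * x ord0 i * Q x + phi x * (Q x + x ord0 i * partial i Q x).
  rewrite (@partialM _ _ 0 phi (fun y => y ord0 i * Q y))//; last first.
    by apply: smoothkM; [exact: smoothk_coord|exact: sQ].
  rewrite (@partialM _ _ 0 (fun y => y ord0 i) Q)//; last exact: smoothk_coord.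
  have -> : partial i (fun y : 'rV[R]_n => y ord0 i) x = 1.
    by apply: derive_val; have := is_derive_coord i i x; rewrite eqxx.
  by rewrite mxE; ring.
under eq_bigr do rewrite pE.
rewrite big_split/= -mulr_suml; congr (_ + _).
rewrite -mulr_sumr big_split/= sumr_const card_ord.
(* At the origin [tvar] is 0, as ln 0 = 0; the identity survives because [chi] vanishes at 0 and the
   profile takes the value 0 there. *)
have [->|x0] := eqVneq x 0.
  have -> : tvar (0 : 'rV[R]_n) = 0.
    by rewrite /tvar (_ : enorm 0 = 0) ?ln0 ?mulr0//; apply/eqP; rewrite enorm_eq0.
  rewrite chia ?ltW// mulr0; congr (_ * _).
  rewrite big1 ?addr0; last by move=> i _; rewrite mxE mul0r.
  rewrite /Q /profile (_ : sqnorm 0 = 0) ?ltxx ?mul0rn//.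
  by rewrite /sqnorm big1// => i _; rewrite mxE expr0n.
congr (_ * _); rewrite /Q profile_tvar//.
have s0 := sqnorm_gt0 x0.
under eq_bigr => i _ do rewrite (partial_profile n0 i x sf fb df).
set c := f (tvar x) - _.
have -> : \sum_(i < n) x ord0 i * (- n%:R * c * x ord0 i / sqnorm x) =
    - n%:R * c / sqnorm x * \sum_i x ord0 i ^+ 2.
  by rewrite mulr_sumr; apply: eq_bigr => i _; rewrite expr2; field; rewrite gt_eqF.
by rewrite -/(sqnorm x) divfK ?gt_eqF// -mulr_natl /c; ring.
Qed.

Lemma flux_identity phi : test_function B phi ->
  (\int[mu]_(x in B) (phi x * (n%:R * expR (tvar x) * chi (tvar x)))%:E =
   \int[mu]_(x in B) (- ((\sum_i gradient phi x ord0 i * x ord0 i) * Q x))%:E)%E.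
Proof.
move=> tphi; have s1 := test_smoothk1 tphi.
pose th i (y : 'rV[R]_n) := phi y * (y ord0 i * Q y).
have sth i : smoothk 1 (th i).
  by apply: smoothkM => //; apply: smoothkM; [exact: smoothk_coord|exact: sQ].
have bth i : bsupp 1 (th i) by move=> x /(test_bsupp tphi) h; rewrite /th h mul0r.
have cp i : continuous (partial i (th i) : 'rV[R]_n -> R^o) := partial_continuous (i := i) (sth i).
have int i : mu.-integrable setT (EFin \o partial i (th i)).
  have [C hC] := continuous_bsupp_bounded (cp i) (partial_bsupp i (bth i)).
  exact: integrable_bsupp ltr01 (continuous_measurable_rV (cp i)) hC (partial_bsupp i (bth i)).
have th0 : (\int[mu]_x (\sum_i partial i (th i) x)%:E = 0)%E.
  under eq_integral do rewrite -sumEFin.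
  rewrite integral_sum//= big1// => i _.
  have [cth /(_ i)[dth _]] := sth i.
  exact: integral_partial0 ltr01 cth dth (cp i) (bth i).
have iS : mu.-integrable setT (EFin \o (fun x => \sum_i partial i (th i) x)).
  rewrite (_ : _ \o _ = (fun x => \sum_i (partial i (th i) x)%:E)%E); last first.
    by apply/funext => x /=; rewrite sumEFin.
  by apply: integrable_sum => // i _; exact: int.
pose A x := (\sum_i gradient phi x ord0 i * x ord0 i) * Q x.
pose F x := phi x * (n%:R * expR (tvar x) * chi (tvar x)).
have AE x : A x = \sum_i partial i phi x * (x ord0 i * Q x).
  by rewrite /A mulr_suml; apply: eq_bigr => i _; rewrite mxE mulrA.
have bA : bsupp 1 A.
  move=> x [j xj]; have nB : ~ B x.
    by move=> Bx; have := le_lt_trans (coord_le_enorm x j) Bx; rewrite ltNge (ltW xj).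
  rewrite /A (test_off tphi nB).2 big1 ?mul0r// => i _; by rewrite mxE mul0r.
have cA : continuous (A : 'rV[R]_n -> R^o).
  have -> : A = (fun x => \sum_i partial i phi x * (x ord0 i * Q x)) by apply/funext.
  apply: (@smoothk_continuous _ _ 0); apply: smoothk_sum => i; apply: smoothkM.
    by split => //; exact: partial_continuous.
  by apply: smoothkM; [exact: smoothk_coord|exact: sQ].
have iA : mu.-integrable setT (EFin \o A).
  have [C hC] := continuous_bsupp_bounded cA bA.
  exact: integrable_bsupp ltr01 (continuous_measurable_rV cA) hC bA.
have FE x : F x = \sum_i partial i (th i) x - A x.
  by rewrite (flux_pointwise x tphi) /A /F; ring.
have eB (g : 'rV[R]_n -> R) : (forall x, ~ B x -> g x = 0) ->
    (\int[mu]_(x in B) (g x)%:E = \int[mu]_x (g x)%:E)%E.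
  move=> g0; rewrite integral_mkcond; apply: eq_integral => x _; rewrite patchE.
  by case: ifPn => // /negP xB; rewrite g0// => Bx; apply: xB; rewrite inE.
rewrite (eB F); last by move=> x /(test_off tphi)[h _]; rewrite /F h mul0r.
rewrite (eB (fun x => - A x)); last first.
  move=> x /(test_off tphi)[_ h]; rewrite /A h big1 ?mul0r ?oppr0// => i _.
  by rewrite mxE mul0r.
transitivity (\int[mu]_x ((\sum_i partial i (th i) x)%:E - (A x)%:E))%E.
  by apply: eq_integral => x _; rewrite FE EFinB.
rewrite integralB// th0 add0e.
rewrite -(integralN (f := EFin \o A))//; last exact: integrable_add_def.
Qed.

End flux_identity.
End radial_flux.

Section flux_bound.
Variables (R : realType) (n : nat).
Hypothesis hn : (2 <= n)%N.
Notation mu := (@lebesgue_rV R n).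
Notation B := (unit_ball R n).

Let n0 : (0 < n)%N. Proof. exact: ltnW. Qed.
Let nR : 0 < n%:R :> R. Proof. by rewrite ltr0n. Qed.
Let mB : measurable B. Proof. exact: measurable_unit_ball. Qed.
Let nE : n.-1.+1 = n. Proof. by case: n hn. Qed.

Lemma enormD_le (a b : 'rV[R]_n) : enorm (a + b) <= enorm a + enorm b.
Proof.
rewrite -ler_sqr ?nnegrE ?addr_ge0 ?enorm_ge0// sqrrD !enorm_sqr.
have -> : \sum_i (a + b) ord0 i ^+ 2 =
    \sum_i a ord0 i ^+ 2 + (\sum_i a ord0 i * b ord0 i) *+ 2 + \sum_i b ord0 i ^+ 2.
  by rewrite -sumrMnl -!big_split/=; apply: eq_bigr => i _; rewrite rV_addE; ring.
by rewrite lerD2r lerD2l lerMn2r/= (le_trans (ler_norm _))// dot_le_enorm.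
Qed.

Lemma integrable_L1_mul (f g : 'rV[R]_n -> R) (C : R) :
  measurable_fun B f -> (L1 f < +oo)%E -> measurable_fun B g ->
  (forall x, `|g x| <= C) -> mu.-integrable B (EFin \o (fun x => f x * g x)).
Proof.
move=> mf ff mg gC; have C0 : 0 <= C := le_trans (normr_ge0 _) (gC 0).
have mfg : measurable_fun B (EFin \o (fun x => f x * g x)).
  by apply/measurable_EFinP; exact: measurable_funM.
apply/integrableP; split => //.
have mf' : measurable_fun B (fun x => `|f x|%:E).
  by apply/measurable_EFinP; exact: measurableT_comp.
apply: (@le_lt_trans _ _ (\int[mu]_(x in B) (C%:E * `|f x|%:E))%E).
  apply: ge0_le_integral => //.
  - exact: measurableT_comp.
  - exact: measurable_funeM.
  - by move=> x _; rewrite /= -EFinM lee_fin normrM mulrC ler_wpM2r.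
rewrite (ge0_integralZl_EFin mu mB _ mf')//.
by rewrite lte_mul_pinfty// lee_fin.
Qed.

Lemma sobolev0_approx (u : 'rV[R]_n -> R) (d : R) : sobolev0 n%:R B u -> 0 < d ->
  exists2 phi, test_function B phi &
    (L1 (fun x => u x - phi x)%R <= d%:E)%E /\
    (L1 (fun x => enorm (grad B u x - gradient phi x)) <= d%:E)%E.
Proof.
move=> [[mu_ [g ug] _] happ] d0; have wg := gradP ug.
have [d1 d10 hd] := L1_small n0 d0.
pose e := Num.min 1 d1; have e0 : 0 < e by rewrite lt_min ltr01.
have [phi tphi] := happ e e0.
have s1 := test_smoothk1 tphi.
have wphi := smoothk1_weak_gradient s1.
have wd := weak_gradientB wg wphi.
move=> /(sobolev_norm_lt n0 _ e0) h.
have {h} h : (Lpow (u \- phi)%R + dirichlet (u \- phi)%R <= d1%:E)%E.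
  apply: (le_trans (ltW h)); rewrite lee_fin (@le_trans _ _ e)//.
    by rewrite -nE exprS ler_piMr ?(ltW e0)// exprn_ile1 ?(ltW e0)// ge_min lexx.
  by rewrite ge_min lexx orbT.
exists phi => //; split; apply: hd.
- apply: measurable_funB => //; apply: measurable_funTS.
  exact: continuous_measurable_rV (@smoothk_continuous _ _ _ phi s1).
- by apply: le_trans h; rewrite leeDl// dirichlet_ge0.
- exact: weak_gradient_measurable wd.
- apply: le_trans h; apply: (@le_trans _ _ (dirichlet (u \- phi)%R)); last by rewrite leeDr// Lpow_ge0.
  rewrite (integral_grad wd) le_eqVlt; apply/orP; left; apply/eqP.
  by apply: eq_integral => x _; rewrite ger0_norm ?enorm_ge0.
Qed.

(** Away from the origin this is |x|^(-(n-1)) on the shell tvar < s. In polar coordinates this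
    weight cancels the Jacobian, so that a radial |grad u| integrates to a multiple of the variation
    of u along a ray. *)
Definition ray_weight (s : R) (x : 'rV[R]_n) : R :=
  (tvar x < s)%R%:R * expR (tvar x / n%:R) ^+ n.-1.

Lemma ray_weight_ge0 s x : 0 <= ray_weight s x.
Proof. by rewrite mulr_ge0// exprn_ge0// expR_ge0. Qed.

Lemma measurable_ray_weight s : measurable_fun [set: 'rV[R]_n] (ray_weight s).
Proof.
have mt := @measurable_tvar R n.
apply: measurable_funM.
  have -> : (fun x => (tvar x < s)%R%:R) = \1_(@tvar R n @^-1` `]-oo, s[) :> ('rV[R]_n -> R).
    apply/funext => x; rewrite indicE; congr (nat_of_bool _)%:R.
    by apply/idP/idP; rewrite inE/= in_itv.
  by apply: measurable_indic; rewrite -[X in measurable X]setTI; exact: mt.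
apply: measurable_funX; apply: measurableT_comp => //.
exact: measurable_funM.
Qed.

Lemma ray_weight_le s x : ray_weight s x <= expR (s / n%:R) ^+ n.-1.
Proof.
rewrite /ray_weight; case: ltP => ts; last by rewrite mul0r exprn_ge0// expR_ge0.
rewrite mul1r lerXn2r ?nnegrE ?expR_ge0// ler_expR ler_pM2r ?invr_gt0//.
exact: ltW.
Qed.

Lemma enorm_mul_expR_tvar_le (x : 'rV[R]_n) :
  enorm x * expR (tvar x) <= expR (tvar x / n%:R) ^+ n.-1.
Proof.
have [->|x0] := eqVneq x 0.
  rewrite (_ : enorm 0 = 0); last by apply/eqP; rewrite enorm_eq0.
  by rewrite mul0r exprn_ge0// expR_ge0.
rewrite -enorm_gt0 in x0.
have xE : enorm x = expR (- tvar x / n%:R).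
  by rewrite /tvar mulNr opprK mulrAC divff ?gt_eqF// mul1r lnK.
rewrite {1}xE -expRD -expRM_natl ler_expR le_eqVlt; apply/orP; left; apply/eqP.
have -> : n.-1%:R = n%:R - 1 :> R by rewrite -[in RHS]nE -natr1 addrK.
by field; rewrite gt_eqF.
Qed.

(** The factor W b - W lies between 0 and e and vanishes from t + e on, because chi is at most the
    indicator of ]t, t + e[; and |x| exp (tvar x) is bounded by exp (tvar x / n)^(n-1), the weight
    of [ray_weight]. The flux identity holds for test functions, and the bound reaches u by L^1
    approximation. *)
Lemma flux_bound (u : 'rV[R]_n -> R) (t e : R) (j : nat) : sobolev0 n%:R B u ->
  0 < t -> 0 < e ->
  (`|\int[mu]_(x in B) (u x * (n%:R * expR (tvar x) * ibump t (t + e) j (tvar x)))%:E| <=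
   e%:E * \int[mu]_(x in B) (enorm (grad B u x) * ray_weight (t + e) x)%:E)%E.
Proof.
move=> su t0 e0; set chi := ibump t (t + e) j; set s := t + e.
have ts : t < s by rewrite ltrDl.
have schi : csmooth chi.
  split; first by move=> k; exact: smooth1_ibump.
  by exists t, s; split => // x; exact: ibump_eq0.
have cchi := csmooth_continuous schi.
have [W [sW dW [a a0 Wa] [b Wb]]] := csmooth_primitive schi.
have chit x : x <= t -> chi x = 0 by move=> xt; apply: ibump_eq0; left.
have chis x : s <= x -> chi x = 0 by move=> xs; apply: ibump_eq0; right.
have chi01 x : 0 <= chi x <= 1 := ibump_itv t s j x.
have etaE x : W b - W x = W (Num.max b x) - W x.
  by congr (_ - _); rewrite [RHS]Wb// le_max lexx.
have xm x : x <= Num.max b x by rewrite le_max lexx orbT.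
have eta0 x : 0 <= W b - W x.
  rewrite etaE -lee_fin -(integral_is_derive (xm x) dW cchi).
  by apply: integral_ge0 => y _; rewrite lee_fin; have /andP[] := chi01 y.
have etas x : s <= x -> W b - W x = 0.
  move=> sx; apply/eqP; rewrite etaE -eqe -(integral_is_derive (xm x) dW cchi).
  rewrite integral0_eq// => y /=; rewrite in_itv/= => /andP[xy _].
  by rewrite chis// (le_trans sx).
have etae x : W b - W x <= e.
  rewrite etaE -lee_fin -(integral_is_derive (xm x) dW cchi).
  have mI : measurable_fun [set: R] (\1_(`]t, s[%classic : set R) : R -> R) by exact: measurable_indic.
  apply: (@le_trans _ _ (\int[lebesgue_measure]_(y in `[x, Num.max b x]) (\1_(`]t, s[%classic : set R) y)%:E)%E).
    apply: ge0_le_integral => //.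
    - by move=> y _; rewrite lee_fin; have /andP[] := chi01 y.
    - by apply: measurable_funTS; apply/measurable_EFinP; exact: continuous_measurable_fun.
    - by apply: measurable_funTS; exact/measurable_EFinP.
    - move=> y _; rewrite lee_fin indicE; case: (boolP (y \in _)) => [_|].
        by have /andP[] := chi01 y.
      rewrite notin_setE/= in_itv/= => /negP; rewrite negb_and -!leNgt => /orP[/chit ->|/chis ->] //.
  rewrite integral_indic//.
  apply: (@le_trans _ _ (lebesgue_measure (`]t, s[%classic : set R))).
    by apply: le_measure; rewrite ?inE; [exact: measurableI| |exact: subIsetl].
  by rewrite lebesgue_measure_itv/= lte_fin ts -EFinB lee_fin /s addrAC subrr add0r.
have [mu_ [g ug] _] := su.1; have wg := gradP ug.
have mG := weak_gradient_measurable wg.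
have mrw : measurable_fun B (ray_weight s).
  by apply: measurable_funTS; exact: measurable_ray_weight.
pose k (x : 'rV[R]_n) := n%:R * expR (tvar x) * chi (tvar x) : R.
have mk : measurable_fun [set: 'rV[R]_n] k.
  have mt := @measurable_tvar R n.
  apply: measurable_funM.
    by apply: measurable_funM => //; exact: measurableT_comp.
  by apply: measurableT_comp => //; exact: continuous_measurable_fun.
have kC x : `|k x| <= n%:R * expR s.
  rewrite /k; have /andP[c0 c1] := chi01 (tvar x).
  rewrite ger0_norm; last by apply: mulr_ge0 => //; rewrite mulr_ge0 ?expR_ge0 ?(ltW nR).
  rewrite -mulrA ler_pM2l//; case: (ltP (tvar x) s) => xs.
    by rewrite -[leRHS]mulr1 ler_pM ?expR_ge0// ler_expR ltW.
  by rewrite chis// mulr0 expR_ge0.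
set C2 := expR (s / n%:R) ^+ n.-1.
have C20 : 0 <= C2 by rewrite exprn_ge0// expR_ge0.
set I := (\int[mu]_(x in B) (enorm (grad B u x) * ray_weight s x)%:E)%E.
apply/lee_addgt0Pr => dd dd0.
(* The errors are n exp s times d for the function and e C2 times d for the gradient; d = dd / M
   makes their sum dd. *)
pose M := n%:R * expR s + e * C2.
have M0 : 0 < M by rewrite ltr_pwDl ?mulr_gt0 ?expR_gt0 ?mulr_ge0// ltW.
have [phi tphi [L1u L1g]] := sobolev0_approx su (divr_gt0 dd0 M0).
set d := dd / M in L1u L1g.
have d0 : 0 < d by rewrite divr_gt0.
have s1 := test_smoothk1 tphi.
have mphi : measurable_fun B phi.
  by apply: measurable_funTS; exact: continuous_measurable_rV (@smoothk_continuous _ _ _ phi s1).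
have wphi := smoothk1_weak_gradient s1.
have mgphi := weak_gradient_measurable wphi.
have mgd := weak_gradient_measurable (weak_gradientB wg wphi).
have fl := flux_identity hn sW dW t0 chit Wb tphi.
pose Q (x : 'rV[R]_n) := profile n (fun t => expR t * (W b - W t)) 0 (sqnorm x) : R.
have sQ : smoothk 0 Q by exact: (smoothk_flux_profile hn sW Wb 0).
have cQ : continuous (Q : 'rV[R]_n -> R^o) := @smoothk_continuous _ _ _ Q sQ.
have QE (x : 'rV[R]_n) : enorm x * `|Q x| <= e * ray_weight s x.
  have rw0 := ray_weight_ge0 s x.
  have [->|x0] := eqVneq x 0.
    rewrite (_ : enorm 0 = 0); last by apply/eqP; rewrite enorm_eq0.
    by rewrite mul0r mulr_ge0 ?(ltW e0)// ray_weight_ge0.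
  rewrite /Q profile_tvar// ger0_norm; last by rewrite mulr_ge0 ?expR_ge0.
  rewrite /ray_weight; case: (ltP (tvar x) s) => xs; last first.
    by rewrite etas// mulr0 mulr0 mul0r mulr0.
  rewrite mulrA mulrC mul1r; apply: ler_pM => //; first by rewrite mulr_ge0 ?enorm_ge0 ?expR_ge0.
  exact: enorm_mul_expR_tvar_le.
have L1phi : (L1 phi < +oo)%E.
  have l1 : loc_integrable B (fun=> 1 : R).
    by apply: loc_integrable_continuous; exact: cst_continuous.
  have [/integrableP[_ h] _] := test_loc_integrable_mul (Ordinal n0) l1 tphi.
  apply: le_lt_trans h; rewrite le_eqVlt; apply/orP; left; apply/eqP.
  by apply: eq_integral => x _; rewrite /= mul1r.
have iphik := integrable_L1_mul mphi L1phi (measurable_funTS mk) kC.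
have mup : measurable_fun B (fun x => u x - phi x) by exact: measurable_funB.
have L1up : (L1 (fun x => u x - phi x)%R < +oo)%E by apply: le_lt_trans L1u (ltry _).
have iupk := integrable_L1_mul mup L1up (measurable_funTS mk) kC.
have -> : (\int[mu]_(x in B) (u x * (n%:R * expR (tvar x) * chi (tvar x)))%:E =
    \int[mu]_(x in B) (phi x * k x)%:E + \int[mu]_(x in B) ((u x - phi x) * k x)%:E)%E.
  rewrite -integralD//; apply: eq_integral => x _; rewrite -EFinD; congr (_%:E).
  by rewrite /k; ring.
apply: le_trans (lee_abs_add _ _) _.
have hb := abse_integral_mul_le (mulr_ge0 (ltW nR) (expR_ge0 s)) mup (measurable_funTS mk)
  (fun x _ => kC x) L1u.
have mGrw : measurable_fun B (fun x => (enorm (grad B u x) * ray_weight s x)%:E).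
  by apply/measurable_EFinP; exact: measurable_funM.
have mgdE : measurable_fun B (fun x => `|enorm (grad B u x - gradient phi x)|%:E).
  by apply/measurable_EFinP; exact: measurableT_comp.
have ha : (`|\int[mu]_(x in B) (phi x * k x)%:E| <= e%:E * (I + (C2 * d)%:E))%E.
  rewrite fl.
  have mQ : measurable_fun B (fun x => (- ((\sum_i gradient phi x ord0 i * x ord0 i) * Q x))%:E).
    apply/measurable_EFinP; apply: measurableT_comp => //; apply: measurable_funM.
      apply: measurable_sum => i; apply: measurable_funM.
        by have [_ /(_ i)[[]]] := wphi.
      by apply: measurable_funTS; exact: measurable_rV_coord.
    apply: measurable_funTS; apply: continuous_measurable_rV.
    exact: cQ.
  apply: (le_trans (le_abse_integral mu mB mQ)).
  apply: (@le_trans _ _ (\int[mu]_(x in B) (e%:E * ((enorm (grad B u x) * ray_weight s x)%:E +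
      C2%:E * `|enorm (grad B u x - gradient phi x)|%:E)))%E).
    apply: ge0_le_integral => //.
    - exact: measurableT_comp.
    - apply: measurable_funeM; apply: emeasurable_funD => //; exact: measurable_funeM.
    - move=> x _; rewrite abse_EFin -EFinM lee_fin normrN normrM.
      apply: (@le_trans _ _ (enorm (gradient phi x) * (e * ray_weight s x))).
        apply: le_trans (ler_wpM2l (enorm_ge0 _) (QE x)).
        by rewrite mulrA ler_wpM2r// dot_le_enorm.
      rewrite mulrCA ler_pM2l// (ger0_norm (enorm_ge0 _)).
      have tri : enorm (gradient phi x) <= enorm (grad B u x) + enorm (grad B u x - gradient phi x).
        have := enormD_le (grad B u x) (- (grad B u x - gradient phi x)).
        by rewrite -[X in _ + enorm X]scaleN1r enormZ normrN1 mul1r opprB addrC subrK.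
      apply: le_trans (ler_wpM2r (ray_weight_ge0 s x) tri) _.
      rewrite mulrDl lerD2l mulrC ler_wpM2r ?enorm_ge0//; exact: ray_weight_le.
  have G0 x : B x -> (0 <= (enorm (grad B u x) * ray_weight s x)%:E)%E.
    by move=> _; rewrite lee_fin mulr_ge0 ?enorm_ge0 ?ray_weight_ge0.
  have g0 x : B x -> (0 <= C2%:E * `|enorm (grad B u x - gradient phi x)|%:E)%E.
    by move=> _; rewrite mule_ge0.
  rewrite ge0_integralZl_EFin//; last 3 first.
  - by move=> x Bx; rewrite adde_ge0 ?G0 ?g0.
  - by apply: emeasurable_funD => //; exact: measurable_funeM.
  - exact: ltW.
  apply: lee_wpmul2l; first by rewrite lee_fin ltW.
  rewrite ge0_integralD//; last exact: measurable_funeM.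
  rewrite -/I leeD2l//; rewrite ge0_integralZl_EFin// [leRHS]EFinM.
  by apply: lee_wpmul2l => //; rewrite lee_fin.
apply: le_trans (leeD ha hb) _.
have I0 : (0 <= I)%E.
  by apply: integral_ge0 => x _; rewrite lee_fin mulr_ge0 ?enorm_ge0 ?ray_weight_ge0.
have Cd0 : (0 <= (C2 * d)%:E)%E by rewrite lee_fin mulr_ge0// ltW.
rewrite ge0_muleDr//.
rewrite -addeA leeD2l// -EFinM -EFinD lee_fin.
have -> : dd = M * d by rewrite /d mulrC divfK// gt_eqF.
by rewrite le_eqVlt; apply/orP; left; apply/eqP; rewrite /M; ring.
Qed.

End flux_bound.

(** * The energy pair of a Sobolev function *)

Section signed_radial_integral.
Variables (R : realType) (n : nat).
Hypothesis n0 : (0 < n)%N.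
Notation mu := (@lebesgue_measure R).
Notation B := (unit_ball R n).
Notation V := (ball_vol R n).

Lemma integral_tvar (g : R -> R) : measurable_fun [set: R] g ->
  mu.-integrable `[0, +oo[ (fun t => (g t * expR (- t))%:E) ->
  (\int[@lebesgue_rV R n]_(x in B) (g (tvar x))%:E =
   V%:E * \int[mu]_(t in `[0%R, +oo[) (g t * expR (- t))%:E)%E.
Proof.
move=> mg ig.
have part (h : R -> R) : measurable_fun [set: R] h -> (forall t, 0 <= h t) ->
    (\int[@lebesgue_rV R n]_(x in B) (h (tvar x))%:E =
      V%:E * \int[mu]_(t in `[0%R, +oo[) (h t * expR (- t))%:E)%E.
  move=> mh h0; have mh' : measurable_fun [set: R] (EFin \o h) by exact/measurable_EFinP.
  exact: (ge0_integral_tvar n0 mh' h0).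
have mD : measurable (`[0, +oo[%classic : set (measurableTypeR R)) by exact: measurable_itv.
pose gp t := Num.max (g t) 0; pose gn t := Num.max (- g t) 0.
have mgp : measurable_fun [set: R] gp by exact: measurable_maxr.
have mgn : measurable_fun [set: R] gn.
  by apply: measurable_maxr => //; exact: measurableT_comp.
have pE : ((fun t => (g t * expR (- t))%:E)^\+ = (fun t => (gp t * expR (- t))%:E))%E.
  by apply/funext => t; rewrite funeposE -EFin_max /gp maxr_pMl ?expR_ge0// mul0r.
have nE : ((fun t => (g t * expR (- t))%:E)^\- = (fun t => (gn t * expR (- t))%:E))%E.
  by apply/funext => t; rewrite funenegE -EFinN -EFin_max /gn maxr_pMl ?expR_ge0// mul0r mulNr.
have fp : (\int[mu]_(t in `[0%R, +oo[) (gp t * expR (- t))%:E \is a fin_num)%E.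
  by have := integrable_fin_num mD (integrable_funepos mD ig); rewrite pE.
have fn : (\int[mu]_(t in `[0%R, +oo[) (gn t * expR (- t))%:E \is a fin_num)%E.
  by have := integrable_fin_num mD (integrable_funeneg mD ig); rewrite nE.
rewrite integralE [in RHS]integralE pE nE.
rewrite muleBr ?fin_num_adde_defl ?fin_numN//; congr (_ - _)%E.
  rewrite -part//; last by move=> t; rewrite le_max lexx orbT.
  by apply: eq_integral => x _; rewrite funeposE -EFin_max.
rewrite -part//; last by move=> t; rewrite le_max lexx orbT.
by apply: eq_integral => x _; rewrite funenegE -EFinN -EFin_max.
Qed.

End signed_radial_integral.

Section energy_pair_of_sobolev.
Variables (R : realType) (n : nat).
Hypothesis hn : (2 <= n)%N.
Notation mu := (@lebesgue_rV R n).
Notation B := (unit_ball R n).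
Notation V := (ball_vol R n).

Let n0 : (0 < n)%N. Proof. exact: ltnW. Qed.
Let nR : 0 < n%:R :> R. Proof. by rewrite ltr0n. Qed.
Let mB : measurable B. Proof. exact: measurable_unit_ball. Qed.
Let nE : n.-1.+1 = n. Proof. by case: n hn. Qed.
Let n1_gt0 : (0 < n.-1)%N. Proof. by case: n hn => [|[]]. Qed.
Let V0 : 0 < V. Proof. exact: ball_vol_gt0. Qed.

Variable u : 'rV[R]_n -> R.
Hypothesis su : sobolev0_rad u.
Hypothesis du : (dirichlet u <= 1)%E.

Let g (x : 'rV[R]_n) : R := enorm (grad B u x).

Let g0 x : 0 <= g x. Proof. exact: enorm_ge0. Qed.

Let mg : measurable_fun B g.
Proof.
have [[[_ [h hu] _] _] _] := su.
exact: weak_gradient_measurable (gradP hu).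
Qed.

Let om (s : R) : \bar R := (\int[mu]_(x in B) (g x * ray_weight s x)%:E)%E.
Let Psi (s : R) : \bar R := (\int[mu]_(x in B) (g x ^+ n * (tvar x < s)%R%:R)%:E)%E.

Let lt_ind (s : R) (x : 'rV[R]_n) : R := (tvar x < s)%R%:R.

Let mlt s : measurable_fun B (lt_ind s).
Proof.
apply: measurable_funTS.
have -> : lt_ind s = \1_(@tvar R n @^-1` `]-oo, s[) :> ('rV[R]_n -> R).
  apply/funext => x; rewrite indicE; congr (nat_of_bool _)%:R.
  by apply/idP/idP; rewrite inE/= in_itv.
by apply: measurable_indic; rewrite -[X in measurable X]setTI; exact: measurable_tvar.
Qed.

Let mrw s : measurable_fun B (ray_weight s : 'rV[R]_n -> R).
Proof. by apply: measurable_funTS; exact: measurable_ray_weight. Qed.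

Let Psi_ge0 s : (0 <= Psi s)%E.
Proof. by apply: integral_ge0 => x _; rewrite lee_fin mulr_ge0// exprn_ge0. Qed.

Let Psi_le1 s : (Psi s <= 1)%E.
Proof.
apply: le_trans du; apply: ge0_le_integral => //.
- by move=> x _; rewrite lee_fin mulr_ge0// exprn_ge0.
- apply/measurable_EFinP; apply: measurable_funM; last exact: mlt.
  exact: measurable_funX.
- by apply/measurable_EFinP; exact: measurable_funX.
- move=> x _; rewrite lee_fin ler_piMr ?exprn_ge0//.
  by case: (_ < _).
Qed.

Let Psi_fin s : Psi s \is a fin_num.
Proof. by rewrite ge0_fin_numE//; apply: le_lt_trans (Psi_le1 s) (ltry 1). Qed.

Let om_ge0 s : (0 <= om s)%E.
Proof. by apply: integral_ge0 => x _; rewrite lee_fin mulr_ge0// ray_weight_ge0. Qed.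

Let om0 s : s <= 0 -> om s = 0%E.
Proof.
move=> s0; apply: integral0_eq => x Bx; rewrite /ray_weight ltNge.
by rewrite (le_trans s0 (tvar_ge0 Bx)) /= mul0r mulr0.
Qed.

Let band (s t : R) (x : 'rV[R]_n) : R := lt_ind t x - lt_ind s x.

Let bandE s t x : s <= t -> band s t x = (s <= tvar x < t)%R%:R.
Proof.
move=> st; rewrite /band /lt_ind; case: (ltP (tvar x) s) => h /=.
  by rewrite (lt_le_trans h st) subrr.
by rewrite subr0.
Qed.

(** Hoelder's inequality on the shell s <= tvar < t, where the n-th power of exp (tvar / n)
    integrates to at most V (t - s). *)
Let increment s t : 0 <= s -> s < t -> exists2 I : R, (om t = om s + I%:E)%E &
  0 <= I /\ I ^+ n <= (fine (Psi t) - fine (Psi s)) * (V * (t - s)) ^+ n.-1.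
Proof.
move=> s0 st; have st' := ltW st.
pose E (x : 'rV[R]_n) := expR (tvar x / n%:R).
have E0 x : 0 <= E x by exact: expR_ge0.
have mE : measurable_fun B E.
  apply: measurable_funTS; apply: measurableT_comp => //; apply: measurable_funM => //.
  exact: measurable_tvar.
have b0 x : 0 <= band s t x by rewrite bandE.
have mb : measurable_fun B (band s t) by apply: measurable_funB; exact: mlt.
have bX k x : (0 < k)%N -> band s t x ^+ k = band s t x.
  by move=> k0; rewrite bandE//; case: (_ && _); rewrite ?expr1n// expr0n gtn_eqF.
have L0 : 0 < V * (t - s) by rewrite mulr_gt0// subr_gt0.
have [||||||I hI [I0 hIn]] := @power_mean _ _ R mu B n.-1 mB (fun x => g x * band s t x)
  (fun x => E x * band s t x) (fine (Psi t) - fine (Psi s)) (V * (t - s)) L0.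
- exact: measurable_funM.
- exact: measurable_funM.
- by move=> x _; rewrite mulr_ge0.
- by move=> x _; rewrite mulr_ge0.
- rewrite nE EFinB !fineK// leeBrDr// -ge0_integralD//; last 4 first.
  + by move=> x _; rewrite lee_fin exprn_ge0// mulr_ge0.
  + by apply/measurable_EFinP; apply: measurable_funX; exact: measurable_funM.
  + by move=> x _; rewrite lee_fin mulr_ge0// exprn_ge0.
  + by apply/measurable_EFinP; apply: measurable_funM; [exact: measurable_funX|exact: mlt].
  rewrite le_eqVlt; apply/orP; left; apply/eqP; apply: eq_integral => x _.
  by rewrite -EFinD; congr (_%:E); rewrite exprMn bX// /band /lt_ind; ring.
- rewrite nE.
  have -> : (\int[mu]_(x in B) ((E x * band s t x) ^+ n)%:E =
      \int[mu]_(x in B) (expR (tvar x) * (s <= tvar x < t)%R%:R)%:E)%E.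
    apply: eq_integral => x _; congr (_%:E); rewrite exprMn bX// bandE//; congr (_ * _).
    by rewrite /E -expRM_natl mulrC divfK// gt_eqF.
  have mI : measurable_fun [set: R] (\1_(`[s, t[%classic : set R) : R -> R) by exact: measurable_indic.
  have -> : (fun x : 'rV[R]_n => (expR (tvar x) * (s <= tvar x < t)%R%:R)%:E) =
      (fun x : 'rV[R]_n => (fun y : R => (expR y * \1_(`[s, t[%classic : set R) y)%:E) (tvar x)).
    apply/funext => x; rewrite indicE; congr (_ * (nat_of_bool _)%:R)%:E.
    by apply/idP/idP; rewrite inE/= in_itv.
  rewrite (ge0_integral_tvar n0 (g := fun y : R => (expR y * \1_(`[s, t[%classic : set R) y)%:E)); last 2 first.
  + by apply/measurable_EFinP; exact: measurable_funM.
  + by move=> y; rewrite lee_fin mulr_ge0// expR_ge0.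
  rewrite EFinM; apply: lee_wpmul2l; first by rewrite lee_fin ltW.
  rewrite (_ : integral _ _ _ = \int[lebesgue_measure]_(y in `[0%R, +oo[) (\1_(`[s, t[%classic : set R) y)%:E)%E; last first.
    by apply: eq_integral => y _; rewrite -EFinM mulrAC -expRD subrr expR0 mul1r.
  rewrite integral_indic//.
  apply: (@le_trans _ _ (lebesgue_measure (`[s, t[%classic : set R))).
    by apply: le_measure; rewrite ?inE; [exact: measurableI| |exact: subIsetl].
  by rewrite (lebesgue_measure_itvco st').
exists I; last by rewrite nE in hIn.
rewrite -hI -ge0_integralD//; last 4 first.
- by move=> x _; rewrite lee_fin mulr_ge0// ray_weight_ge0.
- by apply/measurable_EFinP; exact: measurable_funM.
- by move=> x _; rewrite lee_fin !mulr_ge0 ?exprn_ge0// mulr_ge0.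
- by apply/measurable_EFinP; apply: measurable_funM; [exact: measurable_funM|apply: measurable_funX; exact: measurable_funM].
apply: eq_integral => x _; rewrite -EFinD; congr (_%:E).
rewrite exprMn bX// -[in LHS](subrK (ray_weight s x) (ray_weight t x)).
have -> : ray_weight t x - ray_weight s x = band s t x * E x ^+ n.-1.
  by rewrite /ray_weight /band /lt_ind /E mulrBl.
have bb : band s t x * band s t x = band s t x by rewrite -expr2 bX.
by rewrite -[in LHS]bb; ring.
Qed.

Let om_fin s : om s \is a fin_num.
Proof.
case: (leP s 0) => s0; first by rewrite om0.
have [I -> _] := increment (lexx 0) s0.
by rewrite om0// add0e.
Qed.

(** Up to normalisation, the variation of u along a ray from the boundary to the sphere tvar = s. It
    is nondecreasing and dominates |u| whatever the sign and the oscillations of u, under the same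
    bound on the energy. *)
Let w s := mtc R n / (n%:R * V) * fine (om s).
Let Phi s := fine (Psi s).

Let c0 : 0 < mtc R n / (n%:R * V).
Proof. by rewrite divr_gt0 ?mtc_gt0// mulr_gt0. Qed.

Lemma sobolev_energy_pair : energy_pair n 1 w Phi.
Proof.
split.
- by rewrite /w om0// mulr0.
- move=> s t st; rewrite /w ler_pM2l//; apply: fine_le => //.
  apply: ge0_le_integral => //.
  + by move=> x _; rewrite lee_fin mulr_ge0// ray_weight_ge0.
  + by apply/measurable_EFinP; exact: measurable_funM.
  + by apply/measurable_EFinP; exact: measurable_funM.
  + move=> x _; rewrite lee_fin ler_wpM2l// /ray_weight ler_wpM2r ?exprn_ge0 ?expR_ge0//.
    case: (ltP (tvar x) s) => h; last by [].
    by rewrite (lt_le_trans h st).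
- move=> s t s0; rewrite le_eqVlt => /orP[/eqP <-|st].
    by rewrite !subrr expr0n gtn_eqF//= mul0r.
  have [I hI [I0 hIn]] := increment s0 st.
  have -> : w t - w s = mtc R n / (n%:R * V) * I.
    by rewrite /w -mulrBr hI fineD// addrAC subrr add0r.
  rewrite exprMn expr_div_n mtc_pow//.
  have -> : n%:R ^+ n * V / (n%:R * V) ^+ n = (V ^+ n.-1)^-1.
    have -> : (n%:R * V) ^+ n = n%:R ^+ n * (V ^+ n.-1 * V) by rewrite -exprSr nE exprMn.
    by field; rewrite !expf_neq0 ?gt_eqF.
  rewrite mulrC ler_pdivrMr ?exprn_gt0//; apply: le_trans hIn _.
  by rewrite exprMn /Phi [V ^+ _ * _]mulrC mulrA.
- move=> t _; rewrite /Phi -!lee_fin fineK// Psi_ge0 Psi_le1//.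
Qed.

Let u_measurable : measurable_fun B u. Proof. by have [[[? _ _] _] _] := su. Qed.

Let L1u : (L1 u < +oo)%E.
Proof.
apply: (L1_fin n0) => //; have [[[_ _ h] _] _] := su.
move: h; rewrite sobolev_normE => /lty_poweRy h.
apply: le_lt_trans (h _); first by rewrite leeDl// dirichlet_ge0.
by rewrite invr_eq0 gt_eqF.
Qed.

Let dominated_by (v h : R -> R) (C : R) : measurable_fun [set: R] v ->
  (\int[lebesgue_measure]_(t in `[0%R, +oo[) (`|v t| * expR (- t))%:E < +oo)%E ->
  measurable_fun [set: R] h -> 0 <= C ->
  (forall t, 0 <= t -> `|h t| <= C * (`|v t| * expR (- t))) ->
  lebesgue_measure.-integrable `[0, +oo[ (EFin \o h).
Proof.
move=> mv vfin mh C0 hC.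
have mh' : measurable_fun (`[0, +oo[%classic : set R) (EFin \o h).
  by apply: measurable_funTS; exact/measurable_EFinP.
have mve : measurable_fun (`[0, +oo[%classic : set R) (fun y => (`|v y| * expR (- y))%:E).
  apply: measurable_funTS; apply/measurable_EFinP; apply: measurable_funM; first exact: measurableT_comp.
  by apply/measurable_EFinP; exact: measurable_expRN.
apply/integrableP; split => //.
apply: (@le_lt_trans _ _ (\int[lebesgue_measure]_(y in `[0%R, +oo[)
    (C%:E * (`|v y| * expR (- y))%:E))%E).
  apply: ge0_le_integral => //.
  - exact: measurableT_comp.
  - exact: measurable_funeM.
  - by move=> y; rewrite /= in_itv/= andbT => y0; rewrite -EFinM lee_fin hC.
by rewrite ge0_integralZl_EFin// lte_mul_pinfty.
Qed.

(* Letting the bumps [ibump t (t + e) j] increase to the indicator function of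
   the interval ]t, t + e[ in [flux_bound]. *)
Let average_le (v : R -> R) : measurable_fun [set: R] v ->
  {ae mu, forall x, B x -> u x = v (tvar x)} ->
  (\int[lebesgue_measure]_(t in `[0%R, +oo[) (`|v t| * expR (- t))%:E < +oo)%E ->
  forall t e : R, 0 < t -> 0 < e ->
  (`|\int[lebesgue_measure]_(y in `]t, (t + e)%R[) (v y)%:E| <=
    (e * (w (t + e) / mtc R n))%:E)%E.
Proof.
move=> mv uv vfin t e t0 e0; set s := t + e.
have ts : t < s by rewrite ltrDl.
have mD : measurable (`[0, +oo[%classic : set (measurableTypeR R)) by exact: measurable_itv.
pose k j y := n%:R * expR y * ibump t s j y : R.
have ck j : continuous (ibump t s j).
  by move=> y; apply: smooth1_continuous (smooth1_ibump 0 t s j) _.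
have mi j : measurable_fun [set: R] (ibump t s j) by exact: continuous_measurable_fun.
have mk j : measurable_fun [set: R] (k j).
  by apply: measurable_funM => //; exact: measurable_funM.
have expE y : expR y * expR (- y) = 1 :> R by rewrite -expRD subrr expR0.
have mexp : measurable_fun [set: R] (fun y : R => expR (- y)).
  by apply/measurable_EFinP; exact: measurable_expRN.
have ib_le j y : `|ibump t s j y| <= expR s * expR (- y).
  have /andP[i0 i1] := ibump_itv t s j y; rewrite ger0_norm//.
  case: (ltP y s) => ys; last by rewrite ibump_eq0 ?mulr_ge0 ?expR_ge0//; right.
  by apply: (le_trans i1); rewrite -expRD -expR0 ler_expR subr_ge0 ltW.
have ivb j : lebesgue_measure.-integrable `[0, +oo[ (EFin \o (fun y => v y * ibump t s j y)).
  apply: (dominated_by (C := expR s) mv vfin) => //; first exact: measurable_funM.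
  by move=> y _; rewrite (normrM (v y)) [leRHS]mulrCA ler_wpM2l.
have vkE j y : v y * k j y * expR (- y) = n%:R * (v y * ibump t s j y).
  have -> : v y * k j y * expR (- y) = n%:R * (v y * ibump t s j y) * (expR y * expR (- y)).
    by rewrite /k; ring.
  by rewrite expE mulr1.
have ivk j : lebesgue_measure.-integrable `[0, +oo[ (fun y => (v y * k j y * expR (- y))%:E).
  have -> : (fun y => (v y * k j y * expR (- y))%:E) =
      (fun y => (n%:R%:E * (v y * ibump t s j y)%:E)%E).
    by apply/funext => y; rewrite vkE.
  exact: (integrableZl mD _ (ivb j)).
have bnd j : (`|\int[lebesgue_measure]_(y in `[0%R, +oo[) (v y * ibump t s j y)%:E| <=
    (e * (w s / mtc R n))%:E)%E.
  have := flux_bound hn j su.1 t0 e0.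
  have -> : (\int[mu]_(x in B) (u x * (n%:R * expR (tvar x) * ibump t (t + e) j (tvar x)))%:E =
      \int[mu]_(x in B) (v (tvar x) * k j (tvar x))%:E)%E.
    have mt := @measurable_tvar R n.
    apply: ae_eq_integral => //.
    - apply/measurable_EFinP; apply: measurable_funM => //; apply: measurable_funTS.
      exact: measurableT_comp (mk j) mt.
    - apply/measurable_EFinP; apply: measurable_funTS.
      by apply: measurable_funM; [exact: measurableT_comp|exact: measurableT_comp (mk j) mt].
    - by move: uv; apply: filterS => x h Bx; rewrite h.
  rewrite (@integral_tvar R n n0 (fun y => v y * k j y))//; last exact: measurable_funM.
  have -> : (\int[lebesgue_measure]_(y in `[0%R, +oo[) (v y * k j y * expR (- y))%:E =
      n%:R%:E * \int[lebesgue_measure]_(y in `[0%R, +oo[) (v y * ibump t s j y)%:E)%E.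
    transitivity (\int[lebesgue_measure]_(y in `[0%R, +oo[) (n%:R%:E * (v y * ibump t s j y)%:E))%E.
      by apply: eq_integral => y _; rewrite vkE.
    exact: (integralZl mD (ivb j)).
  have VE : (0 <= V%:E)%E by rewrite lee_fin ltW.
  have nRE : (0 <= n%:R%:E :> \bar R)%E by rewrite lee_fin ltW.
  rewrite abseM abseM (gee0_abs VE) (gee0_abs nRE).
  have -> : (\int[mu]_(x in B) (enorm (grad B u x) * ray_weight (t + e) x)%:E)%E = (fine (om s))%:E.
    by rewrite (fineK (om_fin s)).
  rewrite muleA -!EFinM => h.
  have Vn0 : (0 < (V * n%:R)%:E)%E by rewrite lte_fin mulr_gt0.
  have Vnf : (V * n%:R)%:E \is a fin_num by [].
  rewrite -(lee_pmul2l Vnf Vn0); apply: (le_trans h).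
  rewrite -EFinM lee_fin /w le_eqVlt; apply/orP; left; apply/eqP; field.
  by rewrite !gt_eqF// mtc_gt0.
have [|||||_ _ lim] := @dominated_convergence _ _ _ (@lebesgue_measure R) _ mD
    (fun j y => (v y * ibump t s j y)%:E) (fun y => (v y * \1_(`]t, s[%classic : set R) y)%:E)
    (fun y => (expR s * (`|v y| * expR (- y)))%:E).
- by move=> i; apply: measurable_funTS; apply/measurable_EFinP; exact: (measurable_funM mv (mi i)).
- have mI : measurable_fun [set: R] (\1_(`]t, s[%classic : set R) : R -> R) by exact: measurable_indic.
  by apply: measurable_funTS; apply/measurable_EFinP; exact: (measurable_funM mv mI).
- apply: aeW => y _; apply: cvg_EFin; first exact: nearW.
  by apply: cvgM; [exact: cvg_cst|exact: ibump_cvg].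
- apply: (dominated_by (C := expR s) mv vfin) => //; first last.
  + by move=> y _; rewrite ger0_norm.
  + apply: measurable_funM => //; apply: measurable_funM => //.
    exact: measurableT_comp.
- apply: aeW => y i _; rewrite abse_EFin lee_fin (normrM (v y)) [leRHS]mulrCA.
  by rewrite ler_wpM2l.
have -> : (\int[lebesgue_measure]_(y in `]t, s[) (v y)%:E =
    \int[lebesgue_measure]_(y in `[0%R, +oo[) (v y * \1_(`]t, s[%classic : set R) y)%:E)%E.
  rewrite integral_mkcond [RHS]integral_mkcond; apply: eq_integral => y _.
  rewrite !patchE indicE; case: (boolP (y \in `]t, s[%classic)) => yI.
    rewrite mulr1 ifT// inE/= in_itv/= andbT; move: yI; rewrite inE/= in_itv/= => /andP[ty _].
    by rewrite ltW// (lt_trans t0).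
  by rewrite mulr0; case: ifP.
have lim' : (`|\int[lebesgue_measure]_(y in `[0%R, +oo[) (v y * ibump t s j y)%:E|)%E @[j --> \oo] -->
    (`|\int[lebesgue_measure]_(y in `[0%R, +oo[) (v y * \1_(`]t, s[%classic : set R) y)%:E|)%E.
  exact: cvg_abse lim.
rewrite -(cvg_lim _ lim')//; apply: lime_le; first by apply/cvg_ex; eexists; exact: lim'.
by apply: nearW => j; exact: bnd.
Qed.

(** Lebesgue differentiation of [average_le]: the averages of v over shrinking intervals to the
    right of t tend to v t for almost every t, while w (t + e) exceeds w t by an amount that
    Hoelder's inequality makes small. *)
Lemma sobolev_le_energy_pair :
  {ae mu, forall x, B x -> mtc R n * `|u x| <= w (tvar x)}.
Proof.
have [v mv uv] := radial_rep n0 u_measurable su.2.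
have vfin : (\int[lebesgue_measure]_(t in `[0%R, +oo[) (`|v t| * expR (- t))%:E < +oo)%E.
  have : (L1 u = V%:E * \int[lebesgue_measure]_(t in `[0%R, +oo[) (`|v t| * expR (- t))%:E)%E.
    have mv' : measurable_fun [set: R] (fun t => `|v t|%:E).
      by apply/measurable_EFinP; exact: measurableT_comp.
    have v0 t : (0 <= `|v t|%:E)%E by [].
    apply: etrans (ge0_integral_tvar n0 mv' v0).
    apply: ae_eq_integral => //.
    - by apply/measurable_EFinP; exact: measurableT_comp.
    - by apply: measurable_funTS; apply: measurableT_comp mv' _; exact: measurable_tvar.
    - by move: uv; apply: filterS => x h Bx; rewrite h.
  move: L1u => /[swap] -> h; apply: contraTT h; rewrite -!leNgt !leye_eq => /eqP ->.
  by rewrite gt0_muley ?lte_fin.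
have avg := average_le mv uv vfin.
have c0' : 0 < mtc R n by exact: mtc_gt0.
have key (M : nat) : {ae (@lebesgue_measure R), forall t : R, 0 < t < M%:R ->
    mtc R n * `|v t| <= w t}.
  (* The truncation makes v integrable on the line, as the differentiation theorem asks; M + 1
     leaves room for difference quotients at points below M. *)
  pose vM (t : R) := v t * \1_(`[0, M.+1%:R]%classic : set R) t.
  have mvM : measurable_fun [set: R] vM by apply: measurable_funM => //; exact: measurable_indic.
  have ivM : lebesgue_measure.-integrable setT (EFin \o vM).
    have mD : measurable (`[0, +oo[%classic : set (measurableTypeR R)) by exact: measurable_itv.
    have i1 : lebesgue_measure.-integrable (`[0, +oo[%classic : set R) (EFin \o vM).
      apply: (dominated_by (C := expR M.+1%:R) mv vfin mvM) => [|t t0]; first exact: expR_ge0.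
      rewrite /vM normrM [leRHS]mulrCA ler_wpM2l// indicE -expRD.
      case: (boolP (t \in _)); last by rewrite normr0 expR_ge0.
      rewrite inE/= in_itv/= => /andP[_ tM].
      by rewrite [leLHS](_ : _ = expR 0) ?ler_expR ?subr_ge0// expR0 normr1.
    have := iffLR (integrable_mkcond _ mD) i1.
    rewrite (_ : _ \_ _ = EFin \o vM)//; apply/funext => t; rewrite patchE /= /vM indicE.
    case: ifPn => // /negP t0; rewrite memNset ?mulr0//= in_itv/= => /andP[h _].
    by apply: t0; rewrite inE/= in_itv/= h.
  have gl : locally_integrable setT vM.
    by apply: open_integrable_locally; [exact: openT|exact: ivM].
  have gi y : lebesgue_measure.-integrable [set` Interval (BLeft (0 : R)) (BRight y)] (EFin \o vM).
    exact: integrableS ivM.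
  have := FTC1 gi gl; apply: filterS; first exact: (ae_filter_ringOfSetsType (@lebesgue_measure R)).
  move=> x hx /andP[x0 xM].
  have [|dF FE] := hx _; first by rewrite lte_fin.
  pose F (y : R) := \int[lebesgue_measure]_(t in [set` Interval (BLeft (0 : R)) (BRight y)]) vM t.
  have dF' : is_derive x 1 F (vM x) by rewrite -FE derive1E; exact: derivableP.
  have vMx : vM x = v x.
    by rewrite /vM indicE mem_set ?mulr1//= in_itv/= (ltW x0) (le_trans (ltW xM))// ler_nat.
  have lim : `|dquot F k x| @[k --> \oo] --> `|v x|.
    by rewrite -vMx; exact: cvg_norm (dquot_cvg dF').
  rewrite mulrC -ler_pdivlMr//; apply/ler_addgt0Pr => d d0.
  have md0 : 0 < mtc R n * d by rewrite mulr_gt0.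
  rewrite -(cvg_lim _ lim)//; apply: limr_le; first by apply/cvg_ex; exists `|v x|.
  (* Steps below this threshold keep the increment of w at most mtc d, by [energy_pair_incr] with
     energy 1. *)
  have small0 : 0 < Num.min 1 ((mtc R n * d) ^+ n) by rewrite lt_min ltr01 exprn_gt0.
  near=> j.
  have j0 : 0 < j.+1%:R^-1 :> R by [].
  have jd : j.+1%:R^-1 < Num.min 1 ((mtc R n * d) ^+ n).
    by near: j; exact: near_infty_natSinv_lt (PosNum small0).
  have incr : w (x + j.+1%:R^-1) - w x <= mtc R n * d.
    apply: (energy_pair_incr hn sobolev_energy_pair) => //; rewrite ?(ltW md0) ?(ltW x0)//.
    move: jd; rewrite lt_min => /andP[j1 jd]; rewrite mul1r.
    apply: le_trans (ltW jd); rewrite -[leRHS]expr1 ler_wiXn2l ?(ltW j1)//.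
  apply: (@le_trans _ _ (w (x + j.+1%:R^-1) / mtc R n)); last first.
    by rewrite ler_pdivrMr// mulrDl divfK ?gt_eqF// -lerBlDl [d * _]mulrC.
  rewrite /dquot normrM ger0_norm// -ler_pdivlMl//.
  have xj : x + j.+1%:R^-1 <= M.+1%:R.
    rewrite -(natr1 M) lerD ?(ltW xM)//; move: jd; rewrite lt_min => /andP[/ltW].
    by [].
  have -> : F (x + j.+1%:R^-1) - F x = fine (\int[lebesgue_measure]_(y in `]x, (x + j.+1%:R^-1)%R[) (v y)%:E)%E.
    rewrite /F (@Rintegral_itvB _ vM (BLeft 0) (BRight (x + j.+1%:R^-1)) x)//; last 2 first.
    - by rewrite bnd_simp ltW.
    - by rewrite bnd_simp lerDl.
    rewrite -Rintegral_itv_bndo_bndc; last exact: integrableS ivM.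
    congr fine; apply: eq_integral => y; rewrite inE/= in_itv/= => /andP[xy yx].
    rewrite /vM indicE mem_set ?mulr1//= in_itv/= (ltW (lt_trans x0 xy))/=.
    by rewrite (le_trans (ltW yx)).
  have := avg x _ x0 j0; case: (integral _ _ _) => [r| |] //=.
have [Z [mZ Z0 hZ]] := ae_foralln key.
have ms0 : measurable [set 0 : 'rV[R]_n] by exact: compact_measurable_rV (@compact_set1 _ _).
have mBZ : measurable (B `&` @tvar R n @^-1` Z).
  apply: measurableI => //; rewrite -[X in measurable X]setTI.
  exact: measurable_tvar.
have h1 : {ae mu, forall x : 'rV[R]_n, x != 0}.
  exists [set 0]; split => //; first exact: lebesgue_rV_set0.
  by move=> x /= /negP; rewrite negbK => /eqP.
have h2 : {ae mu, forall x : 'rV[R]_n, ~ (B `&` @tvar R n @^-1` Z) x}.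
  exists (B `&` @tvar R n @^-1` Z); split => //; first exact: null_tvar.
  by move=> x /=; exact: contrapT.
move: uv h1 h2; apply: filterS3 => x ux x0 nZ Bx; rewrite ux//.
have T0 : 0 < tvar x by rewrite tvar_gtE// oppr0 mul0r expR0.
have hx : forall M : nat, 0 < tvar x < M%:R -> mtc R n * `|v (tvar x)| <= w (tvar x).
  by apply: contrapT => h; apply: nZ; split => //; exact: hZ.
by apply: (hx (Num.truncn (tvar x)).+1); rewrite T0 truncnS_gt.
Unshelve. all: by end_near. Qed.

End energy_pair_of_sobolev.

(** * Concentration *)

(** Powers of ln a are o(a): with y = ln a, y^(k+1) / (k+1)! is at most exp y, and one factor y
    absorbs the constants once y >= y0. *)
Lemma pow_ln_le (R : realType) (C d : R) (k : nat) : 0 <= C -> 0 < d ->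
  exists2 A : R, 1 <= A & forall a, A <= a -> (C * ln a) ^+ k <= d * a.
Proof.
move=> C0 d0; pose y0 : R := C ^+ k * (k.+1)`!%:R / d.
have y00 : 0 <= y0 by rewrite divr_ge0 ?(ltW d0)// mulr_ge0// exprn_ge0.
exists (expR y0) => [|a aA]; first by rewrite -expR0 ler_expR.
have a0 : 0 < a by apply: lt_le_trans aA; exact: expR_gt0.
set y := ln a; have yy : y0 <= y by rewrite -[y0]expRK ler_ln ?posrE ?expR_gt0.
have y_ge0 : 0 <= y := le_trans y00 yy.
rewrite -[in leRHS](@lnK _ a)// -/y exprMn.
have f0 : 0 < (k.+1)`!%:R :> R by rewrite ltr0n fact_gt0.
have h : y ^+ k.+1 <= (k.+1)`!%:R * expR y.
  rewrite -ler_pdivrMl// [leLHS]mulrC; apply: le_trans (expR_ge1Dxn k y_ge0).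
  by rewrite lerDr.
rewrite -(ler_pM2l f0); apply: (@le_trans _ _ (d * y ^+ k.+1)).
  rewrite exprS [d * _]mulrA [leLHS]mulrA ler_wpM2r ?exprn_ge0//.
  have yd : C ^+ k * (k.+1)`!%:R <= y * d by rewrite -ler_pdivrMr.
  by rewrite [leLHS]mulrC [leRHS]mulrC.
by rewrite [leRHS]mulrCA ler_pM2l.
Qed.

Lemma expr1D_le (R : realDomainType) (m : nat) (y : R) : 0 <= y <= 1 ->
  (1 + y) ^+ m <= 1 + (2 ^+ m - 1) * y.
Proof.
move=> /andP[y0 y1]; elim: m => [|m IH]; first by rewrite !expr0 subrr mul0r addr0.
rewrite !exprS; apply: le_trans (ler_wpM2l _ IH) _; first by rewrite addr_ge0.
have p0 : 0 <= 2 ^+ m - 1 :> R by rewrite subr_ge0 exprn_ege1// ler1n.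
rewrite -subr_ge0.
have -> : 1 + (2 * 2 ^+ m - 1) * y - (1 + y) * (1 + (2 ^+ m - 1) * y) =
    (2 ^+ m - 1) * (y * (1 - y)) by ring.
by rewrite !mulr_ge0// subr_ge0.
Qed.

Lemma expr1B_ge (R : realDomainType) (m : nat) (x : R) : 0 <= x <= 1 ->
  1 - m%:R * x <= (1 - x) ^+ m.
Proof.
move=> /andP[x0 x1]; elim: m => [|m IH]; first by rewrite mul0r subr0.
rewrite exprS; apply: (@le_trans _ _ ((1 - x) * (1 - m%:R * x))).
  rewrite -subr_ge0 -natr1.
  have -> : (1 - x) * (1 - m%:R * x) - (1 - (m%:R + 1) * x) = m%:R * (x * x) by ring.
  by rewrite !mulr_ge0.
by rewrite ler_wpM2l// subr_ge0.
Qed.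

Lemma exprD_ge (R : realDomainType) (m : nat) (e f : R) : 0 <= e -> 0 <= f ->
  e ^+ m.+1 + f ^+ m.+1 <= (e + f) ^+ m.+1.
Proof.
move=> e0 f0; have ef := addr_ge0 e0 f0.
rewrite !exprS mulrDl lerD// ler_wpM2l// lerXn2r ?nnegrE//.
  by rewrite lerDl.
by rewrite lerDr.
Qed.

Section roots.
Variables (R : realType) (n : nat).
Hypothesis hn : (2 <= n)%N.

Let n1_gt0 : (0 < n.-1)%N. Proof. by case: n hn => [|[]]. Qed.
Let nE : n.-1.+1 = n. Proof. by case: n hn. Qed.
Let n1R : 0 < n.-1%:R :> R. Proof. by rewrite ltr0n. Qed.

(** The critical power of y is the n-th power of this root, and also y times the root; real
    exponents are thereby reduced to integer powers. *)
Definition nroot (y : R) : R := y `^ n.-1%:R^-1.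

Lemma nroot_ge0 y : 0 <= nroot y. Proof. exact: powR_ge0. Qed.

Lemma nrootK y : 0 <= y -> nroot y ^+ n.-1 = y.
Proof.
by move=> y0; rewrite -powR_mulrn ?powR_ge0// -powRrM mulVf ?gt_eqF// powRr1.
Qed.

Lemma nroot_le x y : 0 <= x -> 0 <= y -> y <= x ^+ n.-1 -> nroot y <= x.
Proof.
move=> x0 y0 xy; rewrite leNgt; apply/negP => h; move: xy; apply/negP; rewrite -ltNge.
by rewrite -[ltRHS]nrootK// ltrXn2r -?lt0n.
Qed.

Lemma powR_mexpE y : 0 <= y -> y `^ mexp R n = nroot y ^+ n.
Proof.
move=> y0; rewrite -[RHS]powR_mulrn ?nroot_ge0// -powRrM /mexp mulrC.
by [].
Qed.

Lemma powR_mexp_le x y : 0 <= x -> 0 <= y -> y ^+ n <= x ^+ n.-1 -> y `^ mexp R n <= x.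
Proof.
move=> x0 y0 h; rewrite -(@ler_pXn2r _ n.-1) ?nnegrE ?powR_ge0//.
by rewrite powR_mexpE// -exprM mulnC exprM nrootK.
Qed.

Lemma powR_mexp_pow y : 0 <= y -> (y `^ mexp R n) ^+ n.-1 = y ^+ n.
Proof. by move=> y0; rewrite powR_mexpE// -exprM mulnC exprM nrootK. Qed.

(** Let d be the root of b + p, so that the left side is b d + p d. The first term is bounded
    through the tangent of the concave root at b, the second through subadditivity of the root. The
    linear term then has the exact slope of the critical power at b, and only the power of p is
    lost. *)
Lemma powR_mexpD_le (b p : R) : 0 <= b -> 0 <= p ->
  (b + p) `^ mexp R n <= b `^ mexp R n + mexp R n * nroot b * p + p `^ mexp R n.
Proof.
move=> b0 p0; have bp0 := addr_ge0 b0 p0.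
have pE x : 0 <= x -> x `^ mexp R n = x * nroot x.
  by move=> x0; rewrite powR_mexpE// -[in LHS]nE exprSr nrootK.
rewrite !pE//.
set d := nroot (b + p); set e := nroot b; set f := nroot p.
have d0 : 0 <= d by exact: nroot_ge0.
have e0 : 0 <= e by exact: nroot_ge0.
have f0 : 0 <= f by exact: nroot_ge0.
have def : d <= e + f.
  apply: nroot_le => //; first exact: addr_ge0.
  rewrite -[leLHS](congr2 +%R (nrootK b0) (nrootK p0)) -/e -/f.
  by rewrite -(prednK n1_gt0) exprD_ge.
have bd : b * d <= b * e + e * p / n.-1%:R.
  have := tangent_pow n.-2 d0 e0.
  have -> : n.-2.+1 = n.-1 by rewrite prednK.
  have mE : n.-2%:R = n.-1%:R - 1 :> R by rewrite -(prednK n1_gt0) /= -natr1 addrK.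
  rewrite !nrootK// mE => h.
  rewrite -(ler_pM2l n1R).
  have -> : n.-1%:R * (b * d) = e * (n.-1%:R * e ^+ n.-2 * d).
    by rewrite -[in LHS](nrootK b0) -/e -(prednK n1_gt0) exprS /=; ring.
  apply: le_trans (ler_wpM2l e0 h) _.
  rewrite le_eqVlt; apply/orP; left; apply/eqP; field.
  by rewrite gt_eqF.
have pd : p * d <= p * (e + f) by rewrite ler_wpM2l.
rewrite mulrDl; apply: le_trans (lerD bd pd) _.
rewrite le_eqVlt; apply/orP; left; apply/eqP; rewrite /mexp.
have -> : n%:R = n.-1%:R + 1 :> R by rewrite natr1 nE.
by field; rewrite gt_eqF.
Qed.

End roots.

Section concentration.
Variables (R : realType) (n : nat).
Hypothesis hn : (2 <= n)%N.
Notation mu := (@lebesgue_measure R).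

Let n1_gt0 : (0 < n.-1)%N. Proof. by case: n hn => [|[]]. Qed.
Let nE : n.-1.+1 = n. Proof. by case: n hn. Qed.
Let n1R : 0 < n.-1%:R :> R. Proof. by rewrite ltr0n. Qed.

Lemma energy_pair_ge0 E w Phi (t : R) : energy_pair n E w Phi -> 0 <= t -> 0 <= w t.
Proof. by move=> [w0 wnd _ _] t0; rewrite -w0 wnd. Qed.

Lemma energy_pair_pow_le w Phi (t : R) : energy_pair n 1 w Phi -> 0 <= t ->
  w t ^+ n <= Phi t * t ^+ n.-1 /\ w t ^+ n <= t ^+ n.-1.
Proof.
move=> [w0 wnd wP PE] t0; have := wP 0 t (lexx 0) t0; rewrite w0 !subr0.
have /andP[P00 _] := PE 0 (lexx 0); have /andP[_ Pt1] := PE t t0 => h.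
have h1 : w t ^+ n <= Phi t * t ^+ n.-1.
  by apply: le_trans h _; rewrite ler_wpM2r ?exprn_ge0// gerBl.
by split => //; apply: le_trans h1 _; rewrite ler_piMl ?exprn_ge0.
Qed.

Let choose_rate (C e : R) : 0 < e -> exists2 d : R, 0 < d <= 2^-1 &
  (1 - d)^-1 * expR (harm R n + C * d) <= expR (harm R n) + e.
Proof.
move=> e0; pose f (d : R) := (1 - d)^-1 * expR (harm R n + C * d).
have cf : f d @[d --> (0 : R)] --> f 0.
  apply: cvgM.
    apply: cvgV; first by rewrite subr0 oner_neq0.
    by apply: cvgB; [exact: cvg_cst|exact: cvg_id].
  apply: (@cvg_comp _ _ _ (fun d : R => harm R n + C * d) expR); last exact: continuous_expR.
  by apply: cvgD; [exact: cvg_cst|apply: cvgM; [exact: cvg_cst|exact: cvg_id]].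
have f0 : f 0 = expR (harm R n) by rewrite /f subr0 invr1 mul1r mulr0 addr0.
have : \forall d \near (0 : R)^'+, `|f 0 - f d| < e.
  have := cvg_at_right_filter cf.
  by move=> /cvgrPdist_lt; exact.
move=> nf; near (0 : R)^'+ => d; exists d.
  by apply/andP; split => //; near: d; apply: nbhs_right_le; rewrite invr_gt0.
have : `|f 0 - f d| < e by near: d.
by rewrite ltr_distlC -f0 => /andP[_ /ltW].
Unshelve. all: by end_near. Qed.

(** Here E is the energy left after a, b the value at a, and k = E^(1/(n-1)). In the exponent, Y - a
    <= - a E / (n-1) by Bernoulli's inequality, where Y is the critical power of b, while the energy
    term is Y E / (n-1) divided by (1 - k)^(n-1): the two cancel up to C a E k. Being within 2 ln a
    of the critical line forces a E = O(ln a), so k and a E k are small. *)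
Lemma tail_const (e : R) : 0 < e -> exists2 A : R, 1 <= A &
  forall a E b : R, A <= a -> 0 <= E <= 1 -> 0 <= b ->
  b ^+ n <= (1 - E) * a ^+ n.-1 -> a - 2 * ln a <= b `^ mexp R n ->
  nroot n E < 1 /\
  expR (b `^ mexp R n - a) * ((1 - nroot n E)^-1 *
    expR (harm R n + lcst R n * ((mexp R n * nroot n b) ^+ n * E) / (1 - nroot n E) ^+ n.-1)) <=
  expR (harm R n) + e.
Proof.
(* C comes from 1 / (1 - k) <= 1 + 2 k, valid for k <= 1/2, followed by the chord bound [expr1D_le]
   at y = 2 k. *)
move=> e0; pose C : R := 2 * (2 ^+ n.-1 - 1) / n.-1%:R.
have [d /andP[d0 d2] hd] := choose_rate C e0.
have C0 : 0 <= C.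
  by rewrite divr_ge0// mulr_ge0// subr_ge0 exprn_ege1// ler1n.
have dm0 : 0 < d ^+ n.-1 by rewrite exprn_gt0.
have c20 : 0 <= n.-1%:R * 2 :> R by rewrite mulr_ge0// ltW.
(* Two thresholds: the first, with the logarithm to the power 1, gives k <= d; the second, to the
   power n, gives a E k <= d, because (a E k)^(n-1) = (a E)^n / a. *)
have [A1 A11 hA1] := pow_ln_le 1 c20 dm0.
have [A2 A21 hA2] := pow_ln_le n c20 dm0.
exists (Num.max A1 A2) => [|a E b]; first by rewrite le_max A11.
rewrite ge_max => /andP[aA1 aA2] /andP[E0 E1] b0 hb hY.
have a1 : 1 <= a := le_trans A11 aA1.
have a0 : 0 < a := lt_le_trans ltr01 a1.
have l0 : 0 <= ln a by rewrite ln_ge0.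
set k := nroot n E; set Y := b `^ mexp R n in hY *.
have k0 : 0 <= k := nroot_ge0 n E.
have kE : k ^+ n.-1 = E by rewrite /k nrootK.
have Y0 : 0 <= Y := powR_ge0 _ _.
have YE : Y ^+ n.-1 = b ^+ n by rewrite /Y powR_mexp_pow.
(* Bernoulli's inequality, from above and from below *)
have Ya : Y <= a * (1 - E / n.-1%:R).
  rewrite -(@ler_pXn2r _ n.-1) ?nnegrE//; last first.
    rewrite mulr_ge0 ?(ltW a0)// subr_ge0 ler_pdivrMr// mul1r (le_trans E1)//.
    by rewrite -[1]/(1%:R) ler_nat.
  rewrite YE exprMn; apply: le_trans hb _; rewrite [leRHS]mulrC ler_wpM2r ?exprn_ge0 ?(ltW a0)//.
  have x01 : 0 <= E / n.-1%:R <= 1.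
    rewrite divr_ge0 ?(ltW n1R)//= ler_pdivrMr// mul1r (le_trans E1)//.
    by rewrite -[1]/(1%:R) ler_nat.
  by have := expr1B_ge n.-1 x01; rewrite mulrCA divff ?mulr1// gt_eqF.
have aE : a * E <= n.-1%:R * 2 * ln a.
  rewrite -mulrA; have nx : 2 * ln a <= n.-1%:R * (2 * ln a).
    by rewrite ler_peMl ?mulr_ge0// -[1]/(1%:R) ler_nat.
  have [ax|xa] := leP a (2 * ln a).
    by apply: le_trans nx; apply: le_trans ax; rewrite ler_piMr// ltW.
  pose x := 2 * ln a / a.
  have x01 : 0 <= x <= 1.
    by rewrite divr_ge0 ?mulr_ge0 ?(ltW a0)//= ler_pdivrMr// mul1r ltW.
  have ax : a - 2 * ln a = a * (1 - x) by rewrite /x; field; rewrite gt_eqF.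
  have h1 : (1 - x) ^+ n.-1 <= 1 - E.
    rewrite -(@ler_pM2l _ (a ^+ n.-1)) ?exprn_gt0// -exprMn -ax [leRHS]mulrC.
    apply: le_trans hb; rewrite -YE; apply: lerXn2r; rewrite ?nnegrE ?subr_ge0//.
    exact: ltW.
  have h2 := le_trans (expr1B_ge n.-1 x01) h1.
  have h3 : E <= n.-1%:R * x by move: h2; rewrite lerD2l lerN2.
  have -> : n.-1%:R * (2 * ln a) = a * (n.-1%:R * x) by rewrite /x; field; rewrite gt_eqF.
  by rewrite ler_pM2l.
have kd : k <= d.
  rewrite -(@ler_pXn2r _ n.-1) ?nnegrE ?(ltW d0)// kE.
  rewrite -(ler_pM2l a0); apply: (le_trans aE).
  by rewrite [leRHS]mulrC -[leLHS]expr1; exact: hA1.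
have aEk : a * E * k <= d.
  rewrite -(@ler_pXn2r _ n.-1) ?nnegrE ?(ltW d0)//; last by rewrite !mulr_ge0// ltW.
  rewrite exprMn kE -(ler_pM2l a0).
  have -> : a * ((a * E) ^+ n.-1 * E) = (a * E) ^+ n by rewrite -[in RHS]nE exprS; ring.
  rewrite [leRHS]mulrC; apply: le_trans (hA2 a aA2).
  by rewrite lerXn2r ?nnegrE ?mulr_ge0// ltW.
have k2 : k <= 2^-1 := le_trans kd d2.
have k1 : k < 1 by apply: le_lt_trans k2 _; rewrite invf_lt1// ltr1n.
split=> //.
have lE : lcst R n * ((mexp R n * nroot n b) ^+ n * E) = Y * E / n.-1%:R.
  have rb : nroot n b ^+ n = Y by rewrite /Y powR_mexpE.
  rewrite /lcst (exprMn n (mexp R n) (nroot n b)) rb; field.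
  by rewrite gt_eqF//= expf_neq0// gt_eqF// mexp_gt0.
have ik : (1 - k)^-1 <= 1 + 2 * k.
  rewrite -[leLHS]mul1r ler_pdivrMr ?subr_gt0// -subr_ge0.
  have -> : (1 + 2 * k) * (1 - k) - 1 = k * (1 - 2 * k) by ring.
  by rewrite mulr_ge0// subr_ge0 mulrC -ler_pdivlMr// mul1r.
have ikn : ((1 - k) ^+ n.-1)^-1 <= 1 + n.-1%:R * C * k.
  rewrite -exprVn; apply: (@le_trans _ _ ((1 + 2 * k) ^+ n.-1)).
    by rewrite lerXn2r ?nnegrE ?invr_ge0 ?subr_ge0 ?(ltW k1)// addr_ge0// mulr_ge0.
  apply: (le_trans (@expr1D_le _ n.-1 (2 * k) _)).
    by rewrite mulr_ge0//= mulrC -ler_pdivlMr// mul1r.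
  rewrite lerD2l le_eqVlt; apply/orP; left; apply/eqP; rewrite /C; field.
  by rewrite gt_eqF.
apply: le_trans hd; rewrite mulrCA -expRD; apply: ler_pM.
- by rewrite invr_ge0 subr_ge0 ltW.
- exact: expR_ge0.
- by rewrite lef_pV2 ?posrE ?subr_gt0 ?(le_lt_trans d2) ?invf_lt1 ?ltr1n// lerD2l lerN2.
rewrite ler_expR lE addrCA lerD2l -/k.
apply: (@le_trans _ _ (- (a * E / n.-1%:R) + a * E / n.-1%:R * (1 + n.-1%:R * C * k))).
  apply: lerD.
    by rewrite lerBlDr; apply: (le_trans Ya); rewrite le_eqVlt; apply/orP; left; apply/eqP; ring.
  apply: ler_pM => //.
  - by rewrite !mulr_ge0 ?invr_ge0// ltW.
  - by rewrite invr_ge0 exprn_ge0// subr_ge0 ltW.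
  - rewrite ler_wpM2r ?invr_ge0 ?(ltW n1R)// ler_wpM2r//.
    apply: le_trans Ya _; rewrite ler_piMr ?(ltW a0)// gerBl divr_ge0// ltW.
have -> : - (a * E / n.-1%:R) + a * E / n.-1%:R * (1 + n.-1%:R * C * k) = C * (a * E * k).
  by field; rewrite gt_eqF.
by rewrite ler_wpM2l.
Qed.

End concentration.

Lemma integral_inv_sqr (R : realType) (a : R) : 0 < a ->
  (\int[lebesgue_measure]_(t in `[a, +oo[) (t ^- 2)%:E = (a^-1)%:E)%E.
Proof.
move=> a0; have cV (t : R) : a <= t -> {for t, continuous (fun t : R => t^-1)}.
  by move=> at_; apply: cvgV; [rewrite gt_eqF// (lt_le_trans a0)|exact: cvg_id].
have dV (t : R) : a < t -> is_derive t 1 (fun t : R => - t^-1) (t ^- 2).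
  move=> at_; have t0 : t != 0 by rewrite gt_eqF// (lt_trans a0).
  have h := @is_deriveV R id t 1 1 t0 (is_derive_id _ _).
  by apply: (is_derive_eq (is_deriveN h)); rewrite /GRing.scale/= mulr1 opprK.
rewrite (@ge0_continuous_FTC2y R _ (fun t => - t^-1) _ 0).
- by rewrite EFinN oppeK add0e.
- by move=> t _; rewrite invr_ge0 sqr_ge0.
- apply: continuous_in_subspaceT => t; rewrite inE/= in_itv/= andbT => at_.
  have -> : (fun t : R => t ^- 2) = (fun t => t^-1 * t^-1) by apply/funext => x; rewrite -invfM.
  by apply: cvgM; exact: cV.
- rewrite -oppr0; apply: cvgN; apply: (iffRL (gtr0_cvgV0 _)); last exact: cvg_id.
  exact: nbhs_pinfty_gt.
- by move=> t at_; have d := dV t at_; exact: ex_derive.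
- by apply: cvg_at_right_filter; apply: cvgN; exact: cV.
- by move=> t; rewrite in_itv/= andbT => at_; have d := dV t at_; rewrite derive1E derive_val.
Qed.

(** * The functional on the half line and its concentration level *)

Section moser_functional.
Variables (R : realType) (n : nat).
Hypothesis hn : (2 <= n)%N.
Notation mu := (@lebesgue_measure R).

Let n1_gt0 : (0 < n.-1)%N. Proof. by case: n hn => [|[]]. Qed.
Let nE : n.-1.+1 = n. Proof. by case: n hn. Qed.

Lemma measurable_powR_comp (w : R -> R) (p : R) : measurable_fun [set: R] w ->
  measurable_fun [set: R] (fun t => w t `^ p).
Proof. by move=> mw; exact: (measurableT_comp (measurable_powR p) mw). Qed.

Lemma energy_pair_measurable E w Phi : energy_pair n E w Phi -> measurable_fun [set: R] w.
Proof. by move=> [_ wnd _ _]; exact: nondecreasing_measurable. Qed.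

Let expo (w : R -> R) (t : R) : \bar R := (expR (w t `^ mexp R n - t))%:E.

Let expo_ge0 w t : (0 <= expo w t)%E. Proof. by rewrite lee_fin expR_ge0. Qed.

Let mexpo E w Phi : energy_pair n E w Phi -> measurable_fun [set: R] (expo w).
Proof.
move=> wE; apply/measurable_EFinP; apply: measurableT_comp => //.
apply: measurable_funB => //; apply: measurable_powR_comp.
exact: energy_pair_measurable wE.
Qed.

(** After a, write w = b + p. [powR_mexpD_le] bounds the critical power by its value at b, plus c p,
    plus the power of p, and the last is at most k s since only the energy E is left. So psi = c p
    has energy c^n E and meets the rate 1 - k in [dual_inequality]. *)
Lemma tail_le (e : R) : 0 < e -> exists2 A : R, 1 <= A &
  forall a w Phi, A <= a -> energy_pair n 1 w Phi ->
  a - 2 * ln a <= w a `^ mexp R n ->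
  (\int[mu]_(t in `[a, +oo[) (expR (w t `^ mexp R n - t))%:E <= (expR (harm R n) + e)%:E)%E.
Proof.
move=> e0; have [A A1 hA] := tail_const hn e0; exists A => // a w Phi Aa wE hY.
have a0 : 0 <= a by rewrite (le_trans _ Aa)// (le_trans _ A1).
have [w0 wnd wP PE] := wE.
set b := w a; have b0 : 0 <= b := energy_pair_ge0 wE a0.
pose E := 1 - Phi a.
have /andP[Pa0 Pa1] := PE a a0.
have E0 : 0 <= E by rewrite subr_ge0.
have E1 : E <= 1 by rewrite gerBl.
have hb : b ^+ n <= (1 - E) * a ^+ n.-1.
  by have [h _] := energy_pair_pow_le wE a0; rewrite /E opprB addrC subrK.
have E01 : 0 <= E <= 1 by rewrite E0.
have [k1 hc] := hA a E b Aa E01 b0 hb hY.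
set k := nroot n E in k1 hc.
set c := mexp R n * nroot n b in hc.
have c0 : 0 <= c by rewrite mulr_ge0 ?nroot_ge0// ltW// mexp_gt0.
pose psi s := c * (w (a + s) - b).
pose Ps s := c ^+ n * (Phi (a + s) - Phi a).
have psiE : energy_pair n (c ^+ n * E) psi Ps.
  split.
  - by rewrite /psi addr0 subrr mulr0.
  - by move=> s t st; rewrite /psi ler_wpM2l// lerD2r wnd// lerD2l.
  - move=> s t s0 st.
    have -> : psi t - psi s = c * (w (a + t) - w (a + s)) by rewrite /psi; ring.
    have -> : Ps t - Ps s = c ^+ n * (Phi (a + t) - Phi (a + s)) by rewrite /Ps; ring.
    rewrite exprMn -mulrA ler_wpM2l ?exprn_ge0//.
    have -> : t - s = (a + t) - (a + s) by ring.
    by apply: wP; rewrite ?addr_ge0// lerD2l.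
  - move=> t t0; have at_ : a <= a + t by rewrite lerDl.
    have at0 : 0 <= a + t by rewrite addr_ge0.
    have /andP[_ h1] := PE _ at0.
    have h2 := energy_pair_mono wE a0 at_.
    by rewrite mulr_ge0 ?exprn_ge0 ?subr_ge0//= ler_wpM2l ?exprn_ge0// lerD2r.
have nu0 : 0 < 1 - k by rewrite subr_gt0.
have du := dual_inequality hn psiE nu0.
have k0 : 0 <= k := nroot_ge0 n E.
have pt s : 0 <= s -> expR (w (s + a) `^ mexp R n - (s + a)) <=
    expR (b `^ mexp R n - a) * expR (psi s - (1 - k) * s).
  move=> s0; rewrite -expRD ler_expR [s + a]addrC.
  set p := w (a + s) - b; have p0 : 0 <= p by rewrite subr_ge0 wnd// lerDl.
  have -> : w (a + s) = b + p by rewrite /p [b + _]addrC subrK.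
  have hp : p `^ mexp R n <= k * s.
    apply: powR_mexp_le => //; first by rewrite mulr_ge0.
    rewrite exprMn /k nrootK//.
    have as_ : a <= a + s by rewrite lerDl.
    have as0 : 0 <= a + s by rewrite addr_ge0.
    have := wP _ _ a0 as_; rewrite [a + s - a]addrAC subrr add0r => h.
    apply: le_trans h _; rewrite ler_wpM2r ?exprn_ge0//.
    by have /andP[_ h1] := PE _ as0; rewrite lerD2r.
  have := powR_mexpD_le hn b0 p0; rewrite -/c => h.
  rewrite lerBlDr; apply: (le_trans h).
  apply: (@le_trans _ _ (b `^ mexp R n + c * p + k * s)); first by rewrite lerD2l.
  by rewrite le_eqVlt; apply/orP; left; apply/eqP; rewrite /psi -/p; ring.
have mex := mexpo wE.
apply: ge0_integral_halfline_le => // T aT.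
have Ta : 0 <= T - a by rewrite subr_ge0.
have := ge0_integral_shift a 0 (T - a) mex (expo_ge0 w); rewrite add0r subrK => <-.
have mps : measurable_fun [set: R] (fun s => (expR (psi s - (1 - k) * s))%:E).
  apply/measurable_EFinP; apply: measurableT_comp => //; apply: measurable_funB.
    exact: energy_pair_measurable psiE.
  exact: measurable_funM.
apply: (@le_trans _ _ (\int[mu]_(s in `[0%R, +oo[) ((expR (b `^ mexp R n - a))%:E * (expR (psi s - (1 - k) * s))%:E))%E).
  apply: (@le_trans _ _ (\int[mu]_(s in `[0%R, (T - a)%R[) ((expR (b `^ mexp R n - a))%:E * (expR (psi s - (1 - k) * s))%:E))%E).
    apply: ge0_le_integral => //.
    - apply: measurable_funTS; apply: (measurableT_comp mex).
      exact: measurable_funD.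
    - by apply: measurable_funeM; exact: measurable_funTS.
    - by move=> s; rewrite /= in_itv/= => /andP[s0 _]; rewrite -EFinM lee_fin pt.
  apply: ge0_subset_integral => //.
  - by apply: measurable_funeM; exact: measurable_funTS.
  - by move=> s /=; rewrite !in_itv/= andbT => /andP[].
rewrite ge0_integralZl_EFin ?expR_ge0//; last exact: measurable_funTS.
apply: (@le_trans _ _ ((expR (b `^ mexp R n - a))%:E * ((1 - k)^-1 * expR (harm R n + lcst R n * (c ^+ n * E) / (1 - k) ^+ n.-1))%:E)%E).
  by apply: lee_wpmul2l; rewrite ?lee_fin ?expR_ge0.
by rewrite -EFinM lee_fin.
Qed.

(** What the two functionals have in common. Energy pairs satisfy y^n <= t^(n-1), so the critical
    power has to dominate G, up to an error, only there. [mte_big] and [mte_cubic] provide the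
    strict gain over the level; a cube is weak enough to hold for exponents up to 3, and still gives
    a negative power of the parameter. *)
Record mt_exponent (G : R -> R -> R) : Prop := MtExponent {
  mte_ge0 : forall t y : R, 0 <= t -> 0 <= G t y;
  mte_mono : forall t y z : R, 0 <= t -> 0 <= y -> y <= z -> G t y <= G t z;
  mte_le : exists M, forall t y : R, 0 <= t -> 0 <= y -> y ^+ n <= t ^+ n.-1 ->
    G t y <= y `^ mexp R n + M;
  mte_tail : forall e : R, 0 < e -> exists A, forall t y : R, 0 <= t -> A <= t -> 0 <= y ->
    y ^+ n <= t ^+ n.-1 -> G t y <= y `^ mexp R n + e;
  mte_small : forall A e : R, 0 < e -> exists2 eta, 0 < eta &
    forall t y : R, 0 <= t <= A -> 0 <= y <= eta -> G t y <= e;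
  mte_big : exists y0, forall t y : R, 0 <= t -> 0 <= y -> y0 <= y -> y `^ mexp R n <= G t y;
  mte_cubic : exists k y1, [/\ 0 < k, 0 < y1 &
    forall t y : R, 0 <= t -> 0 <= y <= y1 -> k * y ^+ 3 <= G t y];
  mte_continuous : forall t : R, 0 <= t -> continuous (G t);
  mte_measurable : forall w, measurable_fun [set: R] w ->
    measurable_fun [set: R] (fun t => G t (w t)) }.

Definition mtF (G : R -> R -> R) (w : R -> R) : \bar R :=
  (\int[mu]_(t in `[0%R, +oo[) (expR (G t (w t) - t))%:E)%E.

Lemma energy_pair_powR_le w Phi t : energy_pair n 1 w Phi -> 0 <= t ->
  w t `^ mexp R n <= t.
Proof.
move=> wE t0; apply: powR_mexp_le => //; first exact: energy_pair_ge0 wE t0.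
by have [] := energy_pair_pow_le wE t0.
Qed.

Section fixed_exponent.
Variable G : R -> R -> R.
Hypothesis hG : mt_exponent G.

Let integrand (w : R -> R) (t : R) : \bar R := (expR (G t (w t) - t))%:E.

Let integrand_ge0 w t : (0 <= integrand w t)%E. Proof. by rewrite lee_fin expR_ge0. Qed.

Lemma measurable_mt_integrand (w : R -> R) : measurable_fun [set: R] w ->
  measurable_fun [set: R] (fun t => (expR (G t (w t) - t))%:E).
Proof.
move=> mw; apply/measurable_EFinP; apply: measurableT_comp => //.
by apply: measurable_funB => //; exact: (mte_measurable hG mw).
Qed.

(** While the critical power of w stays below t - 2 ln t, the integrand is below t^(-2), of total at
    most 1 / A. Let S be the set where it does not. Its infimum need not belong to it, so [tail_le]
    is started at a point of S within e / 4 of the infimum; in between the integrand is at most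
    1. *)
Let expo_tail (e : R) : 0 < e -> exists2 A0 : R, 1 <= A0 &
  forall A w Phi, A0 <= A -> energy_pair n 1 w Phi ->
  (\int[mu]_(t in `[A, +oo[) expo w t <= (expR (harm R n) + e)%:E)%E.
Proof.
move=> e0; have e4 : 0 < e / 4 by rewrite divr_gt0.
have [A1 A11 hA1] := tail_le (divr_gt0 e0 (ltr0n _ 2)).
exists (Num.max A1 (4 / e)); first by rewrite le_max A11.
move=> A w Phi; rewrite ge_max => /andP[AA1 Ae] wE.
have A1' : 1 <= A := le_trans A11 AA1; have A0 : 0 < A := lt_le_trans ltr01 A1'.
have iA : A^-1 <= e / 4.
  by rewrite -[leRHS]invrK lef_pV2 ?posrE ?invr_gt0// invf_div.
have mex := mexpo wE.
pose S := [set t : R | A <= t /\ t - 2 * ln t <= w t `^ mexp R n].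
have mV2 : measurable_fun [set: R] (fun t : R => (t ^- 2)%:E).
  apply/measurable_EFinP; rewrite (_ : (fun t : R => t ^- 2) = (fun t => `|t| `^ (-2))); last first.
    by apply/funext => t; rewrite powR_invn// real_normK// num_real.
  apply: measurable_powR_comp; exact: normr_measurable.
have small t : A <= t -> ~ S t -> (expo w t <= (t ^- 2)%:E)%E.
  move=> At nS; have t0 : 0 < t := lt_le_trans A0 At.
  have {}nS : w t `^ mexp R n < t - 2 * ln t by rewrite ltNge; apply/negP => h; apply: nS.
  rewrite lee_fin; apply: (@le_trans _ _ (expR (- (2 * ln t)))).
    by rewrite ler_expR lerBlDr addrC; exact: ltW.
  by rewrite expRN expRM_natl lnK.
have intV2 (D : set (measurableTypeR R)) : measurable D -> D `<=` `[A, +oo[ ->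
    (forall t, D t -> ~ S t) -> (\int[mu]_(t in D) expo w t <= (e / 4)%:E)%E.
  move=> mD DA DS; apply: (@le_trans _ _ (\int[mu]_(t in `[A, +oo[) (t ^- 2)%:E)%E); last first.
    by rewrite integral_inv_sqr// lee_fin.
  apply: (@le_trans _ _ (\int[mu]_(t in D) (t ^- 2)%:E)%E).
    apply: ge0_le_integral => //.
    - exact: measurable_funTS.
    - exact: measurable_funTS.
    - move=> t Dt; apply: small; last exact: DS.
      by have := DA _ Dt; rewrite /= in_itv/= andbT.
  apply: ge0_subset_integral => //; first exact: measurable_funTS.
  by move=> t _; rewrite lee_fin invr_ge0 sqr_ge0.
have eH : e / 4 <= expR (harm R n) + e.
  by rewrite ler_wpDl ?expR_ge0// ler_pdivrMr// ler_peMr ?(ltW e0)// ler1n.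
have [[s0 Ss0]|nS] := pselect (S !=set0); last first.
  apply: (@le_trans _ _ (e / 4)%:E); last by rewrite lee_fin.
  by apply: intV2 => // t _ St; apply: nS; exists t.
have hinf : has_inf S by split; [exists s0|exists A => t []].
have Ainf : A <= inf S by apply: lb_le_inf; [exists s0|move=> t []].
have [a Sa ainf] := inf_adherent e4 hinf.
have infa : inf S <= a by apply: ge_inf => //; exact: hinf.2.
have Aa : A <= a := le_trans Ainf infa.
rewrite (ge0_integral_itv_split (x := BLeft a))//.
rewrite (ge0_integral_itv_split (x := BLeft (inf S)))//.
have I1 : (\int[mu]_(t in `[A, (inf S)[) expo w t <= (e / 4)%:E)%E.
  apply: intV2 => //.
  - by move=> t /=; rewrite !in_itv/= andbT => /andP[].
  - move=> t; rewrite /= in_itv/= => /andP[_ ti] St.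
    by have := ge_inf hinf.2 St; rewrite leNgt ti.
have I2 : (\int[mu]_(t in `[inf S, a[) expo w t <= (e / 4)%:E)%E.
  apply: (@le_trans _ _ (\int[mu]_(t in `[inf S, a[) (cst 1%:E t))%E).
    apply: ge0_le_integral => //.
    - exact: measurable_funTS.
    - move=> t; rewrite /= in_itv/= => /andP[it _]; rewrite lee_fin -expR0 ler_expR subr_le0.
      apply: energy_pair_powR_le wE _; apply: le_trans it; apply: le_trans Ainf; exact: ltW.
  rewrite integral_cst// mul1e.
  have := lebesgue_measure_itvco infa => h.
  apply: (@le_trans _ _ (a - inf S)%:E); first by rewrite le_eqVlt; apply/orP; left; apply/eqP.
  by rewrite lee_fin lerBlDl ltW.
have I3 := hA1 a w Phi (le_trans AA1 Aa) wE Sa.2.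
apply: le_trans (leeD (leeD I1 I2) I3) _.
by rewrite -!EFinD lee_fin le_eqVlt; apply/orP; left; apply/eqP; field.
Qed.

(** The two parts of the level: on [0, A[ the function is small, so that exp G is nearly 1 and exp
    (- t) has mass at most 1; beyond A, G exceeds the critical power by a small constant at most,
    and [expo_tail] applies. *)
Lemma concentration (e : R) : 0 < e -> exists A eta, [/\ 1 <= A, 0 < eta &
  forall w Phi, energy_pair n 1 w Phi -> w A <= eta ->
  (mtF G w <= (1 + expR (harm R n) + e)%:E)%E].
Proof.
move=> e0; set H := expR (harm R n); have H0 : 0 < H := expR_gt0 _.
(* Chosen so that (1 + r) (H + e / 4) <= H + e / 2. *)
pose r := e / (4 * (H + e + 1)).
have d0 : 0 < 4 * (H + e + 1) by rewrite mulr_gt0// !addr_gt0.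
have r0 : 0 < r by rewrite divr_gt0.
have e2_gt0 : 0 < ln (1 + r) by rewrite ln_gt0// ltrDl.
have e3_gt0 : 0 < ln (1 + e / 2) by rewrite ln_gt0// ltrDl divr_gt0.
have [A1 A11 hA1] := expo_tail (divr_gt0 e0 (ltr0n _ 4)).
have [A2 hA2] := mte_tail hG e2_gt0.
pose A := Num.max A1 A2.
have AA1 : A1 <= A by rewrite le_max lexx.
have A1' : 1 <= A := le_trans A11 AA1.
have A0 : 0 <= A := le_trans ler01 A1'.
have [eta eta0 heta] := mte_small hG A e3_gt0.
exists A, eta; split => // w Phi wE wA.
have mw := energy_pair_measurable wE.
have mI := measurable_mt_integrand mw.
have [w0 wnd _ _] := wE.
rewrite /mtF (ge0_integral_itv_split (x := BLeft A) mI (integrand_ge0 w))//.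
have I1 : (\int[mu]_(t in `[0%R, A[) integrand w t <= (1 + e / 2)%:E)%E.
  apply: (@le_trans _ _ (\int[mu]_(t in `[0%R, +oo[) ((1 + e / 2)%:E * (expR (- t))%:E))%E); last first.
    rewrite ge0_integralZl_EFin//; last 2 first.
    - by apply: measurable_funTS; exact: measurable_expRN.
    - by rewrite addr_ge0// divr_ge0// ltW.
    by rewrite integral_expRN oppr0 expR0 mule1.
  have mE : measurable_fun [set: R] (fun t : R => ((1 + e / 2)%:E * (expR (- t))%:E)%E).
    by apply: measurable_funeM; exact: measurable_expRN.
  have E0 (t : R) : (0 <= (1 + e / 2)%:E * (expR (- t))%:E)%E.
    by rewrite mule_ge0// lee_fin ?expR_ge0// addr_ge0// divr_ge0// ltW.
  apply: (@le_trans _ _ (\int[mu]_(t in `[0%R, A[) ((1 + e / 2)%:E * (expR (- t))%:E))%E).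
    apply: ge0_le_integral => //; [exact: measurable_funTS|exact: measurable_funTS|].
    move=> t; rewrite /= in_itv/= => /andP[t0 tA]; rewrite /integrand -EFinM lee_fin expRD.
    rewrite ler_wpM2r ?expR_ge0// -[leRHS]lnK ?posrE ?addr_gt0 ?divr_gt0// ler_expR.
    apply: heta; first by rewrite t0 ltW.
    rewrite (energy_pair_ge0 wE t0)/=; apply: le_trans wA; apply: wnd; exact: ltW.
  apply: ge0_subset_integral => //; first exact: measurable_funTS.
  by move=> t /=; rewrite !in_itv/= andbT => /andP[].
have I2 : (\int[mu]_(t in `[A, +oo[) integrand w t <= ((1 + r) * (H + e / 4))%:E)%E.
  apply: (@le_trans _ _ (\int[mu]_(t in `[A, +oo[) ((1 + r)%:E * expo w t))%E).
    have mex := mexpo wE.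
    have E0 t : (0 <= (1 + r)%:E * expo w t)%E.
      by rewrite mule_ge0// lee_fin addr_ge0// ltW.
    apply: ge0_le_integral => //; first exact: measurable_funTS.
      by apply: measurable_funeM; exact: measurable_funTS.
    move=> t; rewrite /= in_itv/= andbT => At; have t0 := le_trans A0 At.
    rewrite /integrand /expo -EFinM lee_fin -[1 + r]lnK ?posrE ?addr_gt0// -expRD ler_expR.
    rewrite addrA lerD2r addrC; apply: hA2 => //.
    - by apply: le_trans At; rewrite le_max lexx orbT.
    - exact: energy_pair_ge0 wE t0.
    - by have [] := energy_pair_pow_le wE t0.
  rewrite ge0_integralZl_EFin//; last 2 first.
  - by apply: measurable_funTS; exact: mexpo wE.
  - by rewrite addr_ge0// ltW.
  rewrite EFinM; apply: lee_wpmul2l; first by rewrite lee_fin addr_ge0// ltW.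
  exact: hA1 wE.
apply: le_trans (leeD I1 I2) _; rewrite -EFinD lee_fin.
have rH : r * (H + e / 4) <= e / 4.
  rewrite /r mulrAC ler_pdivrMr//.
  have -> : e / 4 * (4 * (H + e + 1)) = e * (H + e + 1) by field.
  rewrite ler_pM2l// -addrA lerD2l (le_trans (_ : _ <= e))//; last by rewrite lerDl.
  by rewrite ler_pdivrMr// ler_peMr ?(ltW e0)// ler1n.
rewrite mulrDl mul1r; apply: (@le_trans _ _ (1 + e / 2 + (H + e / 4 + e / 4))).
  by rewrite lerD2l lerD2l.
by rewrite le_eqVlt; apply/orP; left; apply/eqP; field.
Qed.

(* If [w A] stays away from 0, then some energy is spent before [A], and the
   remaining energy makes [w] subcritical. *)
Lemma subcritical_bound (A eta : R) : 1 <= A -> 0 < eta ->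
  exists s C : R, s < 1 /\ forall w Phi, energy_pair n 1 w Phi -> eta <= w A ->
  forall t, 0 <= t -> G t (w t) <= s * t + C.
Proof.
move=> A1 eta0; have A0 : 0 < A := lt_le_trans ltr01 A1.
have [M hM] := mte_le hG.
(* By Hoelder's inequality, reaching [eta] at A costs at least this energy. At most 1 - d is left,
   so the rate after A is k = (1 - d)^(1/(n-1)) < 1. *)
pose d := Num.min 1 (eta ^+ n / A ^+ n.-1).
have d0 : 0 < d by rewrite lt_min ltr01 divr_gt0// exprn_gt0.
have d1 : d <= 1 by rewrite ge_min lexx.
have d1' : 0 <= 1 - d by rewrite subr_ge0.
set k := nroot n (1 - d); have k0 : 0 <= k := nroot_ge0 _ _.
have k1 : k < 1.
  rewrite ltNge; apply/negP => h; have := exprn_ege1 n.-1 h.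
  by rewrite /k nrootK// leNgt gtrBl d0.
pose e := (1 - k) / 2; have e0 : 0 < e by rewrite divr_gt0// subr_gt0.
pose c := mexp R n * (1 + A).
have c0 : 0 <= c by rewrite mulr_ge0// ?ltW ?mexp_gt0// addr_gt0.
(* Past T the cross term c (w t - w A) is at most e t, because (w t)^n <= t^(n-1) and c^n = e^n
   T. *)
pose T := (c / e) ^+ n; have T0 : 0 <= T by rewrite exprn_ge0// divr_ge0// ltW.
exists (k + e), (A + c * (1 + T) + `|M|); split.
  by rewrite /e (_ : k + (1 - k) / 2 = (1 + k) / 2); [rewrite ltr_pdivrMr// mul1r [2]/(1 + 1) ltrD2l|field].
have w_le (w Phi : R -> R) (t : R) : energy_pair n 1 w Phi -> 0 <= t -> w t <= 1 + t.
  move=> wE t0; have [_ h] := energy_pair_pow_le wE t0.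
  have t1 : 1 <= 1 + t by rewrite lerDl.
  rewrite -(@ler_pXn2r _ n) ?nnegrE ?addr_ge0 ?(energy_pair_ge0 wE t0)//; last by rewrite -nE.
  apply: (le_trans h); apply: (@le_trans _ _ ((1 + t) ^+ n.-1)).
    by rewrite lerXn2r ?nnegrE ?addr_ge0// lerDr.
  by rewrite -[in leRHS]nE; apply: ler_weXn2l.
move=> w Phi wE ew t t0.
have wt0 := energy_pair_ge0 wE t0; have wA0 := energy_pair_ge0 wE (ltW A0).
have [_ wtn] := energy_pair_pow_le wE t0.
have h0 : G t (w t) <= w t `^ mexp R n + `|M|.
  by apply: (le_trans (hM _ _ t0 wt0 wtn)); rewrite lerD2l ler_norm.
apply: (le_trans h0); rewrite addrA lerD2r.
have s0 : 0 <= k + e by rewrite addr_ge0// ltW.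
have [tA|At] := leP t A.
  apply: (le_trans (energy_pair_powR_le wE t0)); apply: (le_trans tA).
  have c1 : 0 <= c * (1 + T) by rewrite mulr_ge0// addr_ge0.
  have c2 : 0 <= (k + e) * t by rewrite mulr_ge0.
  lra.
have [_ wnd wP PE] := wE.
have p0 : 0 <= w t - w A by rewrite subr_ge0 wnd// ltW.
have dP : d <= Phi A.
  rewrite ge_min ler_pdivrMr ?exprn_gt0//; apply/orP; right.
  have [h _] := energy_pair_pow_le wE (ltW A0).
  by apply: le_trans h; rewrite lerXn2r// nnegrE ltW.
have pk : (w t - w A) `^ mexp R n <= k * t.
  apply: powR_mexp_le => //; first by rewrite mulr_ge0.
  rewrite exprMn nrootK//; apply: (le_trans (wP _ _ (ltW A0) (ltW At))).
  have /andP[_ Pt] := PE _ t0.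
  apply: ler_pM.
  - by have h := energy_pair_mono wE (ltW A0) (ltW At); rewrite subr_ge0.
  - by rewrite exprn_ge0// subr_ge0 ltW.
  - by rewrite lerB.
  - by rewrite lerXn2r ?nnegrE ?subr_ge0 ?(ltW At)// gerBl ltW.
have pT : c * (w t - w A) <= e * t + c * (1 + T).
  have pt : w t - w A <= 1 + t by rewrite (le_trans _ (w_le _ _ _ wE t0))// gerBl.
  have [tT|Tt] := leP t T.
    apply: (@le_trans _ _ (c * (1 + T))).
      by rewrite ler_wpM2l// (le_trans pt)// lerD2l.
    by rewrite lerDr mulr_ge0// ltW.
  apply: (@le_trans _ _ (e * t)); last by rewrite lerDl mulr_ge0// addr_ge0.
  have et0 : 0 <= e * t by rewrite mulr_ge0// ltW.
  rewrite -(@ler_pXn2r _ n) ?nnegrE ?(mulr_ge0 c0 p0)//; last by rewrite -nE.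
  rewrite [leLHS](exprMn n c) [leRHS](exprMn n e); apply: (@le_trans _ _ (c ^+ n * t ^+ n.-1)).
    rewrite ler_wpM2l ?exprn_ge0//; apply: le_trans wtn.
    by rewrite lerXn2r ?nnegrE// gerBl.
  rewrite -[in t ^+ n]nE exprSr mulrA [leRHS]mulrAC ler_wpM2r ?exprn_ge0//.
  rewrite mulrC -ler_pdivrMr ?exprn_gt0// -expr_div_n; exact: ltW.
have rA : nroot n (w A) <= 1 + A.
  apply: nroot_le => //; first by rewrite addr_ge0 // ltW.
  apply: (le_trans (w_le _ _ _ wE (ltW A0))); apply: ler_eXnr; first exact: n1_gt0.
  by rewrite lerDl ltW.
have h1 := powR_mexpD_le hn wA0 p0; rewrite [w A + _]addrC subrK in h1.
have h2 : mexp R n * nroot n (w A) * (w t - w A) <= c * (w t - w A).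
  by rewrite ler_wpM2r// ler_wpM2l// ltW// mexp_gt0.
have h3 := energy_pair_powR_le wE (ltW A0).
lra.
Qed.

End fixed_exponent.
End moser_functional.

(** * The Carleson-Chang test function *)

(** A converse to Young's inequality: l = x / h recovers the form of Hoelder's inequality. The
    linearised inequalities, one for each l, are easier to verify since they can be checked by
    comparing derivatives in t. *)
Lemma energy_of_tangent (R : realType) (n : nat) (x d h : R) : (2 <= n)%N ->
  0 <= x -> 0 <= h -> (h = 0 -> x = 0) ->
  (forall l, 0 <= l -> n%:R * l ^+ n.-1 * x <= d + n.-1%:R * l ^+ n * h) ->
  x ^+ n <= d * h ^+ n.-1.
Proof.
move=> hn x0; rewrite le_eqVlt => /predU1P[<- /(_ erefl) -> _|h0 _ hl].
  by case: n hn => [|[|n]]// _; rewrite !expr0n mulr0.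
have nE : n.-1.+1 = n by case: n hn {hl}.
have := hl (x / h) (divr_ge0 x0 (ltW h0)).
have -> : n%:R * (x / h) ^+ n.-1 * x = n%:R * ((x / h) ^+ n * h).
  rewrite -mulrA; congr (_ * _); rewrite -[in RHS]nE exprSr -[RHS]mulrA divfK//.
  by rewrite gt_eqF.
have -> : n.-1%:R * (x / h) ^+ n * h = n.-1%:R * ((x / h) ^+ n * h) by rewrite mulrA.
rewrite -lerBlDr -mulrBl -[in n%:R]nE -natr1 [_ + 1]addrC addrK mul1r => h1.
have hn0 : 0 < h ^+ n.-1 by rewrite exprn_gt0.
rewrite -ler_pdivrMr//; apply: le_trans h1; rewrite le_eqVlt; apply/orP; left; apply/eqP.
rewrite expr_div_n -[X in _ / h ^+ X * h]nE exprSr; set H := h ^+ n.-1 in hn0 *.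
by field; rewrite !gt_eqF.
Qed.

Lemma Gam_ge0 (R : realType) (n : nat) (p : R) : 0 < p <= 1 -> 0 <= Gam n p.
Proof.
move=> /andP[p0 p1].
have := @is_derive_ndecr R (fun x => - Gam n x) (fun x => (1 - x) ^+ n.-1 / x) p 1 p1.
rewrite Gam1 oppr0 oppr_le0; apply.
  move=> x /andP[px _]; have x0 : 0 < x := lt_le_trans p0 px.
  have d := is_derive_Gam n x0.
  by apply: (is_derive_eq (is_deriveN d)); rewrite mulNr opprK.
move=> x /andP[px x1]; rewrite divr_ge0// ?exprn_ge0 ?subr_ge0//.
exact: (le_trans (ltW p0)).
Qed.

Section carleson_chang.
Variables (R : realType) (n : nat).
Hypothesis hn : (2 <= n)%N.
Variable a : R.
Hypothesis a0 : 0 < a.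

Let m : R := n.-1%:R.
Let m0 : 0 < m. Proof. by rewrite ltr0n; case: n hn => [|[]]. Qed.
Let nE : n.-1.+1 = n. Proof. by case: n hn. Qed.

Let z (s : R) : R := expR (- (s / m)).
(** The logistic curve p' = p (1 - p) / m with p 0 = exp (- a). It is the equality case of
    [backward_step] for mu = 1, read forwards: p = 1 / (mu J), with slope mexp (1 - p). *)
Let p (s : R) : R := (1 + (expR a - 1) * z s)^-1.
Let f (s : R) : R := m * (a + ln (p s)).
Let D : R := Gam n (expR (- a)).
Let F (s : R) : R := m * (D - Gam n (p s)).
(** Before scaling, the linear part has energy a and the part after a has energy at most m D;
    division by [rho] brings the total down to 1. *)
Let rho : R := (a + m * D) `^ n%:R^-1.
Let y (t : R) : R := Num.max (t - a) 0.

(* Linear up to [a]; afterwards the slope is [(1 - p) / rho], which is extremal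
   for the dual inequality, and [Gam n (p s)] is proportional to the energy left
   after [a + s]. *)
Definition moser_cc (t : R) : R := (Num.min t a + f (y t)) / rho.
Definition moser_cc_energy (t : R) : R := (Num.min t a + F (y t)) / rho ^+ n.

Let lam0 : 0 < expR a - 1. Proof. by rewrite subr_gt0 expR_gt1. Qed.
Let z0 s : 0 < z s. Proof. exact: expR_gt0. Qed.
Let den0 s : 0 < 1 + (expR a - 1) * z s. Proof. by rewrite addr_gt0// mulr_gt0. Qed.
Let p0 s : 0 < p s. Proof. by rewrite invr_gt0. Qed.
Let p1 s : p s <= 1. Proof. by rewrite invf_le1// lerDl mulr_ge0// ltW. Qed.
Let pE s : p s * ((expR a - 1) * z s) = 1 - p s.
Proof. by rewrite -[(_ - _) * _](addKr 1) mulrDr mulrN1 mulVf ?gt_eqF// addrC. Qed.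
Let p00 : p 0 = expR (- a).
Proof. by rewrite /p /z mul0r oppr0 expR0 mulr1 addrC subrK expRN. Qed.
Let ea : 0 < expR (- a) <= 1. Proof. by rewrite expR_gt0 -expR0 ler_expR lerNl oppr0 ltW. Qed.
Let D0 : 0 <= D. Proof. exact: Gam_ge0 ea. Qed.
Let DE : D = a - \sum_(k < n.-1) (1 - expR (- a)) ^+ k.+1 / k.+1%:R.
Proof. by rewrite /D /Gam expRK opprK. Qed.
Let Da : D <= a.
Proof.
rewrite DE gerBl sumr_ge0// => k _; rewrite divr_ge0// exprn_ge0// subr_ge0.
by have /andP[] := ea.
Qed.
Let s0 : 0 < a + m * D. Proof. by rewrite ltr_wpDr// mulr_ge0// ltW. Qed.
Let rho0 : 0 < rho. Proof. exact: powR_gt0. Qed.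
Let rhon : rho ^+ n = a + m * D.
Proof.
rewrite /rho -powR_mulrn ?powR_ge0// -powRrM mulVf ?powRr1 ?(ltW s0)//.
by rewrite pnatr_eq0; case: n hn.
Qed.

Let dz (s : R) : is_derive s 1 z (- (z s / m)).
Proof.
by rewrite /z; apply: is_derive_eq; rewrite scaler0 add0r /GRing.scale/= mulr1 mulrN.
Qed.

Let dp (s : R) : is_derive s 1 p (p s * (1 - p s) / m).
Proof.
have d1 : is_derive s 1 (fun s => 1 + (expR a - 1) * z s) ((expR a - 1) * - (z s / m)).
  by have d := dz s; apply: is_derive_eq; rewrite add0r mul1r.
have d2 := @is_deriveV R (fun s => 1 + (expR a - 1) * z s) s _ 1 (lt0r_neq0 (den0 s)) d1.
by apply: (is_derive_eq d2); rewrite /GRing.scale/= -pE /p; field; rewrite gt_eqF ?gt_eqF.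
Qed.

Let df (s : R) : is_derive s 1 f (1 - p s).
Proof.
have d1 := is_derive1_ln (p0 s); have d2 := dp s.
have d3 := is_derive1_comp d1 d2.
have d4 : is_derive s 1 (fun s => a + ln (p s)) ((p s)^-1 * (p s * (1 - p s) / m)).
  by apply: (is_derive_eq (is_deriveD (is_derive_cst a s 1) d3)); rewrite add0r.
have d5 := is_deriveZ m d4.
by apply: (is_derive_eq d5); rewrite /GRing.scale/=; field; rewrite !gt_eqF.
Qed.

Let dF (s : R) : is_derive s 1 F ((1 - p s) ^+ n).
Proof.
have d1 := is_derive_Gam n (p0 s); have d2 := dp s.
have d3 := is_derive1_comp d1 d2.
have d4 := is_deriveZ m (is_deriveB (is_derive_cst D s 1) d3).
apply: (is_derive_eq d4); rewrite /GRing.scale/= -[in RHS]nE exprS; field.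
by rewrite !gt_eqF.
Qed.

Let v0 s : 0 <= 1 - p s. Proof. by rewrite subr_ge0. Qed.

Let f_ndecr s t : s <= t -> f s <= f t.
Proof. by move=> st; exact: (is_derive_ndecr st (fun x _ => df x) (fun x _ => v0 x)). Qed.

Let f00 : f 0 = 0. Proof. by rewrite /f p00 expRK subrr mulr0. Qed.
Let F00 : F 0 = 0. Proof. by rewrite /F p00 subrr mulr0. Qed.

Let y_ndecr (s t : R) : s <= t -> y s <= y t.
Proof. by move=> st; rewrite /y ge_max !le_max lerD2r st lexx orbT. Qed.

Let miny (t : R) : Num.min t a + y t = t.
Proof.
rewrite /y; have [ta|ta] := leP t a.
  by rewrite max_r ?addr0// subr_le0.
by rewrite max_l ?subr_ge0 ?ltW// addrC subrK.
Qed.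

(** The third clause goes through [energy_of_tangent]. For each l the inequality splits into the
    linear part, of slope 1, and the part f, of slope 1 - p and energy density (1 - p)^n; on each
    the derivatives compare by [tangent_pow]. *)
Lemma moser_cc_energy_pair : energy_pair n 1 moser_cc moser_cc_energy.
Proof.
have y0 (t : R) : 0 <= y t by rewrite /y le_max lexx orbT.
have mn (s t : R) : s <= t -> Num.min s a <= Num.min t a.
  by move=> st; rewrite le_min !ge_min st lexx orbT.
have nd : {homo moser_cc : s t / s <= t}.
  move=> s t st; rewrite /moser_cc ler_wpM2r ?invr_ge0 ?(ltW rho0)//.
  by rewrite lerD ?mn// f_ndecr// y_ndecr.
split => //.
- by rewrite /moser_cc min_l ?ltW// /y max_r ?f00 ?addr0 ?mul0r// sub0r oppr_le0 ltW.
- move=> s t s_ge0 st.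
  have nds := nd _ _ st.
  apply: energy_of_tangent; rewrite ?subr_ge0//.
    by move=> /subr0_eq ->; rewrite subrr.
  move=> l l0.
  set l' := l * rho; have l'0 : 0 <= l' by rewrite mulr_ge0// ltW.
  have rn0 : 0 < rho ^+ n by rewrite exprn_gt0.
  rewrite -(ler_pM2r rn0).
  have -> : n%:R * l ^+ n.-1 * (moser_cc t - moser_cc s) * rho ^+ n =
     n%:R * l' ^+ n.-1 * (Num.min t a - Num.min s a) +
     n%:R * l' ^+ n.-1 * (f (y t) - f (y s)).
    rewrite /moser_cc /l' exprMn -[X in rho ^+ X]nE [rho ^+ _.+1]exprS.
    by rewrite /=; field; rewrite gt_eqF.
  have -> : (moser_cc_energy t - moser_cc_energy s + n.-1%:R * l ^+ n * (t - s)) * rho ^+ n =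
    (Num.min t a - Num.min s a + m * l' ^+ n * (Num.min t a - Num.min s a)) +
    (F (y t) - F (y s) + m * l' ^+ n * (y t - y s)).
    have -> : t - s = Num.min t a - Num.min s a + (y t - y s).
      by have := miny t; have := miny s; lra.
    rewrite /moser_cc_energy -/m /l' exprMn.
    by field; rewrite gt_eqF.
  have tg x : 0 <= x -> n%:R * l' ^+ n.-1 * x <= x ^+ n + m * l' ^+ n.
    by move=> x0; have := tangent_pow n.-1 x0 l'0; rewrite nE.
  apply: lerD.
    have h0 : 0 <= Num.min t a - Num.min s a by rewrite subr_ge0 mn.
    have := ler_wpM2r h0 (tg 1 ler01); rewrite mulr1 expr1n.
    by rewrite mulrDl mul1r.
  have := @is_derive_ndecr R (fun x => F x + m * l' ^+ n * x - n%:R * l' ^+ n.-1 * f x)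
    (fun x => (1 - p x) ^+ n + m * l' ^+ n - n%:R * l' ^+ n.-1 * (1 - p x)) (y s) (y t)
    (y_ndecr st).
  set c1 := m * l' ^+ n; set c2 := n%:R * l' ^+ n.-1.
  move=> H; have {}H : F (y s) + c1 * y s - c2 * f (y s) <= F (y t) + c1 * y t - c2 * f (y t).
    apply: H => x _; last by rewrite subr_ge0 tg.
    have d1 := df x; have d2 := dF x.
    have d3 := is_deriveZ c2 d1; have d4 := is_deriveZ c1 (is_derive_id x 1).
    apply: (is_derive_eq (is_deriveB (is_deriveD d2 d4) d3)).
    by rewrite /GRing.scale/= mulr1.
  move: H; lra.
- move=> t t0; rewrite /moser_cc_energy; apply/andP; split.
    rewrite divr_ge0// ?exprn_ge0 ?(ltW rho0)//.
    rewrite addr_ge0 ?le_min ?t0 ?(ltW a0)// -F00.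
    apply: (is_derive_ndecr (y0 t) (fun x _ => dF x)) => x _.
    by rewrite exprn_ge0.
  rewrite ler_pdivrMr ?exprn_gt0// mul1r rhon lerD ?ge_min ?lexx ?orbT//.
  by rewrite /F ler_wpM2l ?(ltW m0)// gerBl Gam_ge0// p0 p1.
Qed.

Lemma moser_cc_linear : exists rho, [/\ 0 < rho, a <= rho ^+ n, rho ^+ n <= n%:R * a &
  forall t, t <= a -> moser_cc t = t / rho].
Proof.
exists rho; split => //; first by rewrite rhon lerDl mulr_ge0// ltW.
  rewrite rhon -[in leRHS]nE -natr1 mulrDl mul1r addrC lerD2r ler_wpM2l// ltW//.
by move=> t ta; rewrite /moser_cc min_l// /y max_r ?subr_le0// f00 addr0.
Qed.

Let q0 : 0 < mexp R n. Proof. exact: mexp_gt0. Qed.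

(** [tangent_pow] for [rho] and the root of w replaces the critical power by an affine function of
    w, which is explicit; the exponential of the result has a primitive in closed form. *)
Lemma moser_cc_powR_ge t : a <= t ->
  n%:R * (a + ln (p (t - a))) - D - (t - a) <= moser_cc t `^ mexp R n - t.
Proof.
move=> at_; have t0 : 0 <= t := le_trans (ltW a0) at_.
have w0 : 0 <= moser_cc t := energy_pair_ge0 moser_cc_energy_pair t0.
rewrite powR_mexpE//.
have := tangent_pow n.-1 (ltW rho0) (nroot_ge0 n (moser_cc t)).
rewrite nE nrootK// rhon => h.
rewrite -(ler_pM2l m0); have {}h : n%:R * moser_cc t * rho - (a + m * D) <= m * nroot n (moser_cc t) ^+ n.
  by rewrite lerBlDr addrC.
rewrite [leRHS]mulrBr; apply: le_trans (lerB h (lexx _)).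
rewrite -mulrA /moser_cc divfK ?gt_eqF// min_r// /y max_l ?subr_ge0// /f.
rewrite le_eqVlt; apply/orP; left; apply/eqP.
have -> : n%:R = m + 1 :> R by rewrite /m natr1 nE.
by ring.
Qed.

Let r (s : R) : R := z s * p s.
Let g (t : R) : R := expR (n%:R * (a + ln (p (t - a))) - D - (t - a)).
(** The primitive of [g]: since z^(n-1) = exp (- s) and z' = - z / m, the derivative of (z p)^(n-1)
    is - exp (- s) p^n. *)
Let P (t : R) : R := - (expR (n%:R * a - D) * r (t - a) ^+ n.-1).

Let gE (t : R) : g t = expR (n%:R * a - D) * (expR (- (t - a)) * p (t - a) ^+ n).
Proof.
rewrite /g -[p _ in RHS]lnK ?posrE// -expRM_natl -!expRD; congr expR; ring.
Qed.

Let zm s : z s ^+ n.-1 = expR (- s).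
Proof. by rewrite /z -expRM_natl; congr expR; rewrite mulrN mulrCA divff ?mulr1// gt_eqF. Qed.

Let dP (t : R) : is_derive t 1 P (g t).
Proof.
have dr (s : R) : is_derive s 1 (fun s => r s ^+ n.-1) (- (expR (- s) * p s ^+ n)).
  have d1 := is_deriveM (dz s) (dp s).
  have d2 := is_deriveX n.-1 d1.
  have -> : (fun s => r s ^+ n.-1) = (z * p : R -> R) ^+ n.-1.
    by apply/funext => x; rewrite exprfctE.
  apply: (is_derive_eq d2); rewrite /GRing.scale/= -zm /r.
  have nE' : n.-1.-1.+1 = n.-1 by case: n hn => [|[]].
  have -> : (z * p) s = z s * p s by [].
  have -> : z s ^+ n.-1 = z s * z s ^+ n.-2 by rewrite -exprS nE'.
  have -> : p s ^+ n = p s * (p s * p s ^+ n.-2) by rewrite -!exprS nE' nE.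
  by rewrite exprMn -/m; field; rewrite gt_eqF.
have d3 := @is_derive1_comp R (fun s => r s ^+ n.-1) (fun t => t - a) t _ _ (dr (t - a))
  (is_deriveB (is_derive_id t 1) (is_derive_cst a t 1)).
have d4 := is_deriveN (is_deriveZ (expR (n%:R * a - D)) d3).
by apply: (is_derive_eq d4); rewrite gE subr0 /GRing.scale/= mulr1 mulrN opprK.
Qed.

Let cg : continuous g.
Proof.
have cp : continuous p.
  move=> s; have d := dp s; apply: differentiable_continuous.
  by apply/derivable1_diffP; exact: ex_derive.
have ct : continuous (fun t : R => t - a).
  by move=> t; apply: cvgB; [exact: cvg_id|exact: cvg_cst].
have -> : g = (fun t => expR (n%:R * a - D) * (expR (- (t - a)) * p (t - a) ^+ n)).
  by apply/funext => t; exact: gE.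
move=> t; apply: cvgM; first exact: cvg_cst.
apply: cvgM.
  apply: (@continuous_comp _ _ _ (fun t : R => - (t - a)) expR).
    by apply: cvgN; exact: ct.
  exact: continuous_expR.
apply: (@continuous_comp _ _ _ (fun t : R => p (t - a)) (fun x => x ^+ n)).
  by apply: (@continuous_comp _ _ _ (fun t : R => t - a) p); [exact: ct|exact: cp].
exact: exprn_continuous.
Qed.

Section lower_bound.
Variable G : R -> R -> R.
Hypothesis hG : mt_exponent n G.

(** The primitive yields exp (a - D) up to its value at T, and a - D = sum (1 - exp (- a))^k / k
    falls short of [harm] by at most m exp (- a), by Bernoulli's inequality. *)
Lemma moser_cc_tail : (forall t, a <= t -> moser_cc t `^ mexp R n <= G t (moser_cc t)) ->
  ((expR (harm R n) - (1 + m * expR (harm R n)) * expR (- a))%:E <=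
   \int[lebesgue_measure]_(t in `[a, +oo[) (expR (G t (moser_cc t) - t))%:E)%E.
Proof.
move=> hbig.
have mI : measurable_fun [set: R] (fun t => (expR (G t (moser_cc t) - t))%:E).
  exact: (measurable_mt_integrand hG (energy_pair_measurable moser_cc_energy_pair)).
(* Far enough for the primitive at T to be at most exp (- a) in absolute value: the factor exp (n a)
   is beaten by exp (- (n + 1) a). *)
pose T := a + (n.+1)%:R * a.
have aT : a <= T by rewrite lerDl mulr_ge0// ltW.
apply: (@le_trans _ _ (\int[lebesgue_measure]_(t in `[a, T]) (g t)%:E)%E); last first.
  apply: (@le_trans _ _ (\int[lebesgue_measure]_(t in `[a, T]) (expR (G t (moser_cc t) - t))%:E)%E).
    apply: ge0_le_integral => //.
    - by move=> t _; rewrite lee_fin expR_ge0.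
    - apply/measurable_EFinP; apply: measurable_funTS; exact: continuous_measurable_fun.
    - exact: measurable_funTS.
    - move=> t; rewrite /= in_itv/= => /andP[at_ _]; rewrite lee_fin ler_expR.
      by apply: (le_trans (moser_cc_powR_ge at_)); rewrite lerD2r hbig.
  apply: ge0_subset_integral => //; first exact: measurable_funTS.
  by move=> t /=; rewrite !in_itv/= andbT => /andP[].
rewrite (integral_is_derive aT dP cg) lee_fin /P opprK [leRHS]addrC.
have -> : T - a = n.+1%:R * a by rewrite /T addrAC subrr add0r.
have Pa : expR (n%:R * a - D) * r (a - a) ^+ n.-1 = expR (a - D).
  rewrite subrr /r p00 {1}/z mul0r oppr0 expR0 mul1r -expRM_natl -expRD; congr expR.
  have -> : n%:R = m + 1 :> R by rewrite /m natr1 nE.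
  by rewrite -/m; ring.
rewrite Pa.
have PT : expR (n%:R * a - D) * r (n.+1%:R * a) ^+ n.-1 <= expR (- a).
  rewrite /r exprMn zm; apply: (@le_trans _ _ (expR (n%:R * a - D) * expR (- (n.+1%:R * a)))).
    rewrite ler_wpM2l ?expR_ge0// ler_piMr ?expR_ge0// exprn_ile1// ltW//.
  by rewrite -expRD ler_expR -natr1; have := D0; lra.
apply: le_trans (lerB (lexx _) PT).
rewrite mulrDl mul1r opprD addrA addrAC lerD2r.
set x := expR (- a); have x1 : 0 <= x <= 1 by case/andP: ea => /ltW -> ->.
have hH : harm R n - (a - D) <= m * x.
  rewrite DE subKr /harm -sumrB.
  apply: (@le_trans _ _ (\sum_(k < n.-1) x)); last by rewrite sumr_const card_ord mulr_natl.
  apply: ler_sum => k _; rewrite -{1}[k.+1%:R^-1]mul1r -mulrBl ler_pdivrMr// mulrC.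
  by have := expr1B_ge k.+1 x1; rewrite -/x; lra.
have -> : expR (a - D) = expR (harm R n) * expR (- (harm R n - (a - D))).
  by rewrite -expRD; congr expR; ring.
have -> : expR (harm R n) - m * expR (harm R n) * x = expR (harm R n) * (1 - m * x) by ring.
rewrite ler_wpM2l ?expR_ge0//; apply: (@le_trans _ _ (1 - (harm R n - (a - D)))).
  by rewrite lerB.
exact: expR_ge1Dx.
Qed.

Lemma moser_cc_head (k : R) : 2 <= a -> 0 <= k ->
  (forall t, 1 <= t < 2 -> k <= G t (moser_cc t)) ->
  ((1 - expR (- a) + k * (expR (- 1) - expR (- 2)))%:E <=
   \int[lebesgue_measure]_(t in `[0%R, a[) (expR (G t (moser_cc t) - t))%:E)%E.
Proof.
move=> a2 k0 hk; have a1 : 1 <= a := le_trans (ler1n R 2) a2.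
have mI : measurable_fun [set: R] (fun t => (expR (G t (moser_cc t) - t))%:E).
  exact: (measurable_mt_integrand hG (energy_pair_measurable moser_cc_energy_pair)).
have I0 t : (0 <= (expR (G t (moser_cc t) - t))%:E)%E by rewrite lee_fin expR_ge0.
have mE : measurable_fun [set: R] (fun t : R => (expR (- t))%:E).
  exact: measurable_expRN.
have iE (x x' : R) : x <= x' ->
    (\int[lebesgue_measure]_(t in `[x, x'[) (expR (- t))%:E = (expR (- x) - expR (- x'))%:E)%E.
  move=> xy; have := integral_expRN x.
  rewrite (ge0_integral_itv_split (x := BLeft x') mE)//.
  rewrite integral_expRN EFinB => <-; rewrite addeK//.
have low (c x x' : R) : 0 <= x -> x <= x' -> 0 <= c -> (forall t, x <= t < x' -> c <= G t (moser_cc t)) ->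
    (((1 + c) * (expR (- x) - expR (- x')))%:E <=
     \int[lebesgue_measure]_(t in `[x, x'[) (expR (G t (moser_cc t) - t))%:E)%E.
  move=> x0 xy c0 hc; rewrite EFinM -iE// -ge0_integralZl_EFin//; last 2 first.
  - exact: measurable_funTS.
  - by rewrite addr_ge0.
  apply: ge0_le_integral => //.
  - by move=> t _; rewrite mule_ge0 ?lee_fin ?expR_ge0 ?addr_ge0.
  - by apply: measurable_funeM; exact: measurable_funTS.
  - exact: measurable_funTS.
  - move=> t; rewrite /= in_itv/= => txy; rewrite -EFinM lee_fin expRD ler_wpM2r ?expR_ge0//.
    by apply: le_trans (expR_ge1Dx _); rewrite lerD2l hc.
rewrite (ge0_integral_itv_split (x := BLeft 1%R) mI I0)//.
rewrite (ge0_integral_itv_split (x := BLeft 2%R) (y := BLeft a) mI I0)//; last first.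
  by rewrite bnd_simp ler1n.
have G0 t : 0 <= t -> 0 <= G t (moser_cc t) := fun t0 => mte_ge0 hG _ t0.
have l1 := low 0 0 1 (lexx 0) ler01 (lexx 0).
have l2 := low k 1 2 ler01 (ler1n R 2) k0 hk.
have l3 := low 0 2 a (ler0n R 2) a2 (lexx 0).
apply: le_trans (leeD (l1 _) (leeD l2 (l3 _))).
- by rewrite -!EFinD lee_fin oppr0 expR0 le_eqVlt; apply/orP; left; apply/eqP; ring.
- by move=> t /andP[t0 _]; exact: G0.
- by move=> t /andP[t0 _]; apply: G0; exact: le_trans t0.
- by rewrite bnd_simp.
Qed.

End lower_bound.

End carleson_chang.

Lemma mtF_gt_concentration (R : realType) (n : nat) (G : R -> R -> R) : (2 <= n)%N ->
  mt_exponent n G -> exists w Phi e, [/\ 0 < e, energy_pair n 1 w Phi &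
  ((1 + expR (harm R n) + 2 * e)%:E <= mtF G w)%E].
Proof.
move=> hn hG.
have nE : n.-1.+1 = n by case: n hn {hG}.
have [k [y1 [k0 y10 hk]]] := mte_cubic hG.
have [y0 hy] := mte_big hG.
set E := expR (harm R n); have E0 : 0 < E := expR_gt0 _.
have H0 : 0 <= harm R n by apply: sumr_ge0 => i _; rewrite invr_ge0.
pose c1 : R := expR (- 1) - expR (- 2).
have c10 : 0 < c1 by rewrite subr_gt0 ltr_expR ltrN2 ltr1n.
pose m : R := n.-1%:R; have m0 : 0 <= m by rewrite ler0n.
(* The total loss is K exp (- a): exp (- a) from cutting exp (- t) at a, and (1 + m E) exp (- a)
   from the tail. *)
pose K := 2 + m * E; have K0 : 0 < K by rewrite ltr_wpDr// mulr_ge0// ltW.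
have n0 : 0 < n%:R :> R by rewrite ltr0n ltnW.
(* Thresholds for a: [b1] gives w <= y1 on [1, 2[, [b2] gives w >= y0 from a on, and [b3] makes the
   gain k c1 / (n a)^3 at least twice the loss, by way of exp (- a) <= 24 / a^4. *)
pose b1 := (2 / y1) ^+ n; have b10 : 0 <= b1 by rewrite exprn_ge0// divr_ge0// ltW.
pose b2 := n%:R * `|y0| ^+ n; have b20 : 0 <= b2 by rewrite mulr_ge0// exprn_ge0.
pose b3 := 48 * K * n%:R ^+ 3 / (k * c1).
have b30 : 0 <= b3 by rewrite divr_ge0 ?mulr_ge0 ?exprn_ge0 ?(ltW k0) ?(ltW c10) ?(ltW K0).
pose a := 2 + harm R n + b1 + b2 + b3.
have a2 : 2 <= a by rewrite /a; lra.
have a0 : 0 < a by apply: lt_le_trans a2.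
have a1 : 1 <= a by apply: le_trans a2; rewrite ler1n.
have ab1 : b1 <= a by rewrite /a; lra.
have ab2 : b2 <= a by rewrite /a; lra.
have ab3 : b3 <= a by rewrite /a; lra.
have wE := moser_cc_energy_pair hn a0.
have [rho [r0 ra rna wl]] := moser_cc_linear hn a0.
have r1 : 1 <= rho.
  rewrite leNgt; apply/negP => h.
  have : rho ^+ n < 1 by rewrite exprn_ilt1 ?(ltW r0)//; rewrite -lt0n ltnW.
  by rewrite ltNge (le_trans a1 ra).
have n_gt0 : (0 < n)%N := ltnW hn.
have ry : 2 / rho <= y1.
  rewrite ler_pdivrMr// mulrC -ler_pdivrMr// -(@ler_pXn2r _ n) ?nnegrE ?(ltW r0)//.
    exact: le_trans ab1 ra.
  by rewrite divr_ge0// ltW.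
have ay : y0 <= a / rho.
  apply: (le_trans (ler_norm _)); rewrite ler_pdivlMr//.
  rewrite -(@ler_pXn2r _ n) ?nnegrE ?(ltW a0) ?mulr_ge0 ?(ltW r0)// exprMn.
  apply: (@le_trans _ _ (`|y0| ^+ n * (n%:R * a))); first by rewrite ler_wpM2l ?exprn_ge0.
  rewrite mulrA [_ * n%:R]mulrC -/b2; apply: (@le_trans _ _ (a * a)).
    by rewrite ler_wpM2r// ltW.
  by rewrite -expr2; apply: ler_weXn2l.
have hbig t : a <= t -> moser_cc n a t `^ mexp R n <= G t (moser_cc n a t).
  move=> at_; have t0 := le_trans (ltW a0) at_.
  apply: hy => //; first exact: energy_pair_ge0 wE t0.
  apply: (le_trans ay); rewrite -wl//; have [_ nd _ _] := wE; exact: nd.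
pose c := k / (n%:R * a) ^+ 3.
have na0 : 0 < n%:R * a by rewrite mulr_gt0.
have c0 : 0 <= c by rewrite divr_ge0 ?exprn_ge0 ?(ltW na0) ?(ltW k0).
have hc t : 1 <= t < 2 -> c <= G t (moser_cc n a t).
  move=> /andP[t1 t2]; have t0 : 0 <= t := le_trans ler01 t1.
  have ta : t <= a by rewrite (le_trans _ a2)// ltW.
  have wt : moser_cc n a t = t / rho by exact: wl.
  have wt0 : 0 <= moser_cc n a t by exact: energy_pair_ge0 wE t0.
  apply: le_trans (hk t _ t0 _); last first.
    rewrite wt0 wt (le_trans _ ry)//= ler_wpM2r ?invr_ge0 ?(ltW r0)// ltW//.
  rewrite /c ler_wpM2l ?(ltW k0)// wt.
  apply: (@le_trans _ _ (rho^-1 ^+ 3)).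
    rewrite -exprVn lerXn2r ?nnegrE ?invr_ge0 ?(ltW r0) ?(ltW na0)//.
    rewrite lef_pV2 ?posrE//; apply: le_trans rna; rewrite -[leLHS]expr1; apply: ler_weXn2l => //.
  rewrite lerXn2r ?nnegrE ?invr_ge0 ?divr_ge0 ?(ltW r0)//.
  by rewrite ler_peMl ?invr_ge0// ltW.
pose e := K * expR (- a) / 2.
exists (moser_cc n a), (moser_cc_energy n a), e; split => //.
  by rewrite divr_gt0// mulr_gt0// expR_gt0.
have l1 := moser_cc_head hn a0 hG a2 c0 hc.
have l2 := moser_cc_tail hn a0 hG hbig.
have mI := measurable_mt_integrand hG (energy_pair_measurable wE).
have I0 t : (0 <= (expR (G t (moser_cc n a t) - t))%:E)%E by rewrite lee_fin expR_ge0.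
rewrite /mtF (ge0_integral_itv_split (x := BLeft a) mI I0)//; last first.
  by rewrite bnd_simp ltW.
apply: le_trans (leeD l1 l2); rewrite -EFinD lee_fin -/m -/E -/c1.
have ee : expR (- a) <= 24 / a ^+ 4.
  rewrite expRN -[leRHS]invrK lef_pV2 ?posrE ?expR_gt0 ?invr_gt0 ?divr_gt0 ?exprn_gt0//.
  rewrite invf_div; apply: le_trans (expR_ge1Dxn 3 (ltW a0)).
  by rewrite lerDr.
have key : 2 * (K * expR (- a)) <= c * c1.
  apply: (@le_trans _ _ (2 * (K * (24 / a ^+ 4)))).
    by rewrite ler_wpM2l// ler_wpM2l// ltW.
  rewrite /c exprMn.
  have -> : k / (n%:R ^+ 3 * a ^+ 3) * c1 = (k * c1 / n%:R ^+ 3 * a) / a ^+ 4.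
    by field; rewrite !gt_eqF.
  have -> : 2 * (K * (24 / a ^+ 4)) = (48 * K) / a ^+ 4 by field; rewrite gt_eqF.
  rewrite ler_wpM2r ?invr_ge0 ?exprn_ge0 ?(ltW a0)//.
  have kc0 : 0 < k * c1 / n%:R ^+ 3 by rewrite divr_gt0 ?exprn_gt0// mulr_gt0.
  rewrite [leRHS]mulrC -ler_pdivrMr//; apply: le_trans ab3.
  by rewrite le_eqVlt; apply/orP; left; apply/eqP; rewrite /b3; field; rewrite !gt_eqF.
have -> : 2 * e = K * expR (- a) by rewrite /e mulrCA divff ?mulr1.
move: key; rewrite /K; set x := expR (- a); lra.
Qed.

(** * Maximizers *)

Lemma ultra_bounded_cvg (R : realType) (T : Type) (U : set_system T) (x : T -> R) (a b : R) :
  UltraFilter U -> (forall k, a <= x k <= b) -> exists l : R, x @ U --> l.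
Proof.
move=> UU xab; have PU := @ultra_proper _ U UU.
have [|l [_ cl]] := segment_compact (a := a) (b := b) (fmap_proper_filter x PU).
  rewrite /fmap/=; apply: filterE => k; rewrite /= in_itv/=; exact: xab.
exists l => A lA; have [//|nA] := in_ultra_setVsetC (x @^-1` A) UU.
by have [y [/=]] := cl (~` A) A nA lA.
Qed.

Section maximizer.
Variables (R : realType) (n : nat) (G : R -> R -> R).
Hypothesis hn : (2 <= n)%N.
Hypothesis hG : mt_exponent n G.
Notation mu := (@lebesgue_measure R).

Let n_gt0 : (0 < n)%N. Proof. exact: ltnW hn. Qed.

Let q (i : nat) : R := if unpickle i is Some r then `|ratr (r : rat)| else 0.

Let q_ge0 i : 0 <= q i. Proof. by rewrite /q; case: unpickle. Qed.

Let q_dense (t d : R) : 0 <= t -> 0 < d -> exists i, t <= q i <= t + d.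
Proof.
move=> t0 d0; have [|r] := @rat_in_itvoo R t (t + d); first by rewrite ltrDl.
rewrite in_itv/= => /andP[tr rt]; exists (pickle r); rewrite /q pickleK.
by rewrite ger0_norm ?(le_trans t0) ?ltW.
Qed.

Let equicontinuous (e : R) : 0 < e -> exists2 d, 0 < d &
  forall w Phi s t, energy_pair n 1 w Phi -> 0 <= s -> s <= t -> t <= s + d ->
  0 <= w t - w s <= e.
Proof.
move=> e0; pose d := Num.min 1 (e ^+ n); have d0 : 0 < d by rewrite lt_min ltr01 exprn_gt0.
exists d => // w Phi s t wE s0 st td; have [_ nd _ _] := wE.
rewrite subr_ge0 nd//=; have ts0 : 0 <= t - s by rewrite subr_ge0.
suff : w (s + (t - s)) - w s <= e by rewrite [s + _]addrC subrK.
apply: (energy_pair_incr hn wE) => //; first exact: ltW.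
rewrite mul1r; have tsd : t - s <= d by rewrite lerBlDl.
apply: (@le_trans _ _ (d ^+ n.-1)); first by rewrite lerXn2r// nnegrE ltW.
apply: (@le_trans _ _ d); last by rewrite ge_min lexx orbT.
have j0 : (0 < n.-1)%N by case: n hn => [|[]].
by rewrite -[leRHS]expr1; apply: ler_wiXn2l => //; [exact: ltW|rewrite ge_min lexx].
Qed.

(* The limit is taken along an ultrafilter; since the [w k] are equicontinuous, it
   is enough that the subsequence converges at the rationals. *)
Lemma energy_pair_compact (w Phi : nat -> R -> R) :
  (forall k, energy_pair n 1 (w k) (Phi k)) ->
  exists v Psi (f : nat -> nat), [/\ energy_pair n 1 v Psi,
    forall N, (N <= f N)%N & forall t, 0 <= t -> w (f N) t @[N --> \oo] --> v t].
Proof.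
move=> wE; have [U [UU ooU]] := @ultraFilterLemma nat \oo _.
have PU := @ultra_proper _ U UU.
have w_ge0 k t : 0 <= t -> 0 <= w k t := fun t0 => energy_pair_ge0 (wE k) t0.
have wb (t : R) : 0 <= t -> forall k, 0 <= w k t <= 1 + t.
  move=> t0 k; rewrite w_ge0//=; have [_ h] := energy_pair_pow_le (wE k) t0.
  have t1 : 1 <= 1 + t by rewrite lerDl.
  rewrite -(@ler_pXn2r _ n) ?nnegrE ?addr_ge0 ?w_ge0//.
  apply: (le_trans h); apply: (@le_trans _ _ ((1 + t) ^+ n.-1)).
    by rewrite lerXn2r ?nnegrE ?addr_ge0// lerDr.
  by apply: ler_weXn2l => //; exact: leq_pred.
have /choice[v vP] (t : R) : exists l : R, 0 <= t -> (fun k => w k t) @ U --> l.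
  have [t0|_] := leP 0 t; last by exists 0.
  by have [l hl] := ultra_bounded_cvg UU (wb t t0); exists l.
have /choice[Psi PsiP] (t : R) : exists l : R, 0 <= t -> (fun k => Phi k t) @ U --> l.
  have [t0|_] := leP 0 t; last by exists 0.
  have b k : 0 <= Phi k t <= 1 by have [_ _ _ h] := wE k; exact: h.
  by have [l hl] := ultra_bounded_cvg UU b; exists l.
(* Frozen at v 0 for negative t: [energy_pair] asks for monotonicity on the whole line, whereas
   convergence is available for t >= 0 only. *)
pose vv (t : R) := v (Num.max t 0).
have m0 (t : R) : 0 <= Num.max t 0 by rewrite le_max lexx orbT.
have vvE t : 0 <= t -> vv t = v t by move=> t0; rewrite /vv max_l.
have vvP t : 0 <= t -> (fun k => w k t) @ U --> vv t by move=> t0; rewrite vvE//; exact: vP.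
have vE : energy_pair n 1 vv Psi.
  split.
  - have h := vvP 0 (lexx _); have h0 : (fun k => w k 0) @ U --> (0 : R).
      have -> : (fun k => w k 0) = cst 0 by apply/funext => k; have [->] := wE k.
      exact: cvg_cst.
    exact: (cvg_unique _ h h0).
  - move=> s t st; apply: (ler_cvg_to (vP _ (m0 s)) (vP _ (m0 t))).
    apply: nearW => k; have [_ nd _ _] := wE k; apply: nd.
    by rewrite ge_max !le_max st lexx orbT.
  - move=> s t s0 st; have t0 := le_trans s0 st.
    have c1 : (fun k => (w k t - w k s) ^+ n) @ U --> (vv t - vv s) ^+ n.
      apply: (@cvg_comp _ _ _ (fun k => w k t - w k s) (fun x => x ^+ n)).
        by apply: cvgB; exact: vvP.
      exact: exprn_continuous.
    have c2 : (fun k => (Phi k t - Phi k s) * (t - s) ^+ n.-1) @ U --> (Psi t - Psi s) * (t - s) ^+ n.-1.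
      by apply: cvgMl; apply: cvgB; exact: PsiP.
    apply: (ler_cvg_to c1 c2); apply: nearW => k.
    by have [_ _ h _] := wE k; exact: h.
  - move=> t t0; apply/andP; split.
      apply: (cvgr_to_ge (PsiP _ t0)); apply: nearW => k.
      by have [_ _ _ /(_ t t0)/andP[]] := wE k.
    apply: (cvgr_to_le (PsiP _ t0)); apply: nearW => k.
    by have [_ _ _ /(_ t t0)/andP[]] := wE k.
(* A diagonal choice: an index at least N whose function is within 1 / (N + 1) of the limit at the
   first N + 1 rationals. *)
have /choice[f fP] (N : nat) : exists k, (N <= k)%N /\
    forall i : 'I_N.+1, `|vv (q i) - w k (q i)| < N.+1%:R^-1.
  have h1 : U [set k | (N <= k)%N] by apply: ooU; exact: nbhs_infty_ge.
  have h2 : \forall k \near U, forall i : 'I_N.+1, `|vv (q i) - w k (q i)| < N.+1%:R^-1.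
    apply: (@filter_forall _ 'I_N.+1) => i.
    by have /cvgrPdist_lt := vvP _ (q_ge0 i); apply.
  by have [k] := filter_ex (filterI h1 h2); exists k.
exists vv, Psi, f; split => // [N|t t0]; first by case: (fP N).
apply/cvgrPdist_lt => e e0; have e4 : 0 < e / 4 by rewrite divr_gt0.
have [d d0 hd] := equicontinuous e4.
have [i /andP[ti id_]] := q_dense t0 d0.
near=> N.
have /andP[a1 a2] := hd _ _ _ _ vE t0 ti id_.
have /andP[b1 b2] := hd _ _ _ _ (wE (f N)) t0 ti id_.
have iN : (i < N.+1)%N by rewrite ltnS; near: N; exact: nbhs_infty_ge.
have [_ /(_ (Ordinal iN))/= c] := fP N.
have Ne : N.+1%:R^-1 < e / 4.
  by near: N; exact: (near_infty_natSinv_lt (PosNum e4)).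
move: c Ne; set x := N.+1%:R^-1; rewrite !ltr_norml => /andP[c1 c2] Ne; apply/andP; split; lra.
Unshelve. all: by end_near. Qed.

(** Finiteness of the integral is the case psi = 0, of energy 0, of [dual_inequality]. *)
Lemma integrable_expR_rate (C nu : R) : 0 < nu ->
  mu.-integrable (`[0%R, +oo[%classic : set R) (fun t : R => (expR (C - nu * t))%:E).
Proof.
move=> nu0; have z : energy_pair n 0 (fun=> 0 : R) (fun=> 0).
  split => //; [by move=> s t s0 st; rewrite subrr mul0r expr0n; case: n n_gt0|].
  by move=> t _; rewrite lexx.
have m (C' : R) : measurable_fun [set: R] (fun t : R => (expR (C' - nu * t))%:E).
  apply/measurable_EFinP; apply: measurableT_comp => //; apply: measurable_funB => //.
apply/integrableP; split; first by apply: measurable_funTS; exact: m.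
have -> : (\int[mu]_(t in (`[0%R, +oo[%classic : set R)) `|(expR (C - nu * t))%:E| =
   \int[mu]_(t in `[0%R, +oo[) ((expR C)%:E * (expR (0 - nu * t))%:E))%E.
  by apply: eq_integral => t _; rewrite /= ger0_norm ?expR_ge0// -EFinM -expRD sub0r.
rewrite ge0_integralZl_EFin ?expR_ge0//; last by apply: measurable_funTS; exact: m.
apply: (@le_lt_trans _ _ ((expR C)%:E * (nu^-1 * expR (harm R n + lcst R n * 0 / nu ^+ n.-1))%:E)%E).
  by apply: lee_wpmul2l; [rewrite lee_fin expR_ge0|exact: (dual_inequality hn z nu0)].
by rewrite -EFinM ltry.
Qed.

Lemma mtF_cvg (w : nat -> R -> R) (v : R -> R) (C nu : R) : 0 < nu ->
  (forall k, measurable_fun [set: R] (w k)) ->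
  (forall k t, 0 <= t -> G t (w k t) <= (1 - nu) * t + C) ->
  (forall t, 0 <= t -> w k t @[k --> \oo] --> v t) ->
  mtF G (w k) @[k --> \oo] --> mtF G v.
Proof.
move=> nu0 mw wC wv; rewrite /mtF.
apply: (@dominated_cvg _ _ R mu (`[0%R, +oo[%classic : set R) (measurable_itv _)
  (fun k t => (expR (G t (w k t) - t))%:E) (fun t => (expR (G t (v t) - t))%:E)
  (fun t => (expR (C - nu * t))%:E)).
- by move=> k; apply: measurable_funTS; exact: (measurable_mt_integrand hG (mw k)).
- move=> t; rewrite /= in_itv/= andbT => t0; apply: cvg_EFin; first exact: nearW.
  apply: (@cvg_comp _ _ _ (fun k => G t (w k t) - t) expR); last exact: continuous_expR.
  apply: cvgB; last exact: cvg_cst.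
  apply: (@cvg_comp _ _ _ (fun k => w k t) (G t)); first exact: wv.
  exact: (mte_continuous hG t0).
- by [].
- exact: integrable_expR_rate.
- move=> k t; rewrite /= in_itv/= andbT => t0.
  rewrite ger0_norm ?expR_ge0// lee_fin ler_expR.
  by have := wC k t t0; lra.
Qed.

(* Below the concentration level, mass cannot concentrate, so a maximizing
   sequence is dominated. *)
Lemma mt_maximizer : exists w Phi, energy_pair n 1 w Phi /\
  forall v Psi, energy_pair n 1 v Psi -> (mtF G v <= mtF G w)%E.
Proof.
have [w1 [Phi1 [e [e0 w1E hw1]]]] := mtF_gt_concentration hn hG.
have [A [eta [A1 eta0 hconc]]] := concentration hn hG e0.
have [s [C [s1 hsub]]] := subcritical_bound hn hG A1 eta0.
set c := 1 + expR (harm R n) + e in hconc.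
pose X := [set y | exists w Phi, energy_pair n 1 w Phi /\ y = mtF G w].
have X1 : X (mtF G w1) by exists w1, Phi1.
have nu0 : 0 < 1 - s by rewrite subr_gt0.
have sub w Phi : energy_pair n 1 w Phi -> (c%:E < mtF G w)%E -> forall t, 0 <= t ->
    G t (w t) <= (1 - (1 - s)) * t + C.
  move=> wE cw t t0; rewrite subKr; apply: (hsub _ _ wE) => //.
  rewrite leNgt; apply/negP => wA; move: cw; apply/negP; rewrite -leNgt.
  by apply: (hconc _ _ wE); exact: ltW.
have fin : ereal_sup X \is a fin_num.
  rewrite fin_numElt; apply/andP; split.
    apply: (@lt_le_trans _ _ (1 + expR (harm R n) + 2 * e)%:E); first by rewrite ltNyr.
    by apply: (le_trans hw1); exact: ereal_sup_ubound.
  pose I := (\int[mu]_(t in (`[0%R, +oo[%classic : set R)) (expR (C - (1 - s) * t))%:E)%E.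
  have Ifin : I \is a fin_num by apply: integrable_fin_num => //; exact: integrable_expR_rate.
  apply: (@le_lt_trans _ _ (maxe c%:E I)); last by rewrite gt_max ltry/= ltey_eq Ifin.
  apply: ge_ereal_sup => y [w [Phi [wE ->]]]; rewrite le_max.
  have [le1|cw] := leP (mtF G w) c%:E; [by []|rewrite /=].
  rewrite /mtF /I; apply: ge0_le_integral => //.
  - apply: measurable_funTS; exact: (measurable_mt_integrand hG (energy_pair_measurable wE)).
  - by have /integrableP[] := integrable_expR_rate C nu0.
  - move=> t; rewrite /= in_itv/= andbT => t0; rewrite lee_fin ler_expR.
    by have := sub w Phi wE cw t t0; lra.
have /choice[w wP] (k : nat) : exists w, exists Phi, [/\ energy_pair n 1 w Phi, (c%:E < mtF G w)%E &
    (ereal_sup X - (k.+1%:R^-1)%:E < mtF G w)%E].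
  (* The minimum with e keeps every term above c, since the supremum exceeds the level by at least 2
     e and c by only e. *)
  have m0 : 0 < Num.min e k.+1%:R^-1 by rewrite lt_min e0 invr_gt0 ltr0Sn.
  have [y [w [Phi [wE ->]]] h] := ub_ereal_sup_adherent m0 fin.
  exists w, Phi; split => //; apply: le_lt_trans h.
    apply: (@le_trans _ _ (mtF G w1 - e%:E)%E).
      rewrite leeBrDr//; apply: le_trans hw1; rewrite -EFinD lee_fin /c; lra.
    apply: leeB; first exact: ereal_sup_ubound.
    by rewrite lee_fin ge_min lexx.
  by apply: leeB => //; rewrite lee_fin ge_min lexx orbT.
have /choice[Phi wE] := wP.
have [v [Psi [f [vE fN wv]]]] := energy_pair_compact (fun k => let: And3 h _ _ := wE k in h).
exists v, Psi; split => // u Theta uE.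
apply: (@le_trans _ _ (ereal_sup X)); first by apply: ereal_sup_ubound; exists u, Theta.
have cv : mtF G (w (f N)) @[N --> \oo] --> mtF G v.
  apply: (mtF_cvg nu0) => //.
    by move=> k; have [h _ _] := wE (f k); exact: energy_pair_measurable h.
  by move=> k t t0; have [h h1 _] := wE (f k); exact: sub h h1 t t0.
have cS : (ereal_sup X - (N.+1%:R^-1)%:E)%E @[N --> \oo] --> ereal_sup X.
  rewrite -[X in _ --> X](fineK fin); apply: cvg_EFin.
    by apply: nearW => N; rewrite fin_numB fin.
  have -> : (fine \o (fun N : nat => ereal_sup X - (N.+1%:R^-1)%:E)%E) =
     (fun N => fine (ereal_sup X) - N.+1%:R^-1).
    by apply/funext => N; exact: (fineB fin).
  apply/cvgrPdist_lt => d d0; near=> N.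
  rewrite opprB addrC subrK ger0_norm ?invr_ge0//.
  by near: N; exact: (near_infty_natSinv_lt (PosNum d0)).
apply: (lee_cvg_to cS cv); apply: nearW => N.
have [_ _ h] := wE (f N); apply: le_trans (ltW h); apply: leeB => //.
by rewrite lee_fin lef_pV2 ?posrE// ler_nat ltnS.
Unshelve. all: by end_near. Qed.

End maximizer.

(** * The exponents of the two functionals *)

Lemma measurable_powR2 d (T : measurableType d) (R : realType) (D : set T) (f g : T -> R) :
  measurable D -> measurable_fun D f -> measurable_fun D g ->
  measurable_fun D (fun x => f x `^ g x).
Proof.
move=> mD mf mg; rewrite /powR; apply: measurable_fun_if => //.
- exact: measurable_fun_eqr.
- apply: (measurable_funS mD); first by move=> x [].
  by apply: measurableT_comp => //; exact: measurable_fun_eqr.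
- apply: (measurable_funS mD); first by move=> x [].
  apply: measurableT_comp => //; apply: measurable_funM => //.
  exact: measurableT_comp.
Qed.

Lemma continuous_norm_powR (R : realType) (r : R) : 1 <= r -> continuous (fun y : R => `|y| `^ r).
Proof.
move=> r1 y; have r0 : 0 < r := lt_le_trans ltr01 r1.
have [->|y0] := eqVneq y 0.
  rewrite /continuous_at normr0 powR0 ?gt_eqF//.
  apply/cvgrPdist_lt => e e0; near=> x.
  rewrite sub0r normrN ger0_norm ?powR_ge0//.
  have [->|x0] := eqVneq x 0; first by rewrite normr0 powR0 ?gt_eqF.
  have x1 : `|x| < Num.min 1 e.
    near: x; have m0 : 0 < Num.min 1 e by rewrite lt_min ltr01.
    have := @nbhsx_ballx R R 0 _ m0; apply: filterS => x.
    by rewrite /ball/= sub0r normrN.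
  move: x1; rewrite lt_min => /andP[x1 xe]; apply: le_lt_trans xe.
  by apply: ge1r_powR => //; rewrite normr_gt0 x0 ltW.
apply: (@continuous_comp _ _ _ (fun y : R => `|y|) (fun y => y `^ r)).
  exact: norm_continuous.
apply: differentiable_continuous; apply/derivable1_diffP; apply: derivable_powR.
by rewrite in_itv/= andbT normr_gt0.
Unshelve. all: by end_near. Qed.

(** Three factors are what the second functional consumes: t (1 + t)^2 against exp (- g t) has to
    stay bounded. *)
Lemma expRN_cubic_bound (R : realType) (g : R) : 0 < g ->
  exists2 C, 0 <= C & forall t, 0 <= t -> expR (- (g * t)) * (1 + t) ^+ 3 <= C.
Proof.
move=> g0; exists (6 * expR g / g ^+ 3).
  by rewrite divr_ge0 ?exprn_ge0 ?mulr_ge0 ?expR_ge0 ?(ltW g0).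
move=> t t0; have x0 : 0 <= g * (1 + t) by rewrite mulr_ge0 ?addr_ge0// ltW.
have h : (g * (1 + t)) ^+ 3 / 6 <= expR (g * (1 + t)).
  by apply: le_trans (expR_ge1Dxn 2 x0); rewrite lerDr.
rewrite ler_pdivlMr ?exprn_gt0// -mulrA -exprMn [(1 + t) * g]mulrC.
rewrite [leLHS]mulrC expRN ler_pdivrMr ?expR_gt0// -mulrA -expRD.
rewrite (_ : g + g * t = g * (1 + t)); last by ring.
by rewrite [leRHS]mulrC -ler_pdivrMr.
Qed.

Lemma expR_sub1_le (R : realType) (x : R) : expR x - 1 <= x * expR x.
Proof.
have := expR_ge1Dx (- x); rewrite expRN => /(ler_wpM2r (expR_ge0 x)).
by rewrite mulVf ?gt_eqF ?expR_gt0// mulrBl mul1r; lra.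
Qed.

Section exponents.
Variables (R : realType) (n : nat).
Hypothesis hn : (2 <= n)%N.
Notation q := (mexp R n).

Let n1_gt0 : (0 < n.-1)%N. Proof. by case: n hn => [|[]]. Qed.
Let nE : n.-1.+1 = n. Proof. by case: n hn. Qed.

Lemma mexp_ge1 : 1 <= q.
Proof. by rewrite /mexp ler_pdivlMr ?ltr0n// mul1r ler_nat leq_pred. Qed.

Lemma mexp_le2 : q <= 2.
Proof.
rewrite /mexp ler_pdivrMr ?ltr0n// -natrM ler_nat mul2n -addnn -[leqLHS]nE.
by rewrite -addn1 leq_add2l.
Qed.

(** The single rate C / (1 + t) provides both the uniform excess over the critical power and its
    decay at infinity; the linear bound near 0 gives smallness uniformly in t. *)
Lemma mt_exponent_intro (G : R -> R -> R) (C : R) :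
  (forall t y, 0 <= t -> 0 <= G t y) ->
  (forall t y z, 0 <= t -> 0 <= y -> y <= z -> G t y <= G t z) ->
  0 <= C ->
  (forall t y, 0 <= t -> 0 <= y -> y ^+ n <= t ^+ n.-1 ->
    G t y <= y `^ q + C / (1 + t)) ->
  (exists2 L, 0 < L & forall t y, 0 <= t -> 0 <= y -> y <= L^-1 -> G t y <= L * y) ->
  (exists y0, forall t y, 0 <= t -> 0 <= y -> y0 <= y -> y `^ q <= G t y) ->
  (exists k y1, [/\ 0 < k, 0 < y1 &
    forall t y, 0 <= t -> 0 <= y <= y1 -> k * y ^+ 3 <= G t y]) ->
  (forall t, 0 <= t -> continuous (G t)) ->
  (forall w, measurable_fun [set: R] w -> measurable_fun [set: R] (fun t => G t (w t))) ->
  mt_exponent n G.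
Proof.
move=> G0 Gm C0 Gle [L L0 GL] Gb Gc Gcont Gmeas; split => //.
- exists C => t y t0 y0 yt; apply: (le_trans (Gle t y t0 y0 yt)); rewrite lerD2l.
  by rewrite ler_pdivrMr ?ltr_pwDl// ler_peMr// lerDl.
- move=> e e0; exists (C / e) => t y t0 tA y0 yt; apply: (le_trans (Gle t y t0 y0 yt)).
  rewrite lerD2l ler_pdivrMr ?ltr_pwDl// mulrDr mulr1.
  rewrite -[leLHS]add0r lerD// ?(ltW e0)//.
  by rewrite mulrC -ler_pdivrMr.
- move=> A e e0; exists (Num.min L^-1 (e / L)).
    by rewrite lt_min invr_gt0 L0 divr_gt0.
  move=> t y /andP[t0 _] /andP[y0]; rewrite le_min => /andP[yL ye].
  apply: (le_trans (GL t y t0 y0 yL)).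
  by rewrite mulrC -ler_pdivlMr.
Qed.

(* Normalizations of the two exponents in the variables [t = tvar x] and
   [y = mtc * |u x|], where [|x| `^ alpha = expR (- (g * t))]. *)
Definition exponent1 (kappa g t y : R) : R := (1 + kappa * expR (- (g * t))) * `|y| `^ q.
Definition exponent2 (c g t y : R) : R := c `^ q * (`|y| / c) `^ (q + expR (- (g * t))).

Let le1 (g t : R) : 0 < g -> 0 <= t -> expR (- (g * t)) <= 1.
Proof. by move=> g0 t0; rewrite -[leRHS]expR0 ler_expR oppr_le0 mulr_ge0// ltW. Qed.

Let powR_cube_le (a r : R) : 0 <= a <= 1 -> 1 <= r <= 3 -> a ^+ 3 <= a `^ r <= a.
Proof.
move=> /andP[a0 a1] /andP[r1 r3].
have [->|a0'] := eqVneq a 0.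
  by rewrite expr0n/= powR0 ?lexx// gt_eqF// (lt_le_trans ltr01).
have {}a0 : 0 < a <= 1 by rewrite lt_neqAle eq_sym a0' a0.
rewrite ge1r_powR// andbT -powR_mulrn; last by case/andP: a0 => /ltW.
exact: ger_powR.
Qed.

Lemma measurable_exponent1 d (T : measurableType d) (D : set T) (kappa g : R) (f w : T -> R) :
  measurable D -> measurable_fun D f -> measurable_fun D w ->
  measurable_fun D (fun x => exponent1 kappa g (f x) (w x)).
Proof.
move=> mD mf mw; apply: measurable_funM.
  apply: measurable_funD => //; apply: measurable_funM => //.
  apply: measurableT_comp => //; apply: measurableT_comp => //.
  exact: measurable_funM.
by apply: measurable_powR2 => //; exact: measurableT_comp.
Qed.

Lemma measurable_exponent2 d (T : measurableType d) (D : set T) (c g : R) (f w : T -> R) :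
  measurable D -> measurable_fun D f -> measurable_fun D w ->
  measurable_fun D (fun x => exponent2 c g (f x) (w x)).
Proof.
move=> mD mf mw; apply: measurable_funM => //; apply: measurable_powR2 => //.
  by apply: measurable_funM => //; exact: measurableT_comp.
apply: measurable_funD => //.
apply: measurableT_comp => //; apply: measurableT_comp => //.
exact: measurable_funM.
Qed.

Lemma mt_exponent1 (kappa g : R) : 0 <= kappa -> 0 < g -> mt_exponent n (exponent1 kappa g).
Proof.
move=> k0 g0; have q1 := mexp_ge1; have q0 : 0 <= q := le_trans ler01 q1.
have [C C0 hC] := expRN_cubic_bound g0.
have m1 t : 1 <= 1 + kappa * expR (- (g * t)) by rewrite lerDl mulr_ge0// expR_ge0.
have m0 t : 0 <= 1 + kappa * expR (- (g * t)) := le_trans ler01 (m1 t).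
have q3 : 1 <= q <= 3 by rewrite q1 (le_trans mexp_le2)// ler_nat.
apply: (@mt_exponent_intro _ (kappa * C)).
- by move=> t y t0; rewrite mulr_ge0// powR_ge0.
- move=> t y z t0 y0 yz; rewrite ler_wpM2l// ge0_ler_powR ?nnegrE//.
  by rewrite !ger0_norm// (le_trans y0).
- exact: mulr_ge0.
- move=> t y t0 y0 yt; rewrite /exponent1 mulrDl mul1r ger0_norm// lerD2l.
  rewrite -!mulrA ler_wpM2l// ler_pdivlMr ?ltr_pwDl//.
  have yq : y `^ q <= t by exact: powR_mexp_le.
  apply: le_trans (hC t t0); rewrite -mulrA ler_wpM2l ?expR_ge0//.
  rewrite exprSr ler_wpM2r ?addr_ge0//; apply: (le_trans yq).
  by rewrite expr2; nra.
- exists (1 + kappa); first by rewrite ltr_pwDl.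
  move=> t y t0 y0 yL.
  have y1 : 0 <= y <= 1.
    by rewrite y0 (le_trans yL)// invf_le1 ?ltr_pwDl// lerDl.
  have /andP[_ h] := powR_cube_le y1 q3.
  rewrite /exponent1 ger0_norm//; apply: ler_pM => //; first exact: powR_ge0.
  by rewrite lerD2l ler_piMr// le1.
- by exists 0 => t y t0 y0 _; rewrite /exponent1 ger0_norm// ler_peMl// powR_ge0.
- exists 1, 1; split => // t y t0 y1; rewrite mul1r.
  have /andP[h _] := powR_cube_le y1 q3; have /andP[y0 _] := y1.
  by rewrite /exponent1 ger0_norm//; apply: (le_trans h); rewrite ler_peMl// powR_ge0.
- move=> t t0 y; apply: cvgMr; exact: continuous_norm_powR.
- by move=> w mw; apply: measurable_exponent1.
Qed.

Lemma mt_exponent2 (c g : R) : 0 < c -> 0 < g -> mt_exponent n (exponent2 c g).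
Proof.
move=> c0 g0; have q1 := mexp_ge1; have q0 : 0 <= q := le_trans ler01 q1.
have [C C0 hC] := expRN_cubic_bound g0.
pose eps t := expR (- (g * t)).
have eps0 t : 0 < eps t := expR_gt0 _.
have cq0 : 0 < c `^ q := powR_gt0 _ c0.
have r0 t : 1 <= q + eps t by rewrite (le_trans q1)// lerDl ltW.
have r3 t : 0 <= t -> 1 <= q + eps t <= 3.
  move=> t0; rewrite r0/=; have := le1 g0 t0; have := mexp_le2; rewrite /eps; lra.
have cE y : 0 <= y -> c `^ q * (y / c) `^ q = y `^ q.
  by move=> y0; rewrite -powRM ?divr_ge0 ?(ltW c0)// mulrC divfK// gt_eqF.
pose Z := C / c; have Z0 : 0 <= Z by rewrite divr_ge0// ltW.
have a0 y : 0 <= y -> 0 <= y / c by move=> y0; rewrite divr_ge0// ltW.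
have Ez t y : 0 <= y -> exponent2 c g t y = c `^ q * (y / c) `^ (q + eps t).
  by move=> y0; rewrite /exponent2 ger0_norm.
apply: (@mt_exponent_intro _ (Z * expR Z)).
- by move=> t y t0; rewrite mulr_ge0// powR_ge0.
- move=> t y z t0 y0 yz; rewrite !Ez ?(le_trans y0)// ler_wpM2l ?(ltW cq0)//.
  apply: ge0_ler_powR; first exact: le_trans ler01 (r0 t).
  - by rewrite nnegrE a0.
  - by rewrite nnegrE a0// (le_trans y0).
  by rewrite ler_wpM2r// invr_ge0 ltW.
- by rewrite mulr_ge0// expR_ge0.
- move=> t y t0 y0 yt; rewrite Ez//; have t1 : 0 < 1 + t by rewrite ltr_pwDl.
  have CC : 0 <= Z * expR Z / (1 + t) := divr_ge0 (mulr_ge0 Z0 (expR_ge0 _)) (ltW t1).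
  (* For y <= c, raising the exponent lowers the power, so there is no excess at all. *)
  have [a1|a1] := leP (y / c) 1.
    apply: (@le_trans _ _ (y `^ q)); last by rewrite lerDl.
    rewrite -(cE y y0) ler_wpM2l ?(ltW cq0)//.
    have [->|a0'] := eqVneq (y / c) 0.
      by rewrite !powR0// gt_eqF// (lt_le_trans ltr01).
    by apply: ger_powR; rewrite ?lerDl ?(ltW (eps0 t))// lt_neqAle eq_sym a0' a0.
  have a_gt0 : 0 < y / c := lt_trans ltr01 a1.
  rewrite powRD; last by rewrite (gt_eqF a_gt0) implybT.
  rewrite mulrA cE//.
  have yq : y `^ q <= t by exact: powR_mexp_le.
  have y1t : y <= 1 + t.
    rewrite -(@ler_pXn2r _ n) ?nnegrE ?(ltW t1)//; last by rewrite -nE.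
    apply: (le_trans yt); apply: (@le_trans _ _ ((1 + t) ^+ n.-1)).
      by rewrite lerXn2r ?nnegrE ?(ltW t1)// lerDr.
    by apply: ler_weXn2l; [rewrite lerDl|exact: leq_pred].
  (* The extra factor is exp x with x <= eps t (1 + t) / c. Since the critical power of y is at most
     t, the excess is at most t (exp x - 1) <= t x exp x, and eps decays exponentially. *)
  set x := eps t * ln (y / c).
  have -> : (y / c) `^ eps t = expR x by rewrite /powR gt_eqF.
  have lny : 0 <= ln (y / c) by rewrite ln_ge0// ltW.
  have x0 : 0 <= x by rewrite mulr_ge0// ltW.
  have xle : x <= eps t * (1 + t) / c.
    rewrite /x -mulrA ler_wpM2l ?(ltW (eps0 t))//.
    apply: (@le_trans _ _ (y / c)); last by rewrite ler_wpM2r// invr_ge0 ltW.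
    by have := expR_ge1Dx (ln (y / c)); rewrite lnK ?posrE//; lra.
  have p1 : 1 <= 1 + t by rewrite lerDl.
  have e1 : eps t * (1 + t) <= C.
    apply: le_trans (hC t t0); rewrite ler_wpM2l ?(ltW (eps0 t))//.
    by rewrite -[leLHS]expr1; apply: ler_weXn2l.
  have xZ : x <= Z by apply: (le_trans xle); rewrite ler_wpM2r// invr_ge0 ltW.
  have tx : t * x <= Z / (1 + t).
    rewrite ler_pdivlMr//; apply: (@le_trans _ _ (t * (eps t * (1 + t) / c) * (1 + t))).
      by rewrite ler_wpM2r ?(ltW t1)// ler_wpM2l.
    have -> : t * (eps t * (1 + t) / c) * (1 + t) = (eps t * (t * (1 + t) ^+ 2)) / c by ring.
    rewrite ler_wpM2r ?invr_ge0 ?(ltW c0)//; apply: le_trans (hC t t0).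
    rewrite ler_wpM2l ?(ltW (eps0 t))// [leRHS]exprS ler_wpM2r ?exprn_ge0 ?(ltW t1)//.
    by rewrite lerDr.
  rewrite -lerBlDl -{2}[y `^ q]mulr1 -mulrBr.
  apply: (@le_trans _ _ (t * (x * expR x))).
    apply: ler_pM; rewrite ?powR_ge0 ?expR_sub1_le//.
    by rewrite subr_ge0 -[leLHS]expR0 ler_expR.
  rewrite mulrA [leRHS]mulrAC; apply: ler_pM => //; [exact: mulr_ge0|by rewrite ler_expR].
- exists (Num.max (c `^ q / c) c^-1); first by rewrite lt_max invr_gt0 c0 orbT.
  move=> t y t0 y0; rewrite Ez// => yL.
  have yc : y <= c.
    apply: (le_trans yL); rewrite -[leRHS]invrK lef_pV2 ?posrE ?invr_gt0//.
      by rewrite le_max lexx orbT.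
    by rewrite lt_max invr_gt0 c0 orbT.
  have a1 : 0 <= y / c <= 1 by rewrite a0//= ler_pdivrMr// mul1r.
  have /andP[_ h] := powR_cube_le a1 (r3 t t0).
  apply: (@le_trans _ _ (c `^ q * (y / c))); first by rewrite ler_wpM2l// ltW.
  by rewrite mulrA mulrAC ler_wpM2r// le_max lexx.
- exists c => t y t0 y0 cy; rewrite Ez// -(cE y y0) ler_wpM2l ?(ltW cq0)//.
  by apply: ler_powR; rewrite ?lerDl ?(ltW (eps0 t))// ler_pdivlMr// mul1r.
- exists (c `^ q / c ^+ 3), c; split => //; first by rewrite divr_gt0// exprn_gt0.
  move=> t y t0 /andP[y0 yc]; rewrite Ez//.
  have a1 : 0 <= y / c <= 1 by rewrite a0//= ler_pdivrMr// mul1r.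
  have /andP[h _] := powR_cube_le a1 (r3 t t0).
  by rewrite mulrAC -mulrA -expr_div_n ler_wpM2l// ltW.
- move=> t t0.
  have -> : exponent2 c g t = (fun y => c `^ q * `|y / c| `^ (q + eps t)).
    by apply/funext => y; rewrite normrM (gtr0_norm (x := c^-1)) ?invr_gt0.
  move=> y; apply: cvgMr.
  apply: (@continuous_comp _ _ _ (fun y : R => y / c) (fun y => `|y| `^ (q + eps t))).
    by apply: cvgMl; exact: cvg_id.
  exact: continuous_norm_powR.
- by move=> w mw; apply: measurable_exponent2.
Qed.

End exponents.

(** * Attainment on the ball *)

Section attained.
Variables (R : realType) (n : nat).
Hypothesis hn : (2 <= n)%N.
Notation mu := (@lebesgue_rV R n).
Notation B := (unit_ball R n).
Notation c := (mtc R n).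

Let n0 : (0 < n)%N. Proof. exact: ltnW hn. Qed.
Let nE : n.-1.+1 = n. Proof. by case: n hn. Qed.
Let mB : measurable B. Proof. exact: measurable_unit_ball. Qed.
Let c0 : 0 < c. Proof. exact: mtc_gt0. Qed.

(** The (n-1)-th powers of both sides are n^n V, because the sphere has area n V. *)
Lemma mtc_mexp : c `^ mexp R n = mt_const R n.
Proof.
have j0 : (0 < n.-1)%N by case: n hn => [|[]].
have K0 : 0 <= mt_const R n by rewrite mulr_ge0// powR_ge0.
apply/eqP; rewrite -(@eqrXn2 _ n.-1)// ?powR_ge0//; apply/eqP.
rewrite powR_mexp_pow ?(ltW c0)// mtc_pow//.
rewrite /mt_const exprMn sphere_areaE//.
have -> : ((n%:R * ball_vol R n) `^ n.-1%:R^-1) ^+ n.-1 = n%:R * ball_vol R n.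
  by apply: (nrootK hn); rewrite mulr_ge0// ltW// ball_vol_gt0.
by rewrite -[in LHS]nE exprS nE; ring.
Qed.

Lemma enorm_powR_tvar (alpha : R) (x : 'rV[R]_n) : x != 0 ->
  enorm x `^ alpha = expR (- (alpha / n%:R * tvar x)).
Proof.
move=> x0; rewrite /powR gt_eqF ?enorm_gt0//; congr expR; rewrite /tvar; field.
by rewrite pnatr_eq0 -lt0n.
Qed.

Lemma exponent1E (alpha : R) (u : 'rV[R]_n -> R) (x : 'rV[R]_n) : x != 0 ->
  (mt_const R n + enorm x `^ alpha) * `|u x| `^ (n%:R / n.-1%:R) =
  exponent1 n (mt_const R n)^-1 (alpha / n%:R) (tvar x) (c * `|u x|).
Proof.
move=> x0; rewrite enorm_powR_tvar// /exponent1 (ger0_norm (mulr_ge0 (ltW c0) (normr_ge0 _))).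
rewrite powRM ?(ltW c0)// mtc_mexp mulrA; congr (_ * _).
have K0 : mt_const R n != 0 by rewrite -mtc_mexp gt_eqF// powR_gt0.
by field.
Qed.

Lemma exponent2E (alpha : R) (u : 'rV[R]_n -> R) (x : 'rV[R]_n) : x != 0 ->
  mt_const R n * `|u x| `^ (n%:R / n.-1%:R + enorm x `^ alpha) =
  exponent2 n c (alpha / n%:R) (tvar x) (c * `|u x|).
Proof.
move=> x0; rewrite enorm_powR_tvar// /exponent2 (ger0_norm (mulr_ge0 (ltW c0) (normr_ge0 _))).
by rewrite mtc_mexp [c * _]mulrC mulfK// gt_eqF.
Qed.

Variables (G : R -> R -> R) (J : ('rV[R]_n -> R) -> 'rV[R]_n -> R).
Hypothesis hG : mt_exponent n G.
Hypothesis measurable_G : forall f w : 'rV[R]_n -> R,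
  measurable_fun B f -> measurable_fun B w -> measurable_fun B (fun x => G (f x) (w x)).
Hypothesis measurable_J : forall u, measurable_fun B u -> measurable_fun B (J u).
Hypothesis JE : forall u x, x != 0 -> J u x = G (tvar x) (c * `|u x|).

Let I (u : 'rV[R]_n -> R) : \bar R := (\int[mu]_(x in B) (expR (J u x))%:E)%E.

Let mT : measurable_fun B (@tvar R n).
Proof. apply: measurable_funTS; exact: measurable_tvar. Qed.

Let mEX (f : 'rV[R]_n -> R) : measurable_fun B f ->
  measurable_fun B (fun x => (expR (f x))%:E).
Proof. by move=> mf; apply/measurable_EFinP; exact: measurableT_comp. Qed.

Let integral_energy_pair w Phi : energy_pair n 1 w Phi ->
  (\int[mu]_(x in B) (expR (G (tvar x) (w (tvar x))))%:E = (ball_vol R n)%:E * mtF G w)%E.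
Proof.
move=> wE; rewrite (ge0_integral_tvar n0 (g := fun t => (expR (G t (w t)))%:E)).
- by congr (_ * _)%E; apply: eq_integral => t _; rewrite -EFinM -expRD.
- apply/measurable_EFinP; apply: measurableT_comp => //.
  exact: (mte_measurable hG (energy_pair_measurable wE)).
- by move=> t; rewrite lee_fin expR_ge0.
Qed.

(** The energy pair of an admissible v bounds its integral by V times a value of the half-line
    functional; the maximizing pair comes back as an admissible u on which the two integrals are
    comparable in the other direction. [JE] leaves out x = 0, where ln 0 = 0 gives [tvar] a
    conventional value; the origin is a null set. *)
Lemma mt_attained : exists u : 'rV[R]_n -> R, [/\ sobolev0_rad u, (dirichlet u <= 1)%E &
  I u = ereal_sup [set I u | u in [set u | sobolev0_rad u /\ (dirichlet u <= 1)%E]]].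
Proof.
have [w [Phi [wE wmax]]] := mt_maximizer hn hG.
have [su du] := energy_pair_sobolev hn wE.
set u := (fun x : 'rV[R]_n => w (tvar x) / c) in su du.
have mu_ v : sobolev0_rad v -> measurable_fun B v by move=> [[[h _ _] _] _].
have V0 := ball_vol_gt0 R n.
exists u; split => //; apply/eqP; rewrite eq_le; apply/andP; split.
  by apply: ereal_sup_ubound; exists u.
apply: ge_ereal_sup => _ [v [sv dv] <-].
have vE := sobolev_energy_pair hn sv dv; have hv := sobolev_le_energy_pair hn sv dv.
move: vE hv; set z := (z in energy_pair n 1 z _) => zE hz.
have nz : {ae mu, forall x : 'rV[R]_n, x != 0}.
  exists [set 0]; split => //.
  - exact: (compact_measurable_rV (@compact_set1 _ _)).
  - exact: lebesgue_rV_set0.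
  - by move=> x /= /negP; rewrite negbK => /eqP.
have mGw v' Psi : energy_pair n 1 v' Psi ->
    measurable_fun B (fun x => (expR (G (tvar x) (v' (tvar x))))%:E).
  move=> vE; apply: mEX; apply: measurable_G => //.
  exact: (measurableT_comp (energy_pair_measurable vE)).
apply: (@le_trans _ _ (\int[mu]_(x in B) (expR (G (tvar x) (z (tvar x))))%:E)%E).
  apply: ae_ge0_le_integral => //.
  - by apply: mEX; apply: measurable_J; exact: mu_.
  - exact: mGw zE.
  - apply: filterS2 hz nz => x hx x0 Bx.
    rewrite lee_fin ler_expR JE//; apply: (mte_mono hG); rewrite ?tvar_ge0//.
      by rewrite mulr_ge0// ltW.
    exact: hx.
rewrite (integral_energy_pair zE).
apply: (@le_trans _ _ ((ball_vol R n)%:E * mtF G w)%E).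
  by apply: lee_wpmul2l; [rewrite lee_fin ltW|exact: wmax zE].
rewrite -(integral_energy_pair wE); apply: ae_ge0_le_integral => //.
- exact: mGw wE.
- by apply: mEX; apply: measurable_J; exact: mu_.
- apply: filterS nz => x x0 Bx; rewrite lee_fin JE// /u normrM (gtr0_norm (x := c^-1)) ?invr_gt0//.
  rewrite mulrC divfK ?gt_eqF// ger0_norm//.
  exact: (energy_pair_ge0 wE (tvar_ge0 Bx)).
Qed.

End attained.

Theorem theorem1p3 (R : realType) (n : nat) (alpha : R)
    (hn : (2 <= n)%N) (halpha : 0 < alpha) :
  (exists u : 'rV[R]_n -> R,
     [/\ sobolev0_rad u, (dirichlet u <= 1)%E & MT1_integral alpha u = MT1 n alpha]) /\
  (exists u : 'rV[R]_n -> R,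
     [/\ sobolev0_rad u, (dirichlet u <= 1)%E & MT2_integral alpha u = MT2 n alpha]).
Proof.
have n0 : (0 < n)%N := ltnW hn.
have g0 : 0 < alpha / n%:R by rewrite divr_gt0// ltr0n.
have mB : measurable (unit_ball R n) by exact: measurable_unit_ball.
have me (D : set 'rV[R]_n) : measurable_fun D (fun x : 'rV[R]_n => enorm x `^ alpha).
  apply: measurable_funTS; apply: (measurableT_comp (measurable_powR alpha)).
  exact: measurable_enorm.
have mn (u : 'rV[R]_n -> R) : measurable_fun (unit_ball R n) u ->
  measurable_fun (unit_ball R n) (fun x => `|u x|) by move=> mu_; exact: measurableT_comp.
split.
- have K0 : 0 <= (mt_const R n)^-1 by rewrite invr_ge0 -mtc_mexp// powR_ge0.
  apply: (mt_attained hn (mt_exponent1 hn K0 g0)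
    (J := fun u x => (mt_const R n + enorm x `^ alpha) * `|u x| `^ (n%:R / n.-1%:R))).
  + by move=> f w; exact: measurable_exponent1.
  + move=> u mu_; apply: measurable_funM; first exact: measurable_funD.
    by apply: measurable_powR2 => //; exact: mn.
  + by move=> u x x0; exact: exponent1E.
- apply: (mt_attained hn (mt_exponent2 hn (mtc_gt0 R hn) g0)
    (J := fun u x => mt_const R n * `|u x| `^ (n%:R / n.-1%:R + enorm x `^ alpha))).
  + by move=> f w; exact: measurable_exponent2.
  + move=> u mu_; apply: measurable_funM => //.
    by apply: measurable_powR2 => //; [exact: mn|exact: measurable_funD].
  + by move=> u x x0; exact: exponent2E.
Qed.
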